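(* Let $m=\{m_\alpha\}$ be $W$-invariant positive integers and let $m-1=\{m_\alpha-1\}$. Let $D_m$, $D_{m-1}$ be the Macdonald operators (for a (quasi)minuscule coweight $\pi$) with $t=q^{-m}$ and $t=q^{-m+1}$, and $\psi_m,\psi_{m-1}$ the corresponding normalized Baker--Akhiezer functions. There is a difference operator $S_m^+$ in $x$ with $S^+_m\psi_{m-1}=\psi_m$ (so that $D_m\circ S_m^+=S_m^+\circ D_{m-1}$), it is $W$-invariant, and it has the form $$S_m^+=\sum_{\tau\in W\varrho^\vee}b_\tau T^\tau+\dots,$$ where the dots stand for a sum of lower terms $b_\nu T^\nu$ with $\nu\in\varrho^\vee+Q^\vee$ lying inside the convex hull of the orbit $W\varrho^\vee$, and the leading coefficients are $$b_{\varrho^\vee}(x)=q^{\sum_{\alpha\in R_+}m_\alpha}\,\frac{\Delta_{1-m}(x+\varrho^\vee)}{\Delta_{-m}(x)},\qquad b_{w\varrho^\vee}(x)=b_{\varrho^\vee}(w^{-1}x)\quad(w\in W),$$ where $\varrho^\vee=\frac12\sum_{\alpha\in R_+}\alpha^\vee$ and $\Delta_{-m}(x)=\prod_{\alpha\in R_+}\prod_{j=1}^{m_\alpha}\bigl(q^{-(\alpha,x)}-q^{-2j+(\alpha,x)}\bigr)^{-1}$.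
   Context: $V=\mathbb R^n$ is a Euclidean space with scalar product $(\cdot,\cdot)$, extended complex-bilinearly to $V\otimes\mathbb C$; variables $x,z$ range over $V\otimes\mathbb C$. $R\subset V$ is a reduced irreducible root system of rank $n$, $R_+$ positive roots, $W$ the Weyl group, $\alpha^\vee=2\alpha/(\alpha,\alpha)$, $Q^\vee$ the lattice generated by the $\alpha^\vee$, $P^\vee=\{\pi:(\pi,\alpha)\in\mathbb Z\ \forall\alpha\in R\}$. $q\in\mathbb C^\times$ is not a root of unity, $\log q$ fixed, $q^a=e^{a\log q}$, $[a]=q^a-q^{-a}$, $(T^vf)(x)=f(x+v)$. A difference operator is a finite sum $\sum_{\nu\in P^\vee}d_\nu(x)T^\nu$; it is $W$-invariant if $d_{w\nu}(wx)=d_\nu(x)$. A coweight $\pi\in P^\vee$ is minuscule if $|(\pi,\alpha)|\le1$ for all $\alpha\in R$, quasiminuscule if $\pi\in R^\vee$ and $|(\pi,\alpha)|\le1$ for all $\alpha\in R\setminus\{\pm\pi^\vee\}$, $\pi^\vee=2\pi/(\pi,\pi)$; (quasi)minuscule means nonzero and one of these. The Macdonald operator with $t=q^{-m}$ is $$D_m=\sum_{\tau\in W\pi}a_\tau(T^\tau-1)+\sum_{\tau\in W\pi}q^{2(\rho,\tau)},\quad a_\tau(x)=\prod_{\alpha\in R,(\alpha,\tau)>0}\frac{[(\alpha,x)-m_\alpha]}{[(\alpha,x)]}\prod_{\alpha\in R,(\alpha,\tau)=2}\frac{[(\alpha,x)-m_\alpha+1]}{[(\alpha,x)+1]},\quad\rho=\tfrac12\sum_{\alpha\in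 R_+}m_\alpha\alpha.$$ Let $\rho^\vee=\frac12\sum_{\alpha\in R_+}m_\alpha\alpha^\vee$, $\mathcal N=\{\rho^\vee-\sum_{\alpha\in R_+}l_\alpha\alpha^\vee:0\le l_\alpha\le m_\alpha\}$. The normalized Baker--Akhiezer function $\psi_m$ is the unique function $\psi(x,z)=q^{2(x,z)}\sum_{\nu\in\mathcal N\cap P^\vee}\psi_\nu(x)q^{2(\nu,z)}$ such that $\psi(x,z+\frac12s\alpha)=\psi(x,z-\frac12s\alpha)$ whenever $q^{2(\alpha^\vee,z)}=1$, for all $\alpha\in R$, $s=1,\dots,m_\alpha$, and $\psi_{\rho^\vee}(x)=\prod_{\alpha\in R_+}\prod_{j=1}^{m_\alpha}[j-(\alpha,x)]$. *)

(* Defs.v *)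
From HB Require Import structures.
From mathcomp Require Import all_boot all_order all_algebra.
From mathcomp Require Import finmap.
From mathcomp Require Import all_classical all_reals all_analysis.
From mathcomp Require Import complex.

Set Implicit Arguments.
Unset Strict Implicit.
Unset Printing Implicit Defensive.

Import Order.TTheory GRing.Theory Num.Theory.

Local Open Scope classical_set_scope.
Local Open Scope ring_scope.
Local Open Scope complex_scope.

(* Used both on R^n (scalar product) and on C^n, where it is the bilinear
   extension: there is no complex conjugation. *)
Definition dot (K : comPzRingType) (n : nat) (u v : 'cV[K]_n) : K :=
  \sum_(i < n) u i ord0 * v i ord0.

Section RootSystem.
Variables (R : realType) (n : nat).
Implicit Types (Phi Phip : {fset 'cV[R]_n}) (a b u v varpi : 'cV[R]_n)
  (m : 'cV[R]_n -> nat) (w : 'M[R]_n).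

Definition coroot a : 'cV[R]_n := (2 / dot a a) *: a.

(* v |-> v - (v, coroot a) a *)
Definition refl a : 'M[R]_n := 1%:M - a *m (coroot a)^T.

Record root_system Phi : Prop := RootSystem {
  root_neq0 : forall a, a \in Phi -> a != 0;
  root_span : forall v, exists c : 'cV[R]_n -> R,
    v = \sum_(a <- Phi) c a *: a;
  root_refl : forall a b, a \in Phi -> b \in Phi -> refl a *m b \in Phi;
  root_int : forall a b, a \in Phi -> b \in Phi ->
    dot b (coroot a) \is a Num.int }.

Definition reduced Phi : Prop :=
  forall a (c : R), a \in Phi -> c *: a \in Phi -> c = 1 \/ c = -1.

Definition irreducible Phi : Prop :=
  (exists a, a \in Phi) /\
  forall P : pred 'cV[R]_n,
    (forall a b, a \in Phi -> b \in Phi -> P a -> ~~ P b -> dot a b = 0) ->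
    (forall a, a \in Phi -> P a) \/ (forall a, a \in Phi -> ~~ P a).

Definition positive_roots Phi Phip : Prop :=
  exists xi : 'cV[R]_n,
    (forall a, a \in Phi -> dot xi a != 0) /\
    (forall a, (a \in Phip) = (a \in Phi) && (0 < dot xi a)).

Inductive weyl Phi : 'M[R]_n -> Prop :=
| weyl_1 : weyl Phi 1%:M
| weyl_refl a w : a \in Phi -> weyl Phi w -> weyl Phi (refl a *m w).

Definition weyl_orbit Phi v : set 'cV[R]_n :=
  [set u | exists2 w, weyl Phi w & u = w *m v].

Definition coroot_lattice Phi : set 'cV[R]_n :=
  [set v | exists c : 'cV[R]_n -> int, v = \sum_(a <- Phi) coroot a *~ c a].

Definition coweight_lattice Phi : set 'cV[R]_n :=
  [set v | forall a, a \in Phi -> dot v a \is a Num.int].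

Definition minuscule Phi varpi : Prop :=
  varpi \in coweight_lattice Phi /\
  forall a, a \in Phi -> `|dot varpi a| <= 1.

Definition quasiminuscule Phi varpi : Prop :=
  (exists2 a, a \in Phi & varpi = coroot a) /\
  forall a, a \in Phi -> a != coroot varpi -> a != - coroot varpi ->
    `|dot varpi a| <= 1.

Definition quasi_or_minuscule Phi varpi : Prop :=
  varpi != 0 /\ (minuscule Phi varpi \/ quasiminuscule Phi varpi).

Definition weyl_invariant Phi m : Prop :=
  forall w a, weyl Phi w -> a \in Phi -> m (w *m a) = m a.

Definition rho Phip m : 'cV[R]_n :=
  2^-1 *: \sum_(a <- Phip) (m a)%:R *: a.

Definition rhov Phip m : 'cV[R]_n :=
  2^-1 *: \sum_(a <- Phip) (m a)%:R *: coroot a.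

(* The l_a are real: this is a polytope, cut down to a finite set only by
   intersecting with the coweight lattice. *)
Definition ba_polytope Phip m : set 'cV[R]_n :=
  [set v | exists l : 'cV[R]_n -> R,
    (forall a, a \in Phip -> 0 <= l a <= (m a)%:R) /\
    v = rhov Phip m - \sum_(a <- Phip) l a *: coroot a].

Definition conv_hull (A : set 'cV[R]_n) : set 'cV[R]_n :=
  [set v | exists (s : seq 'cV[R]_n) (t : 'cV[R]_n -> R),
    [/\ forall u, u \in s -> A u,
        forall u, u \in s -> 0 <= t u,
        \sum_(u <- s) t u = 1 &
        v = \sum_(u <- s) t u *: u]].

End RootSystem.

Section ComplexFunctions.
Variables (R : realType) (n : nat).

Definition cexp (z : R[i]) : R[i] :=
  (expR (complex.Re z) * cos (complex.Im z)) +i*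
  (expR (complex.Re z) * sin (complex.Im z)).

Definition toC (k l : nat) (A : 'M[R]_(k, l)) : 'M[R[i]]_(k, l) :=
  map_mx (real_complex R) A.

(* lq is the chosen value of log q. *)
Variable lq : R[i].

Definition qpow (a : R[i]) : R[i] := cexp (a * lq).

Definition qbr (a : R[i]) : R[i] := qpow a - qpow (- a).

Implicit Types (f : 'cV[R[i]]_n -> R[i]) (d : 'cV[R]_n -> 'cV[R[i]]_n -> R[i])
  (x z : 'cV[R[i]]_n) (Phi Phip : {fset 'cV[R]_n}) (m : 'cV[R]_n -> nat).

(* Finite sums of c q^(lambda, x): these are entire functions of x. *)
Definition qpoly f : Prop :=
  exists s : seq (R[i] * 'cV[R]_n),
    forall x, f x = \sum_(p <- s) p.1 * qpow (dot (toC p.2) x).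

Definition nonzero_qpoly f : Prop := qpoly f /\ exists x, f x != 0.

(* Meromorphic functions are represented by total functions with arbitrary
   values at the poles, so that identities between them are asserted off the
   zero set of some nonzero entire function. *)
Definition generically (P : 'cV[R[i]]_n -> Prop) : Prop :=
  exists2 g, nonzero_qpoly g & forall x, g x != 0 -> P x.

Definition qrational f : Prop :=
  exists g h, [/\ qpoly g, nonzero_qpoly h &
                  forall x, h x != 0 -> f x = g x / h x].

(* d represents the operator \sum_nu d_nu(x) T^nu. *)
Definition difference_operator Phi d : Prop :=
  [/\ finite_set [set nu | exists x, d nu x != 0],
      forall nu x, d nu x != 0 -> nu \in coweight_lattice Phi &
      forall nu, qrational (d nu)].

Definition diff_apply d f x : R[i] :=
  \sum_(nu \in [set: 'cV[R]_n]) d nu x * f (x + toC nu).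

Definition diff_invariant Phi d : Prop :=
  forall w nu, weyl Phi w ->
    generically (fun x => d (w *m nu) (toC w *m x) = d nu x).

Definition mac_coef Phi m (tau : 'cV[R]_n) x : R[i] :=
  (\prod_(a <- Phi | 0 < dot a tau)
     (qbr (dot (toC a) x - (m a)%:R) / qbr (dot (toC a) x))) *
  (\prod_(a <- Phi | dot a tau == 2)
     (qbr (dot (toC a) x - (m a)%:R + 1) / qbr (dot (toC a) x + 1))).

(* Macdonald operator D_m (with t = q^(-m)) for the coweight varpi. *)
Definition macdonald Phi Phip m (varpi : 'cV[R]_n) f x : R[i] :=
  \sum_(tau \in weyl_orbit Phi varpi) mac_coef Phi m tau x * (f (x + toC tau) - f x) +
  (\sum_(tau \in weyl_orbit Phi varpi) qpow (2 * (dot (rho Phip m) tau)%:C)) * f x.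

(* No regularity in x is imposed on the coefficients c_nu: the conditions
   determine psi(x, -) for generic x only. *)
Definition baker_akhiezer Phi Phip m
    (psi : 'cV[R[i]]_n -> 'cV[R[i]]_n -> R[i]) : Prop :=
  exists c : 'cV[R]_n -> 'cV[R[i]]_n -> R[i],
  [/\ forall x z, psi x z = qpow (2 * dot x z) *
        \sum_(nu \in ba_polytope Phip m `&` coweight_lattice Phi)
           c nu x * qpow (2 * dot (toC nu) z),
      forall a s x z, a \in Phi -> (1 <= s <= m a)%N ->
        qpow (2 * dot (toC (coroot a)) z) = 1 ->
        psi x (z + (s%:R / 2) *: toC a) = psi x (z - (s%:R / 2) *: toC a) &
      forall x, c (rhov Phip m) x =
        \prod_(a <- Phip) \prod_(1 <= j < (m a).+1)
          qbr (j%:R - dot (toC a) x)].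

(* This is Delta_{-m}. *)
Definition Delta_neg Phip m x : R[i] :=
  \prod_(a <- Phip) \prod_(1 <= j < (m a).+1)
    (qpow (- dot (toC a) x) - qpow (- (2 * j)%:R + dot (toC a) x))^-1.

End ComplexFunctions.

(* Submission.v *)
(** For fixed x, psi_m(x, -) is a finite combination of exponentials in z, encoded by a
    finitely supported measure mu_x on the vectors u. The defining conditions become
    linear conditions E on mu_x, one family per root a. For generic x they force every
    nonzero coefficient to lie on a line in direction a^vee that contains two points of
    the support at distance at least m_a a^vee. Following the highest point of the support
    while a linear form crosses the walls shows that the support of any solution
    is as wide as N in every direction; in particular a solution supported in N is
    determined by its coefficient at the vertex rho^vee, and a solution supported in
    conv(A) + N is a combination of shifts mu_(x + nu) with nu in conv(A), obtained by
    peeling off highest points.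

    With A = W varrho^vee and the measure of psi_m, which satisfies the conditions for
    m - 1, this gives S. Uniqueness gives its W-invariance, Cramer's rule the
    rationality of its coefficients, and the vertex coefficients of psi_m and psi_(m-1)
    the leading coefficient.

    With A = W pi and the measure of f psi_m, f(z) = sum of q^(2 (tau, z)) over
    tau in W pi, it gives f psi_m as a combination of the shifts of psi_m by W pi and 0.
    The coefficient at 0 is found at z = rho, because psi_m(x, rho) is a nonzero constant
    in x. For this one restricts x to a line of lattice points x0 + k v and puts T = q^k:
    the coefficients are Laurent polynomials in T, since at a zero of a denominator the
    numerators would form a solution too narrow to be nonzero; their extreme coefficients
    solve the limit conditions as T tends to 0 or infinity, which bounds their degrees.
    Comparing rho with -rho, conjugate under W, leaves a single power of T.

    So D_m S and S D_(m-1) agree on psi_(m-1)(-, z) for all z, and the shifts of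
    psi_(m-1) are linearly independent. *)

Require Import Defs.
From HB Require Import structures.
From mathcomp Require Import all_boot all_order all_algebra.
From mathcomp Require Import finmap.
From mathcomp Require Import all_classical all_reals all_analysis.
From mathcomp Require Import complex.
From mathcomp Require Import ring lra zify.

Set Implicit Arguments.
Unset Strict Implicit.
Unset Printing Implicit Defensive.

Import Order.TTheory GRing.Theory Num.Theory.

Local Open Scope classical_set_scope.
Local Open Scope ring_scope.
Local Open Scope complex_scope.

(** The definition of psi imposes no regularity in x: it gives a finite linear problem for each x,
    so the arguments are pointwise at generic x, and rationality has to be extracted afterwards by
    Cramer's rule from an infinite family of equations. The delicate point is the action of D_m. In
    the expansion of f psi_m the coefficients at W pi can be read at vertices of N, where psi_m is
    explicit; the coefficient at 0 cannot, and a value independent of x takes their place. Along a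
    lattice line the obstacle is resonance: at some T a root may have b(u) b(v) = 1 for two points,
    so that b + b^-1 no longer determines b and the strings in that direction are lost. The base
    point of the line is chosen so that, for each T, this concerns at most one pair of opposite
    roots. For this pair, coefficients on edges of N in its direction are explicit Laurent
    polynomials, and no pole can arise. That the constant found in this way is nonzero comes from an
    explicit solution of the limit conditions, whose exponential sum is a product of q-brackets. *)

Local Notation qpoly := Defs.qpoly.

(** * Euclidean geometry *)

Section Dot.
Variables (K : comPzRingType) (n : nat).
Implicit Types (u v w : 'cV[K]_n) (A : 'M[K]_n).

Lemma dotC u v : dot u v = dot v u.
Proof. by apply: eq_bigr => i _; rewrite mulrC. Qed.

Lemma dotDl u v w : dot (u + v) w = dot u w + dot v w.
Proof. by rewrite -big_split; apply: eq_bigr => i _; rewrite mxE mulrDl. Qed.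

Lemma dotZl c u v : dot (c *: u) v = c * dot u v.
Proof. by rewrite mulr_sumr; apply: eq_bigr => i _; rewrite mxE mulrA. Qed.

Lemma dotNl u v : dot (- u) v = - dot u v.
Proof. by rewrite -scaleN1r dotZl mulN1r. Qed.

Lemma dotBl u v w : dot (u - v) w = dot u w - dot v w.
Proof. by rewrite dotDl dotNl. Qed.

Lemma dot0l v : dot 0 v = 0.
Proof. by rewrite -(scale0r 0) dotZl mul0r. Qed.

Lemma dotDr u v w : dot u (v + w) = dot u v + dot u w.
Proof. by rewrite dotC dotDl !(dotC u). Qed.

Lemma dotZr c u v : dot u (c *: v) = c * dot u v.
Proof. by rewrite dotC dotZl dotC. Qed.

Lemma dotNr u v : dot u (- v) = - dot u v.
Proof. by rewrite dotC dotNl dotC. Qed.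

Lemma dotBr u v w : dot u (v - w) = dot u v - dot u w.
Proof. by rewrite dotDr dotNr. Qed.

Lemma dot0r u : dot u 0 = 0.
Proof. by rewrite dotC dot0l. Qed.

Lemma dot_suml (I : Type) (r : seq I) (P : pred I) (F : I -> 'cV[K]_n) v :
  dot (\sum_(i <- r | P i) F i) v = \sum_(i <- r | P i) dot (F i) v.
Proof.
elim/big_rec2: _ => [|i x y _ <-]; first exact: dot0l.
exact: dotDl.
Qed.

Lemma dot_sumr (I : Type) (r : seq I) (P : pred I) (F : I -> 'cV[K]_n) v :
  dot v (\sum_(i <- r | P i) F i) = \sum_(i <- r | P i) dot v (F i).
Proof. by rewrite dotC dot_suml; apply: eq_bigr => i _; rewrite dotC. Qed.

Lemma dot_trmx A u v : dot (A *m u) v = dot u (A^T *m v).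
Proof.
rewrite /dot.
under eq_bigr => i _ do rewrite mxE mulr_suml.
rewrite exchange_big /=; apply: eq_bigr => j _.
rewrite mxE mulr_sumr; apply: eq_bigr => i _.
by rewrite !mxE mulrA (mulrC (u j ord0)).
Qed.

Lemma dot_mxE u v : u^T *m v = (dot u v)%:M.
Proof.
apply/matrixP => i j; rewrite !ord1 !mxE eqxx mulr1n.
by apply: eq_bigr => k _; rewrite mxE.
Qed.

End Dot.

Section RealDot.
Variables (R : realType) (n : nat).
Implicit Types (u v w a b xi eta : 'cV[R]_n).

Lemma dot_ge0 u : 0 <= dot u u.
Proof. by apply: sumr_ge0 => i _; rewrite -expr2 sqr_ge0. Qed.

Lemma dot_eq0 u : (dot u u == 0) = (u == 0).
Proof.
apply/eqP/eqP => [h|->]; last exact: dot0l.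
apply/matrixP => i j; rewrite (ord1 j) mxE.
have /eqP := h; rewrite psumr_eq0 => [/allP /(_ i (mem_index_enum i)) /=|k _].
  by rewrite mulf_eq0 orbb => /eqP.
by rewrite -expr2 sqr_ge0.
Qed.

Lemma dot_gt0 u : u != 0 -> 0 < dot u u.
Proof. by move=> u0; rewrite lt0r dot_eq0 u0 dot_ge0. Qed.

Lemma norm1_gt0 (t : R) : 0 < `|t| + 1.
Proof. by apply: ltr_wpDl. Qed.

(** The witness is [xi + e *: eta] with e > 0 small: the inequalities on Y are open, and each b in B
    vanishes for at most one e because [dot eta b != 0]. *)
Lemma perturb xi eta (Y B : seq 'cV[R]_n) :
  {in Y, forall y, dot xi y < 0} -> {in B, forall b, dot eta b != 0} ->
  exists xi', [/\ {in Y, forall y, dot xi' y < 0}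
                & {in B, forall b, dot xi' b != 0}].
Proof.
move=> hY hB.
have [e0 e0gt he0] : exists2 e0 : R, 0 < e0 &
    forall e, 0 < e < e0 ->
      {in Y, forall y, dot (xi + e *: eta) y < 0} /\
      {in B, forall b, dot (xi + e *: eta) b != 0}.
  have [e1 e1gt he1] : exists2 e0 : R, 0 < e0 & forall e, 0 < e < e0 ->
      {in Y, forall y, dot (xi + e *: eta) y < 0}.
    elim: Y hY => [_|y Y IH hY]; first by exists 1.
    have [] := IH; first by move=> z zY; apply: hY; rewrite inE zY orbT.
    move=> e0 e0gt he0.
    have y0 : dot xi y < 0 by apply: hY; rewrite inE eqxx.
    exists (Num.min e0 (- dot xi y / (`|dot eta y| + 1))).
      by rewrite lt_min e0gt /= divr_gt0 ?oppr_gt0 ?norm1_gt0.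
    move=> e /andP[egt]; rewrite lt_min => /andP[el1 el2] z.
    rewrite inE => /predU1P[->|zY]; last by apply: he0 => //; rewrite egt.
    rewrite dotDl dotZl; move: el2; rewrite ltr_pdivlMr ?norm1_gt0 //.
    have := ler_norm (dot eta y); set t := `|_| => h1 h2.
    have : e * dot eta y <= e * t by rewrite ler_pM2l.
    by nra.
  have [e2 e2gt he2] : exists2 e0 : R, 0 < e0 & forall e, 0 < e < e0 ->
      {in B, forall b, dot (xi + e *: eta) b != 0}.
    elim: B hB => [_|y B IH hB]; first by exists 1.
    have [] := IH; first by move=> z zY; apply: hB; rewrite inE zY orbT.
    move=> e0 e0gt he0.
    have y0 : dot eta y != 0 by apply: hB; rewrite inE eqxx.
    have [xy0|xy0] := eqVneq (dot xi y) 0.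
      exists e0 => // e he z; rewrite inE => /predU1P[->|zB]; last exact: he0.
      rewrite dotDl dotZl xy0 add0r mulf_neq0 //.
      by case/andP: he => /gt_eqF ->.
    exists (Num.min e0 (`|dot xi y| / `|dot eta y|)).
      by rewrite lt_min e0gt /= divr_gt0 ?normr_gt0.
    move=> e /andP[egt]; rewrite lt_min => /andP[el1 el2] z.
    rewrite inE => /predU1P[->|zY]; last by apply: he0 => //; rewrite egt.
    rewrite dotDl dotZl; move: el2; rewrite ltr_pdivlMr ?normr_gt0 //.
    rewrite -{1}(gtr0_norm egt) -normrM => hlt.
    apply: contraTneq hlt => /eqP; rewrite addr_eq0 => /eqP ->.
    by rewrite normrN ltxx.
  exists (Num.min e1 e2); first by rewrite lt_min e1gt.
  move=> e /andP[egt]; rewrite lt_min => /andP[h1 h2]; split.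
    by apply: he1; rewrite egt.
  by apply: he2; rewrite egt.
exists (xi + (e0 / 2) *: eta); apply: he0.
by rewrite divr_gt0 //= ltr_pdivrMr // ltr_pMr // ltr1n.
Qed.

Lemma avoid (B : seq 'cV[R]_n) : {in B, forall b, b != 0} ->
  exists eta, {in B, forall b, dot eta b != 0}.
Proof.
elim: B => [_|b B IH hB]; first by exists 0.
have [] := IH; first by move=> z zB; apply: hB; rewrite inE zB orbT.
move=> eta heta.
have b0 : b != 0 by apply: hB; rewrite inE eqxx.
have [eb|eb] := eqVneq (dot eta b) 0; last first.
  by exists eta => z; rewrite inE => /predU1P[->|/heta].
(* When the chosen [eta] is orthogonal to b, the vector b itself, perturbed towards [eta], is
   nonzero on b and generic for the rest. *)
have hY : {in [:: - b], forall y, dot b y < 0}.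
  by move=> y; rewrite inE => /eqP ->; rewrite dotNr oppr_lt0 dot_gt0.
have [xi [h1 h2]] := perturb hY heta.
exists xi => z; rewrite inE => /predU1P[->|/h2] //.
have := h1 (- b); rewrite inE eqxx dotNr oppr_lt0 => /(_ isT).
by move/gt_eqF => ->.
Qed.

Lemma perturb_generic xi (Y B : seq 'cV[R]_n) :
  {in Y, forall y, dot xi y < 0} -> {in B, forall b, b != 0} ->
  exists xi', [/\ {in Y, forall y, dot xi' y < 0}
                & {in B, forall b, dot xi' b != 0}].
Proof.
move=> hY /avoid[eta heta]; exact: perturb hY heta.
Qed.

End RealDot.

Section Gordan.
Variables (R : realType) (n : nat).

(** Gordan's alternative. It turns the description of a convex hull by half-spaces into actual
    weights. The induction projects along one vector [f y]. *)
Lemma gordan (T : eqType) (s : seq T) (f : T -> 'cV[R]_n) : uniq s ->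
  (exists xi : 'cV[R]_n, {in s, forall i, dot xi (f i) < 0}) \/
  (exists t : T -> R, [/\ {in s, forall i, 0 <= t i},
     \sum_(i <- s) t i = 1 & \sum_(i <- s) t i *: f i = 0]).
Proof.
elim: s f => [|y s IH] f /=; first by left; exists 0.
case/andP=> ys us.
have ext (t : T -> R) c : \sum_(u <- s) (if u == y then c else t u) =
    \sum_(u <- s) t u.
  rewrite !big_seq; apply: eq_bigr => u us'; case: eqP => // uy.
  by move: us'; rewrite uy (negbTE ys).
have extZ (t : T -> R) c : \sum_(u <- s) (if u == y then c else t u) *: f u =
    \sum_(u <- s) t u *: f u.
  rewrite !big_seq; apply: eq_bigr => u us'; case: eqP => // uy.
  by move: us'; rewrite uy (negbTE ys).
have ext0 (t : T -> R) c : 0 <= c -> {in s, forall i, 0 <= t i} ->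
   {in y :: s, forall i, 0 <= if i == y then c else t i}.
  by move=> c0 ht u; rewrite inE; case: eqP => //= _ /ht.
have [y0|y0] := eqVneq (f y) 0.
  right; exists (fun u => (u == y)%:R); split.
  - by move=> u _; rewrite ler0n.
  - rewrite big_cons eqxx big1_seq ?addr0 // => u /= us'.
    by case: eqP us' => // ->; rewrite (negbTE ys).
  - rewrite big_cons eqxx y0 scaler0 add0r big1_seq // => u /= us'.
    by case: eqP us' => [->|]; rewrite ?(negbTE ys) ?scale0r.
have [[xi1 h1]|[t [t0 t1 tf]]] := IH f us; last first.
  right; exists (fun u => if u == y then 0 else t u); split; first exact: ext0.
    by rewrite big_cons eqxx add0r ext.
  by rewrite big_cons eqxx scale0r add0r extZ.
pose pr v := v - (dot (f y) v / dot (f y) (f y)) *: f y.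
have fy0 := dot_gt0 y0.
have pr_orth v : dot (f y) (pr v) = 0.
  by rewrite /pr dotBr dotZr divfK ?subrr // gt_eqF.
(* A form negative on the projections becomes negative on [f y] too after subtracting a small
   multiple of [f y]. Otherwise the vanishing combination of projections lifts to [l *: f y], and
   the sign of l decides. *)
have [[xi h]|[t [t0 t1 tf]]] := IH (pr \o f) us.
  have prC u v : dot (pr u) v = dot u (pr v).
    rewrite /pr dotBl dotBr dotZl dotZr (dotC (f y) u).
    by congr (_ - _); ring.
  left.
  have key : exists2 e : R, 0 < e &
     {in s, forall i, dot (pr xi - e *: f y) (f i) < 0}.
    clear -h prC.
    elim: s h => [|z s IHs] h; first by exists 1.
    have [] := IHs; first by move=> u us; apply: h; rewrite inE us orbT.
    move=> e e0 he.
    have z0 : dot (pr xi) (f z) < 0 by rewrite prC; apply: h; rewrite inE eqxx.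
    pose e' := - dot (pr xi) (f z) / (`|dot (f y) (f z)| + 1).
    have e'0 : 0 < e' by rewrite divr_gt0 ?oppr_gt0 ?norm1_gt0.
    exists (Num.min e e' / 2).
      by rewrite divr_gt0 // lt_min e0.
    set d := Num.min e e' / 2.
    have d0 : 0 < d by rewrite divr_gt0 // lt_min e0.
    have de : d < e by rewrite ltr_pdivrMr // (le_lt_trans (y:=e)) ?ge_min ?lexx // ltr_pMr // ltr1n.
    have de' : d < e' by rewrite ltr_pdivrMr // (le_lt_trans (y:=e')) ?ge_min ?lexx ?orbT // ltr_pMr // ltr1n.
    move=> u; rewrite inE => /predU1P[->|us].
      rewrite dotBl dotZl; move: de'; rewrite ltr_pdivlMr ?norm1_gt0 //.
      have := ler_norm (- dot (f y) (f z)); rewrite normrN; set t := `|_| => g1 g2.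
      have : d * - dot (f y) (f z) <= d * t by rewrite ler_pM2l.
      by nra.
    have g1 := he u us; have g2 : dot (pr xi) (f u) < 0.
      by rewrite prC; apply: h; rewrite inE us orbT.
    move: g1; rewrite !(dotBl (pr xi)) !(dotZl d) !(dotZl e) => g1.
    have [g3|g3] := leP 0 (dot (f y) (f u)).
      by rewrite subr_lt0 (lt_le_trans g2) // mulr_ge0 // ltW.
    by apply: le_lt_trans g1; rewrite lerD2l lerN2 ler_wnM2r // ltW.
  case: key => e e0 he; exists (pr xi - e *: f y) => u.
  rewrite inE => /predU1P[->|/he //].
  rewrite dotBl dotZl prC dotC.
  have -> : pr (f y) = 0 by rewrite /pr divff ?gt_eqF // scale1r subrr.
  by rewrite dot0l sub0r oppr_lt0 mulr_gt0.
pose l := \sum_(u <- s) t u * (dot (f y) (f u) / dot (f y) (f y)).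
have tfl : \sum_(u <- s) t u *: f u = l *: f y.
  apply/eqP; rewrite -subr_eq0 /l scaler_suml -sumrB -[X in _ == X]tf.
  apply/eqP; apply: eq_bigr => u _; rewrite /= /pr scalerBr.
  by rewrite scalerA.
have [l0|l0] := leP l 0.
  right.
  have c0 : 0 < 1 - l by rewrite subr_gt0 (le_lt_trans l0).
  exists (fun u => (if u == y then - l else t u) / (1 - l)); split.
  - move=> u us'; apply: divr_ge0; last exact: ltW.
    by apply: ext0 => //; rewrite oppr_ge0.
  - by rewrite -mulr_suml big_cons eqxx ext t1 addrC divff // gt_eqF.
  - under eq_bigr => u _ do rewrite mulrC -scalerA.
    rewrite -scaler_sumr big_cons eqxx extZ tfl scaleNr addNr.
    by rewrite scaler0.
left; exists xi1 => u; rewrite inE => /predU1P[->|/h1 //].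
have : dot xi1 (l *: f y) < 0.
  rewrite -tfl dot_sumr.
  have [v vs tv] : exists2 v, v \in s & 0 < t v.
    apply: contrapT => hn; suff : \sum_(u <- s) t u = 0.
      by rewrite t1 => /eqP; rewrite oner_eq0.
    apply: big1_seq => w /= ws; apply/eqP; rewrite eq_le t0 // andbT.
    by rewrite leNgt; apply/negP => tw; apply: hn; exists w.
  rewrite (bigD1_seq v) //= dotZr; apply: ltr_wnDr.
    rewrite big_seq_cond sumr_le0 // => w /andP[ws _].
    by rewrite dotZr mulr_ge0_le0 ?t0 // ltW // h1.
  by rewrite pmulr_rlt0 ?h1.
by rewrite dotZr pmulr_rlt0.
Qed.

End Gordan.

Lemma seq_argmax (d : Order.disp_t) (O : orderType d) (T : eqType) (s : seq T)
    (f : T -> O) x : x \in s ->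
  exists2 y, y \in s & forall z, z \in s -> (f z <= f y)%O.
Proof.
elim: s x => // a s IH x _.
case: s IH => [_|b s IH].
  by exists a; rewrite ?mem_head // => z; rewrite inE => /eqP ->.
have [y ys hy] := IH b (mem_head _ _).
have [le|lt] := leP (f a) (f y).
  exists y; first by rewrite inE ys orbT.
  by move=> z; rewrite inE => /predU1P[->|/hy].
exists a; rewrite ?mem_head // => z; rewrite inE => /predU1P[->//|/hy h].
exact: le_trans h (ltW lt).
Qed.

(** * Finitely supported measures *)

Section Measures.
Variables (K : fieldType) (T : zmodType).
Implicit Types (mu nu : seq (K * T)) (F G : T -> K) (u v : T).

(* A finitely supported K-valued function on T, as a formal combination of
   points; [ev] is its pairing with a test function. *)
Definition ev mu F := \sum_(p <- mu) p.1 * F p.2.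
Definition cf mu u := ev mu (fun w => (w == u)%:R).
Definition mZ c mu := [seq (c * p.1, p.2) | p <- mu].
Definition mshift v mu := [seq (p.1, p.2 + v) | p <- mu].
Definition mk (L : seq T) (c : T -> K) := [seq (c u, u) | u <- L].

Lemma eq_ev mu F G : F =1 G -> ev mu F = ev mu G.
Proof. by move=> FG; apply: eq_bigr => p _; rewrite FG. Qed.

Lemma ev_cat mu nu F : ev (mu ++ nu) F = ev mu F + ev nu F.
Proof. by rewrite /ev big_cat. Qed.

Lemma cf_cat mu nu u : cf (mu ++ nu) u = cf mu u + cf nu u.
Proof. exact: ev_cat. Qed.

Lemma ev_flatten (I : Type) (s : seq I) (f : I -> seq (K * T)) F :
  ev (flatten [seq f i | i <- s]) F = \sum_(i <- s) ev (f i) F.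
Proof.
elim: s => [|i s IH] /=; first by rewrite big_nil /ev big_nil.
by rewrite ev_cat IH big_cons.
Qed.

Lemma cf_flatten (I : Type) (s : seq I) (f : I -> seq (K * T)) u :
  cf (flatten [seq f i | i <- s]) u = \sum_(i <- s) cf (f i) u.
Proof. exact: ev_flatten. Qed.

Lemma ev_scale c mu F : ev (mZ c mu) F = c * ev mu F.
Proof. by rewrite /ev big_map mulr_sumr; apply: eq_bigr => p _; rewrite mulrA. Qed.

Lemma cf_scale c mu u : cf (mZ c mu) u = c * cf mu u.
Proof. exact: ev_scale. Qed.

Lemma ev_shift v mu F : ev (mshift v mu) F = ev mu (fun u => F (u + v)).
Proof. by rewrite /ev big_map. Qed.

Lemma cf_shift v mu u : cf (mshift v mu) u = cf mu (u - v).
Proof.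
rewrite /cf ev_shift; apply: eq_ev => w.
by rewrite -[in RHS]subr_eq opprK.
Qed.

Lemma ev_mk L c F : ev (mk L c) F = \sum_(u <- L) c u * F u.
Proof. by rewrite /ev big_map. Qed.

Lemma cf_mk L c u : uniq L -> cf (mk L c) u = if u \in L then c u else 0.
Proof.
move=> uL; rewrite /cf ev_mk; case: ifP => uinL.
  rewrite (bigD1_seq u) //= eqxx mulr1 big1 ?addr0 // => w /negbTE ->.
  by rewrite mulr0.
rewrite big1_seq // => w /= wL; case: eqP => [wu|]; last by rewrite mulr0.
by rewrite -wu wL in uinL.
Qed.

Lemma evD mu F G : ev mu (fun u => F u + G u) = ev mu F + ev mu G.
Proof. by rewrite /ev -big_split; apply: eq_bigr => p _; rewrite mulrDr. Qed.

Lemma evZ mu c F : ev mu (fun u => c * F u) = c * ev mu F.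
Proof. by rewrite /ev mulr_sumr; apply: eq_bigr => p _; rewrite mulrCA. Qed.

Lemma evB mu F G : ev mu (fun u => F u - G u) = ev mu F - ev mu G.
Proof.
rewrite evD -(mulN1r (ev mu G)) -evZ; congr (_ + _).
by apply: eq_ev => u; rewrite mulN1r.
Qed.

Lemma ev_sum (I : Type) (s : seq I) mu (F : I -> T -> K) :
  ev mu (fun u => \sum_(i <- s) F i u) = \sum_(i <- s) ev mu (F i).
Proof.
rewrite /ev exchange_big; apply: eq_bigr => p _; exact: mulr_sumr.
Qed.

Lemma ev_nseq mu F : (forall p, p \in mu -> F p.2 = 0) -> ev mu F = 0.
Proof. by move=> h; apply: big1_seq => p /= /h ->; rewrite mulr0. Qed.

Lemma ev_cf_big (S : seq T) mu F : uniq S ->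
  (forall p, p \in mu -> p.2 \in S) -> ev mu F = \sum_(u <- S) cf mu u * F u.
Proof.
move=> uS hS.
under eq_bigr => u _ do rewrite /cf /ev mulr_suml.
rewrite exchange_big /= /ev [LHS]big_seq [RHS]big_seq.
apply: eq_bigr => p /hS pS.
rewrite (bigD1_seq p.2) //= eqxx mulr1 big1 ?addr0 // => u up.
by rewrite eq_sym (negbTE up) mulr0 mul0r.
Qed.

Lemma ev_cf (S : seq T) mu F : uniq S ->
  (forall u, cf mu u != 0 -> u \in S) -> ev mu F = \sum_(u <- S) cf mu u * F u.
Proof.
move=> uS hS.
pose S' := undup ([seq p.2 | p <- mu] ++ S).
rewrite (@ev_cf_big S') ?undup_uniq //; last first.
  by move=> p pmu; rewrite mem_undup mem_cat map_f.
rewrite (bigID (mem S)) /= [X in _ + X]big1 ?addr0; last first.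
  by move=> u uS'; rewrite (contraNeq (hS u) uS') mul0r.
rewrite -big_filter; apply: perm_big; apply: uniq_perm => //.
  by rewrite filter_uniq ?undup_uniq.
by move=> u; rewrite mem_filter mem_undup mem_cat; case: (u \in S); rewrite ?orbT.
Qed.

Lemma cf_notin mu u : u \notin [seq p.2 | p <- mu] -> cf mu u = 0.
Proof.
move=> h; apply: ev_nseq => p pmu; case: eqP => // pu.
by rewrite -pu map_f in h.
Qed.

Lemma cf_in mu u : cf mu u != 0 -> u \in [seq p.2 | p <- mu].
Proof. by apply: contraNT => /cf_notin ->. Qed.

Definition msupp mu := [seq u <- undup [seq p.2 | p <- mu] | cf mu u != 0].

Lemma mem_msupp mu u : (u \in msupp mu) = (cf mu u != 0).
Proof.
rewrite mem_filter mem_undup; apply: andb_idr; exact: cf_in.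
Qed.

Lemma msupp_uniq mu : uniq (msupp mu).
Proof. by rewrite filter_uniq ?undup_uniq. Qed.

Lemma ev_msupp mu F : ev mu F = \sum_(u <- msupp mu) cf mu u * F u.
Proof.
by apply: ev_cf; [exact: msupp_uniq | move=> u; rewrite mem_msupp].
Qed.

Lemma ev_cf0 mu F : (forall u, cf mu u = 0) -> ev mu F = 0.
Proof.
by move=> h; rewrite ev_msupp big1_seq // => u _; rewrite h mul0r.
Qed.

Lemma eq_ev_cf mu nu F : (forall u, cf mu u = cf nu u) -> ev mu F = ev nu F.
Proof.
move=> h; apply/eqP; rewrite -subr_eq0 -(mulN1r (ev nu F)) -ev_scale -ev_cat.
apply/eqP; apply: ev_cf0 => u.
by rewrite cf_cat cf_scale h mulN1r subrr.
Qed.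

End Measures.

Section Nodes.
Variables (K : fieldType) (T : zmodType) (d : T).
Implicit Types (mu : seq (K * T)) (F : T -> K) (b : T -> K) (Q : {poly K}).

Definition invariant_by F := forall u, F (u + d) = F u.

(* As Q ranges over the polynomials of size at most m, [e u * Q.[X u]] ranges over
   the span of the b^s - b^-s, 1 <= s <= m, when e = b - b^-1 and X = b + b^-1. *)
Definition kills mu (m : nat) (e X : T -> K) := forall F Q, invariant_by F ->
  (size Q <= m)%N -> ev mu (fun u => e u * Q.[X u] * F u) = 0.

Lemma periodicz F u (j : int) : invariant_by F -> F (u + d *~ j) = F u.
Proof.
move=> pF; have nat_case v k : F (v + d *+ k) = F v.
  by elim: k => [|k IH]; rewrite ?mulr0n ?addr0 // mulrSr addrA pF.
case: j => k; first by rewrite -pmulrn nat_case.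
by rewrite NegzE mulrNz -pmulrn -[in RHS](subrK (d *+ k.+1) u) nat_case.
Qed.

Lemma kills_monom mu m (e X : T -> K) :
  (forall F i, invariant_by F -> (i < m)%N ->
     ev mu (fun u => e u * X u ^+ i * F u) = 0) -> kills mu m e X.
Proof.
move=> h F Q pF sQ.
rewrite (@eq_ev _ _ _ _ (fun u => \sum_(i < size Q) Q`_i * (e u * X u ^+ i * F u))).
  rewrite ev_sum big1 // => i _; rewrite evZ h ?mulr0 //.
  exact: leq_trans (ltn_ord i) sQ.
move=> u; rewrite horner_coef mulr_sumr mulr_suml.
by apply: eq_bigr => i _; ring.
Qed.

(** By (b^k - b^-k)(b + b^-1) = (b^(k+1) - b^-(k+1)) + (b^(k-1) - b^-(k-1)), each factor b + b^-1
    raises the index by at most one; hence the invariant k + i <= m in the auxiliary claim [gen]. *)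
Lemma kills_qnum mu m b : (forall u, b u != 0) ->
  (forall F s, invariant_by F -> (1 <= s <= m)%N ->
     ev mu (fun u => (b u ^+ s - b u ^- s) * F u) = 0) ->
  kills mu m (fun u => b u - (b u)^-1) (fun u => b u + (b u)^-1).
Proof.
move=> b0 h; apply: kills_monom => F i pF im.
have gen k : (1 <= k)%N -> (k + i <= m)%N ->
  ev mu (fun u => (b u ^+ k - b u ^- k) * (b u + (b u)^-1) ^+ i * F u) = 0.
  elim: i k {im} => [|i IH] k k1 km.
    rewrite -[RHS](h F k) //; last by rewrite k1 -(addn0 k).
    by apply: eq_ev => u; rewrite expr0 mulr1.
  rewrite (@eq_ev _ _ _ _ (fun u =>
     (b u ^+ k.+1 - b u ^- k.+1) * (b u + (b u)^-1) ^+ i * F u +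
     (b u ^+ k.-1 - b u ^- k.-1) * (b u + (b u)^-1) ^+ i * F u)).
    rewrite evD IH ?addSnnS // add0r.
    case: k k1 km => // -[|k] _ km /=.
      by apply: ev_nseq => p _; rewrite expr0 invr1 subrr !mul0r.
    by apply: IH => //; move: km; lia.
  move=> u; case: k k1 {km} => // k _ /=.
  rewrite [_ ^+ i.+1]exprSr -!exprVn !exprS.
  have : b u * (b u)^-1 = 1 by rewrite divff.
  set x := b u; set y := x^-1 => xy.
  have -> : (x * x ^+ k - y * y ^+ k) * ((x + y) ^+ i * (x + y)) * F u =
   (x * (x * x ^+ k) + (x * y) * x ^+ k - (x * y) * y ^+ k - y * (y * y ^+ k)) *
     (x + y) ^+ i * F u by ring.
  rewrite xy; ring.
by rewrite -[RHS](gen 1%N) // ?add1n.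
Qed.

Lemma uniq_int_spread (js : seq int) (m : nat) : uniq js -> (m < size js)%N ->
  exists j1 j2 : int, [/\ j1 \in js, j2 \in js & j2 + m%:Z <= j1].
Proof.
case: js => // j js; set s := j :: js => us ms.
have [j2 j2s hj2] := @seq_argmax _ int _ s (fun j => - j) j (mem_head _ _).
apply: contrapT => hn.
have : (size s <= size [seq ((j2 : int) + i%:Z)%R | i <- iota 0 m])%N.
  apply: uniq_leq_size => // k ks.
  have k1 : j2 <= k by have := hj2 k ks; rewrite lerN2.
  have k2 : k < j2 + m%:Z.
    by rewrite ltNge; apply/negP => le; apply: hn; exists k, j2.
  apply/mapP; exists `|k - j2|%N; last by lia.
  by rewrite mem_iota; lia.
by rewrite size_map size_iota leqNgt ms.
Qed.

(** If the line p + Z d carried at most m support points, a polynomial in X of degree less than m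
    could vanish at all of them except p, and testing against it would make the coefficient at p
    zero. So there are at least m + 1 of them, and m + 1 distinct integers spread over at least
    m. *)
Lemma kills_edge mu m e X : (forall j : int, d *~ j = 0 -> j = 0) ->
  kills mu m e X -> (forall u, cf mu u != 0 -> e u != 0) ->
  (forall u (j : int), cf mu u != 0 -> cf mu (u + d *~ j) != 0 ->
     X u = X (u + d *~ j) -> j = 0) ->
  forall p, cf mu p != 0 -> exists j1 j2 : int,
    [/\ cf mu (p + d *~ j1) != 0, cf mu (p + d *~ j2) != 0 & j2 + m%:Z <= j1].
Proof.
move=> d0 hk he hX p hp.
pose onstr u := `[< exists j : int, u = p + d *~ j >].
pose S := [seq u <- msupp mu | onstr u].
have uS : uniq S by rewrite filter_uniq ?msupp_uniq.
have pS : p \in S.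
  rewrite mem_filter mem_msupp hp andbT.
  by apply/asboolP; exists 0; rewrite mulr0z addr0.
have Sstr u : u \in S -> {j : int | u = p + d *~ j}.
  by rewrite mem_filter => /andP[/asboolP h _]; apply: cid.
have [sS|sS] := leqP (size S) m; last first.
  pose J u := if pselect (u \in S) is left h then projT1 (Sstr u h) else 0.
  have JE u : u \in S -> u = p + d *~ J u.
    by rewrite /J; case: pselect => // h _; case: (Sstr u h).
  have [||j1 [j2 []]] := @uniq_int_spread [seq J u | u <- S] m.
  - rewrite map_inj_in_uniq // => u v uS' vS Juv.
    by rewrite (JE u uS') (JE v vS) Juv.
  - by rewrite size_map.
  move=> /mapP[u1 u1S ->] /mapP[u2 u2S ->] le.
  exists (J u1), (J u2); split => //; rewrite -JE //.
    by move: u1S; rewrite mem_filter mem_msupp => /andP[].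
  by move: u2S; rewrite mem_filter mem_msupp => /andP[].
pose Q := \prod_(u <- rem p S) ('X - (X u)%:P).
have sQ : (size Q <= m)%N.
  rewrite size_prod_XsubC size_rem // prednK //.
  by case: (S) pS.
(* The indicator of the line through p is invariant under d, hence an admissible test function. *)
pose F u : K := (onstr u)%:R.
have pF : invariant_by F.
  move=> u; rewrite /F; congr (nat_of_bool _)%:R; apply/asboolP/asboolP => -[j hj].
    by exists (j - 1); rewrite mulrzBr mulr1z addrA -hj addrK.
  by exists (j + 1); rewrite mulrzDr mulr1z addrA -hj.
have := hk F Q pF sQ; rewrite ev_msupp (bigD1_seq p) ?msupp_uniq ?mem_msupp //=.
rewrite big1_seq ?addr0; last first.
  move=> u /andP[up us]; rewrite /F.
  case ou: (onstr u); last by rewrite !mulr0.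
  suff -> : Q.[X u] = 0 by rewrite mulr0 !mul0r mulr0.
  rewrite horner_prod (big_rem u) /= ?hornerXsubC ?subrr ?mul0r //.
  by rewrite mem_rem_uniq // inE up mem_filter ou.
have -> : F p = 1.
  rewrite /F (_ : onstr p) //; apply/asboolP; exists 0.
  by rewrite mulr0z addr0.
move/eqP; rewrite mulr1 !mulf_eq0 (negbTE hp) (negbTE (he p hp)) /=.
rewrite horner_prod prodf_seq_eq0 => /hasP[u]; rewrite mem_rem_uniq // inE.
case/andP=> up uS'; rewrite hornerXsubC subr_eq0 => /eqP Xpu.
have [j uj] := Sstr u uS'.
have cu : cf mu (p + d *~ j) != 0.
  by move: uS'; rewrite uj mem_filter mem_msupp => /andP[].
rewrite uj in Xpu; have j0 := hX p j hp cu Xpu.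
by case/eqP: up; rewrite uj j0 mulr0z addr0.
Qed.

End Nodes.

Section Interpolation.
Variables (K : fieldType) (T : eqType).

Lemma interpolation (s : seq T) (X F : T -> K) :
  {in s &, forall u v, X u = X v -> F u = F v} ->
  exists Q : {poly K}, {in s, forall u, Q.[X u] = F u}.
Proof.
elim: s => [|a s IH] h; first by exists 0.
have [] := IH; first by move=> u v us vs; apply: h; rewrite inE ?us ?vs orbT.
move=> Q hQ.
pose B := \prod_(u <- s | X u != X a) ('X - (X u)%:P).
have B0 : B.[X a] != 0.
  rewrite horner_prod prodf_seq_neq0; apply/allP => u _; apply/implyP => ua.
  by rewrite hornerXsubC subr_eq0 eq_sym.
exists (Q + ((F a - Q.[X a]) / B.[X a]) *: B) => u.
have main : X u = X a -> F u = F a ->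
    (Q + ((F a - Q.[X a]) / B.[X a]) *: B).[X u] = F u.
  by move=> -> ->; rewrite hornerD hornerZ divfK // addrC subrK.
rewrite inE => /predU1P[ua|us]; first by apply: main; rewrite ua.
have [Xua|Xua] := eqVneq (X u) (X a).
  by apply: main => //; apply: h => //; rewrite inE ?us ?orbT ?eqxx.
rewrite hornerD hornerZ.
suff -> : B.[X u] = 0 by rewrite mulr0 addr0 hQ.
by rewrite horner_prod (big_rem u) //= Xua hornerXsubC subrr mul0r.
Qed.

End Interpolation.

(** By interpolation F is a polynomial in X on the support. When X is the value of a character, its
    powers are the values at multiples of one point, so a single point that separates the
    frequencies suffices. *)
Lemma power_sums_ev (K : fieldType) (T : zmodType) (mu : seq (K * T)) (X F : T -> K) :
  (forall k, ev mu (fun u => X u ^+ k) = 0) ->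
  (forall u v, u \in [seq p.2 | p <- mu] -> v \in [seq p.2 | p <- mu] ->
     X u = X v -> F u = F v) -> ev mu F = 0.
Proof.
move=> h hF; have [Q hQ] := @interpolation K T [seq p.2 | p <- mu] X F hF.
transitivity (ev mu (fun u => \sum_(i < size Q) Q`_i * X u ^+ i)).
  rewrite /ev !big_seq; apply: eq_bigr => p pmu.
  by rewrite -hQ ?map_f // horner_coef.
by rewrite ev_sum big1 // => i _; rewrite evZ h mulr0.
Qed.

(** * Cramer's rule for infinite families of equations *)

Section Cramer.
Variables (K : fieldType) (I : Type) (r : nat).

(** Greedy choice: while fewer than r rows are chosen, some nonzero u is killed by all of them, and
    triviality of the common kernel provides a further row that does not kill u. *)
Lemma row_selection (rows : I -> 'rV[K]_r) :
  (forall c : 'cV[K]_r, (forall i, rows i *m c = 0) -> c = 0) ->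
  exists f : 'I_r -> I, \matrix_j rows (f j) \in unitmx.
Proof.
move=> triv.
suff [f] : exists f : 'I_r -> I, row_free (\matrix_j rows (f j)).
  by rewrite row_free_unit; exists f.
suff gen k : (k <= r)%N -> exists f : 'I_k -> I, row_free (\matrix_j rows (f j)).
  exact: gen.
elim: k => [|k IH] kr.
  (* [I] may be empty, so the empty family is obtained by elimination on the impossible bound. *)
  exists (fun i : 'I_0 => match ltn_ord i in (_ = b) return
    (if b then I else unit) with erefl => tt end).
  by rewrite /row_free -leqn0 rank_leq_row.
have [f hf] := IH (ltnW kr).
set M := \matrix_j _ in hf.
have [u uM u0] : exists2 u : 'rV_r, u *m M^T = 0 & u != 0.
  have : kermx M^T != 0.
    rewrite kermx_eq0 /row_free mxrank_tr; move: hf; rewrite /row_free.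
    by move=> /eqP ->; rewrite neq_ltn kr.
  by case/rowV0Pn=> u /sub_kermxP uM u0; exists u.
have [i hi] : exists i, rows i *m u^T != 0.
  apply: contrapT => hn; case/eqP: u0; apply: trmx_inj; rewrite trmx0.
  apply: triv => i; apply/eqP; apply: contrapT => /negP h; apply: hn.
  by exists i.
rewrite -addn1.
exists (fun j => match fintype.split j with inl a => f a | inr _ => i end).
set M' := \matrix_j _.
have -> : M' = col_mx M (rows i).
  apply/matrixP => a b; rewrite mxE [RHS]mxE.
  by case: (fintype.split a) => c; rewrite ?mxE // (ord1 c).
apply: inj_row_free => v; rewrite -[v]hsubmxK mul_row_col.
set v1 := lsubmx v; set v2 := rsubmx v => h.
have v20 : v2 = 0.
  move: (congr1 (mulmx^~ u^T) h); rewrite /= mulmxDl mul0mx -!mulmxA.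
  have -> : M *m u^T = 0 by apply: trmx_inj; rewrite trmx_mul trmxK uM trmx0.
  rewrite mulmx0 add0r [v2]mx11_scalar mul_scalar_mx => /eqP.
  by rewrite scaler_eq0 (negbTE hi) orbF => /eqP ->; rewrite raddf0.
move: h; rewrite v20 mul0mx addr0 => h.
have -> : v1 = 0 by apply: (row_free_inj hf); rewrite h mul0mx.
by rewrite row_mx0.
Qed.

Variables (X : Type) (A : I -> 'I_r -> X -> K) (b : I -> X -> K) (x0 : X).
Variable Pd : (X -> K) -> Prop.
Hypotheses (Pd_cst : forall c, Pd (fun=> c))
  (Pd_add : forall f g, Pd f -> Pd g -> Pd (fun x => f x + g x))
  (Pd_mul : forall f g, Pd f -> Pd g -> Pd (fun x => f x * g x))
  (Pd_ext : forall f g, f =1 g -> Pd f -> Pd g).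

Lemma Pd_sum (J : Type) (s : seq J) (P : pred J) (f : J -> X -> K) :
  (forall j, Pd (f j)) -> Pd (fun x => \sum_(j <- s | P j) f j x).
Proof.
move=> h; elim: s => [|j s IH].
  by apply: Pd_ext (Pd_cst 0) => x; rewrite big_nil.
have [pj|pj] := boolP (P j).
  by apply: Pd_ext (Pd_add (h j) IH) => x; rewrite big_cons pj.
by apply: Pd_ext IH => x; rewrite big_cons (negbTE pj).
Qed.

Lemma Pd_prod (J : Type) (s : seq J) (P : pred J) (f : J -> X -> K) :
  (forall j, Pd (f j)) -> Pd (fun x => \prod_(j <- s | P j) f j x).
Proof.
move=> h; elim: s => [|j s IH].
  by apply: Pd_ext (Pd_cst 1) => x; rewrite big_nil.
have [pj|pj] := boolP (P j).
  by apply: Pd_ext (Pd_mul (h j) IH) => x; rewrite big_cons pj.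
by apply: Pd_ext IH => x; rewrite big_cons (negbTE pj).
Qed.

Lemma Pd_det k (M : 'I_k -> 'I_k -> X -> K) : (forall i j, Pd (M i j)) ->
  Pd (fun x => \det (\matrix_(i, j) M i j x)).
Proof.
move=> h; rewrite /determinant.
apply: Pd_sum => s; apply: Pd_mul => //.
have hp : Pd (fun x => \prod_i M i (perm.fun_of_perm s i) x) by apply: Pd_prod.
apply: Pd_ext hp => x.
by apply: eq_bigr => i _; rewrite mxE.
Qed.

Lemma cramer :
  (forall i j, Pd (A i j)) -> (forall i, Pd (b i)) ->
  (forall c : 'I_r -> K, (forall i, \sum_j A i j x0 * c j = 0) ->
     forall j, c j = 0) ->
  exists D N, [/\ Pd D, forall j : 'I_r, Pd (N j), D x0 != 0 &
    forall x (c : 'I_r -> K), (forall i, \sum_j A i j x * c j = b i x) ->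
      forall j, D x * c j = N j x].
Proof.
move=> hA hb triv.
have [f hf] : exists f : 'I_r -> I,
    \matrix_j (\row_k A (f j) k x0) \in unitmx.
  apply: (@row_selection (fun i => \row_k A i k x0)) => c hc.
  apply/matrixP => j l; rewrite (ord1 l) mxE.
  apply: (triv (fun j => c j ord0)) => i.
  by have /matrixP/(_ ord0 ord0) := hc i; rewrite !mxE => h; rewrite -[RHS]h; apply: eq_bigr => k _; rewrite mxE.
pose M x := \matrix_(j, k) A (f j) k x.
have cofP i j : Pd (fun x => cofactor (M x) i j).
  apply: Pd_mul => //.
  have hd := @Pd_det _ (fun a c => A (f (lift i a)) (lift j c))
    (fun a c => hA _ _).
  apply: Pd_ext hd => x.
  by congr (\det _); apply/matrixP => a c; rewrite !mxE.
exists (fun x => \det (M x)).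
exists (fun j x => \sum_k cofactor (M x) k j * b (f k) x); split.
- by apply: Pd_det => i j; apply: hA.
- by move=> j; apply: Pd_sum => k; apply: Pd_mul.
- move: hf; rewrite unitmxE unitfE; congr (\det _ != 0).
  by apply/matrixP => a c; rewrite !mxE.
move=> x c hc j.
have : \adj (M x) *m (M x *m \col_k c k) = \adj (M x) *m \col_k b (f k) x.
  congr (_ *m _); apply/matrixP => k l; rewrite !mxE -hc.
  by apply: eq_bigr => a _; rewrite !mxE.
rewrite mulmxA mul_adj_mx mul_scalar_mx => /matrixP/(_ j ord0).
by rewrite !mxE => ->; apply: eq_bigr => k _; rewrite !mxE.
Qed.

End Cramer.

(** * Chambers and walls *)

Section Roots.
Variables (R : realType) (n : nat) (Phi : {fset 'cV[R]_n}).
Hypotheses (Phi_root : root_system Phi) (Phi_red : reduced Phi).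
Local Notation V := 'cV[R]_n.
Implicit Types (a b u v xi : V) (m : V -> nat) (w : 'M[R]_n).

Lemma root_dot_gt0 a : a \in Phi -> 0 < dot a a.
Proof. by move=> aP; rewrite dot_gt0 // (root_neq0 Phi_root). Qed.

Lemma corootE (a : V) : coroot a = (2 / dot a a) *: a.
Proof. by []. Qed.

Lemma reflE a v : refl a *m v = v - dot v (coroot a) *: a.
Proof.
rewrite /refl mulmxBl mul1mx -mulmxA dot_mxE mul_mx_scalar dotC.
by [].
Qed.

Lemma reflE' a v : refl a *m v = v - dot v a *: coroot a.
Proof. by rewrite reflE /coroot dotZr !scalerA mulrC. Qed.

Lemma dot_corootl a v : dot (coroot a) v = 2 / dot a a * dot a v.
Proof. exact: dotZl. Qed.

Lemma coroot_dot a : a \in Phi -> dot (coroot a) a = 2.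
Proof. by move=> aP; rewrite dot_corootl divfK // gt_eqF // root_dot_gt0. Qed.

Lemma corootN a : coroot (- a) = - coroot a.
Proof. by rewrite /coroot dotNl dotNr opprK scalerN. Qed.

Lemma coroot_dotr a : a \in Phi -> dot a (coroot a) = 2.
Proof. by move=> aP; rewrite dotC coroot_dot. Qed.

Lemma coroot_neq0 a : a \in Phi -> coroot a != 0.
Proof.
move=> aP; apply/eqP => h; have := coroot_dot aP.
by rewrite h dot0l => /esym/eqP; rewrite pnatr_eq0.
Qed.

Lemma coroot_dot_gt0 a xi : a \in Phi ->
  (0 < dot (coroot a) xi) = (0 < dot xi a).
Proof.
move=> aP; rewrite dot_corootl pmulr_rgt0 1?dotC //.
by rewrite divr_gt0 // root_dot_gt0.
Qed.

Lemma coroot_dot_eq0 a xi : a \in Phi ->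
  (dot (coroot a) xi == 0) = (dot xi a == 0).
Proof.
move=> aP; rewrite dot_corootl mulf_eq0 dotC orb_idl // mulf_eq0 pnatr_eq0.
by rewrite invr_eq0 (gt_eqF (root_dot_gt0 aP)).
Qed.

Lemma sgr_coroot a xi : a \in Phi ->
  Num.sg (dot (coroot a) xi) = Num.sg (dot xi a).
Proof.
move=> aP; rewrite dot_corootl sgrM gtr0_sg ?mul1r 1?dotC //.
by rewrite divr_gt0 // root_dot_gt0.
Qed.

Lemma neg_root a : a \in Phi -> - a \in Phi.
Proof.
move=> aP; have := root_refl Phi_root aP aP; rewrite reflE dotC coroot_dot //.
suff -> : a - (2 : R) *: a = - a by [].
by rewrite scaler_nat mulr2n opprD addrA subrr add0r.
Qed.

Lemma dot_refl a u v : a \in Phi -> dot (refl a *m u) (refl a *m v) = dot u v.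
Proof.
move=> aP; have a0 := lt0r_neq0 (root_dot_gt0 aP).
rewrite !reflE !dotBl !dotBr !dotZl !dotZr /coroot ?dotZr (dotC a v).
by field.
Qed.

Lemma refl_invol a v : a \in Phi -> refl a *m (refl a *m v) = v.
Proof.
move=> aP; rewrite !reflE dotBl dotZl (dotC a) coroot_dot // mulr2n.
by rewrite mulrDr mulr1 opprD addNKr scaleNr opprK subrK.
Qed.

Lemma dot_refl_adj a u v : a \in Phi -> dot (refl a *m u) v = dot u (refl a *m v).
Proof. by move=> aP; rewrite -{1}(refl_invol v aP) dot_refl. Qed.

Lemma coroot_dot_int a b : a \in Phi -> b \in Phi ->
  dot (coroot a) b \is a Num.int.
Proof. by move=> aP bP; rewrite dotC (root_int Phi_root). Qed.

Lemma root_noncol a b (c d : R) : a \in Phi -> b \in Phi -> b != a -> b != - a ->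
  c *: b = d *: a -> c = 0.
Proof.
move=> aP bP ba bNa h; apply: contrapT => /eqP c0.
have bE : b = (d / c) *: a by rewrite mulrC -scalerA -h scalerA mulVf // scale1r.
have := Phi_red aP (c := d / c); rewrite -bE => /(_ bP)[e|e].
  by move: ba; rewrite bE e scale1r eqxx.
by move: bNa; rewrite bE e scaleN1r eqxx.
Qed.

Definition regular xi := forall a, a \in Phi -> dot xi a != 0.

Lemma weyl_root w a : weyl Phi w -> a \in Phi -> w *m a \in Phi.
Proof.
elim=> [|b w' bP _ IH] aP; first by rewrite mul1mx.
by rewrite -mulmxA (root_refl Phi_root) // IH.
Qed.

Lemma dot_weyl w u v : weyl Phi w -> dot (w *m u) (w *m v) = dot u v.
Proof.
elim=> [|b w' bP _ IH]; first by rewrite !mul1mx.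
by rewrite -!mulmxA dot_refl.
Qed.

Lemma weyl_mul w w' : weyl Phi w -> weyl Phi w' -> weyl Phi (w *m w').
Proof.
elim=> [|b u bP _ IH] h; first by rewrite mul1mx.
by rewrite -mulmxA; apply: weyl_refl => //; apply: IH.
Qed.

Lemma refl_sq a : a \in Phi -> refl a *m refl a = 1%:M.
Proof.
move=> aP; apply/matrixP => i j.
have := refl_invol (delta_mx j ord0) aP.
move/matrixP/(_ i ord0); rewrite mulmxA -colE !mxE => ->.
by rewrite andbT.
Qed.

Lemma weyl_refl1 a : a \in Phi -> weyl Phi (refl a).
Proof. by move=> aP; rewrite -[refl a]mulmx1; apply: weyl_refl => //; apply: weyl_1. Qed.

Lemma weyl_inv w : weyl Phi w ->
  exists w', [/\ weyl Phi w', w *m w' = 1%:M & w' *m w = 1%:M].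
Proof.
elim=> [|b u bP _ [u' [h1 h2 h3]]].
  by exists 1%:M; split; rewrite ?mulmx1 //; apply: weyl_1.
exists (u' *m refl b); split.
- by apply: weyl_mul => //; apply: weyl_refl1.
- by rewrite mulmxA -(mulmxA (refl b)) h2 mulmx1 refl_sq.
- by rewrite mulmxA -(mulmxA u') refl_sq // mulmx1.
Qed.

Lemma coroot_weyl w a : weyl Phi w -> coroot (w *m a) = w *m coroot a.
Proof. by move=> hw; rewrite /coroot dot_weyl // scalemxAr. Qed.

Lemma weyl_inj w u v : weyl Phi w -> w *m u = w *m v -> u = v.
Proof.
case/weyl_inv=> w' [_ _ h] /(congr1 (mulmx w')).
by rewrite !mulmxA h !mul1mx.
Qed.

Lemma refl_tr a : (refl a)^T = refl a.
Proof.
rewrite /refl linearB /= trmx1 trmx_mul trmxK /coroot.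
by rewrite linearZ /= -scalemxAl -scalemxAr.
Qed.

Lemma weyl_orth w : weyl Phi w -> w^T *m w = 1%:M.
Proof.
elim=> [|a u aP _ IH]; first by rewrite trmx1 mulmx1.
by rewrite trmx_mul refl_tr -mulmxA (mulmxA (refl a)) (refl_sq aP) mul1mx.
Qed.

Lemma sum_root_weyl (M : nmodType) w (F : V -> M) : weyl Phi w ->
  \sum_(a <- Phi) F (w *m a) = \sum_(a <- Phi) F a.
Proof.
move=> hw; rewrite -(big_map (mulmx w) xpredT F); apply: perm_big.
have um : uniq [seq w *m a | a <- Phi].
  by rewrite map_inj_uniq ?fset_uniq // => u v; apply: weyl_inj.
apply: uniq_perm => //; first exact: fset_uniq.
move=> a; apply/mapP/idP => [[b bP ->]|aP]; first exact: weyl_root.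
have [w' [hw' h1 h2]] := weyl_inv hw.
exists (w' *m a); first by apply: weyl_root.
by rewrite mulmxA h1 mul1mx.
Qed.

Lemma sum_rootN (M : nmodType) (F : V -> M) :
  \sum_(a <- Phi) F (- a) = \sum_(a <- Phi) F a.
Proof.
rewrite -(big_map -%R xpredT F); apply: perm_big.
have um : uniq [seq - a | a <- Phi].
  by rewrite map_inj_uniq ?fset_uniq //; apply: oppr_inj.
apply: uniq_perm => //; first exact: fset_uniq.
move=> a; apply/mapP/idP => [[b bP ->]|aP]; first exact: neg_root.
by exists (- a); rewrite ?opprK //; apply: neg_root.
Qed.

Lemma regular_weyl w xi : weyl Phi w -> regular xi -> regular (w *m xi).
Proof.
move=> hw hxi a aP; have [w' [hw' h1 h2]] := weyl_inv hw.
rewrite -[a]mul1mx -h1 -mulmxA dot_weyl //; apply: hxi.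
exact: weyl_root.
Qed.

(* Only the segment from xi to xi' is used; the second condition makes it
   cross the walls one at a time. *)
Lemma regular_perturb xi xi' (Y : seq V) : regular xi -> {in Y, forall y, dot xi' y < 0} ->
  exists xi2, [/\ {in Y, forall y, dot xi2 y < 0}, regular xi2 &
   forall a b, a \in Phi -> b \in Phi -> b != a -> b != - a ->
     dot xi2 a * dot xi b != dot xi2 b * dot xi a].
Proof.
move=> hxi hY.
pose z (a b : V) := dot xi a *: b - dot xi b *: a.
pose B := [seq z p.1 p.2 | p <- [seq (a, b) | a <- Phi, b <- Phi] &
             (p.2 != p.1) && (p.2 != - p.1)] ++ Phi.
have hB : {in B, forall b, b != 0}.
  move=> y; rewrite mem_cat => /orP[/mapP[[a b]]|]; last exact: root_neq0.
  rewrite mem_filter /= => /andP[/andP[ab aNb]].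
  case/allpairsP=> -[a' b'] /= [aP bP [? ?]] ->; subst a' b'.
  rewrite subr_eq0; apply/eqP => h.
  have := root_noncol aP bP ab aNb h.
  by move/eqP; rewrite (negbTE (hxi a aP)).
have [xi2 [h1 h2]] := perturb_generic hY hB.
exists xi2; split => // [a aP|a b aP bP ab aNb].
  by apply: h2; rewrite mem_cat aP orbT.
have := h2 (z a b); rewrite mem_cat => /(_ _)/wrap[].
  apply/orP; left; apply/mapP; exists (a, b) => //.
  rewrite mem_filter /= ab aNb /=; apply/allpairsP; exists (a, b).
  by split.
rewrite /z dotBr !dotZr subr_eq0; apply: contraNneq => h.
by rewrite mulrC -h mulrC.
Qed.

Definition same_chamber xi xi' :=
  forall a, a \in Phi -> (0 < dot xi a) = (0 < dot xi' a).

(* [xi0] is interior to the facet of the chamber of [xi] that is orthogonal to [a]. *)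
Definition wall xi a xi0 := [/\ regular xi, a \in Phi, 0 < dot xi a, dot xi0 a = 0 &
  forall b, b \in Phi -> b != a -> b != - a ->
    (dot xi0 b != 0) /\ (0 < dot xi b) = (0 < dot xi0 b)].

(** Induction on the number of roots positive at xi and negative at xi'. The first wall met on the
    segment belongs to a single pair of roots, and the reflection in it takes xi to the adjacent
    chamber, which removes one root from the count and adds none. *)
Lemma chamber_walk (Pr : V -> Prop) :
  (forall xi xi', regular xi -> regular xi' -> same_chamber xi xi' -> Pr xi -> Pr xi') ->
  (forall xi a xi0, wall xi a xi0 -> Pr xi -> Pr (refl a *m xi)) ->
  forall xi xi', regular xi -> regular xi' -> Pr xi -> Pr xi'.
Proof.
move=> hsame hwall xi xi' hxi hxi'.
have [N le] := ubnP (size [seq a <- Phi | (0 < dot xi a) && (dot xi' a < 0)]).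
elim: N xi hxi le => // N IH xi hxi le Pxi.
(* Negativity on Y keeps the perturbed end point in the chamber of [xi']. *)
pose Y := [seq (if 0 < dot xi' a then - a else a) | a <- Phi].
have hY : {in Y, forall y, dot xi' y < 0}.
  move=> y /mapP[a aP ->]; case: ifP => [|/negbT]; first by rewrite dotNr oppr_lt0.
  by rewrite -leNgt lt_neqAle hxi' ?aP.
have [xi2 [h1 h2 h3]] := regular_perturb hxi hY.
have sc a : a \in Phi -> (0 < dot xi' a) = (0 < dot xi2 a).
  move=> aP; have := h1 (if 0 < dot xi' a then - a else a).
  rewrite map_f // => /(_ isT).
  case: ifP => _; first by rewrite dotNr oppr_lt0.
  by rewrite lt_neqAle => /andP[_]; rewrite leNgt => /negbTE.
have scn a : a \in Phi -> (dot xi' a < 0) = (dot xi2 a < 0).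
  by move=> aP; have := sc _ (neg_root aP); rewrite !dotNr !oppr_gt0.
pose S := [seq a <- Phi | (0 < dot xi a) && (dot xi2 a < 0)].
have SE : [seq a <- Phi | (0 < dot xi a) && (dot xi' a < 0)] = S.
  by apply: eq_in_filter => a /scn ->.
rewrite SE in le.
case SS : S => [|a0 S'].
  apply: (hsame xi) => // a aP; rewrite sc //; apply/idP/idP => ha.
    rewrite lt_neqAle eq_sym h2 //= leNgt; apply/negP => ha'.
    have : a \in S by rewrite mem_filter ha ha' aP.
    by rewrite SS.
  rewrite lt_neqAle eq_sym hxi //= leNgt; apply/negP => ha'.
  have : - a \in S by rewrite mem_filter !dotNr oppr_gt0 oppr_lt0 ha ha' neg_root.
  by rewrite SS.
(* The time at which the segment from [xi] to [xi2] meets the wall of a; by [h3] these times are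
   distinct. *)
pose t (a : V) := dot xi a / (dot xi a - dot xi2 a).
have a0S : a0 \in S by rewrite SS mem_head.
have [al alS ht] := @seq_argmax _ R _ S (fun a => - t a) a0 a0S.
have {alS} [] : [/\ 0 < dot xi al, dot xi2 al < 0 & al \in Phi].
  by move: alS; rewrite mem_filter => /andP[/andP[]].
move=> p1 p2 alP.
pose tt := t al.
pose xi0 := xi + tt *: (xi2 - xi).
have den : 0 < dot xi al - dot xi2 al by rewrite subr_gt0 (lt_trans p2).
have t0 : 0 < tt by rewrite divr_gt0.
have t1 : tt < 1 by rewrite ltr_pdivrMr // mul1r ltrDl oppr_gt0.
have xi0E a : dot xi0 a = (1 - tt) * dot xi a + tt * dot xi2 a.
  by rewrite dotDl dotZl dotBl; ring.
have xi0al : dot xi0 al = 0.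
  by rewrite xi0E /tt /t; field; rewrite gt_eqF.
have key b : b \in Phi -> b != al -> b != - al -> 0 < dot xi b -> 0 < dot xi0 b.
  move=> bP bal bNal b0.
  have [b2|b2] := leP 0 (dot xi2 b).
    rewrite xi0E ltr_pwDl ?mulr_gt0 ?subr_gt0 //.
    by rewrite mulr_ge0 // ltW.
  have bS : b \in S by rewrite mem_filter b0 b2.
  have denb : 0 < dot xi b - dot xi2 b by rewrite subr_gt0 (lt_trans b2).
  have := ht b bS; rewrite lerN2 -/tt => tb.
  have {tb} tb : tt < t b.
    rewrite lt_neqAle tb andbT; apply/eqP => /eqP.
    rewrite /tt /t (eqr_div _ _ (lt0r_neq0 den) (lt0r_neq0 denb)) => /eqP h.
    have := h3 al b alP bP bal bNal; rewrite -subr_eq0; apply/negP; rewrite negbK.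
    by apply/eqP; move: h; lra.
  rewrite xi0E; move: tb; rewrite ltr_pdivlMr //; lra.
have hw : wall xi al xi0.
  split => // b bP bal bNal.
  have [b0|b0] := ltP 0 (dot xi b).
    by have := key b bP bal bNal b0 => k; rewrite k gt_eqF.
  have b0' : 0 < dot xi (- b).
    by rewrite dotNr oppr_gt0 lt_neqAle hxi.
  have := key (- b) (neg_root bP) _ _ b0'; rewrite eqr_oppLR bNal eqr_opp bal.
  move=> /(_ isT isT); rewrite dotNr oppr_gt0 => k.
  by rewrite lt_eqF //; split=> //; apply/esym/negbTE; rewrite -leNgt ltW.
have hw2 := hwall _ _ _ hw Pxi.
apply: (IH (refl al *m xi)) => //.
  by apply: regular_weyl => //; apply: weyl_refl1.
have reflN b : refl al *m b = - al -> b = al.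
  move=> h; rewrite -[b](refl_invol _ alP) h mulmxN reflE coroot_dotr //.
  by rewrite scaler_nat mulr2n opprB addrK.
have reflP b : refl al *m b = al -> b = - al.
  move=> h; rewrite -[b](refl_invol _ alP) h reflE coroot_dotr //.
  by rewrite scaler_nat mulr2n opprD addrA subrr add0r.
have sgn b : b \in Phi -> b != al -> b != - al ->
    (0 < dot (refl al *m xi) b) = (0 < dot xi b).
  move=> bP bal bNal; rewrite dot_refl_adj //.
  have [_ _ _ _ hxi0] := hw.
  have [_ ->] := hxi0 (refl al *m b) (root_refl Phi_root alP bP)
    (introN eqP (fun h => elimN eqP bNal (reflP b h)))
    (introN eqP (fun h => elimN eqP bal (reflN b h))).
  have [_ ->] := hxi0 b bP bal bNal.
  by rewrite -dot_refl_adj // reflE' xi0al scale0r subr0.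
have alS : al \in S by rewrite mem_filter p1 p2 alP.
rewrite -ltnS; apply: leq_ltn_trans le; rewrite -(prednK (n := size S)); last first.
  by case: (S) alS.
rewrite ltnS -(size_rem alS); apply: uniq_leq_size.
  by rewrite filter_uniq // fset_uniq.
move=> b; rewrite mem_filter => /andP[/andP[b1 b2] bP].
rewrite mem_rem_uniq ?filter_uniq ?fset_uniq // inE mem_filter.
have bal : b != al.
  apply: contraTneq b1 => ->; rewrite dot_refl_adj // reflE coroot_dotr //.
  by rewrite scaler_nat mulr2n opprD addrA subrr add0r dotNr oppr_gt0 -leNgt ltW.
have bNal : b != - al.
  by apply: contraTneq b2 => ->; rewrite dotNr oppr_lt0 -leNgt ltW ?scn.
by rewrite bal -sgn // b1 -scn // b2 bP.
Qed.
End Roots.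

Local Opaque coroot.

(** * Supports with long root strings *)

Section Support.
Variables (R : realType) (n : nat) (Phi : {fset 'cV[R]_n}).
Hypotheses (Phi_root : root_system Phi) (Phi_red : reduced Phi).
Local Notation V := 'cV[R]_n.
Implicit Types (a b u v xi p : V) (m k : V -> nat) (w : 'M[R]_n) (P : seq V).

Definition edges P a (k : nat) := forall p, p \in P ->
  exists p1 p2 (l r : R), [/\ p1 \in P, p2 \in P,
    p1 = p2 + l *: coroot a, k%:R <= l & p = p1 + r *: coroot a].

Lemma edges0 P a : edges P a 0.
Proof.
move=> p pP; exists p, p, 0, 0; split; rewrite ?scale0r ?addr0 //.
Qed.

Definition crossed xi xi' := [seq a <- Phi | (0 < dot xi a) && (dot xi' a < 0)].

(** The maximum over P of the form at time t on the segment from xi to xi' is a convex piecewise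
    linear function of t. When the wall of a is crossed, the highest points contain a pair at
    distance at least m_a along a^vee, so the slope jumps accordingly; following the maximum up to
    time 1 gives the bound. The induction runs over the walls s still to be crossed after [t0]. *)
Lemma support_generic xi xi' m P p : regular Phi xi ->
  (forall a b, a \in Phi -> b \in Phi -> b != a -> b != - a ->
     dot xi' a * dot xi b != dot xi' b * dot xi a) ->
  (forall a, a \in crossed xi xi' -> edges P a (m a)) ->
  p \in P -> (forall p', p' \in P -> dot xi p' <= dot xi p) ->
  exists2 p', p' \in P &
    dot xi' p - \sum_(a <- crossed xi xi') (m a)%:R * dot (coroot a) xi'
      <= dot xi' p'.
Proof.
move=> hxi good hedge pP pmax.
pose pth (t : R) := xi + t *: (xi' - xi).
pose t (a : V) := dot xi a / (dot xi a - dot xi' a).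
suff gen N s : (size s < N)%N -> uniq s -> {subset s <= crossed xi xi'} ->
    forall (t0 : R) p0, p0 \in P -> t0 < 1 ->
    (forall p', p' \in P -> dot (pth t0) p' <= dot (pth t0) p0) ->
    (forall a, a \in s -> t0 < t a) ->
    exists2 p', p' \in P &
      dot xi' p0 - \sum_(a <- s) (m a)%:R * dot (coroot a) xi' <= dot xi' p'.
  apply: (gen _ _ (ltnSn _) _ (fun _ h => h) 0 p) => //.
  - by rewrite filter_uniq // fset_uniq.
  - by move=> p'; rewrite /pth scale0r addr0; apply: pmax.
  - move=> a; rewrite mem_filter => /andP[/andP[h1 h2] _].
    by rewrite divr_gt0 // subr_gt0 (lt_trans h2).
elim: N s => // N IH s sN us ss t0 p0 p0P t01 p0max ht.
case s0 : (s == [::]).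
  by exists p0 => //; rewrite (eqP s0) big_nil subr0.
have [a1 a1s] : exists a, a \in s.
  by case: (s) s0 => // a ? _; exists a; rewrite mem_head.
have [al als hmin] := @seq_argmax _ R _ s (fun a => - t a) a1 a1s.
have := ss _ als; rewrite mem_filter => /andP[/andP[p1 p2] alP].
have den : 0 < dot xi al - dot xi' al by rewrite subr_gt0 (lt_trans p2).
have ta1 : t al < 1 by rewrite ltr_pdivrMr // mul1r ltrDl oppr_gt0.
have pthE (tt : R) v : dot (pth tt) v = dot xi v + tt * (dot xi' v - dot xi v).
  by rewrite dotDl dotZl dotBl.
have pth0 : dot (pth (t al)) (coroot al) = 0.
  rewrite dotC dot_corootl dotC pthE /t; apply/eqP; rewrite mulf_eq0; apply/orP; right.
  by apply/eqP; field; rewrite gt_eqF.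
(* At the crossing time the form is orthogonal to the coroot of [al], so both ends [q1], [q2] of the
   string through the highest point are highest as well: [q1] is used before the crossing and [q2]
   after it. *)
have [ps psP psmax] := @seq_argmax _ R _ P (dot (pth (t al))) p0 p0P.
have [q1 [q2 [l [r [q1P q2P q12 hl hr]]]]] := hedge al (ss _ als) ps psP.
have v1 : dot (pth (t al)) q1 = dot (pth (t al)) ps.
  by rewrite hr dotDr dotZr pth0 mulr0 addr0.
have v2 : dot (pth (t al)) q2 = dot (pth (t al)) ps.
  by rewrite -v1 q12 dotDr dotZr pth0 mulr0 addr0.
have cpos : 0 < dot (coroot al) xi by rewrite (coroot_dot_gt0 Phi_root).
have cneg : dot (coroot al) xi' < 0.
  by rewrite -oppr_gt0 -dotNr (coroot_dot_gt0 Phi_root) // dotNl oppr_gt0.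
have tal := ht _ als.
have psp0 := psmax _ p0P.
(* Convexity: [p0] is highest at [t0] and [q1] at the later time [t al]. *)
have slope : dot xi' p0 - dot xi p0 <= dot xi' q1 - dot xi q1.
  have g1 := p0max _ q1P; move: psp0; rewrite -v1.
  move: g1; rewrite !pthE => g1 g2.
  rewrite -(ler_pM2l (x := t al - t0)) ?subr_gt0 //; move: g1 g2; lra.
have [p' p'P hp'] : exists2 p', p' \in P &
   dot xi' q2 - \sum_(a <- rem al s) (m a)%:R * dot (coroot a) xi' <= dot xi' p'.
  apply: (IH _ _ _ _ (t al)) => //.
  - by rewrite size_rem // -ltnS prednK //; case: (s) als.
  - by rewrite rem_uniq.
  - by move=> a /mem_rem /ss.
  - by move=> q qP; rewrite v2; apply: psmax.
  - move=> a; rewrite mem_rem_uniq // inE => /andP[aal aS].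
    rewrite lt_neqAle; have := hmin a aS; rewrite lerN2 => ->; rewrite andbT.
    have := ss _ aS; rewrite mem_filter => /andP[/andP[p3 p4] aP].
    have dena : 0 < dot xi a - dot xi' a by rewrite subr_gt0 (lt_trans p4).
    rewrite /t (eqr_div _ _ (lt0r_neq0 den) (lt0r_neq0 dena)).
    have aNal : a != - al.
      by apply: contraTneq p3 => ->; rewrite dotNr oppr_gt0 -leNgt ltW.
    have := good al a alP aP aal aNal; apply: contraNneq => h.
    by apply/eqP; move: h; lra.
exists p' => //; apply: le_trans hp'.
rewrite (big_rem al) //= opprD addrA lerD2r.
have e1 : dot xi' q2 = dot (pth (t al)) q2 + (1 - t al) * (dot xi' q2 - dot xi q2).
  by rewrite pthE; ring.
have e2 : dot xi' q1 - dot xi q1 =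
    dot xi' q2 - dot xi q2 + l * (dot (coroot al) xi' - dot (coroot al) xi).
  by rewrite q12 !(dotDr _ q2) !(dotZr l) !(dotC _ (coroot al)); ring.
have e3 : (1 - t al) * (dot (coroot al) xi - dot (coroot al) xi') = - dot (coroot al) xi'.
  by move: pth0; rewrite pthE !(dotC _ (coroot al)); lra.
have e4 : dot (pth (t al)) p0 = dot xi p0 + t al * (dot xi' p0 - dot xi p0).
  by rewrite pthE.
have e5 : (1 - t al) * (dot xi' p0 - dot xi p0) <=
    (1 - t al) * (dot xi' q1 - dot xi q1) by rewrite ler_pM2l ?subr_gt0.
have e6 : (m al)%:R * - dot (coroot al) xi' <= l * - dot (coroot al) xi'.
  by rewrite ler_pM2r // oppr_gt0.
have e7 : (1 - t al) * (dot xi' q1 - dot xi q1) =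
   (1 - t al) * (dot xi' q2 - dot xi q2) + l * dot (coroot al) xi'.
  rewrite e2 mulrDr; congr (_ + _).
  rewrite mulrCA -(opprB (dot (coroot al) xi)) mulrN e3 opprK //.
move: psp0; rewrite -v2 e4 => g.
rewrite e1; move: e5 e6; rewrite e7; lra.
Qed.

(** Reduction to a generic end point. Perturbing xi' may cross roots orthogonal to it, which is why
    strings are also required for those; their terms have the favourable sign. *)
Lemma support_bound xi xi' m P p : regular Phi xi ->
  (forall a, a \in crossed xi xi' -> edges P a (m a)) ->
  (forall a, a \in Phi -> dot xi a > 0 -> dot xi' a = 0 -> edges P a (m a)) ->
  p \in P -> (forall p', p' \in P -> dot xi p' <= dot xi p) ->
  exists2 p', p' \in P &
    dot xi' p - \sum_(a <- crossed xi xi') (m a)%:R * dot (coroot a) xi'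
      <= dot xi' p'.
Proof.
move=> hxi hedge hedge0 pP pmax.
set v := p - \sum_(a <- crossed xi xi') (m a)%:R *: coroot a.
have vE eta : dot eta v =
    dot eta p - \sum_(a <- crossed xi xi') (m a)%:R * dot (coroot a) eta.
  rewrite /v dotBr dot_sumr; congr (_ - _).
  by apply: eq_bigr => a _; rewrite dotZr dotC.
rewrite -vE.
apply: contrapT => hn.
have hlt p' : p' \in P -> dot xi' p' < dot xi' v.
  by move=> p'P; rewrite ltNge; apply/negP => le; apply: hn; exists p'.
(* If no point of P reaches the level of [v], this persists for nearby forms, as do the signs of the
   nonzero pairings of [xi'] with roots. *)
pose Y := [seq p' - v | p' <- P] ++ [seq a <- Phi | dot xi' a < 0] ++
          [seq - a | a <- Phi & 0 < dot xi' a].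
have hY : {in Y, forall y, dot xi' y < 0}.
  move=> y; rewrite !mem_cat => /or3P[/mapP[p' /hlt h ->]||/mapP[a + ->]].
  - by rewrite dotBr subr_lt0.
  - by rewrite mem_filter => /andP[].
  - by rewrite mem_filter dotNr oppr_lt0 => /andP[].
have [xi2 [h1 h2 h3]] := regular_perturb Phi_root Phi_red hxi hY.
have cr a : a \in Phi -> dot xi2 a < 0 -> dot xi' a <= 0.
  move=> aP; apply: contraTT; rewrite -!ltNge => h; rewrite -leNgt ltW //.
  rewrite -oppr_lt0 -dotNr; apply: h1; rewrite !mem_cat; apply/or3P/Or33.
  by apply/mapP; exists a; rewrite // mem_filter h.
have [p' p'P hp'] : exists2 p', p' \in P &
    dot xi2 p - \sum_(a <- crossed xi xi2) (m a)%:R * dot (coroot a) xi2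
      <= dot xi2 p'.
  apply: support_generic => // a; rewrite mem_filter => /andP[/andP[g1 g2] aP].
  have := cr a aP g2; rewrite le_eqVlt => /predU1P[g3|g3]; first exact: hedge0.
  by apply: hedge; rewrite mem_filter g1 g3.
have : dot xi2 (p' - v) < 0 by apply: h1; rewrite mem_cat; apply/orP; left; apply/mapP; exists p'.
rewrite dotBr subr_lt0 ltNge => /negP; apply; apply: le_trans hp'.
rewrite vE lerD2l lerN2 /crossed !big_filter.
rewrite [leLHS](bigID (fun a => dot xi' a < 0)) /= -[leRHS]addr0.
apply: lerD; last first.
  rewrite big_seq_cond; apply: sumr_le0 => a /andP[aP /andP[/andP[_ g] _]].
  rewrite mulr_ge0_le0 // ltW // -oppr_gt0 -dotNr (coroot_dot_gt0 Phi_root) //.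
  by rewrite dotNl oppr_gt0.
rewrite big_seq_cond [leRHS]big_seq_cond le_eqVlt; apply/orP; left; apply/eqP.
apply: eq_bigl => a; case aP: (a \in _) => //=.
case g: (dot xi' a < 0); rewrite ?andbF ?andbT //.
suff -> : dot xi2 a < 0 by rewrite !andbT.
by apply: h1; rewrite !mem_cat; apply/or3P/Or32; rewrite mem_filter g.
Qed.

End Support.

(** * The zonotope N *)

Section Zonotope.
Variables (R : realType) (n : nat) (Phi : {fset 'cV[R]_n}).
Hypotheses (Phi_root : root_system Phi) (Phi_red : reduced Phi).
Local Notation V := 'cV[R]_n.
Implicit Types (a b u v xi p : V) (m : V -> nat) (w : 'M[R]_n) (P : seq V).

Definition lat v := forall a, a \in Phi -> dot v a \is a Num.int.

Lemma lat_coroot a : a \in Phi -> lat (coroot a).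
Proof. by move=> aP b bP; apply: (coroot_dot_int Phi_root). Qed.

Lemma lat0 : lat 0.
Proof. by move=> a _; rewrite dot0l int_num0. Qed.

Lemma latD u v : lat u -> lat v -> lat (u + v).
Proof. by move=> hu hv a aP; rewrite dotDl rpredD ?hu ?hv. Qed.

Lemma latN u : lat u -> lat (- u).
Proof. by move=> hu a aP; rewrite dotNl rpredN hu. Qed.

Lemma latB u v : lat u -> lat v -> lat (u - v).
Proof. by move=> hu hv; apply: latD => //; apply: latN. Qed.

Lemma latMz u (j : int) : lat u -> lat (u *~ j).
Proof. by move=> hu a aP; rewrite -scaler_int dotZl rpredM ?hu ?intr_int. Qed.

Lemma lat_weyl w u : weyl Phi w -> lat u -> lat (w *m u).
Proof.
move=> hw hu a aP; have [w' [hw' h1 h2]] := weyl_inv Phi_root hw.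
rewrite -[a]mul1mx -h1 -mulmxA (dot_weyl Phi_root) //; apply: hu.
exact: (weyl_root Phi_root).
Qed.

Lemma in_coweight v : reflect (lat v) (v \in coweight_lattice Phi).
Proof. by apply: (iffP idP); rewrite inE. Qed.

Local Notation Qv := (coroot_lattice Phi).

Lemma Qv0 : Qv 0.
Proof. by exists (fun=> 0); rewrite big1 // => a _; rewrite mulr0z. Qed.

Lemma QvD u v : Qv u -> Qv v -> Qv (u + v).
Proof.
move=> [c ->] [d ->]; exists (fun a => c a + d a).
by rewrite -big_split; apply: eq_bigr => a _; rewrite mulrzDr.
Qed.

Lemma QvN u : Qv u -> Qv (- u).
Proof.
move=> [c ->]; exists (fun a => - c a).
by rewrite -sumrN; apply: eq_bigr => a _; rewrite mulrNz.
Qed.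

Lemma QvB u v : Qv u -> Qv v -> Qv (u - v).
Proof. by move=> hu hv; apply: QvD => //; apply: QvN. Qed.

Lemma QvMz u (j : int) : Qv u -> Qv (u *~ j).
Proof.
move=> [c ->]; exists (fun a => c a * j).
by rewrite mulrz_suml; apply: eq_bigr => a _; rewrite mulrzA.
Qed.

Lemma Qv_coroot a : a \in Phi -> Qv (coroot a).
Proof.
move=> aP; exists (fun b => (b == a)%:Z).
rewrite (bigD1_seq a) ?fset_uniq //= eqxx mulr1z big1 ?addr0 //.
by move=> b /negbTE ->; rewrite mulr0z.
Qed.

Lemma Qv_lat u : Qv u -> lat u.
Proof.
move=> [c ->] b bP; rewrite dot_suml big_seq rpred_sum // => a aP.
by apply: latMz => //; apply: lat_coroot.
Qed.

Lemma root_ext u v : (forall a, a \in Phi -> dot u a = dot v a) -> u = v.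
Proof.
move=> h; apply/eqP; rewrite -subr_eq0 -dot_eq0.
have [c {2}->] := root_span Phi_root (u - v).
rewrite dot_sumr big1_seq // => a /= aP.
by rewrite dotZr dotBl h // subrr mulr0.
Qed.

Lemma lattice_finite (B : R) :
  finite_set [set v | lat v /\ forall a, a \in Phi -> `|dot v a| <= B].
Proof.
pose K := Num.bound B.
pose G (f : {ffun Phi -> 'I_(K + K).+1}) : V :=
  xget 0 [set v | forall a : Phi, dot v (val a) = (f a)%:R - K%:R].
apply: (@sub_finite_set _ _ (G @` [set: {ffun Phi -> 'I_(K + K).+1}])); last first.
  by apply: finite_image; apply: finite_finset.
move=> v [hv hB].
have val_int (a : Phi) : exists i : 'I_(K + K).+1, dot v (val a) = i%:R - K%:R.
  have /intrP[z hz] := hv _ (valP a).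
  have := hB _ (valP a); rewrite hz => hzB.
  have B0 : 0 <= B by apply: le_trans hzB.
  have zK : `|z| <= K%:Z.
    rewrite -(ler_int R) intr_norm; apply: le_trans hzB _.
    by apply: ltW; have := archi_boundP B0.
  have hz0 : 0 <= z + K%:Z by lia.
  have hi : (absz (z + K%:Z)%R < (K + K).+1)%N by lia.
  exists (Ordinal hi) => /=.
  by rewrite natr_absz ger0_norm // intrD -pmulrn addrK.
pose f : {ffun Phi -> 'I_(K + K).+1} := [ffun a => projT1 (cid (val_int a))].
have hf (c : Phi) : dot v (val c) = (f c)%:R - K%:R.
  by rewrite ffunE; case: (cid _).
exists f => //; rewrite /G; case: xgetP => [u -> hu|hn].
  apply: root_ext => a aP.
  by rewrite (hu [` aP]%fset) (hf [` aP]%fset).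
by case: (hn v).
Qed.

Lemma finite_enum (A : set V) : finite_set A ->
  exists s : seq V, uniq s /\ forall v, (v \in s) <-> A v.
Proof.
move=> fA; exists (fset_set A); split; first exact: fset_uniq.
by move=> v; rewrite in_fset_set //; split; rewrite inE.
Qed.

Variable m : V -> nat.
Hypothesis m_inv : weyl_invariant Phi m.

Lemma mN a : a \in Phi -> m (- a) = m a.
Proof.
move=> aP; rewrite -(m_inv (weyl_refl1 aP) aP) (reflE a a).
by rewrite (coroot_dotr Phi_root) // scaler_nat mulr2n opprD addrA subrr add0r.
Qed.

(* [zono] is the polytope N and [Hz] its support function. For the positive system
   of xi, [rv xi] is rho^vee, a vertex of N, and [rr xi] is rho. The sums run over
   all roots, so that none of this depends on a positive system: hence 1/4. *)
Definition zono : set V := [set v | exists k : V -> R,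
  (forall a, a \in Phi -> `|k a| <= (m a)%:R) /\
  v = 4^-1 *: \sum_(a <- Phi) k a *: coroot a].
Definition Hz xi : R := 4^-1 * \sum_(a <- Phi) (m a)%:R * `|dot (coroot a) xi|.
Definition rv xi : V :=
  4^-1 *: \sum_(a <- Phi) ((m a)%:R * Num.sg (dot xi a)) *: coroot a.
Definition rr xi : V :=
  4^-1 *: \sum_(a <- Phi) ((m a)%:R * Num.sg (dot xi a)) *: a.

Lemma zonoE v (k : V -> R) xi : v = 4^-1 *: \sum_(a <- Phi) k a *: coroot a ->
  dot xi v = 4^-1 * \sum_(a <- Phi) k a * dot (coroot a) xi.
Proof.
move=> ->; rewrite dotZr dot_sumr; congr (_ * _).
by apply: eq_bigr => a _; rewrite dotZr dotC.
Qed.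

Lemma term_le (k M x : R) : `|k| <= M -> k * x <= M * `|x|.
Proof.
move=> h; apply: le_trans (ler_norm _) _; rewrite normrM.
by rewrite ler_wpM2r.
Qed.

Lemma zono_le v xi : zono v -> dot xi v <= Hz xi.
Proof.
move=> [k [hk /zonoE ->]]; rewrite ler_pM2l // !big_seq.
by apply: ler_sum => a /hk; apply: term_le.
Qed.

Lemma HzN xi : Hz (- xi) = Hz xi.
Proof.
by congr (_ * _); apply: eq_bigr => a _; rewrite dotNr normrN.
Qed.

Lemma Hz_ge0 xi : 0 <= Hz xi.
Proof.
by apply: mulr_ge0 => //; apply: sumr_ge0 => a _; apply: mulr_ge0.
Qed.

Lemma zono_ge v xi : zono v -> - Hz xi <= dot xi v.
Proof. by move=> h; rewrite lerNl -dotNl -HzN; apply: zono_le. Qed.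

Lemma rv_zono xi : zono (rv xi).
Proof.
exists (fun a => (m a)%:R * Num.sg (dot xi a)); split => // a _.
rewrite normrM normr_nat normr_sg -[leRHS]mulr1 ler_wpM2l //.
by case: (_ != 0).
Qed.

Lemma dot_rv xi xi' : (forall a, a \in Phi -> dot xi a != 0 ->
    Num.sg (dot xi' a) = Num.sg (dot xi a)) -> dot xi (rv xi') = Hz xi.
Proof.
move=> h; rewrite (zonoE (k := fun a => (m a)%:R * Num.sg (dot xi' a))) //.
congr (_ * _); rewrite !big_seq; apply: eq_bigr => a aP; rewrite -mulrA; congr (_ * _).
have [x0|x0] := eqVneq (dot xi a) 0.
  have : dot (coroot a) xi == 0 by rewrite (coroot_dot_eq0 Phi_root) // x0.
  by move/eqP ->; rewrite mulr0 normr0.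
by rewrite h // -(sgr_coroot Phi_root) // -normrEsg.
Qed.

Lemma dot_rv_self xi : dot xi (rv xi) = Hz xi.
Proof. by apply: dot_rv. Qed.

(** [Hz] is a sum of termwise bounds, so equality in the sum forces equality in every term. *)
Lemma zono_tight v xi (k : V -> R) : (forall a, a \in Phi -> `|k a| <= (m a)%:R) ->
  v = 4^-1 *: \sum_(a <- Phi) k a *: coroot a -> dot xi v = Hz xi ->
  forall a, a \in Phi -> dot xi a != 0 -> k a = (m a)%:R * Num.sg (dot xi a).
Proof.
move=> hk /zonoE ->.
have four0 : (4^-1 : R) != 0 by rewrite invr_eq0 pnatr_eq0.
move/(mulfI four0) => h a aP x0.
have : \sum_(a <- Phi) ((m a)%:R * `|dot (coroot a) xi| - k a * dot (coroot a) xi) == 0.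
  by rewrite sumrB h subrr.
rewrite big_seq psumr_eq0; last by move=> b bP; rewrite subr_ge0 term_le ?hk.
move=> /allP /(_ a aP); rewrite aP /= subr_eq0 eq_sym => /eqP e.
have y0 : dot (coroot a) xi != 0 by rewrite (coroot_dot_eq0 Phi_root).
apply: (mulIf y0); rewrite e -(sgr_coroot Phi_root) // -mulrA; congr (_ * _).
by rewrite normrEsg.
Qed.

Lemma zono_vertex v xi : regular Phi xi -> zono v -> dot xi v = Hz xi -> v = rv xi.
Proof.
move=> hxi [k [hk hv]] h; rewrite hv /rv; congr (_ *: _).
rewrite !big_seq; apply: eq_bigr => a aP.
by rewrite (zono_tight hk hv h aP (hxi a aP)).
Qed.

Lemma sum_pm (M : nmodType) a (F : V -> M) : a \in Phi ->
  (forall b, b \in Phi -> b != a -> b != - a -> F b = 0) ->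
  \sum_(b <- Phi) F b = F a + F (- a).
Proof.
move=> aP h; rewrite (bigD1_seq a) ?fset_uniq //=; congr (_ + _).
have aNa : - a != a.
  rewrite -subr_eq0 -opprD oppr_eq0 -mulr2n -scaler_nat scaler_eq0 pnatr_eq0 /=.
  exact: (root_neq0 Phi_root).
rewrite -big_filter (bigD1_seq (- a)) ?filter_uniq ?fset_uniq //=; last first.
  by rewrite mem_filter aNa (neg_root Phi_root).
rewrite big_seq_cond big1 ?addr0 // => b; rewrite mem_filter.
by move=> /andP[/andP[b1 b2] b3]; apply: h.
Qed.

Lemma sgr_eq (x y : R) : x != 0 -> y != 0 -> (0 < x) = (0 < y) -> Num.sg x = Num.sg y.
Proof. by case: (sgrP x) => // _ _; case: (sgrP y). Qed.

(** By tightness only the coefficients of a and -a remain free, so the face of N exposed by xi0 is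
    an edge leaving [rv xi] along -a^vee. *)
Lemma zono_face xi a xi0 v : wall Phi xi a xi0 -> zono v -> dot xi0 v = Hz xi0 ->
  exists2 l : R, 0 <= l <= (m a)%:R & v = rv xi - l *: coroot a.
Proof.
move=> [hxi aP xa xi0a hb] [k [hk hv]] h.
have hta := zono_tight hk hv h.
(* a^vee and (-a)^vee are opposite, so [k a] and [k (- a)] enter through their difference, whose
   value at [rv xi] is twice m_a. *)
pose l := 4^-1 * ((m a)%:R * 2 - k a + k (- a)).
have ka := hk a aP; have kNa := hk (- a) (neg_root Phi_root aP).
exists l.
  move: ka kNa; rewrite mN // !ler_norml /l => /andP[h1 h2] /andP[h3 h4].
  by apply/andP; split; lra.
suff E : rv xi - v = l *: coroot a by rewrite -E subKr.
rewrite hv /rv -scalerBr -sumrB (sum_pm (a := a)) //; last first.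
  move=> b bP b1 b2; have [h1 h2] := hb b bP b1 b2.
  by rewrite hta // (sgr_eq h1 (hxi b bP)) ?subrr.
rewrite dotNr sgrN gtr0_sg // mulr1 mulrN1 mN // corootN -!scalerBl scalerN.
rewrite -scalerBl scalerA; congr (_ *: _); rewrite /l.
by ring.
Qed.

Lemma rv_same xi xi' : regular Phi xi -> regular Phi xi' -> same_chamber Phi xi xi' ->
  rv xi = rv xi'.
Proof.
move=> h1 h2 sc; congr (_ *: _); rewrite !big_seq; apply: eq_bigr => a aP.
by rewrite (sgr_eq (h1 a aP) (h2 a aP) (sc a aP)).
Qed.

Lemma rr_same xi xi' : regular Phi xi -> regular Phi xi' -> same_chamber Phi xi xi' ->
  rr xi = rr xi'.
Proof.
move=> h1 h2 sc; congr (_ *: _); rewrite !big_seq; apply: eq_bigr => a aP.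
by rewrite (sgr_eq (h1 a aP) (h2 a aP) (sc a aP)).
Qed.

Lemma rv_weyl w xi : weyl Phi w -> rv (w *m xi) = w *m rv xi.
Proof.
move=> hw; rewrite /rv -scalemxAr mulmx_sumr; congr (_ *: _).
rewrite -(sum_root_weyl Phi_root _ hw) !big_seq; apply: eq_bigr => a aP.
by rewrite (dot_weyl Phi_root) // m_inv // (coroot_weyl Phi_root) // scalemxAr.
Qed.

Lemma rr_weyl w xi : weyl Phi w -> rr (w *m xi) = w *m rr xi.
Proof.
move=> hw; rewrite /rr -scalemxAr mulmx_sumr; congr (_ *: _).
rewrite -(sum_root_weyl Phi_root _ hw) !big_seq; apply: eq_bigr => a aP.
by rewrite (dot_weyl Phi_root) // m_inv // scalemxAr.
Qed.

Lemma zono_weyl w v : weyl Phi w -> zono v -> zono (w *m v).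
Proof.
move=> hw [k [hk ->]]; have [w' [hw' h1 h2]] := weyl_inv Phi_root hw.
exists (fun a => k (w' *m a)); split.
  by move=> a aP; rewrite -(m_inv hw') // hk // (weyl_root Phi_root).
rewrite -scalemxAr mulmx_sumr; congr (_ *: _).
rewrite -[RHS](sum_root_weyl Phi_root _ hw); apply: eq_bigr => a aP.
by rewrite mulmxA h2 mul1mx (coroot_weyl Phi_root) // scalemxAr.
Qed.

Lemma wall_sign xi a xi0 b : wall Phi xi a xi0 -> b \in Phi -> b != a -> b != - a ->
  Num.sg (dot (refl a *m xi) b) = Num.sg (dot xi b).
Proof.
move=> [hxi aP xa xi0a hb] bP b1 b2.
have r1 : refl a *m a = - a.
  by rewrite reflE (coroot_dotr Phi_root) // scaler_nat mulr2n opprD addrA subrr add0r.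
have c1 : refl a *m b != a.
  apply: contraNneq b2 => h.
  by rewrite -[b](refl_invol Phi_root _ aP) h r1.
have c2 : refl a *m b != - a.
  apply: contraNneq b1 => h.
  by rewrite -[b](refl_invol Phi_root _ aP) h mulmxN r1 opprK.
rewrite (dot_refl_adj Phi_root) //.
have bP' := root_refl Phi_root aP bP.
have [h1 h2] := hb _ bP' c1 c2; have [h3 h4] := hb _ bP b1 b2.
rewrite (sgr_eq (hxi _ bP') h1 h2) (sgr_eq (hxi _ bP) h3 h4).
by rewrite -(dot_refl_adj Phi_root) // reflE' xi0a scale0r subr0.
Qed.

Lemma wall_sign_a xi a xi0 : wall Phi xi a xi0 ->
  Num.sg (dot (refl a *m xi) a) = -1.
Proof.
move=> [hxi aP xa xi0a hb]; rewrite (dot_refl_adj Phi_root) //.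
rewrite reflE (coroot_dotr Phi_root) // scaler_nat mulr2n opprD addrA subrr add0r.
by rewrite dotNr sgrN gtr0_sg.
Qed.

Lemma rv_wall xi a xi0 : wall Phi xi a xi0 ->
  rv (refl a *m xi) = rv xi - (m a)%:R *: coroot a.
Proof.
move=> hw; have [hxi aP xa xi0a hb] := hw.
suff E : rv xi - rv (refl a *m xi) = (m a)%:R *: coroot a by rewrite -E subKr.
rewrite /rv -scalerBr -sumrB (sum_pm (a := a)) //; last first.
  by move=> b bP b1 b2; rewrite (wall_sign hw) // subrr.
rewrite !dotNr !sgrN (wall_sign_a hw) gtr0_sg // !opprK mN // corootN.
rewrite -!scalerBl scalerN -scalerBl scalerA.
by congr (_ *: _); field.
Qed.

Lemma rr_wall xi a xi0 : wall Phi xi a xi0 ->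
  rr (refl a *m xi) = rr xi - (m a)%:R *: a.
Proof.
move=> hw; have [hxi aP xa xi0a hb] := hw.
suff E : rr xi - rr (refl a *m xi) = (m a)%:R *: a by rewrite -E subKr.
rewrite /rr -scalerBr -sumrB (sum_pm (a := a)) //; last first.
  by move=> b bP b1 b2; rewrite (wall_sign hw) // subrr.
rewrite !dotNr !sgrN (wall_sign_a hw) gtr0_sg // !opprK mN //.
rewrite -!scalerBl scalerN -scalerBl scalerA.
by congr (_ *: _); field.
Qed.

(** The vertex of the reflected chamber is both [rv xi] moved by m_a along -a^vee and the reflection
    of [rv xi]; comparing the two gives the pairing. *)
Lemma rv_wall_dot xi a xi0 : wall Phi xi a xi0 -> dot (rv xi) a = (m a)%:R.
Proof.
move=> hw; have [_ aP _ _ _] := hw; have := rv_wall hw.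
rewrite rv_weyl; last exact: weyl_refl1.
rewrite reflE' => /addrI /oppr_inj /eqP; rewrite -subr_eq0 -scalerBl scaler_eq0.
by rewrite (negbTE (coroot_neq0 Phi_root aP)) orbF subr_eq0 => /eqP.
Qed.

Lemma rr_wall_dot xi a xi0 : wall Phi xi a xi0 -> dot (rr xi) (coroot a) = (m a)%:R.
Proof.
move=> hw; have [_ aP _ _ _] := hw; have := rr_wall hw.
rewrite rr_weyl; last exact: weyl_refl1.
rewrite reflE => /addrI /oppr_inj /eqP; rewrite -subr_eq0 -scalerBl scaler_eq0.
by rewrite (negbTE (root_neq0 Phi_root aP)) orbF subr_eq0 => /eqP.
Qed.

(** Take xi0 generic in the hyperplane of a and xi slightly off it. By reducedness the other roots
    project to nonzero vectors of the hyperplane, so xi0 can avoid their walls. *)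
Lemma wall_exists a : a \in Phi -> exists xi xi0, wall Phi xi a xi0.
Proof.
move=> aP.
pose B := [seq b - (dot b a / dot a a) *: a | b <- Phi & (b != a) && (b != - a)].
have hB : {in B, forall b, b != 0}.
  move=> y /mapP[b]; rewrite mem_filter => /andP[/andP[b1 b2] bP] ->.
  rewrite subr_eq0; apply/eqP => h.
  have := root_noncol Phi_red aP bP b1 b2 (c := 1) (d := dot b a / dot a a).
  by rewrite scale1r => /(_ h)/eqP; rewrite oner_eq0.
have [eta heta] := avoid hB.
pose xi0 := eta - (dot eta a / dot a a) *: a.
have aa := root_dot_gt0 Phi_root aP.
have xi0a : dot xi0 a = 0 by rewrite dotBl dotZl divfK ?subrr // gt_eqF.
have hxi0 b : b \in Phi -> b != a -> b != - a -> dot xi0 b != 0.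
  move=> bP b1 b2.
  have hb : b \in [seq b <- Phi | (b != a) && (b != - a)] by rewrite mem_filter b1 b2.
  have := heta _ (map_f _ hb); congr (_ != _).
  rewrite dotBl dotBr dotZl dotZr (dotC b a).
  by congr (_ - _); rewrite mulrAC (mulrC (dot a b)) -!mulrA; congr (_ * _); rewrite mulrC.
pose Y := [seq (if 0 < dot xi0 b then - b else b) | b <- Phi & (b != a) && (b != - a)].
have hY : {in Y, forall y, dot xi0 y < 0}.
  move=> y /mapP[b]; rewrite mem_filter => /andP[/andP[b1 b2] bP] ->.
  case: ifP => [|/negbT]; first by rewrite dotNr oppr_lt0.
  by rewrite -leNgt lt_neqAle hxi0.
have hB2 : {in [:: a], forall b, dot a b != 0}.
  by move=> b; rewrite inE => /eqP ->; rewrite gt_eqF.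
have [xi [h1 h2]] := perturb hY hB2.
have sgnb b : b \in Phi -> b != a -> b != - a ->
    (dot xi b != 0) /\ (0 < dot xi b) = (0 < dot xi0 b).
  move=> bP b1 b2.
  have hb : b \in [seq b <- Phi | (b != a) && (b != - a)] by rewrite mem_filter b1 b2.
  have := h1 _ (map_f _ hb); case: ifP => _.
    by rewrite dotNr oppr_lt0 => g; rewrite g gt_eqF.
  by move=> g; rewrite lt_eqF //; split=> //; apply/negbTE; rewrite -leNgt ltW.
have xa : dot xi a != 0 by apply: h2; rewrite inE.
pose xi' := if 0 < dot xi a then xi else refl a *m xi.
have r1 : refl a *m a = - a.
  by rewrite reflE (coroot_dotr Phi_root) // scaler_nat mulr2n opprD addrA subrr add0r.
have sgnb' b : b \in Phi -> b != a -> b != - a ->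
    (dot xi' b != 0) /\ (0 < dot xi' b) = (0 < dot xi0 b).
  move=> bP b1 b2; rewrite /xi'; case: ifP => _; first exact: sgnb.
  have c1 : refl a *m b != a.
    apply: contraNneq b2 => h.
    by rewrite -[b](refl_invol Phi_root _ aP) h r1.
  have c2 : refl a *m b != - a.
    apply: contraNneq b1 => h.
    by rewrite -[b](refl_invol Phi_root _ aP) h mulmxN r1 opprK.
  rewrite (dot_refl_adj Phi_root) //.
  have [-> ->] := sgnb _ (root_refl Phi_root aP bP) c1 c2.
  by rewrite -(dot_refl_adj Phi_root) // reflE' xi0a scale0r subr0.
have xa' : 0 < dot xi' a.
  rewrite /xi'; case: ifP => // /negbT; rewrite -leNgt => h.
  by rewrite (dot_refl_adj Phi_root) // r1 dotNr oppr_gt0 lt_neqAle xa.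
exists xi', xi0; split => //; last first.
  by move=> b bP b1 b2; have [_ ->] := sgnb' b bP b1 b2; split => //; apply: hxi0.
move=> b bP; have [->|b1] := eqVneq b a; first by rewrite gt_eqF.
have [->|b2] := eqVneq b (- a); first by rewrite dotNr oppr_eq0 gt_eqF.
by case: (sgnb' b bP b1 b2).
Qed.

Lemma rv_Qv xi xi' : regular Phi xi -> regular Phi xi' -> Qv (rv xi' - rv xi).
Proof.
move=> h1 h2; apply: (chamber_walk Phi_root Phi_red (Pr := fun x => Qv (rv x - rv xi)) _ _ h1 h2).
- by move=> x y hx hy sc; rewrite (rv_same hx hy sc).
- move=> x a x0 hw; rewrite (rv_wall hw) addrAC => h; apply: QvB => //.
  rewrite scaler_nat pmulrn; apply: QvMz; apply: Qv_coroot.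
  by case: hw.
by rewrite subrr; apply: Qv0.
Qed.

(** Changing the chamber moves the vertex by coroots, and a given root a bounds some chamber, whose
    vertex pairs with a to m_a. *)
Lemma rv_lat xi : regular Phi xi -> lat (rv xi).
Proof.
move=> hxi a aP; have [x [x0 hw]] := wall_exists aP.
have hx : regular Phi x by case: hw.
rewrite -(subrK (rv x) (rv xi)) dotDl rpredD //.
  by apply: Qv_lat => //; apply: rv_Qv.
by rewrite (rv_wall_dot hw) rpred_nat.
Qed.

Lemma sum_root_half (M : zmodType) (xi : V) (F : V -> M) :
  (forall a, a \in Phi -> F (- a) = F a) ->
  (forall a, a \in Phi -> dot xi a = 0 -> F a = 0) ->
  \sum_(a <- Phi) F a = (\sum_(a <- Phi | 0 < dot xi a) F a) *+ 2.
Proof.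
move=> Feven F0; rewrite (bigID (fun a => 0 < dot xi a)) /= mulr2n; congr (_ + _).
rewrite (bigID (fun a => dot xi a == 0)) /= [X in X + _]big1_seq ?add0r; last first.
  by move=> a /andP[/andP[_ /eqP h] aP]; apply: F0.
rewrite big_mkcond -(sum_rootN Phi_root) [RHS]big_mkcond !big_seq.
apply: eq_bigr => a aP; rewrite dotNr oppr_gt0 oppr_eq0 Feven //.
by case: sgrP.
Qed.

End Zonotope.

Section Hull.
Variables (R : realType) (n : nat) (Phi : {fset 'cV[R]_n}).
Hypotheses (Phi_root : root_system Phi) (Phi_red : reduced Phi).
Local Notation V := 'cV[R]_n.
Local Notation Qv := (coroot_lattice Phi).
Implicit Types (a b u v xi p : V) (m : V -> nat) (w : 'M[R]_n) (P A : seq V).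

Lemma edgesN P a k : edges P a k -> edges P (- a) k.
Proof.
move=> h p /h[p1 [p2 [l [r [h1 h2 h3 h4 h5]]]]].
exists p2, p1, l, (- (r + l)); split => //.
  by rewrite h3 corootN scalerN addrK.
by rewrite h5 h3 corootN scalerN scaleNr opprK scalerDl -addrA [l *: _ + _]addrC.
Qed.

Section Bounds.
Variable m : V -> nat.
Hypothesis m_inv : weyl_invariant Phi m.
Local Notation zono := (zono Phi m).
Local Notation Hz := (Hz Phi m).
Local Notation rv := (rv Phi m).

(** Passing from the vertex of xi to one that maximises xi' flips exactly the crossed roots. The
    correction is that of [support_bound], whose conclusion thus compares the width of a support
    with that of N. *)
Lemma Hz_rv xi xi' : regular Phi xi -> Hz xi' =
  dot xi' (rv xi) - \sum_(a <- crossed Phi xi xi') (m a)%:R * dot (coroot a) xi'.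
Proof.
move=> hxi.
have e1 : Hz xi' = 2^-1 * \sum_(a <- Phi | 0 < dot xi a) (m a)%:R * `|dot (coroot a) xi'|.
  rewrite /Hz (sum_root_half Phi_root (xi := xi)).
  - by rewrite -mulr_natr; field.
  - by move=> a aP; rewrite corootN dotNl normrN (mN Phi_root m_inv).
  - by move=> a aP /eqP; rewrite (negbTE (hxi a aP)).
have e2 : dot xi' (rv xi) = 2^-1 * \sum_(a <- Phi | 0 < dot xi a) (m a)%:R * dot (coroot a) xi'.
  rewrite (@zonoE _ _ Phi _ (fun a => (m a)%:R * Num.sg (dot xi a))) //.
  rewrite (sum_root_half Phi_root (xi := xi)).
  - rewrite -mulr_natr (_ : \sum_(a <- Phi | _) _ = \sum_(a <- Phi | 0 < dot xi a) (m a)%:R * dot (coroot a) xi'); first by field.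
    by apply: eq_bigr => a h; rewrite gtr0_sg // mulr1.
  - by move=> a aP; rewrite corootN dotNl dotNr sgrN (mN Phi_root m_inv) // !mulrN !mulNr opprK.
  - by move=> a aP h; rewrite h sgr0 mulr0 mul0r.
apply/eqP; rewrite eq_sym subr_eq addrC -subr_eq; apply/eqP.
rewrite e1 e2 -mulrBr -sumrB /crossed big_filter big_mkcondr mulr_sumr /=.
rewrite big_seq_cond [RHS]big_seq_cond; apply: eq_bigr => a /andP[aP _].
rewrite -mulrBr; case: ifP => h.
  have c0 : dot (coroot a) xi' < 0.
    by rewrite -oppr_gt0 -dotNr (coroot_dot_gt0 Phi_root) // dotNl oppr_gt0.
  by rewrite ltr0_norm //; field.
have c0 : 0 <= dot (coroot a) xi'.
  rewrite -oppr_le0 -dotNr leNgt (coroot_dot_gt0 Phi_root) // dotNl oppr_gt0.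
  by rewrite h.
by rewrite ger0_norm // subrr !mulr0.
Qed.

(** With xi' = -xi the support bound puts a highest and some other point of P at least twice [Hz xi]
    apart in the direction xi. As P lies in N, the highest point is then the vertex [rv xi]. *)
Lemma zono_unique P xi : regular Phi xi ->
  (forall a, a \in Phi -> 0 < dot xi a -> edges P a (m a)) ->
  (forall p, p \in P -> zono p) -> rv xi \notin P -> P = [::].
Proof.
move=> hxi hedge hz hrv; case hP : P => [//|x P']; exfalso.
have xP : x \in P by rewrite hP mem_head.
have [p pP pmax] := @seq_argmax _ R _ P (dot xi) x xP.
have [a|a aP xa _|p' p'P] :=
    support_bound Phi_root Phi_red (xi' := - xi) (m := m) hxi _ _ pP pmax.
- by rewrite mem_filter => /andP[/andP[xa _] aP]; apply: hedge.
- exact: hedge.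
have := Hz_rv (- xi) hxi; rewrite HzN !dotNl (dot_rv_self Phi_root).
move: (\sum_(a <- _) _) => s hs hle.
have h1 := zono_ge xi (hz _ p'P); have h2 := zono_le xi (hz _ pP).
have h3 : dot xi p = Hz xi by move: hle h1 h2 hs; lra.
have := zono_vertex Phi_root hxi (hz _ pP) h3.
by move=> e; rewrite -e pP in hrv.
Qed.

(** No strings along a0 are available. The form therefore moves from xi to -xi0, which crosses every
    positive root except a0, and a nonempty P would reach the edge of N on which xi0 is maximal. *)
Lemma zono_wall_unique P xi a0 xi0 : wall Phi xi a0 xi0 ->
  (forall a, a \in Phi -> a != a0 -> a != - a0 -> edges P a (m a)) ->
  (forall p, p \in P -> zono p) ->
  (forall p, p \in P -> dot xi0 p != Hz xi0) ->
  (forall p, p \in P -> dot xi0 p != - Hz xi0) -> P = [::].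
Proof.
move=> hw hedge hz hmax hmin; case hP : P => [//|x P']; exfalso.
have xP : x \in P by rewrite hP mem_head.
have [hxi a0P xa0 xi0a hb] := hw.
have [p pP pmax] := @seq_argmax _ R _ P (dot xi) x xP.
(* [xi0] is orthogonal to [a0], so the support bound also asks for strings along [a0]; multiplicity
   0 makes that demand trivial. *)
pose m' b := if b == a0 then 0%N else m b.
have aNa0 a : 0 < dot xi a -> a != - a0.
  by move=> h; apply: contraTneq h => ->; rewrite dotNr oppr_gt0 -leNgt ltW.
have [|a aP xa _|p' p'P] := support_bound Phi_root Phi_red (xi' := - xi0) (m := m') hxi _ _ pP pmax.
- move=> a; rewrite mem_filter => /andP[/andP[h1 h2] aP].
  rewrite /m'; case: eqP => [_|/eqP aa0]; first exact: edges0.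
  by apply: hedge => //; apply: aNa0.
- rewrite /m'; case: eqP => [_|/eqP aa0]; first exact: edges0.
  by apply: hedge => //; apply: aNa0.
have -> : \sum_(a <- crossed Phi xi (- xi0)) (m' a)%:R * dot (coroot a) (- xi0)
   = \sum_(a <- crossed Phi xi (- xi0)) (m a)%:R * dot (coroot a) (- xi0).
  rewrite !big_seq; apply: eq_bigr => a; rewrite mem_filter /m'.
  by case: eqP => // ->; rewrite dotNl xi0a oppr0 ltxx andbF.
have hrv0 : dot xi0 (rv xi) = Hz xi0.
  apply: (dot_rv Phi_root) => a aP x0.
  have a1 : a != a0 by apply: contraNneq x0 => ->; rewrite xi0a.
  have a2 : a != - a0 by apply: contraNneq x0 => ->; rewrite dotNr xi0a oppr0.
  have [h1 h2] := hb a aP a1 a2.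
  by apply: sgr_eq => //; apply: hxi.
have := Hz_rv (- xi0) hxi; rewrite HzN !dotNl hrv0.
move: (\sum_(a <- _) _) => s hs hle.
have h1 := zono_ge xi0 (hz _ p'P); have h2 := zono_le xi0 (hz _ pP).
have : dot xi0 p = Hz xi0 by move: hle h1 h2 hs; lra.
by apply/eqP; apply: hmax.
Qed.

(* The convex hull of A, by half-spaces; [region A] is its Minkowski sum with [zono]. *)
Definition hullf A v := forall xi, exists2 u, u \in A & dot xi v <= dot xi u.
Definition region A p := forall xi, exists2 u, u \in A & dot xi p <= dot xi u + Hz xi.

Lemma hull_region A v p : hullf A v -> zono p -> region A (v + p).
Proof.
move=> hv hp xi; have [u uA hu] := hv xi; exists u => //.
by rewrite dotDr lerD // zono_le.
Qed.

(** For each form xi' the support bound gives p' in P whose value is at least that of p - [rv xi]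
    plus [Hz xi']; being in the region, p' has value at most that of some u in A plus [Hz xi']. The
    two terms cancel. *)
Lemma span_top A P xi p : regular Phi xi ->
  (forall a, a \in Phi -> 0 < dot xi a -> edges P a (m a)) ->
  (forall p', p' \in P -> region A p') ->
  p \in P -> (forall p', p' \in P -> dot xi p' <= dot xi p) ->
  hullf A (p - rv xi).
Proof.
move=> hxi hedge hreg pP pmax xi'.
have [|a aP xa _|p' p'P hp'] := support_bound Phi_root Phi_red (xi' := xi') (m := m) hxi _ _ pP pmax.
- by move=> a; rewrite mem_filter => /andP[/andP[h1 h2] aP]; apply: hedge.
- exact: hedge.
have [u uA hu] := hreg _ p'P xi'.
exists u => //; rewrite dotBr.
by move: (Hz_rv xi' hxi) hu hp'; move: (\sum_(a <- _) _) => s; lra.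
Qed.

Lemma region_bound A p a B : region A p -> (forall u, u \in A -> `|dot u a| <= B) ->
  `|dot p a| <= B + Hz a.
Proof.
move=> hp hB; rewrite ler_norml; apply/andP; split.
  have [u uA] := hp (- a); rewrite HzN !dotNl !(dotC a) => h.
  by have := hB u uA; rewrite ler_norml => /andP[h1 h2]; lra.
have [u uA] := hp a; rewrite !(dotC a) => h.
by have := hB u uA; rewrite ler_norml => /andP[h1 h2]; lra.
Qed.

End Bounds.

Lemma coroot_dot_lt0 a xi : a \in Phi -> (dot (coroot a) xi < 0) = (dot xi a < 0).
Proof.
by move=> aP; rewrite -oppr_gt0 -dotNr (coroot_dot_gt0 Phi_root) // dotNl oppr_gt0.
Qed.

(** If one of the two Cartan integers is -1, a reflection produces the sum. Otherwise both are at
    most -2, and then |a + b|^2 <= 0. *)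
Lemma coroot_string a b : a \in Phi -> b \in Phi -> dot (coroot a) b < 0 ->
  coroot a + coroot b = 0 \/ exists2 c, c \in Phi & coroot a + coroot b = coroot c.
Proof.
move=> aP bP ab0.
have ba0 : dot (coroot b) a < 0.
  by rewrite coroot_dot_lt0 // dotC -coroot_dot_lt0.
have /intrP[k hk] := coroot_dot_int Phi_root aP bP.
have /intrP[l hl] := coroot_dot_int Phi_root bP aP.
have k0 : k < 0 by rewrite hk ltrz0 in ab0.
have l0 : l < 0 by rewrite hl ltrz0 in ba0.
have [k1|k1] := eqVneq k (-1).
  right; exists (refl b *m a); first exact: (root_refl Phi_root).
  rewrite (coroot_weyl Phi_root _ (weyl_refl1 bP)).
  by rewrite reflE' hk k1 mulrNz mulr1z scaleN1r opprK.
have [l1|l1] := eqVneq l (-1).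
  right; exists (refl a *m b); first exact: (root_refl Phi_root).
  rewrite (coroot_weyl Phi_root _ (weyl_refl1 aP)).
  by rewrite reflE' hl l1 mulrNz mulr1z scaleN1r opprK addrC.
left.
have aa := root_dot_gt0 Phi_root aP; have bb := root_dot_gt0 Phi_root bP.
have hk2 : 2 * dot a b <= -2 * dot a a.
  have : dot (coroot a) b <= -2.
    by rewrite hk (_ : -2 = (-2)%:~R) // ler_int; lia.
  rewrite dot_corootl mulrAC ler_pdivrMr //.
have hl2 : 2 * dot a b <= -2 * dot b b.
  have : dot (coroot b) a <= -2.
    by rewrite hl (_ : -2 = (-2)%:~R) // ler_int; lia.
  rewrite dot_corootl (dotC b a) mulrAC ler_pdivrMr //.
have : a + b == 0.
  rewrite -dot_eq0 eq_le dot_ge0 andbT dotDl !dotDr (dotC b a); lra.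
by rewrite addr_eq0 => /eqP ->; rewrite corootN addNr.
Qed.

Lemma Qv_seq v : Qv v -> exists s : seq V,
  (forall b, b \in s -> b \in Phi) /\ v = \sum_(b <- s) coroot b.
Proof.
move=> [c ->].
pose one a := match c a with Posz k => nseq k a | Negz k => nseq k.+1 (- a) end.
exists (flatten [seq one a | a <- Phi]); split.
  move=> b /flattenP[s /mapP[a aP ->]]; rewrite /one.
  case: (c a) => k; rewrite mem_nseq => /andP[_ /eqP ->] //.
  exact: (neg_root Phi_root).
have nseqE k (x : V) : \sum_(b <- nseq k x) coroot b = coroot x *+ k.
  by elim: k => [|k IH] /=; rewrite ?big_nil ?mulr0n // big_cons IH mulrS.
rewrite big_flatten big_map; apply: eq_bigr => a _; rewrite /one.
case: (c a) => k; rewrite nseqE ?pmulrn //.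
by rewrite corootN NegzE mulrNz mulNrz.
Qed.

(** Write varpi - nu as a sum of as few coroots as possible. No two terms form an obtuse angle, or
    [coroot_string] would shorten the sum. Pairing with a term b then gives at least 2, while the
    bounds allow at most 2: so (varpi, b) = 1, the terms are mutually orthogonal, and nu is obtained
    by reflecting varpi in them one after the other. *)
Lemma min_orbit (varpi nu : V) : Qv (varpi - nu) ->
  (forall a, a \in Phi -> dot varpi a <= 1) -> (forall a, a \in Phi -> -1 <= dot nu a) ->
  (exists2 w, weyl Phi w & nu = w *m varpi) /\
  (varpi != nu -> exists2 a, a \in Phi & dot varpi a = 1).
Proof.
move=> hq h1 h2.
have exN : exists N, `[< exists s : seq V, [/\ size s = N,
    forall b, b \in s -> b \in Phi & varpi - nu = \sum_(b <- s) coroot b] >].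
  by have [s [hs e]] := Qv_seq hq; exists (size s); apply/asboolP; exists s.
case: (ex_minnP exN) => N /asboolP[s [sN sP se]] hmin {exN}.
have pos b c : b \in s -> c \in rem b s -> 0 <= dot (coroot c) b.
  move=> bs cs; rewrite leNgt; apply/negP => neg.
  have e1 : perm_eq s (b :: c :: rem c (rem b s)).
    by rewrite (permPl (perm_to_rem bs)) perm_cons perm_to_rem.
  have bP := sP _ bs; have cP := sP _ (mem_rem cs).
  have hs : size s = (size (rem c (rem b s))).+2 by rewrite (perm_size e1).
  have sP' d : d \in rem c (rem b s) -> d \in Phi by move=> /mem_rem /mem_rem /sP.
  have e2 : varpi - nu = coroot c + coroot b + \sum_(d <- rem c (rem b s)) coroot d.
    by rewrite se (perm_big _ e1) /= !big_cons addrA (addrC (coroot b)).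
  have [z|[d dP z]] := coroot_string cP bP neg.
    have /hmin : `[< exists s0 : seq V, [/\ size s0 = size (rem c (rem b s)),
        forall b, b \in s0 -> b \in Phi & varpi - nu = \sum_(b <- s0) coroot b] >].
      by apply/asboolP; exists (rem c (rem b s)); split => //; rewrite e2 z add0r.
    by rewrite -sN hs; lia.
  have /hmin : `[< exists s0 : seq V, [/\ size s0 = (size (rem c (rem b s))).+1,
      forall b, b \in s0 -> b \in Phi & varpi - nu = \sum_(b <- s0) coroot b] >].
    apply/asboolP; exists (d :: rem c (rem b s)); split => //.
      by move=> x; rewrite inE => /predU1P[->|/sP'].
    by rewrite e2 z big_cons.
  by rewrite -sN hs; lia.
have tight b : b \in s -> dot varpi b = 1 /\ forall c, c \in rem b s -> dot (coroot c) b = 0.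
  move=> bs; have bP := sP _ bs.
  have e : dot varpi b - dot nu b = 2 + \sum_(c <- rem b s) dot (coroot c) b.
    rewrite -dotBl se (perm_big _ (perm_to_rem bs)) /= big_cons dotDl.
    by rewrite (coroot_dot Phi_root) // dot_suml.
  have g1 := h1 b bP; have g2 := h2 b bP.
  have g3 : 0 <= \sum_(c <- rem b s) dot (coroot c) b.
    by rewrite big_seq; apply: sumr_ge0 => c cs; apply: pos.
  split; first by move: e g1 g2 g3; lra.
  have : \sum_(c <- rem b s) dot (coroot c) b == 0.
    by apply/eqP; move: e g1 g2 g3; lra.
  rewrite big_seq psumr_eq0 => [/allP h c cs|c cs]; last exact: pos.
  by apply/eqP; have := h c cs; rewrite cs.
split; last first.
  case: (s) se tight sP => [|b s'] e ht hP.
    by rewrite big_nil in e; move/subr0_eq: e => -> ; rewrite eqxx.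
  move=> _; exists b; first by apply: hP; rewrite mem_head.
  by have [] := ht b (mem_head _ _).
have -> : nu = varpi - \sum_(b <- s) coroot b by rewrite -se subKr.
have : forall b, b \in s -> dot varpi b = 1 by move=> b /tight[].
have : forall b, b \in s -> forall c, c \in rem b s -> dot (coroot c) b = 0.
  by move=> b /tight[].
move: sP; clear -Phi_root; elim: s varpi => [|b s IH] varpi sP orth one.
  by exists 1%:M; [apply: weyl_1 | rewrite big_nil subr0 mul1mx].
have bP : b \in Phi by apply: sP; rewrite mem_head.
have r : refl b *m varpi = varpi - coroot b.
  by rewrite reflE' one ?mem_head // scale1r.
have [||c cs|w hw hwe] := IH (varpi - coroot b).
- by move=> c cs; apply: sP; rewrite inE cs orbT.
- move=> c cs d ds; apply: orth; first by rewrite inE cs orbT.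
  move=> /=; case: eqP => [|_]; first by move: ds => /mem_rem.
  by rewrite inE ds orbT.
- rewrite dotBl one ?inE ?cs ?orbT //.
  suff -> : dot (coroot b) c = 0 by rewrite subr0.
  have cP : c \in Phi by apply: sP; rewrite inE cs orbT.
  have := orth b (mem_head _ _) c; rewrite /= eqxx => /(_ cs)/eqP.
  rewrite (coroot_dot_eq0 Phi_root) // dotC -(coroot_dot_eq0 Phi_root) //.
  by move/eqP.
exists (w *m refl b).
  by apply: weyl_mul => //; apply: weyl_refl1.
by rewrite big_cons -mulmxA r -hwe opprD addrA.
Qed.

End Hull.

(** * Exponential polynomials *)

Section Cexp.
Variable R : realType.
Implicit Types (x y z : R[i]).

Lemma cexpD x y : cexp (x + y) = cexp x * cexp y.
Proof.
case: x y => [a b] [c d]; rewrite /cexp /= expRD cosD sinD.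
by apply/eqP; rewrite eq_complex /=; apply/andP; split; apply/eqP; ring.
Qed.

Lemma cexpR (r : R) : cexp r%:C = (expR r)%:C.
Proof. by rewrite /cexp /= cos0 sin0 mulr1 mulr0. Qed.

Lemma cexp0 : cexp (0 : R[i]) = 1.
Proof. by rewrite -[0]/(0%:C) cexpR expR0. Qed.

Lemma cexpN_mul x : cexp x * cexp (- x) = 1.
Proof. by rewrite -cexpD subrr cexp0. Qed.

Lemma cexp_neq0 x : cexp x != 0.
Proof.
apply/eqP => h; have := cexpN_mul x; rewrite h mul0r => /esym/eqP.
by rewrite oner_eq0.
Qed.

Lemma cexpN x : cexp (- x) = (cexp x)^-1.
Proof. by apply: (mulfI (cexp_neq0 x)); rewrite cexpN_mul divff // cexp_neq0. Qed.

Lemma cexp_nat k x : cexp (k%:R * x) = cexp x ^+ k.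
Proof.
elim: k => [|k IH]; first by rewrite mul0r cexp0.
by rewrite -addn1 natrD mulrDl mul1r cexpD IH exprD expr1.
Qed.

Lemma cexp_ipi : cexp ('i * (pi : R)%:C) = -1.
Proof.
have -> : 'i * (pi : R)%:C = 0 +i* pi by simpc.
rewrite /cexp /= expR0 cospi sinpi !mul1r.
by apply/eqP; rewrite eq_complex /= oppr0 !eqxx.
Qed.

Lemma cexp_ipi_int (j : int) : cexp ('i * (pi : R)%:C * j%:~R) = (-1) ^+ absz j.
Proof.
case: j => k; first by rewrite mulrC cexp_nat cexp_ipi.
rewrite NegzE mulrNz mulrN cexpN mulrC cexp_nat cexp_ipi.
by rewrite abszN /= -signr_odd; case: odd; rewrite ?expr1 ?expr0 ?invrN invr1.
Qed.

End Cexp.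

Section ToC.
Variable R : realType.

Lemma toCD k l (A B : 'M[R]_(k, l)) : toC (A + B) = toC A + toC B.
Proof. exact: map_mxD. Qed.

Lemma toCB k l (A B : 'M[R]_(k, l)) : toC (A - B) = toC A - toC B.
Proof. exact: map_mxB. Qed.

Lemma toCN k l (A : 'M[R]_(k, l)) : toC (- A) = - toC A.
Proof. exact: map_mxN. Qed.

Lemma toC0 k l : toC (0 : 'M[R]_(k, l)) = 0.
Proof. exact: map_mx0. Qed.

Lemma toCZ k l c (A : 'M[R]_(k, l)) : toC (c *: A) = c%:C *: toC A.
Proof. exact: map_mxZ. Qed.

Lemma toCM k l p (A : 'M[R]_(k, l)) (B : 'M[R]_(l, p)) : toC (A *m B) = toC A *m toC B.
Proof. exact: map_mxM. Qed.

Lemma toC1 k : toC (1%:M : 'M[R]_k) = 1%:M.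
Proof. exact: map_mx1. Qed.

Lemma toC_tr k l (A : 'M[R]_(k, l)) : (toC A)^T = toC A^T.
Proof. by rewrite /toC map_trmx. Qed.

Lemma dot_toC n (u v : 'cV[R]_n) : dot (toC u) (toC v) = (dot u v)%:C.
Proof.
rewrite /dot rmorph_sum; apply: eq_bigr => i _.
by rewrite !mxE rmorphM.
Qed.

End ToC.

Section Qpoly.
Variables (R : realType) (n : nat) (q lq : R[i]).
Hypotheses (q_log : cexp lq = q) (q_nroot : forall k : nat, (0 < k)%N -> q ^+ k != 1).
Local Notation V := 'cV[R]_n.
Local Notation C := R[i].
Local Notation VC := 'cV[R[i]]_n.
Local Notation qpow := (qpow lq).
Implicit Types (u v : V) (x z : VC) (mu nu : seq (C * V)) (f g : VC -> C).

Lemma qpowD (a b : C) : qpow (a + b) = qpow a * qpow b.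
Proof. by rewrite /Defs.qpow mulrDl cexpD. Qed.

Lemma qpow0 : qpow 0 = 1.
Proof. by rewrite /Defs.qpow mul0r cexp0. Qed.

Lemma qpow_neq0 (a : C) : qpow a != 0.
Proof. exact: cexp_neq0. Qed.

Lemma qpowN (a : C) : qpow (- a) = (qpow a)^-1.
Proof. by rewrite /Defs.qpow mulNr cexpN. Qed.

Lemma qpowB (a b : C) : qpow (a - b) = qpow a / qpow b.
Proof. by rewrite qpowD qpowN. Qed.

Lemma qpow_natl k (a : C) : qpow (k%:R * a) = qpow a ^+ k.
Proof. by rewrite /Defs.qpow -mulrA cexp_nat. Qed.

Lemma qpow_nat k : qpow k%:R = q ^+ k.
Proof. by rewrite -[k%:R]mulr1 qpow_natl /Defs.qpow mul1r q_log. Qed.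

Lemma q_neq0 : q != 0.
Proof. by rewrite -q_log cexp_neq0. Qed.

Lemma lq_neq0 : lq != 0.
Proof.
apply: contraNneq (q_nroot (ltnSn 0)) => h.
by rewrite expr1 -q_log h cexp0.
Qed.

Lemma qpow_int_neq1 (j : int) : j != 0 -> qpow j%:~R != 1.
Proof.
case: j => k k0; first by rewrite -pmulrn qpow_nat q_nroot // lt0n.
by rewrite NegzE mulrNz qpowN -pmulrn qpow_nat invr_eq1 q_nroot.
Qed.

Lemma q_inj j k : q ^+ j = q ^+ k -> j = k.
Proof.
wlog le : j k / (j <= k)%N.
  by move=> h; case/orP: (leq_total j k) => le; [|move/esym]; move/h => -> //.
rewrite -(subnKC le) exprD -{1}[q ^+ j]mulr1 => /(mulfI (expf_neq0 _ q_neq0)) h.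
apply/eqP; rewrite -{1}[j]addn0 eqn_add2l eq_sym; apply: contraT.
by rewrite -lt0n => /q_nroot; rewrite -h eqxx.
Qed.

Definition qkey x u := qpow (dot (toC u) x).

Lemma qkeyD x u v : qkey x (u + v) = qkey x u * qkey x v.
Proof. by rewrite /qkey toCD dotDl qpowD. Qed.

Lemma qpoly_ext f g : f =1 g -> qpoly lq f -> qpoly lq g.
Proof. by move=> fg [s hs]; exists s => x; rewrite -fg. Qed.

Lemma qpoly_key u (c : C) : qpoly lq (fun x => qpow (dot (toC u) x + c)).
Proof.
exists [:: (qpow c, u)] => x.
by rewrite big_seq1 /= addrC qpowD.
Qed.

Lemma qpoly_cst (c : C) : qpoly lq (fun _ : VC => c).
Proof.
exists [:: (c, 0)] => x.
by rewrite big_seq1 /= toC0 dot0l qpow0 mulr1.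
Qed.

Lemma qpolyD f g : qpoly lq f -> qpoly lq g -> qpoly lq (fun x => f x + g x).
Proof. by move=> [s hs] [t ht]; exists (s ++ t) => x; rewrite hs ht big_cat. Qed.

Lemma ev_allpairs mu nu (F : V -> C) :
  ev [seq (p.1 * r.1, p.2 + r.2) | p <- mu, r <- nu] F =
  ev mu (fun u => ev nu (fun v => F (u + v))).
Proof.
rewrite /ev big_allpairs_dep; apply: eq_bigr => p _.
by rewrite mulr_sumr; apply: eq_bigr => r _ /=; rewrite mulrA.
Qed.

Lemma qpolyM f g : qpoly lq f -> qpoly lq g -> qpoly lq (fun x => f x * g x).
Proof.
move=> [s hs] [t ht]; exists [seq (p.1 * r.1, p.2 + r.2) | p <- s, r <- t] => x.
rewrite -/(ev _ (qkey x)) ev_allpairs hs ht mulr_suml; apply: eq_bigr => p _.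
rewrite -mulrA; congr (_ * _); rewrite mulr_sumr; apply: eq_bigr => r _.
by rewrite qkeyD mulrCA.
Qed.

Lemma qpolyN f : qpoly lq f -> qpoly lq (fun x => - f x).
Proof.
move=> h; apply: qpoly_ext (qpolyM (qpoly_cst (-1)) h) => x.
by rewrite mulN1r.
Qed.

Lemma qpolyB f g : qpoly lq f -> qpoly lq g -> qpoly lq (fun x => f x - g x).
Proof. by move=> hf hg; apply: qpolyD => //; apply: qpolyN. Qed.

Lemma qpoly_affine f (A : 'M[R]_n) v : qpoly lq f ->
  qpoly lq (fun x => f (toC A *m x + toC v)).
Proof.
move=> [s hs]; exists [seq (p.1 * qpow (dot (toC p.2) (toC v)), A^T *m p.2) | p <- s] => x.
rewrite hs big_map; apply: eq_bigr => p _ /=.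
rewrite toCM -toC_tr dot_trmx trmxK dotDr qpowD -mulrA.
by rewrite [qpow _ * qpow _]mulrC.
Qed.

Lemma qpoly_shift f v : qpoly lq f -> qpoly lq (fun x => f (x + toC v)).
Proof.
move=> h; apply: qpoly_ext (qpoly_affine 1%:M v h) => x.
by rewrite toC1 mul1mx.
Qed.

Lemma qpoly_linear f (A : 'M[R]_n) : qpoly lq f -> qpoly lq (fun x => f (toC A *m x)).
Proof.
move=> h; apply: qpoly_ext (qpoly_affine A 0 h) => x.
by rewrite toC0 addr0.
Qed.

(** Division by log q makes q^(u, x) the k-th power of the positive real exp((u, eta)), so distinct
    values of (u, eta) are separated. *)
Definition ray (eta : V) (k : nat) : VC := (k%:R / lq) *: toC eta.

Lemma qkey_ray eta k u : qkey (ray eta k) u = (expR (dot u eta))%:C ^+ k.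
Proof.
rewrite /qkey /ray dotZr dot_toC -mulrA qpow_natl /Defs.qpow mulrAC mulVf ?lq_neq0 //.
by rewrite mul1r cexpR.
Qed.

Lemma qpoly_top f : nonzero_qpoly lq f -> exists mu,
  (forall x, f x = ev mu (qkey x)) /\ exists u, u \in msupp mu.
Proof.
move=> [[mu hf] [x fx0]]; exists mu; split => //.
case E : (msupp mu) => [|u s]; last by exists u; rewrite mem_head.
move: fx0; rewrite hf -/(ev mu (qkey x)) ev_msupp E big_nil eqxx; done.
Qed.

Lemma ev_at_max (eta : V) mu u : u \in msupp mu ->
  (forall v, v \in msupp mu -> dot eta v <= dot eta u) ->
  (forall v w, v \in msupp mu -> w \in msupp mu -> v != w -> dot eta (v - w) != 0) ->
  forall v, v \in msupp mu -> v != u -> dot eta v < dot eta u.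
Proof.
move=> us mx inj v vs vu; rewrite lt_neqAle mx // andbT.
by have := inj v u vs us vu; rewrite dotBr subr_eq0.
Qed.

(** Exponential polynomials form a domain: for eta separating all exponents, the leading terms
    multiply to a term that nothing cancels. This makes [generically] stable under conjunction. *)
Lemma nonzero_qpolyM f g : nonzero_qpoly lq f -> nonzero_qpoly lq g ->
  nonzero_qpoly lq (fun x => f x * g x).
Proof.
move=> hf hg; split; first by apply: qpolyM; [case: hf | case: hg].
have [mu [fE [u0 u0s]]] := qpoly_top hf.
have [nu [gE [v0 v0s]]] := qpoly_top hg.
pose S := msupp mu ++ msupp nu.
pose B := [seq p.1 - p.2 | p <- [seq (u, v) | u <- S, v <- S] & p.1 != p.2].
have hB : {in B, forall b, b != 0}.
  by move=> b /mapP[p]; rewrite mem_filter => /andP[h _] ->; rewrite subr_eq0.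
have [eta heta] := avoid hB.
have inj v w : v \in S -> w \in S -> v != w -> dot eta (v - w) != 0.
  move=> vS wS vw; apply: heta; apply/mapP; exists (v, w) => //.
  by rewrite mem_filter /= vw; apply/allpairsP; exists (v, w).
have [u us umax] := @seq_argmax _ R _ _ (dot eta) u0 u0s.
have [v vs vmax] := @seq_argmax _ R _ _ (dot eta) v0 v0s.
have ult := ev_at_max us umax (fun a b ha hb =>
  inj a b (etrans (mem_cat _ _ _) (introT orP (or_introl ha)))
     (etrans (mem_cat _ _ _) (introT orP (or_introl hb)))).
have vlt := ev_at_max vs vmax (fun a b ha hb =>
  inj a b (etrans (mem_cat _ _ _) (introT orP (or_intror ha)))
     (etrans (mem_cat _ _ _) (introT orP (or_intror hb)))).
apply: contrapT => hn.
have fg0 x : f x * g x = 0.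
  by apply/eqP; apply: contrapT => /negP h; apply: hn; exists x.
pose pr := [seq (p.1 * r.1, p.2 + r.2) | p <- mu, r <- nu].
(* This test retains only the top value of (eta, .), and it is a function of the separating
   character, as [power_sums_ev] requires. *)
pose F (w : V) : C := (dot eta w == dot eta (u + v))%:R.
have : ev pr F = 0.
  apply: (@power_sums_ev _ _ pr (fun w => (expR (dot w eta))%:C)).
    move=> k; rewrite -(fg0 (ray eta k)) fE gE.
    rewrite (eq_ev _ (fun w => esym (qkey_ray eta k w))) ev_allpairs.
    rewrite mulrC -evZ; apply: eq_ev => a; rewrite mulrC -evZ.
    by apply: eq_ev => b; rewrite qkeyD.
  move=> a b _ _ /complexI/expR_inj h; rewrite /F.
  by rewrite !(dotC eta) h.
rewrite ev_allpairs ev_msupp (bigD1_seq u) ?msupp_uniq //=.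
rewrite [X in _ + X]big1_seq ?addr0; last first.
  move=> a /andP[au aS]; rewrite ev_msupp big1_seq ?mulr0 // => b bS.
  rewrite /F !dotDr lt_eqF ?mulr0 // ltr_leD //; first exact: ult.
  exact: vmax.
rewrite ev_msupp (bigD1_seq v) ?msupp_uniq //=.
rewrite [X in _ + X]big1_seq ?addr0; last first.
  move=> a /andP[au aS].
  by rewrite /F !dotDr lt_eqF ?mulr0 // ltrD2l; apply: vlt.
rewrite /F eqxx mulr1 => /eqP; rewrite mulf_eq0.
by move: us vs; rewrite !mem_msupp => /negbTE -> /negbTE ->.
Qed.

Lemma nonzero_qpoly_key u (c d : C) : u != 0 -> d != 0 ->
  nonzero_qpoly lq (fun x => c * qpow (dot (toC u) x) - d).
Proof.
move=> u0 d0; split.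
  apply: qpolyB; last exact: qpoly_cst.
  apply: qpolyM; first exact: qpoly_cst.
  by apply: qpoly_ext (qpoly_key u 0) => x; rewrite addr0.
have [c0|c0] := eqVneq c 0.
  by exists 0; rewrite c0 mul0r sub0r oppr_eq0.
have [h|h] := eqVneq (c * qkey (ray u 0) u) d.
  exists (ray u 1); rewrite -/(qkey _ u) -h -mulrBr mulf_neq0 // subr_eq0.
  rewrite !qkey_ray expr1 expr0; apply/eqP => /(@complexI R _ 1).
  by rewrite -expR0 => /expR_inj/eqP; rewrite dot_eq0 (negbTE u0).
by exists (ray u 0); rewrite subr_eq0.
Qed.

End Qpoly.

Section Generic.
Variables (R : realType) (n : nat) (q lq : R[i]).
Hypotheses (q_log : cexp lq = q) (q_nroot : forall k : nat, (0 < k)%N -> q ^+ k != 1).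
Local Notation V := 'cV[R]_n.
Local Notation C := R[i].
Local Notation VC := 'cV[R[i]]_n.
Implicit Types (P Q : VC -> Prop) (v : V).
Local Notation gen := (generically lq).

Lemma gen_true P : (forall x, P x) -> gen P.
Proof.
move=> h; exists (fun=> 1) => //; split; first exact: qpoly_cst.
by exists 0; rewrite oner_eq0.
Qed.

Lemma gen_imp P Q : (forall x, P x -> Q x) -> gen P -> gen Q.
Proof. by move=> h [g hg gP]; exists g => // x /gP/h. Qed.

Lemma gen_and P Q : gen P -> gen Q -> gen (fun x => P x /\ Q x).
Proof.
move=> [g hg gP] [k hk kQ]; exists (fun x => g x * k x).
  exact: (nonzero_qpolyM q_log q_nroot).
by move=> x; rewrite mulf_eq0 negb_or => /andP[/gP ? /kQ].
Qed.

Lemma gen_imp2 P1 P2 Q : (forall x, P1 x -> P2 x -> Q x) -> gen P1 -> gen P2 -> gen Q.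
Proof. by move=> h h1 h2; apply: gen_imp (gen_and h1 h2) => x [/h]; apply. Qed.

Lemma gen_shift P v : gen P -> gen (fun x => P (x + toC v)).
Proof.
move=> [g [hg [x gx]] gP]; exists (fun x => g (x + toC v)); last by move=> y /gP.
by split; [apply: qpoly_shift | exists (x - toC v); rewrite subrK].
Qed.

Lemma gen_linear P (w w' : 'M[R]_n) : w *m w' = 1%:M -> gen P ->
  gen (fun x => P (toC w *m x)).
Proof.
move=> ww [g [hg [x gx]] gP]; exists (fun x => g (toC w *m x)); last by move=> y /gP.
split; first exact: qpoly_linear.
by exists (toC w' *m x); rewrite mulmxA -toCM ww toC1 mul1mx.
Qed.

Lemma gen_seq (T : eqType) (s : seq T) (P : T -> VC -> Prop) :
  (forall i, i \in s -> gen (P i)) -> gen (fun x => forall i, i \in s -> P i x).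
Proof.
elim: s => [|i s IH] h; first exact: gen_true.
have hs j : j \in s -> gen (P j) by move=> js; apply: h; rewrite inE js orbT.
have := IH hs.
apply: (gen_imp2 _ (h i (mem_head _ _))) => x h1 h2 j.
by rewrite inE => /predU1P[->|/h2].
Qed.

Lemma gen_exists P : gen P -> exists x, P x.
Proof. by move=> [g [_ [x gx]] gP]; exists x; apply: gP. Qed.

Lemma gen_nonzero (f : VC -> C) : nonzero_qpoly lq f -> gen (fun x => f x != 0).
Proof. by move=> hf; exists f. Qed.

Lemma gen_key (u : V) (c : C) : u != 0 -> gen (fun x => c * qpow lq (dot (toC u) x) != 1).
Proof.
move=> u0; have := gen_nonzero (nonzero_qpoly_key q_log q_nroot c u0 (oner_neq0 _)).
by apply: gen_imp => x; rewrite subr_eq0.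
Qed.

Lemma qbr_eq0 (c : C) : (qbr lq c == 0) = (qpow lq (2 * c) == 1).
Proof.
rewrite /qbr subr_eq0 qpowN -(inj_eq (mulIf (qpow_neq0 lq c))) mulVf ?qpow_neq0 //.
by rewrite (qpow_natl lq 2) expr2.
Qed.

Lemma qbrN (c : C) : qbr lq (- c) = - qbr lq c.
Proof. by rewrite /qbr opprK opprB. Qed.

Lemma gen_qbr (u : V) (c : C) : u != 0 -> gen (fun x => qbr lq (c + dot (toC u) x) != 0).
Proof.
move=> u0; have u20 : (2 : R) *: u != 0 by rewrite scaler_eq0 pnatr_eq0.
apply: gen_imp (gen_key (qpow lq (2 * c)) u20) => x.
rewrite qbr_eq0 -qpowD toCZ dotZl mulrDr; congr (qpow _ (_ + _) != 1).
by rewrite rmorph_nat.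
Qed.

Lemma gen_qbrN (u : V) (c : C) : u != 0 -> gen (fun x => qbr lq (c - dot (toC u) x) != 0).
Proof.
move=> u0; have u20 : - u != 0 by rewrite oppr_eq0.
apply: gen_imp (gen_qbr c u20) => x.
by rewrite toCN dotNl.
Qed.

Lemma qbr_mul (s d : C) : qbr lq s * qbr lq d =
  (qpow lq (s + d) + qpow lq (- (s + d))) - (qpow lq (s - d) + qpow lq (- (s - d))).
Proof.
rewrite /qbr opprB opprD !qpowD !qpowN; ring.
Qed.

Lemma qbr_int_neq0 (j : int) : j != 0 -> qbr lq j%:~R != 0.
Proof.
move=> j0; rewrite qbr_eq0.
have -> : (2 : C) * j%:~R = (2 * j)%:~R by rewrite intrM.
by apply: (qpow_int_neq1 q_log q_nroot); rewrite mulf_eq0.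
Qed.

End Generic.

(** * Quasi-invariance and uniqueness *)

Section QuasiInvariance.
Variables (R : realType) (n : nat) (q lq : R[i]) (Phi : {fset 'cV[R]_n}).
Hypotheses (q_log : cexp lq = q) (q_nroot : forall k : nat, (0 < k)%N -> q ^+ k != 1).
Hypotheses (Phi_root : root_system Phi) (Phi_red : reduced Phi).
Local Notation V := 'cV[R]_n.
Local Notation C := R[i].
Local Notation VC := 'cV[R[i]]_n.
Local Notation qpow := (qpow lq).
Implicit Types (a u v : V) (x z : VC) (mu nu : seq (C * V)) (y : C) (S : seq V).

(* [bb (y a) a u] is q^(alpha, x + u), where y a = q^(alpha, x). *)
Definition bb (y : C) a u := y * qpow (dot a u)%:C.
Definition yx x a := qpow (dot (toC a) x).

Lemma bb_neq0 y a u : y != 0 -> bb y a u != 0.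
Proof. by move=> y0; rewrite mulf_neq0 ?qpow_neq0. Qed.

Lemma yx_neq0 x a : yx x a != 0.
Proof. exact: qpow_neq0. Qed.

Lemma bb_shift x v a u : bb (yx (x + toC v) a) a u = bb (yx x a) a (u + v).
Proof.
rewrite /bb /yx dotDr dot_toC (dotDr a) rmorphD !qpowD /=; ring.
Qed.

Lemma qpow_dot_coroot a u (j : int) : a \in Phi ->
  qpow (dot a (u + coroot a *~ j))%:C = qpow (dot a u)%:C * qpow (2 * j)%:~R.
Proof.
move=> aP; rewrite dotDr -scaler_int dotZr (coroot_dotr Phi_root) // -qpowD.
congr Defs.qpow; rewrite rmorphD rmorphM /= rmorph_int rmorph_nat.
by rewrite mulrC -[2]/(2%:~R) -intrM.
Qed.

Lemma bb_coroot y a u (j : int) : a \in Phi ->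
  bb y a (u + coroot a *~ j) = bb y a u * qpow (2 * j)%:~R.
Proof. by move=> aP; rewrite /bb qpow_dot_coroot // mulrA. Qed.

Lemma coroot_torsion a (j : int) : a \in Phi -> coroot a *~ j = 0 -> j = 0.
Proof.
move=> aP /eqP; rewrite -scaler_int scaler_eq0 intr_eq0.
by rewrite (negbTE (coroot_neq0 Phi_root aP)) orbF => /eqP.
Qed.

Lemma qpow2_inj (j : int) : qpow (2 * j)%:~R = 1 -> j = 0.
Proof.
move=> h; have [//|j0] := eqVneq j 0.
have : 2 * j != 0 by rewrite mulf_neq0.
by move/(qpow_int_neq1 q_log q_nroot); rewrite h eqxx.
Qed.

(* The condition psi(x, z + s a / 2) = psi(x, z - s a / 2) on the coefficients of
   psi(x, -), with y = q^(a, x): the characters u |-> q^(2 (u, z)) with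
   q^(2 (a^vee, z)) = 1 span the a^vee-periodic functions F on a finite set. *)
Definition Eat (k : nat) (y : C) mu a := forall F s, invariant_by (coroot a) F ->
  (1 <= s <= k)%N ->
  ev mu (fun u => (bb y a u ^+ s - bb y a u ^- s) * F u) = 0.

(* The limits of [Eat] as y tends to infinity (e = false) and to 0 (e = true). *)
Definition Einf (e : bool) (k : nat) mu a := forall F s, invariant_by (coroot a) F ->
  (1 <= s <= k)%N -> ev mu (fun u => qpow ((-1) ^+ e * (dot a u)%:C) ^+ s * F u) = 0.

(* Then b + b^-1, with b = [bb y a u], determines b. *)
Definition nonres (S : seq V) (y : C) a :=
  forall u v, u \in S -> v \in S -> bb y a u * bb y a v != 1.

Lemma Eat_kills k y mu a : y != 0 -> Eat k y mu a ->
  kills (coroot a) mu k (fun u => bb y a u - (bb y a u)^-1)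
                    (fun u => bb y a u + (bb y a u)^-1).
Proof. by move=> y0 h; apply: kills_qnum => // u; apply: bb_neq0. Qed.

(** Nonresonance supplies both hypotheses of [kills_edge]: b(u)^2 != 1 makes b - b^-1 nonzero, and
    b(u) b(v) != 1 makes b + b^-1 injective along a string. *)
Lemma Eat_node k y mu a : a \in Phi -> y != 0 -> nonres (msupp mu) y a -> Eat k y mu a ->
  forall p, cf mu p != 0 -> exists j1 j2 : int,
    [/\ cf mu (p + coroot a *~ j1) != 0, cf mu (p + coroot a *~ j2) != 0
      & j2 + k%:Z <= j1].
Proof.
move=> aP y0 hn hE; apply: (kills_edge (coroot_torsion (a := a) ^~ aP) (Eat_kills y0 hE)).
  move=> u hu; have := hn u u; rewrite mem_msupp => /(_ hu hu); apply: contraNneq.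
  move/eqP; rewrite subr_eq0 => /eqP {2}->; rewrite divff //; exact: bb_neq0.
move=> u j hu hu' hX; apply: qpow2_inj.
have := hn u (u + coroot a *~ j); rewrite !mem_msupp => /(_ hu hu').
move: hX; rewrite bb_coroot //.
have b0 := bb_neq0 a u y0; have t0 := qpow_neq0 lq (2 * j)%:~R.
set b := bb y a u in b0 *; set t := Defs.qpow _ _ in t0 * => hX hbt.
have : (t - 1) * (1 - b * (b * t)) = 0.
  transitivity ((b + b^-1 - (b * t + (b * t)^-1)) * (b * t)).
    by field; rewrite ?b0 ?t0.
  by rewrite hX subrr mul0r.
move/eqP; rewrite mulf_eq0 !subr_eq0 => /orP[/eqP //|/eqP e].
by rewrite -e eqxx in hbt.
Qed.

(** In the limit only one of b^s and b^-s survives; it is a power of a function that is already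
    injective along a string, so resonances do not occur. *)
Lemma Einf_node e k mu a : a \in Phi -> Einf e k mu a ->
  forall p, cf mu p != 0 -> exists j1 j2 : int,
    [/\ cf mu (p + coroot a *~ j1) != 0, cf mu (p + coroot a *~ j2) != 0
      & j2 + k%:Z <= j1].
Proof.
move=> aP hE; pose X u := qpow ((-1) ^+ e * (dot a u)%:C).
apply: (kills_edge (e := X) (X := X) (coroot_torsion (a := a) ^~ aP)).
- apply: kills_monom => F i pF ik; rewrite -[RHS](hE F i.+1 pF) //.
  by apply: eq_ev => u; rewrite -exprS.
- by move=> u _; apply: qpow_neq0.
move=> u j _ _; rewrite /X dotDr rmorphD mulrDr qpowD => /esym/eqP.
rewrite -{2}[qpow _]mulr1 (inj_eq (mulfI (qpow_neq0 _ _))) => /eqP h.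
apply: qpow2_inj; move: h; have := qpow_dot_coroot 0 j aP.
rewrite add0r dot0r qpow0 mul1r => <-.
by case: e {hE X} => /=; rewrite ?expr1 ?expr0 ?mulN1r ?mul1r ?qpowN // => h; rewrite -[LHS]invrK h invr1.
Qed.

Lemma node_edges k mu a :
  (forall p, cf mu p != 0 -> exists j1 j2 : int,
    [/\ cf mu (p + coroot a *~ j1) != 0, cf mu (p + coroot a *~ j2) != 0
      & j2 + k%:Z <= j1]) -> edges (msupp mu) a k.
Proof.
move=> h p; rewrite mem_msupp => /h[j1 [j2 [h1 h2 h3]]].
exists (p + coroot a *~ j1), (p + coroot a *~ j2), (j1 - j2)%:~R, (- j1)%:~R.
rewrite !mem_msupp; split => //.
- by rewrite scaler_int -addrA -mulrzDr addrCA subrr addr0.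
- by rewrite pmulrn ler_int; lia.
- by rewrite scaler_int -addrA -mulrzDr subrr mulr0z addr0.
Qed.

Lemma Eat_cat k y mu nu a : Eat k y mu a -> Eat k y nu a -> Eat k y (mu ++ nu) a.
Proof. by move=> h1 h2 F s pF hs; rewrite ev_cat h1 // h2 // addr0. Qed.

Lemma Eat_scale k y c mu a : Eat k y mu a -> Eat k y (mZ c mu) a.
Proof. by move=> h F s pF hs; rewrite ev_scale h // mulr0. Qed.

Lemma Eat_shift k x v mu a : Eat k (yx (x + toC v) a) mu a ->
  Eat k (yx x a) (mshift v mu) a.
Proof.
move=> h F s pF hs.
have pF' : invariant_by (coroot a) (fun u => F (u + v)) by move=> u; rewrite addrAC pF.
rewrite ev_shift; apply: etrans (h _ s pF' hs).
by apply: eq_ev => u; rewrite bb_shift.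
Qed.

Section Uniqueness.
Variable m : V -> nat.
Hypothesis m_inv : weyl_invariant Phi m.
Local Notation zono := (zono Phi m).
Local Notation Hz := (Hz Phi m).
Local Notation rv := (rv Phi m).

Lemma E_unique (y : V -> C) mu xi : regular Phi xi ->
  (forall a, a \in Phi -> 0 < dot xi a -> y a != 0) ->
  (forall a, a \in Phi -> 0 < dot xi a -> nonres (msupp mu) (y a) a) ->
  (forall a, a \in Phi -> 0 < dot xi a -> Eat (m a) (y a) mu a) ->
  (forall p, cf mu p != 0 -> zono p) -> cf mu (rv xi) = 0 -> forall u, cf mu u = 0.
Proof.
move=> hxi hy hn hE hz hrv u.
have e : msupp mu = [::].
  apply: (zono_unique Phi_root Phi_red m_inv hxi).
  - by move=> a aP xa; apply: node_edges; apply: (Eat_node aP _ (hn a aP xa) (hE a aP xa)); apply: hy.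
  - by move=> p; rewrite mem_msupp; apply: hz.
  - by rewrite mem_msupp hrv eqxx.
by apply/eqP; apply: contraT; rewrite -mem_msupp e.
Qed.

(** Strings along a and along -a are the same, so the positive system [eta] of the conditions may
    differ from the one that marks the vertex. *)
Lemma Einf_unique e mu xi eta : regular Phi xi -> regular Phi eta ->
  (forall a, a \in Phi -> 0 < dot eta a -> Einf e (m a) mu a) ->
  (forall p, cf mu p != 0 -> zono p) -> cf mu (rv xi) = 0 -> forall u, cf mu u = 0.
Proof.
move=> hxi heta hE hz hrv u.
have e0 : msupp mu = [::].
  apply: (zono_unique Phi_root Phi_red m_inv hxi).
  - move=> a aP xa; have [h|h] := ltP 0 (dot eta a).
      by apply: node_edges; apply: (Einf_node aP (hE a aP h)).
    have h' : 0 < dot eta (- a) by rewrite dotNr oppr_gt0 lt_neqAle heta.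
    have aP' := neg_root Phi_root aP.
    rewrite -[a]opprK; apply: edgesN; rewrite opprK -(mN Phi_root m_inv aP).
    by apply: node_edges; apply: (Einf_node aP' (hE _ aP' h')).
  - by move=> p; rewrite mem_msupp; apply: hz.
  - by rewrite mem_msupp hrv eqxx.
by apply/eqP; apply: contraT; rewrite -mem_msupp e0.
Qed.

(** The pair of [a0] and [- a0] may be resonant; vanishing on the edges exposed by [xi0] and [- xi0]
    makes up for the lost strings. *)
Lemma E_wall_unique (y : V -> C) mu xi a0 xi0 eta : wall Phi xi a0 xi0 -> regular Phi eta ->
  (forall a, a \in Phi -> 0 < dot eta a -> y a != 0) ->
  (forall a, a \in Phi -> 0 < dot eta a -> a != a0 -> a != - a0 -> nonres (msupp mu) (y a) a) ->
  (forall a, a \in Phi -> 0 < dot eta a -> Eat (m a) (y a) mu a) ->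
  (forall p, cf mu p != 0 -> zono p) ->
  (forall p, zono p -> dot xi0 p = Hz xi0 -> cf mu p = 0) ->
  (forall p, zono p -> dot xi0 p = - Hz xi0 -> cf mu p = 0) ->
  forall u, cf mu u = 0.
Proof.
move=> hw heta hy hn hE hz hmax hmin u.
have e0 : msupp mu = [::].
  apply: (zono_wall_unique Phi_root Phi_red m_inv hw).
  - move=> a aP a1 a2; have [h|h] := ltP 0 (dot eta a).
      by apply: node_edges; apply: (Eat_node aP (hy a aP h) (hn a aP h a1 a2) (hE a aP h)).
    have h' : 0 < dot eta (- a) by rewrite dotNr oppr_gt0 lt_neqAle heta.
    have aP' := neg_root Phi_root aP.
    rewrite -[a]opprK; apply: edgesN.
    rewrite opprK -(mN Phi_root m_inv aP); apply: node_edges.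
    apply: (Eat_node aP' (hy _ aP' h') _ (hE _ aP' h')); apply: hn => //.
      by rewrite eqr_oppLR.
    by rewrite eqr_opp.
  - by move=> p; rewrite mem_msupp; apply: hz.
  - move=> p; rewrite mem_msupp => hp; apply/eqP => h.
    by move: (hp); rewrite (hmax p) ?eqxx //; apply: hz.
  - move=> p; rewrite mem_msupp => hp; apply/eqP => h.
    by move: (hp); rewrite (hmin p) ?eqxx //; apply: hz.
by apply/eqP; apply: contraT; rewrite -mem_msupp e0.
Qed.

End Uniqueness.
End QuasiInvariance.

(** * From points z on a subgroup to periodic test functions *)

Section Separation.
Variables (R : realType) (n : nat) (q lq : R[i]) (Phi : {fset 'cV[R]_n}).
Hypotheses (q_log : cexp lq = q) (q_nroot : forall k : nat, (0 < k)%N -> q ^+ k != 1).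
Hypotheses (Phi_root : root_system Phi) (Phi_red : reduced Phi).
Local Notation V := 'cV[R]_n.
Local Notation C := R[i].
Local Notation VC := 'cV[R[i]]_n.
Local Notation qpow := (qpow lq).
Implicit Types (a u v : V) (x z : VC).

Lemma signr_expR_inj (r s : R) (i j : int) :
  (expR r)%:C * (-1) ^+ absz i = (expR s)%:C * (-1) ^+ absz j ->
  r = s /\ odd (absz i) = odd (absz j).
Proof.
rewrite -(signr_odd _ (absz i)) -(signr_odd _ (absz j)).
have r0 := expR_gt0 r; have s0 := expR_gt0 s.
case: (odd _); case: (odd _); rewrite ?expr0 ?expr1 ?mulr1 ?mulrN1.
- by move=> /oppr_inj /complexI /expR_inj.
- by move=> /eqP; rewrite eq_complex /= => /andP[/eqP h _]; lra.
- by move=> /eqP; rewrite eq_complex /= => /andP[/eqP h _]; lra.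
- by move=> /complexI /expR_inj.
Qed.

(* One z (together with its multiples) on the subgroup q^{2(alpha^v, z)} = 1
   that already separates the classes of L modulo Z alpha^v. *)
Lemma separator a (L : seq V) : a \in Phi -> (forall u, u \in L -> lat Phi u) ->
  exists z : VC, qpow (2 * dot (toC (coroot a)) z) = 1 /\
    forall u v, u \in L -> v \in L ->
      qpow (2 * dot (toC u) z) = qpow (2 * dot (toC v) z) ->
      exists j : int, u = v + coroot a *~ j.
Proof.
move=> aP hL.
pose pr u := u - (dot u a / 2) *: coroot a.
pose B := [seq b <- [seq pr (u - v) | u <- L, v <- L] | b != 0].
have hB : {in B, forall b, b != 0} by move=> b; rewrite mem_filter => /andP[].
have [eta0 heta0] := avoid hB.
pose eta := eta0 - (dot eta0 (coroot a) / 2) *: a.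
have etaa : dot eta (coroot a) = 0.
  by rewrite dotBl dotZl (coroot_dotr Phi_root) // divfK ?subrr.
have etapr u : dot u eta = dot eta0 (pr u).
  rewrite dotBr dotBr !dotZr (dotC u eta0); ring.
have lq0 := lq_neq0 q_log q_nroot.
(* The term in [eta] separates the projections orthogonal to a. The term in a contributes the sign
   (-1)^(u, a), without which u - v would only be a half-integral multiple of a^vee. *)
pose z : VC := (2 * lq)^-1 *: toC eta + ('i * (pi : R)%:C / (2 * lq)) *: toC a.
have key u : lat Phi u -> exists2 j : int, dot u a = j%:~R &
    qpow (2 * dot (toC u) z) = (expR (dot u eta))%:C * (-1) ^+ absz j.
  move=> hu; have /intrP[j hj] := hu a aP.
  exists j => //; rewrite dotDr !dotZr !dot_toC hj /Defs.qpow.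
  rewrite -cexp_ipi_int -cexpR -cexpD; congr cexp.
  rewrite rmorph_int; set A := (dot u eta)%:C; set P := (pi)%:C; set J := _%:~R.
  by field; rewrite lq0.
exists z; split.
  have [j hj ->] := key _ (lat_coroot Phi_root aP).
  rewrite dotC etaa expR0 mul1r; move: hj; rewrite (coroot_dot Phi_root) //.
  by move/eqP; rewrite -[2]/(2%:~R) eqr_int => /eqP <-; rewrite expr2 mulrNN mulr1.
move=> u v uL vL.
have [j hj ->] := key u (hL u uL); have [k hk ->] := key v (hL v vL).
move=> /signr_expR_inj[e1 e2].
have pr0 : pr (u - v) = 0.
  apply/eqP; apply: contraT => h.
  have : pr (u - v) \in B.
    by rewrite mem_filter h; apply/allpairsP; exists (u, v).
  by move/heta0; rewrite -etapr dotBl e1 subrr eqxx.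
have [l hl] : exists l : int, j - k = 2 * l.
  have : ~~ odd (absz (j - k)) by lia.
  move=> ho; exists (divz (j - k) 2); lia.
exists l; apply/eqP; rewrite -subr_eq0 opprD addrA -[X in _ == X]pr0 /pr.
by rewrite dotBl hj hk -intrB hl intrM mulrC mulKf // scaler_int eqxx.
Qed.

(** The multiples of the separating point stay on the subgroup, and a periodic function on L depends
    only on the value of that one character. *)
Lemma char_extract a (L : seq V) (d : V -> C) (F : V -> C) : a \in Phi ->
  (forall u, u \in L -> lat Phi u) ->
  (forall z, qpow (2 * dot (toC (coroot a)) z) = 1 ->
     \sum_(u <- L) d u * qpow (2 * dot (toC u) z) = 0) ->
  invariant_by (coroot a) F -> \sum_(u <- L) d u * F u = 0.
Proof.
move=> aP hL hz pF; have [z [z1 zsep]] := separator aP hL.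
rewrite -ev_mk; apply: (@power_sums_ev _ _ _ (fun u => qpow (2 * dot (toC u) z))).
  move=> k; rewrite ev_mk -[RHS](hz (k%:R *: z)).
    by apply: eq_bigr => u _; rewrite dotZr mulrCA (qpow_natl _ k).
  by rewrite dotZr mulrCA (qpow_natl _ k) z1 expr1n.
have -> : [seq p.2 | p <- mk L d] = L by rewrite -map_comp map_id.
move=> u v uL vL /(zsep u v uL vL)[j ->].
by rewrite (periodicz _ _ pF).
Qed.

End Separation.

(** * The polytope of the definition as a zonotope over all roots *)

Section Polytope.
Variables (R : realType) (n : nat) (Phi Phip : {fset 'cV[R]_n}) (xi : 'cV[R]_n).
Hypotheses (Phi_root : root_system Phi) (Phi_red : reduced Phi).
Hypotheses (hxi : regular Phi xi)
  (Phip_def : forall a, (a \in Phip) = (a \in Phi) && (0 < dot xi a)).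
Local Notation V := 'cV[R]_n.
Variable m : V -> nat.
Hypothesis m_inv : weyl_invariant Phi m.

Lemma quarter_double (v : V) : 4^-1 *: (v *+ 2) = 2^-1 *: v.
Proof. by rewrite -(scaler_nat 2 v) scalerA; congr (_ *: _); field. Qed.

Lemma big_Phip (T : Type) (idx : T) (op : Monoid.com_law idx) (F : V -> T) :
  \big[op/idx]_(a <- Phip) F a = \big[op/idx]_(a <- Phi | 0 < dot xi a) F a.
Proof.
rewrite -[RHS]big_filter; apply: perm_big; apply: uniq_perm.
- exact: fset_uniq.
- by rewrite filter_uniq ?fset_uniq.
by move=> a; rewrite mem_filter andbC -Phip_def.
Qed.

Lemma rv_pos (k : V -> nat) : weyl_invariant Phi k ->
  rv Phi k xi = 2^-1 *: \sum_(a <- Phi | 0 < dot xi a) (k a)%:R *: coroot a.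
Proof.
move=> k_inv; rewrite /rv (sum_root_half Phi_root (xi := xi)).
- rewrite quarter_double.
  by congr (_ *: _); apply: eq_bigr => a h; rewrite gtr0_sg // mulr1.
- by move=> a aP; rewrite (mN Phi_root k_inv) // dotNr sgrN corootN mulrN scaleNr scalerN opprK.
- by move=> a aP /eqP; rewrite (negbTE (hxi aP)).
Qed.

Lemma rhov_rv (k : V -> nat) : weyl_invariant Phi k -> rhov Phip k = rv Phi k xi.
Proof.
by move=> k_inv; rewrite rv_pos // /rhov big_Phip.
Qed.

Lemma rho_rr (k : V -> nat) : weyl_invariant Phi k -> rho Phip k = rr Phi k xi.
Proof.
move=> k_inv; rewrite /rho /rr big_Phip (sum_root_half Phi_root (xi := xi)).
- rewrite quarter_double.
  by congr (_ *: _); apply: eq_bigr => a h; rewrite gtr0_sg // mulr1.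
- by move=> a aP; rewrite (mN Phi_root k_inv) // dotNr sgrN mulrN scaleNr scalerN opprK.
- by move=> a aP /eqP; rewrite (negbTE (hxi aP)).
Qed.

Lemma ba_zono : ba_polytope Phip m = zono Phi m.
Proof.
apply/seteqP; split => v.
  move=> [l [hl ->]].
  exists (fun a => if 0 < dot xi a then (m a)%:R - 2 * l a else - ((m a)%:R - 2 * l (- a))).
  split.
    move=> a aP; case: ifP => h.
      have /hl /andP[h1 h2] : a \in Phip by rewrite Phip_def aP h.
      by rewrite ler_norml; apply/andP; split; lra.
    have h' : 0 < dot xi (- a) by rewrite dotNr oppr_gt0 lt_neqAle hxi // leNgt h.
    have /hl : - a \in Phip by rewrite Phip_def (neg_root Phi_root).
    rewrite (mN Phi_root m_inv) // => /andP[h1 h2].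
    by rewrite normrN ler_norml; apply/andP; split; lra.
  rewrite (sum_root_half Phi_root (xi := xi)).
  - rewrite quarter_double rhov_rv //.
    rewrite rv_pos //.
    rewrite (big_Phip _ (fun a => l a *: coroot a)) !scaler_sumr -sumrB; apply: eq_bigr => a h.
    rewrite h; move: (coroot a) => ca; rewrite !scalerA -scalerBl.
    by congr (_ *: _); field.
  - move=> a aP; rewrite corootN scalerN -scaleNr opprK dotNr oppr_gt0 (mN Phi_root m_inv) //.
    by have := hxi aP; case: sgrP => // _ _; rewrite ?opprK.
  - by move=> a aP /eqP; rewrite (negbTE (hxi aP)).
move=> [k [hk ->]].
(* The roots a and -a together contribute a^vee with coefficient (k a - k (-a)) / 4, which has to
   equal m_a / 2 - l_a. *)
exists (fun a => (m a)%:R / 2 - (k a - k (- a)) / 4); split.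
  move=> a; rewrite Phip_def => /andP[aP _].
  have := hk a aP; have := hk (- a) (neg_root Phi_root aP).
  rewrite (mN Phi_root m_inv) // !ler_norml => /andP[h1 h2] /andP[h3 h4].
  by apply/andP; split; lra.
rewrite rhov_rv // rv_pos //.
have -> : \sum_(a <- Phi) k a *: coroot a =
    \sum_(a <- Phi) ((k a - k (- a)) / 2) *: coroot a.
  have e : \sum_(a <- Phi) k a *: coroot a = \sum_(a <- Phi) (- k (- a)) *: coroot a.
    rewrite -[LHS](sum_rootN Phi_root); apply: eq_bigr => a _.
    by rewrite corootN scalerN scaleNr.
  rewrite -[LHS]scale1r (_ : 1 = 2^-1 + 2^-1 :> R); last by field.
  rewrite scalerDl {2}e !scaler_sumr -big_split; apply: eq_bigr => a _ /=.
  by move: (coroot a) => ca; rewrite !scalerA -scalerDl; congr (_ *: _); field.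
rewrite (sum_root_half Phi_root (xi := xi)).
- rewrite quarter_double.
  rewrite (big_Phip _ (fun a => ((m a)%:R / 2 - (k a - k (- a)) / 4) *: coroot a)).
  rewrite !scaler_sumr -sumrB; apply: eq_bigr => a h.
  move: (coroot a) => ca; rewrite !scalerA -scalerBl.
  by congr (_ *: _); field.
- by move=> a aP; rewrite corootN opprK; move: (coroot a) => ca; rewrite scalerN -scaleNr; congr (_ *: _); field.
- by move=> a aP /eqP; rewrite (negbTE (hxi aP)).
Qed.

End Polytope.

(** * Coefficients of the Baker-Akhiezer function *)

Section RankOneAlgebra.
Variable K : fieldType.

(* Ratio of the coefficients of a rank one solution, cleared of denominators. *)
Lemma rank1_algebra (h : nat -> K) (m j : nat) (cj c0 rest Kj K0 : K) :
  (1 <= j <= m)%N -> (forall i, (j < i <= m + j)%N -> h i != 0) -> Kj != 0 ->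
  cj * (\prod_(j.+1 <= i < (m + j).+1) h i) * Kj +
    c0 * (\prod_(0 <= i < m.+1 | i != j) h i) * K0 = 0 ->
  c0 = rest * \prod_(m.+1 <= i < (m + m).+1) h i ->
  cj = rest * (- K0 / Kj) * (\prod_(0 <= i < j) h i) *
     (\prod_((m + j).+1 <= i < (m + m).+1) h i).
Proof.
move=> /andP[j1 jm] h0 Kj0 + c0E; rewrite c0E.
have -> : \prod_(0 <= i < m.+1 | i != j) h i =
    (\prod_(0 <= i < j) h i) * (\prod_(j.+1 <= i < m.+1) h i).
  rewrite (big_cat_nat (n := j)) //=; last by lia.
  congr (_ * _).
    rewrite big_nat_cond [RHS]big_nat_cond; apply: eq_bigl => i.
    by lia.
  rewrite big_ltn_cond //.
  rewrite eqxx /= big_nat_cond [RHS]big_nat_cond; apply: eq_bigl => i; lia.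
have e : (\prod_(j.+1 <= i < m.+1) h i) * (\prod_(m.+1 <= i < (m + m).+1) h i) =
    (\prod_(j.+1 <= i < (m + j).+1) h i) * (\prod_((m + j).+1 <= i < (m + m).+1) h i).
  transitivity (\prod_(j.+1 <= i < (m + m).+1) h i).
    by symmetry; apply: big_cat_nat; lia.
  by apply: big_cat_nat; lia.
have M0 : \prod_(j.+1 <= i < (m + j).+1) h i != 0.
  rewrite big_nat_cond prodf_seq_neq0; apply/allP => i _; apply/implyP.
  by rewrite andbT => hi; apply: h0; lia.
move: e M0; set A := \prod_(j.+1 <= i < m.+1) _; set B := \prod_(m.+1 <= i < _) _.
set M := \prod_(j.+1 <= i < (m + j).+1) _; set N := \prod_((m + j).+1 <= i < _) _.
set Z := \prod_(0 <= i < j) _ => e M0 /eqP; rewrite addr_eq0 => /eqP h1.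
apply: (mulIf M0); apply: (mulIf Kj0).
rewrite h1.
have -> : rest * B * (Z * A) = rest * Z * (A * B) by ring.
rewrite e; field.
by [].
Qed.

End RankOneAlgebra.

Lemma ev_on (K : fieldType) (T : zmodType) (s : seq T) (nu : seq (K * T)) (F : T -> K) : uniq s ->
  (forall u, cf nu u != 0 -> u \notin s -> F u = 0) ->
  ev nu F = \sum_(u <- s) cf nu u * F u.
Proof.
move=> us h; pose s' := undup (msupp nu ++ s).
have us' : uniq s' by apply: undup_uniq.
rewrite (ev_cf F us'); last first.
  by move=> u hu; rewrite mem_undup mem_cat mem_msupp hu.
rewrite (bigID (mem s)) /= [X in _ + X]big1 ?addr0; last first.
  move=> u uS; have [->|hu] := eqVneq (cf nu u) 0; first by rewrite mul0r.
  by rewrite h // mulr0.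
rewrite -big_filter; apply: perm_big; apply: uniq_perm => //.
  by rewrite filter_uniq.
by move=> u; rewrite mem_filter mem_undup mem_cat; case: (u \in s); rewrite ?orbT ?andbF.
Qed.

Section RankOne.
Variables (R : realType) (n : nat) (q lq : R[i]) (Phi : {fset 'cV[R]_n}).
Hypotheses (q_log : cexp lq = q) (q_nroot : forall k : nat, (0 < k)%N -> q ^+ k != 1).
Hypotheses (Phi_root : root_system Phi) (Phi_red : reduced Phi).
Local Notation V := 'cV[R]_n.
Local Notation C := R[i].
Local Notation VC := 'cV[R[i]]_n.
Local Notation qbr := (qbr lq).
Implicit Types (a u v : V) (x z : VC) (mu nu : seq (C * V)) (y : C) (S : seq V).

Variable m : V -> nat.
Hypothesis m_inv : weyl_invariant Phi m.
Local Notation zono := (zono Phi m).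
Local Notation Hz := (Hz Phi m).
Local Notation rv := (rv Phi m).
Local Notation Eat := (Eat lq).

(* The coefficient at the vertex [rv xi]. *)
Definition topc xi x := \prod_(a <- Phi | 0 < dot xi a)
  \prod_(1 <= j < (m a).+1) qbr (j%:R - dot (toC a) x).

(** For the points at distances i and k from the vertex on an edge in direction a^vee, 1 - b(u) b(v)
    is [hb a x (i + k)] up to a unit; for i = k this bracket is b - b^-1. *)
Definition hb a x (i : nat) := qbr (dot (toC a) x + (m a)%:R - i%:R).

(** The factor -K0 / Kj of [rank1_algebra]: the part independent of x in the ratio between the
    coefficient at distance j and the one at the vertex. *)
Definition facec a (j : nat) : C :=
  let mm := m a in
  - (\prod_(1 <= i < mm.+1 | i != j) qbr i%:R) /
    (\prod_(1 <= i < mm.+1 | i != j) qbr (i%:R - j%:R)).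

Lemma dot_string a xi0 v (j : int) : a \in Phi -> dot xi0 a = 0 ->
  dot xi0 (v + coroot a *~ j) = dot xi0 v.
Proof.
move=> aP h; rewrite -scaler_int dotDr (dotZr j%:~R).
have /eqP -> : dot xi0 (coroot a) == 0 by rewrite dotC (coroot_dot_eq0 Phi_root) // h.
by rewrite mulr0 addr0.
Qed.

Lemma zono_string xi a xi0 v (j : int) : wall Phi xi a xi0 -> zono (v + coroot a *~ j) ->
  dot xi0 v = Hz xi0 -> exists2 l : R, 0 <= l <= (m a)%:R & v = rv xi - (l + j%:~R) *: coroot a.
Proof.
move=> hw hz hv; have [_ aP _ xi0a _] := hw.
have hv' : dot xi0 (v + coroot a *~ j) = Hz xi0.
  by rewrite dot_string.
have [l hl e] := zono_face Phi_root m_inv hw hz hv'.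
exists l => //; rewrite scalerDl opprD addrA -e scaler_int addrK //.
Qed.

(** A string of length at least m_a fits into an edge of length m_a only by filling it, so v is an
    integral number of steps from the vertex. *)
Lemma face_int xi a xi0 mu y v : wall Phi xi a xi0 -> y != 0 ->
  nonres lq (msupp mu) y a -> Eat (m a) y mu a ->
  (forall p, cf mu p != 0 -> zono p) -> dot xi0 v = Hz xi0 -> cf mu v != 0 ->
  exists2 j : nat, (j <= m a)%N & v = rv xi - j%:R *: coroot a.
Proof.
move=> hw y0 hn hE hz hv cv; have [_ aP _ xi0a _] := hw.
have [j1 [j2 [h1 h2 h3]]] := Eat_node q_log q_nroot Phi_root aP y0 hn hE cv.
have [l1 hl1 e1] := zono_string hw (hz _ h1) hv.
have [l2 hl2 e2] := zono_string hw (hz _ h2) hv.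
have [l0 hl0 e0] : exists2 l : R, 0 <= l <= (m a)%:R & v = rv xi - (l + (0 : int)%:~R) *: coroot a.
  by apply: (zono_string hw) => //; rewrite mulr0z addr0; apply: hz.
have inj (s t : R) : rv xi - s *: coroot a = rv xi - t *: coroot a -> s = t.
  move=> /addrI /oppr_inj /eqP; rewrite -subr_eq0 -scalerBl scaler_eq0.
  by rewrite (negbTE (coroot_neq0 Phi_root aP)) orbF subr_eq0 => /eqP.
have e12 : l1 + j1%:~R = l2 + j2%:~R by apply: inj; rewrite -e1 -e2.
have e01 : l0 = l1 + j1%:~R by apply: inj; rewrite -e1 e0 addr0.
have h3' : j2%:~R + (m a)%:R <= (j1%:~R : R).
  by rewrite -(ler_int R) intrD -pmulrn in h3.
have l10 : l1 = 0 by move: hl1 hl2 e12 h3' => /andP[? ?] /andP[? ?]; lra.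
rewrite l10 add0r in e01.
have j10 : 0 <= j1 by rewrite -(ler_int R) -e01; case/andP: hl0.
case: j1 j10 e01 {e1 h1 h3 e12 h3'} => // j _ e01.
exists j; first by move: hl0; rewrite e01 -pmulrn ler_nat => /andP[].
by rewrite e0 addr0 e01.
Qed.

Lemma lat_face xi a xi0 (j : nat) : wall Phi xi a xi0 -> lat Phi (rv xi - j%:R *: coroot a).
Proof.
move=> [hxi aP _ _ _]; apply: latB; first exact: rv_lat.
by rewrite scaler_nat pmulrn; apply: latMz; apply: lat_coroot.
Qed.

Lemma face_zono xi a xi0 (j : nat) : wall Phi xi a xi0 -> (j <= m a)%N ->
  zono (rv xi - j%:R *: coroot a).
Proof.
move=> hw jm; have [hxi aP xa _ _] := hw.
(* With the normalization 1/4, moving by j along -a^vee changes the coefficients at a and at -a by 2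
   j each, in opposite directions. *)
exists (fun b => (m b)%:R * Num.sg (dot xi b) - (if b == a then 2 * j%:R else 0)
   + (if b == - a then 2 * j%:R else 0)); split.
  move=> b bP; case: eqP => [->|_].
    have aNa : a != - a.
      by apply/eqP => h; have := xa; rewrite h dotNr oppr_gt0 ltNge ltW.
    rewrite (negbTE aNa) gtr0_sg // mulr1 addr0 ler_norml.
    have := jm; rewrite -(ler_nat R) => h; have := ler0n R j.
    by move=> h0; apply/andP; split; lra.
  case: eqP => [->|_].
    rewrite dotNr sgrN gtr0_sg // mulrN1 subr0 (mN Phi_root m_inv) // ler_norml.
    have := jm; rewrite -(ler_nat R) => h; have := ler0n R j.
    by move=> h0; apply/andP; split; lra.
  rewrite subr0 addr0 normrM normr_nat normr_sg -[leRHS]mulr1 ler_wpM2l //.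
  by case: (_ != 0).
rewrite /Submission.rv.
under [in RHS]eq_bigr do rewrite scalerDl scalerBl.
rewrite big_split sumrB /= scalerDr scalerBr -addrA; congr (_ + _).
rewrite (bigD1_seq a) ?fset_uniq //= eqxx big1 ?addr0; last first.
  by move=> b /negbTE ->; rewrite scale0r.
rewrite (bigD1_seq (- a)) ?fset_uniq ?(neg_root Phi_root) //= eqxx big1 ?addr0; last first.
  by move=> b /negbTE ->; rewrite scale0r.
rewrite corootN; move: (coroot a) => ca; rewrite scalerN scalerN -opprD -scalerDr -scalerDl.
by rewrite scalerA; congr (- (_ *: _)); field.
Qed.

End RankOne.

Lemma sum_two (T : eqType) (M : nmodType) (s : seq T) (i j : T) (G : T -> M) : uniq s ->
  i \in s -> j \in s -> i != j ->
  (forall k, k \in s -> k != i -> k != j -> G k = 0) ->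
  \sum_(k <- s) G k = G i + G j.
Proof.
move=> us si sj ij h; rewrite (bigD1_seq i) //=; congr (_ + _).
have jS : j \in [seq k <- s | k != i] by rewrite mem_filter eq_sym ij.
rewrite -big_filter (bigD1_seq j) ?filter_uniq //= big1_seq ?addr0 // => k.
by rewrite mem_filter => /and3P[h1 h2 h3]; apply: h.
Qed.

(** * Coefficients along the edges and at the vertices of N *)

Section Vertices.
Variables (R : realType) (n : nat) (q lq : R[i]) (Phi : {fset 'cV[R]_n}).
Hypotheses (q_log : cexp lq = q) (q_nroot : forall k : nat, (0 < k)%N -> q ^+ k != 1).
Hypotheses (Phi_root : root_system Phi) (Phi_red : reduced Phi).
Local Notation V := 'cV[R]_n.
Local Notation C := R[i].
Local Notation VC := 'cV[R[i]]_n.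
Local Notation qpow := (qpow lq).
Local Notation qbr := (qbr lq).
Implicit Types (a u v : V) (x z : VC) (mu nu : seq (C * V)) (y : C) (S : seq V).

Lemma big_root_weyl (T : Type) (idx : T) (op : Monoid.com_law idx) w (P : pred V) (F : V -> T) :
  weyl Phi w ->
  \big[op/idx]_(a <- Phi | P a) F a = \big[op/idx]_(a <- Phi | P (w *m a)) F (w *m a).
Proof.
move=> hw; rewrite -(big_map (mulmx w) P F); apply: perm_big.
have um : uniq [seq w *m a | a <- Phi].
  by rewrite map_inj_uniq ?fset_uniq // => u v; apply: (weyl_inj Phi_root).
apply: uniq_perm; [exact: fset_uniq | exact: um |].
move=> a; apply/idP/mapP => [aP|[b bP ->]]; last exact: (weyl_root Phi_root).
have [w' [hw' h1 h2]] := weyl_inv Phi_root hw.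
exists (w' *m a); first by apply: (weyl_root Phi_root).
by rewrite mulmxA h1 mul1mx.
Qed.

Variable m : V -> nat.
Hypothesis m_inv : weyl_invariant Phi m.
Local Notation zono := (zono Phi m).
Local Notation Hz := (Hz Phi m).
Local Notation rv := (rv Phi m).
Local Notation yx := (yx lq).
Local Notation Eat := (Eat lq).
Local Notation topc := (topc lq Phi m).
Local Notation hb := (hb lq m).
Local Notation facec := (facec lq m).

(** The pointwise form of a normalized Baker--Akhiezer function, used for m and for m - 1.
    Coefficients are set to 0 outside L, so sums of shifts need no range conditions. *)
Record ba_sol (xi : V) (L : seq V) (c : V -> VC -> C) : Prop := BaSol {
  bs_uniq : uniq L;
  bs_L : forall v, (v \in L) <-> (zono v /\ lat Phi v);
  bs_out : forall v x, v \notin L -> c v x = 0;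
  bs_reg : regular Phi xi;
  bs_E : forall x a, a \in Phi -> Eat (m a) (yx x a) (mk L (c^~ x)) a;
  bs_top : forall x, c (rv xi) x = topc xi x }.

Variables (xi : V) (L : seq V) (c : V -> VC -> C).
Hypothesis bs : ba_sol xi L c.
Local Notation mu x := (mk L (c^~ x)).

Definition good x := forall a, a \in Phi -> nonres lq L (yx x a) a.

Lemma cf_mu x u : cf (mu x) u = c u x.
Proof.
rewrite (cf_mk _ _ (bs_uniq bs)); case: ifP => // /negbT h.
by rewrite (bs_out bs).
Qed.

Lemma c_in x u : c u x != 0 -> u \in L.
Proof. by apply: contraNT => h; rewrite (bs_out bs). Qed.

Lemma c_zono x u : c u x != 0 -> zono u.
Proof. by move/c_in/(bs_L bs)=> []. Qed.

Lemma cf_mu_zono x u : cf (mu x) u != 0 -> zono u.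
Proof. by rewrite cf_mu; apply: c_zono. Qed.

Lemma good_msupp x a : good x -> a \in Phi -> nonres lq (msupp (mu x)) (yx x a) a.
Proof.
move=> h aP u v; rewrite !mem_msupp !cf_mu => /c_in uL /c_in vL.
exact: h.
Qed.

Definition restc xi1 a x := \prod_(b <- Phi | (0 < dot xi1 b) && (b != a))
  \prod_(1 <= j < (m b).+1) qbr (j%:R - dot (toC b) x).

Lemma topc_wall xi1 a x : a \in Phi -> 0 < dot xi1 a ->
  topc xi1 x = restc xi1 a x * \prod_(1 <= j < (m a).+1) qbr (j%:R - dot (toC a) x).
Proof.
move=> aP xa; rewrite /Submission.topc -big_filter (bigD1_seq a) /=; first last.
- by rewrite filter_uniq ?fset_uniq.
- by rewrite mem_filter xa.
by rewrite mulrC big_filter_cond.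
Qed.

Lemma topc_refl xi1 a xi0 x : wall Phi xi1 a xi0 ->
  topc (refl a *m xi1) x =
  restc xi1 a x * \prod_(1 <= j < (m a).+1) qbr (j%:R + dot (toC a) x).
Proof.
move=> hw; have [hxi1 aP xa _ _] := hw.
have sa := wall_sign_a Phi_root hw.
have sa1 : dot (refl a *m xi1) a < 0 by rewrite -sgr_cp0 sa.
rewrite (@topc_wall _ (- a)) ?(neg_root Phi_root) ?dotNr ?oppr_gt0 //.
rewrite (mN Phi_root m_inv) //; congr (_ * _); last first.
  by apply: eq_bigr => j _; rewrite toCN dotNl opprK.
rewrite /restc big_seq_cond [RHS]big_seq_cond; apply: eq_bigl => b.
case bP: (b \in _) => //=.
have [->|b1] := eqVneq b a; first by rewrite andbF ltNge ltW.
have [->|b2] := eqVneq b (- a).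
  by rewrite andbF dotNr oppr_gt0 [RHS]andbT; apply/esym/negbTE; rewrite -leNgt ltW.
have := wall_sign Phi_root hw bP b1 b2.
by rewrite !andbT -!sgr_cp0 => ->.
Qed.

(* The coefficient at [rv xi1 - j a^vee], on an edge of N of direction a^vee. *)
Definition facefun xi1 a (j : nat) x := if j == 0%N then topc xi1 x else
  restc xi1 a x * (-1) ^+ m a * facec a j * (\prod_(0 <= i < j) hb a x i) *
  (\prod_((m a + j).+1 <= i < (m a + m a).+1) hb a x i).

(** Only m_a + 1 points of the line through the edge can carry a coefficient. A polynomial of degree
    m_a - 1 vanishing at all but two of them leaves a relation between the coefficients at the
    vertex and at distance j, solved by [rank1_algebra]. *)
Lemma face_coef xi1 a xi0 x (j : nat) : good x -> wall Phi xi1 a xi0 ->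
  c (rv xi1) x = topc xi1 x -> (j <= m a)%N ->
  c (rv xi1 - j%:R *: coroot a) x = facefun xi1 a j x.
Proof.
move=> gx hw ctop jm; have [hxi1 aP xa xi0a _] := hw.
rewrite /facefun; case: eqP => [->|/eqP j0]; first by rewrite scale0r subr0.
have j1 : (1 <= j)%N by rewrite lt0n.
set mm := m a in jm *; set U := dot (toC a) x.
pose p (i : nat) := rv xi1 - i%:R *: coroot a.
have pL i : (i <= mm)%N -> p i \in L.
  move=> im; apply/(bs_L bs); split; first exact: (face_zono Phi_root m_inv hw).
  exact: (lat_face Phi_root Phi_red m_inv i hw).
pose b u := bb lq (yx x a) a u.
pose wd (i : nat) : C := U + mm%:R - (2 * i)%:R.
have bp i : b (p i) = qpow (wd i).
  rewrite /b /bb /Submission.yx -qpowD; congr Defs.qpow.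
  rewrite /p /wd -/U -addrA; congr (_ + _).
  rewrite dotC dotBl (rv_wall_dot Phi_root m_inv hw) dotZl (coroot_dot Phi_root) //.
  by rewrite rmorphB rmorphM /= !rmorph_nat mulrC -natrM.
have bbp i k : b (p i) * b (p k) = qpow (2 * (U + mm%:R - (i + k)%:R)).
  rewrite !bp -qpowD; congr Defs.qpow; rewrite /wd !natrM natrD; ring.
have hbn i k : (i <= mm)%N -> (k <= mm)%N -> hb a x (i + k) != 0.
  move=> im km; rewrite /Submission.hb qbr_eq0 -/U -/mm -bbp.
  exact: (gx a aP _ _ (pL i im) (pL k km)).
pose X u := b u + (b u)^-1.
have Xdiff i k : X (p k) - X (p i) = hb a x (i + k) * qbr (i%:R - k%:R).
  rewrite qbr_mul /X !bp !qpowN /hb -/U -/mm /wd natrD !natrM.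
  congr (_ + _^-1 - (_ + _^-1)); congr Defs.qpow; ring.
have p_inj : injective p.
  move=> i k /addrI /oppr_inj /eqP; rewrite -subr_eq0 -scalerBl scaler_eq0.
  by rewrite (negbTE (coroot_neq0 Phi_root aP)) orbF subr_eq0 eqr_nat => /eqP.
pose F (u : V) : C := `[< exists k : int, u = rv xi1 + coroot a *~ k >]%:R.
have pF : invariant_by (coroot a) F.
  move=> u; rewrite /F; congr (nat_of_bool _)%:R; apply/asboolP/asboolP => -[k hk].
    by exists (k - 1); rewrite mulrzBr mulr1z addrA -hk addrK.
  by exists (k + 1); rewrite mulrzDr mulr1z addrA -hk.
have Fp i : F (p i) = 1.
  rewrite /F; suff -> : `[< exists k : int, p i = rv xi1 + coroot a *~ k >] by [].
  apply/asboolP; exists (- i%:Z).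
  by rewrite /p scaler_nat mulrNz pmulrn.
pose Q := \prod_(1 <= i < mm.+1 | i != j) ('X - (X (p i))%:P).
have sQ : (size Q <= mm)%N.
  rewrite /Q -big_filter size_prod_XsubC size_filter.
  have := count_predC (fun i => i != j) (index_iota 1 mm.+1).
  rewrite size_iota subn1 /= => cnt; rewrite -[leqRHS]cnt.
  rewrite -[leqLHS]addn1 leq_add2l -has_count; apply/hasP; exists j; last by rewrite /= negbK.
  by rewrite mem_index_iota j1 ltnS.
have hk := Eat_kills (yx_neq0 lq x a) (bs_E bs x aP) pF sQ.
have us : uniq [seq p i | i <- iota 0 mm.+1] by rewrite map_inj_uniq ?iota_uniq.
rewrite (ev_on us) in hk; last first.
  move=> u hu; apply: contraNeq; rewrite /F => hF.
  have {hF} : `[< exists k : int, u = rv xi1 + coroot a *~ k >].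
    by move: hF; case: (asbool _); rewrite ?mulr0 ?eqxx.
  move/asboolP => [k uk].
  have hz : dot xi0 (rv xi1) = Hz xi0.
    apply: (dot_rv Phi_root) => b' b'P x0.
    have [_ _ _ _ hb'] := hw.
    have b1 : b' != a by apply: contraNneq x0 => ->; rewrite xi0a.
    have b2 : b' != - a by apply: contraNneq x0 => ->; rewrite dotNr xi0a oppr0.
    have [h1 h2] := hb' b' b'P b1 b2.
    by apply: sgr_eq => //; apply: hxi1.
  have hzu : dot xi0 u = Hz xi0.
    by rewrite uk (dot_string Phi_root).
  have [i im ui] := face_int q_log q_nroot Phi_root m_inv hw (yx_neq0 lq x a)
     (good_msupp gx aP) (bs_E bs x aP) (@cf_mu_zono x) hzu hu.
  apply/mapP; exists i => //; by rewrite mem_iota.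
move: hk; rewrite big_map (sum_two (i := 0%N) (j := j)) ?iota_uniq ?mem_iota //; last first.
- move=> i iI i0 ij.
  have iL : i \in [seq i <- index_iota 1 mm.+1 | i != j].
    by move: iI; rewrite mem_filter ij mem_index_iota (mem_iota 0 mm.+1) /=; lia.
  rewrite /Q -big_filter horner_prod (big_rem i iL) /= hornerXsubC subrr.
  by rewrite mul0r mulr0 mul0r mulr0.
- by rewrite eq_sym.
rewrite !Fp !mulr1 !cf_mu {1}/p scale0r subr0 ctop (topc_wall x aP xa) -/mm => hk.
have Qp k : Q.[X (p k)] = (\prod_(1 <= i < mm.+1 | i != j) hb a x (i + k)) *
    (\prod_(1 <= i < mm.+1 | i != j) qbr (i%:R - k%:R)).
  rewrite /Q horner_prod -big_split; apply: eq_bigr => i _ /=.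
  by rewrite hornerXsubC Xdiff.
have eb k : b (p k) - (b (p k))^-1 = hb a x (k + k).
  rewrite bp -qpowN /hb /Defs.qbr -/U -/mm /wd natrD natrM.
  by congr (_ - _); congr Defs.qpow; ring.
have := @rank1_algebra _ (hb a x) mm j (c (p j) x) (topc xi1 x)
  (restc xi1 a x * (-1) ^+ mm) (\prod_(1 <= i < mm.+1 | i != j) qbr (i%:R - j%:R))
  (\prod_(1 <= i < mm.+1 | i != j) qbr i%:R).
rewrite j1 jm /p => ->; rewrite ?mulrA //.
- move=> i /andP[h1 h2]; rewrite -(subnKC (ltnW h1)) addnC; apply: hbn => //; lia.
- rewrite prodf_seq_neq0; apply/allP => i _; apply/implyP => ij.
  have -> : (i%:R - j%:R : C) = (i%:Z - j%:Z)%:~R by rewrite intrB.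
  by apply: (qbr_int_neq0 q_log q_nroot); lia.
- have eA : \prod_(0 <= i < mm.+1 | i != j) hb a x i =
      hb a x (0 + 0) * \prod_(1 <= i < mm.+1 | i != j) hb a x (i + 0).
    rewrite big_mkcond big_ltn //= [in if _ then _ else _]eq_sym j0 -big_mkcond.
    by congr (_ * _); apply: eq_bigr => i _; rewrite addn0.
  have eB : \prod_(1 <= i < mm.+1 | i != j) qbr (i%:R - 0%:R) =
      \prod_(1 <= i < mm.+1 | i != j) qbr i%:R.
    by apply: eq_bigr => i _; rewrite subr0.
  have eC : \prod_(j.+1 <= i < (mm + j).+1) hb a x i =
      hb a x (j + j) * \prod_(1 <= i < mm.+1 | i != j) hb a x (i + j).
    rewrite -[j.+1]add1n -addSn big_addn addnK.
    by rewrite (bigD1_seq j) ?iota_uniq //= mem_index_iota j1 ltnS.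
  move: hk; rewrite -/(b (p 0%N)) -/(b (p j)) !eb !Qp eB (topc_wall x aP xa) -/mm => hk.
  rewrite eA eC -[RHS]hk; ring.
rewrite (topc_wall x aP xa) -/mm -mulrA; congr (_ * _).
have -> : (-1) ^+ mm = \prod_(1 <= i < mm.+1) (-1 : C).
  by rewrite prodr_const_nat subn1.
have -> : \prod_(mm.+1 <= i < (mm + mm).+1) hb a x i =
    \prod_(1 <= i < mm.+1) hb a x (i + mm).
  change (\prod_(1 + mm <= i < mm.+1 + mm) hb a x i =
    \prod_(1 <= i < mm.+1) hb a x (i + mm)).
  by rewrite big_addn addnK.
rewrite -big_split; apply: eq_bigr => i _ /=.
rewrite mulN1r -qbrN /Submission.hb -/U -/mm natrD; congr Defs.qbr; ring.
Qed.

(** For j = m_a the two products agree after the reversal of i to m_a - i, up to the sign of each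
    bracket. *)
Lemma facec_last a : m a != 0%N -> (-1) ^+ m a * facec a (m a) = 1.
Proof.
move=> m0; set mm := m a in m0 *.
rewrite /Submission.facec -/mm.
have drop_last (f : nat -> C) : \prod_(1 <= i < mm.+1 | i != mm) f i = \prod_(1 <= i < mm) f i.
  rewrite big_mkcond big_nat_recr ?lt0n //= eqxx mulr1.
  rewrite big_nat_cond [RHS]big_nat_cond; apply: eq_bigr => i.
  by rewrite andbT => /andP[_ im]; rewrite neq_ltn im.
rewrite !drop_last.
have -> : \prod_(1 <= i < mm) qbr (i%:R - mm%:R) =
    (-1) ^+ (mm - 1) * \prod_(1 <= i < mm) qbr i%:R.
  rewrite [in RHS]big_nat_rev -prodr_const_nat -big_split big_nat_cond [RHS]big_nat_cond.
  apply: eq_bigr => i; rewrite andbT => /andP[i1 im] /=.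
  rewrite mulN1r -qbrN; congr Defs.qbr.
  by rewrite add1n subSS natrB ?opprB // ltnW.
have P0 : \prod_(1 <= i < mm) qbr i%:R != 0.
  rewrite big_nat_cond prodf_seq_neq0; apply/allP => i _; apply/implyP.
  by rewrite andbT => /andP[i1 _]; rewrite pmulrn (qbr_int_neq0 q_log q_nroot) //; lia.
have mE : mm = (mm - 1).+1 by lia.
rewrite {1}mE exprS; set s := (-1) ^+ _; set P := \prod_(1 <= i < mm) _ in P0 *.
have s0 : s != 0 by rewrite expf_neq0 // oppr_eq0 oner_eq0.
by field; rewrite s0 P0.
Qed.

(** Neighbouring vertices are the ends of an edge, so [face_coef] at j = m_a carries the
    normalization from chamber to chamber. *)
Lemma good_vertex x xi1 : good x -> regular Phi xi1 -> c (rv xi1) x = topc xi1 x.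
Proof.
move=> gx h1.
apply: (chamber_walk Phi_root Phi_red (Pr := fun t : V => c (rv t) x = topc t x) _ _ (bs_reg bs) h1).
- move=> z z' hz hz' sc; rewrite (rv_same m hz hz' sc) => ->.
  rewrite /Submission.topc big_seq_cond [RHS]big_seq_cond; apply: eq_bigl => a.
  by case aP: (a \in _) => //=; rewrite sc.
- move=> z a z0 hw hz; rewrite (rv_wall Phi_root m_inv hw).
  rewrite (face_coef gx hw hz (leqnn _)) (topc_refl _ hw) /facefun.
  have [_ aP xa _ _] := hw.
  case: eqP => [m0|/eqP m0]; first by rewrite (topc_wall _ aP xa) m0 !big_geq.
  have := facec_last m0; move: (facec a (m a)) => fc; set mm := m a in m0 * => hfc.
  rewrite [X in _ * X]big_geq // mulr1 -!mulrA; congr (_ * _).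
  have e1 : \prod_(0 <= i < mm) hb a x i = \prod_(1 <= i < mm.+1) qbr (i%:R + dot (toC a) x).
    rewrite big_nat_rev.
    rewrite -[RHS]/(\prod_(0 + 1 <= i < mm.+1) qbr (i%:R + dot (toC a) x)).
    rewrite [RHS]big_addn subn1 /=.
    rewrite big_nat_cond [RHS]big_nat_cond; apply: eq_bigr => i; rewrite andbT => /andP[_ im].
    rewrite /Submission.hb -/mm add0n; congr Defs.qbr.
    by rewrite natrB // addn1 -natr1; ring.
  rewrite e1.
  by rewrite mulrA hfc mul1r.
exact: (bs_top bs).
Qed.

End Vertices.

(** * Uniqueness, symmetry and support of the coefficients *)

Section Solutions.
Variables (R : realType) (n : nat) (q lq : R[i]) (Phi : {fset 'cV[R]_n}).
Hypotheses (q_log : cexp lq = q) (q_nroot : forall k : nat, (0 < k)%N -> q ^+ k != 1).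
Hypotheses (Phi_root : root_system Phi) (Phi_red : reduced Phi).
Local Notation V := 'cV[R]_n.
Local Notation C := R[i].
Local Notation VC := 'cV[R[i]]_n.
Local Notation qpow := (qpow lq).
Implicit Types (a u v : V) (x z : VC) (mu nu : seq (C * V)) (y : C) (S : seq V).

Variable m : V -> nat.
Hypothesis m_inv : weyl_invariant Phi m.
Local Notation zono := (zono Phi m).
Local Notation Hz := (Hz Phi m).
Local Notation rv := (rv Phi m).
Local Notation yx := (yx lq).
Local Notation Eat := (Eat lq).
Local Notation topc := (topc lq Phi m).

(** On the exponential of frequency u, moving z by s a / 2 and by -s a / 2 gives factors b^s and
    b^-s with b = q^(a, x + u); [char_extract] then trades the points z for periodic functions. N
    contains finitely many lattice points because it is bounded. *)
Lemma ba_data xi Phip (psi : VC -> VC -> C) : regular Phi xi ->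
  (forall a, (a \in Phip) = (a \in Phi) && (0 < dot xi a)) ->
  baker_akhiezer lq Phi Phip m psi ->
  exists L c, ba_sol lq Phi m xi L c /\
    forall x z, psi x z = ev (mk L (c^~ x)) (fun u => qpow (2 * dot (x + toC u) z)).
Proof.
move=> hxi hp [c0 [hpsi hqi htop]].
set A := ba_polytope Phip m `&` coweight_lattice Phi in hpsi.
have AE v : A v <-> zono v /\ lat Phi v.
  by rewrite /A (ba_zono Phi_root hxi hp m_inv).
have Afin : finite_set A.
  apply: (@sub_finite_set _ _ [set v | lat Phi v /\ forall a, a \in Phi ->
     `|dot v a| <= \sum_(a <- Phi) `|Hz a|]); last exact: lattice_finite.
  move=> v /AE[hz hv]; split => // a aP.
  have : `|dot v a| <= `|Hz a|.
    rewrite ler_norml dotC; apply/andP; split.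
      apply: le_trans (zono_ge a hz); rewrite lerN2; exact: ler_norm.
    by apply: le_trans (zono_le a hz) _; apply: ler_norm.
  move=> h; apply: le_trans h _; rewrite (bigD1_seq a) ?fset_uniq //=.
  by rewrite lerDl sumr_ge0.
have [L [uL hL]] := finite_enum Afin.
pose c v x := if v \in L then c0 v x else 0.
have psiE x z : psi x z = ev (mk L (c^~ x)) (fun u => qpow (2 * dot (x + toC u) z)).
  rewrite hpsi fsbig_finite // ev_mk mulr_sumr.
  rewrite (perm_big L) /=; last first.
    apply: uniq_perm => //; first exact: fset_uniq.
    move=> v; apply/idP/idP; rewrite in_fset_set // inE => /hL //.
  rewrite big_seq [RHS]big_seq; apply: eq_bigr => u uL'.
  by rewrite /c uL' dotDl mulrDr qpowD mulrCA.
exists L, c; split => //; split => //.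
- by move=> v; rewrite hL AE.
- by move=> v x; rewrite /c => /negbTE ->.
- move=> x a aP F s pF hs; rewrite ev_mk.
  under eq_bigr do rewrite mulrA.
  apply: (char_extract q_log q_nroot Phi_root aP _ _ pF).
    by move=> u /hL /AE[].
  move=> z hz.
  have := hqi a s x z aP hs hz; rewrite !psiE !ev_mk => /eqP.
  rewrite -subr_eq0 -sumrB.
  under eq_bigr => u _.
    have -> : c u x * qpow (2 * dot (x + toC u) (z + s%:R / 2 *: toC a)) -
       c u x * qpow (2 * dot (x + toC u) (z - s%:R / 2 *: toC a)) =
       qpow (2 * dot x z) * (c u x * (bb lq (yx x a) a u ^+ s - bb lq (yx x a) a u ^- s) *
         qpow (2 * dot (toC u) z)).
      have -> : bb lq (yx x a) a u = qpow (dot (x + toC u) (toC a)).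
        rewrite /bb /Submission.yx -qpowD dotDl dot_toC (dotC x); congr (Defs.qpow _ (_ + _%:C)).
        by rewrite dotC.
      rewrite -exprVn -qpowN -!qpow_natl dotDr dotBr dotZr !mulrDr !qpowD.
      rewrite (_ : 2 * (s%:R / 2 * dot (x + toC u) (toC a)) = s%:R * dot (x + toC u) (toC a)); last first.
        by field.
      rewrite (_ : 2 * - (s%:R / 2 * dot (x + toC u) (toC a)) = s%:R * - dot (x + toC u) (toC a)); last first.
        by field.
      rewrite (dotDl x _ z) mulrDr qpowD; ring.
    over.
  rewrite -mulr_sumr mulf_eq0 (negbTE (qpow_neq0 _ _)) /= => /eqP //.
move=> x; rewrite /c.
have rvA : A (rv xi).
  apply/AE; split; first exact: rv_zono.
  exact: (rv_lat Phi_root Phi_red m_inv).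
have -> : rv xi \in L by apply/hL.
rewrite -(rhov_rv Phi_root hxi hp m_inv) htop.
by rewrite (big_Phip hp) /Submission.topc.
Qed.

Variables (xi : V) (L : seq V) (c : V -> VC -> C).
Hypothesis bs : ba_sol lq Phi m xi L c.
Local Notation mu x := (mk L (c^~ x)).
Local Notation good := (good lq Phi L).

Lemma good_unique x nu : good x -> (forall u, cf nu u != 0 -> u \in L) ->
  (forall a, a \in Phi -> Eat (m a) (yx x a) nu a) -> cf nu (rv xi) = 0 ->
  forall u, cf nu u = 0.
Proof.
move=> gx hL hE; apply: (E_unique q_log q_nroot Phi_root Phi_red m_inv (y := yx x) (bs_reg bs)).
- by move=> a _ _; apply: yx_neq0.
- by move=> a aP _ u v; rewrite !mem_msupp => /hL ? /hL ?; apply: gx.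
- by move=> a aP _; apply: hE.
- by move=> u /hL /(bs_L bs)[].
Qed.

Lemma L_weyl w u : weyl Phi w -> u \in L -> w *m u \in L.
Proof.
move=> hw /(bs_L bs)[h1 h2]; apply/(bs_L bs); split.
  exact: zono_weyl.
exact: lat_weyl.
Qed.

Lemma bb_weyl w x a u : weyl Phi w ->
  bb lq (yx (toC w *m x) (w *m a)) (w *m a) (w *m u) = bb lq (yx x a) a u.
Proof.
move=> hw; rewrite /bb /Submission.yx (dot_weyl Phi_root) //; congr (_ * _).
by rewrite toCM dot_trmx toC_tr mulmxA -toCM (weyl_orth Phi_root hw) toC1 mul1mx.
Qed.

Lemma good_weyl w x : weyl Phi w -> good x -> good (toC w *m x).
Proof.
move=> hw gx a aP u v uL vL.
have [w' [hw' h1 h2]] := weyl_inv Phi_root hw.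
have e (t : V) : t = w *m (w' *m t) by rewrite mulmxA h1 mul1mx.
rewrite (e a) (e u) (e v) (bb_weyl x _ (w' *m u) hw) (bb_weyl x _ (w' *m v) hw).
apply: gx; try exact: L_weyl.
exact: (weyl_root Phi_root).
Qed.

Lemma topc_weyl w xi1 x : weyl Phi w -> topc (w *m xi1) (toC w *m x) = topc xi1 x.
Proof.
move=> hw; rewrite /Submission.topc (big_root_weyl Phi_root _ _ _ hw).
rewrite big_seq_cond [RHS]big_seq_cond.
apply: eq_big => [a|a /andP[aP _]]; first by rewrite (dot_weyl Phi_root).
rewrite m_inv //; apply: eq_bigr => j _; congr (Defs.qbr _ (_ - _)).
by rewrite toCM dot_trmx toC_tr mulmxA -toCM (weyl_orth Phi_root hw) toC1 mul1mx.
Qed.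

(** Transport by w gives another solution at x. Since vertex coefficients are known in every
    chamber, it has the same coefficient at [rv xi], and uniqueness applies. *)
Lemma equivariance w u x : weyl Phi w -> good x -> c (w *m u) (toC w *m x) = c u x.
Proof.
move=> hw gx.
have gwx := good_weyl hw gx.
have [w' [hw' h1 h2]] := weyl_inv Phi_root hw.
pose nu := mk L (fun u => c (w *m u) (toC w *m x)).
have cfnu v : cf nu v = c (w *m v) (toC w *m x).
  rewrite (cf_mk _ _ (bs_uniq bs)); case: ifP => // /negbT h.
  rewrite (bs_out bs) //; apply: contra h => h.
  by rewrite -[v]mul1mx -h2 -mulmxA; apply: L_weyl.
have hE a : a \in Phi -> Eat (m a) (yx x a) nu a.
  move=> aP F s pF hs.
  have waP := weyl_root Phi_root hw aP.
  have pF' : invariant_by (coroot (w *m a)) (fun v => F (w' *m v)).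
    move=> v; rewrite (coroot_weyl Phi_root _ hw) mulmxDr (mulmxA w' w) h2 mul1mx.
    exact: pF.
  have := bs_E bs (toC w *m x) waP pF'; rewrite m_inv // => /(_ s hs) h.
  rewrite -[RHS]h !ev_mk.
  have e : perm_eq L [seq w *m v | v <- L].
    have uw : uniq [seq w *m v | v <- L].
      by rewrite map_inj_uniq ?(bs_uniq bs) // => v1 v2; apply: (weyl_inj Phi_root).
    apply: uniq_perm => //; first exact: (bs_uniq bs).
    move=> v; apply/idP/mapP => [vL|[v' v'L ->]]; last exact: L_weyl.
    by exists (w' *m v); [apply: L_weyl | rewrite mulmxA h1 mul1mx].
  rewrite [RHS](perm_big _ e) big_map; apply: eq_bigr => v _.
  by rewrite (bb_weyl x a v hw) mulmxA h2 mul1mx.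
pose d := nu ++ mZ (-1) (mu x).
have cfd v : cf d v = c (w *m v) (toC w *m x) - c v x.
  by rewrite cf_cat cf_scale cfnu (cf_mu bs) mulN1r.
have : cf d u = 0.
  apply: (good_unique gx).
  - move=> v; rewrite cfd; apply: contraNT => vL.
    have wvL : w *m v \notin L.
      by apply: contra vL => h; rewrite -[v]mul1mx -h2 -mulmxA; apply: L_weyl.
    by rewrite !(bs_out bs) ?subrr.
  - move=> a aP; apply: Eat_cat; first exact: hE.
    by apply: Eat_scale; apply: (bs_E bs).
  - rewrite cfd -(rv_weyl Phi_root m_inv) //.
    rewrite (good_vertex q_log q_nroot Phi_root Phi_red m_inv bs gwx); last first.
      by apply: (regular_weyl Phi_root) => //; apply: (bs_reg bs).
    by rewrite topc_weyl // (bs_top bs) subrr.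
by rewrite cfd => /eqP; rewrite subr_eq0 => /eqP.
Qed.

(** The indicator of a coset of Q^vee is periodic under every coroot, so the part off the coset of
    [rv xi] is a solution by itself, and it vanishes at that vertex. *)
Lemma coset_support u x : good x -> c u x != 0 -> coroot_lattice Phi (u - rv xi).
Proof.
move=> gx; apply: contraNP => hu; apply/eqP.
pose nu := mk L (fun v => if `[< coroot_lattice Phi (v - rv xi) >] then 0 else c v x).
have cfnu v : cf nu v = if `[< coroot_lattice Phi (v - rv xi) >] then 0 else c v x.
  rewrite (cf_mk _ _ (bs_uniq bs)); case: ifP => // /negbT h.
  by rewrite (bs_out bs) // if_same.
have : cf nu u = 0; last first.
  by rewrite cfnu; case: asboolP.
apply: (good_unique gx).
- move=> v; rewrite cfnu; case: asboolP => _; rewrite ?eqxx //.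
  exact: (c_in bs).
- move=> a aP F s pF hs.
  pose F' v : C := if `[< coroot_lattice Phi (v - rv xi) >] then 0 else F v.
  have pF' : invariant_by (coroot a) F'.
    move=> v; rewrite /F' pF; congr (if _ then _ else _).
    have hc := Qv_coroot aP.
    apply/asboolP/asboolP => h.
      by rewrite (_ : v - _ = v + coroot a - rv xi - coroot a); [apply: QvB | rewrite addrAC addrK].
    by rewrite addrAC; apply: QvD.
  rewrite -[RHS](bs_E bs x aP pF' hs) !ev_mk; apply: eq_bigr => v _.
  by rewrite /F'; case: asboolP => _; rewrite ?mul0r ?mulr0.
- by rewrite cfnu; case: asboolP => // h; case: h; rewrite subrr; apply: Qv0.
Qed.

End Solutions.

(** * The value at z = rho does not depend on x *)

Section CramerSolution.
Variables (R : realType) (n : nat) (q lq : R[i]) (Phi : {fset 'cV[R]_n}).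
Hypotheses (q_log : cexp lq = q) (q_nroot : forall k : nat, (0 < k)%N -> q ^+ k != 1).
Hypotheses (Phi_root : root_system Phi) (Phi_red : reduced Phi).
Local Notation V := 'cV[R]_n.
Local Notation C := R[i].
Local Notation VC := 'cV[R[i]]_n.
Local Notation qpow := (qpow lq).
Local Notation qbr := (qbr lq).
Implicit Types (a u v : V) (x z : VC) (mu nu : seq (C * V)) (y : C) (S : seq V).

Variable m : V -> nat.
Hypothesis m_inv : weyl_invariant Phi m.
Local Notation rv := (rv Phi m).
Local Notation yx := (yx lq).
Local Notation topc := (topc lq Phi m).

Variables (xi : V) (L : seq V) (c : V -> VC -> C).
Hypothesis bs : ba_sol lq Phi m xi L c.
Local Notation mu x := (mk L (c^~ x)).
Local Notation good := (good lq Phi L).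

(* Solving the defining equations by Cramer's rule over an algebra Pd of
   functions on X, along a map pt from X to the space of the parameter x. *)
Lemma ba_cramer (X : Type) (pt : X -> VC) (x0 : X) (Pd : (X -> C) -> Prop) :
  (forall d, Pd (fun=> d)) ->
  (forall f g, Pd f -> Pd g -> Pd (fun t => f t + g t)) ->
  (forall f g, Pd f -> Pd g -> Pd (fun t => f t * g t)) ->
  (forall f g, f =1 g -> Pd f -> Pd g) ->
  (forall a d, a \in Phi -> Pd (fun t => qpow (dot (toC a) (pt t) + d))) ->
  good (pt x0) ->
  exists D N, [/\ Pd D, forall u, Pd (N u), D x0 != 0 &
    forall t u, u \in L -> D t * c u (pt t) = N u t].
Proof.
move=> Pc Pa Pm Pe Pk gx.
have Psum := Pd_sum Pc Pa Pe; have Pprod := Pd_prod Pc Pm Pe.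
have Pexp f k : Pd f -> Pd (fun t => f t ^+ k).
  move=> hf; elim: k => [|k IH]; first exact: Pe (fun t => esym (expr0 _)) (Pc 1).
  exact: Pe (fun t => esym (exprS _ _)) (Pm _ _ hf IH).
have Pqbr a (d : C) : a \in Phi -> Pd (fun t => qbr (d - dot (toC a) (pt t))).
  move=> aP; have aP' := neg_root Phi_root aP.
  apply: Pe (Pa _ _ (Pk (- a) d aP') (Pm _ _ (Pc (-1)) (Pk a (- d) aP))) => t.
  by rewrite /Defs.qbr toCN dotNl mulN1r opprB; congr (Defs.qpow _ _ - Defs.qpow _ _); rewrite addrC.
pose r := size L.
pose Lj (j : 'I_r) : V := tnth (in_tuple L) j.
(* One equation for the normalization and one for each root, exponent and periodic function;
   inadmissible triples give 0 = 0. *)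
pose I := (unit + (V * nat * (V -> C)))%type.
pose valid (i : V * nat * (V -> C)) := `[< [/\ i.1.1 \in Phi,
   (1 <= i.1.2 <= m i.1.1)%N & invariant_by (coroot i.1.1) i.2] >].
pose A (i : I) (j : 'I_r) (t : X) : C := match i with
  | inl _ => (Lj j == rv xi)%:R
  | inr p => if valid p then
     (bb lq (yx (pt t) p.1.1) p.1.1 (Lj j) ^+ p.1.2 -
      bb lq (yx (pt t) p.1.1) p.1.1 (Lj j) ^- p.1.2) * p.2 (Lj j) else 0 end.
pose bv (i : I) (t : X) : C := if i is inl _ then topc xi (pt t) else 0.
pose mu' (d : 'I_r -> C) := [seq (d j, Lj j) | j <- index_enum 'I_r].
have Lj_inj : injective Lj.
  by move=> i j; apply: (tuple_uniqP (in_tuple L) (bs_uniq bs)).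
have evmu' d F : ev (mu' d) F = \sum_j d j * F (Lj j) by rewrite /ev big_map.
have cfmu' d j : cf (mu' d) (Lj j) = d j.
  rewrite /cf evmu' (bigD1 j) //= eqxx mulr1 big1 ?addr0 // => k kj.
  by rewrite (inj_eq Lj_inj) (negbTE kj) mulr0.
have [i j|i|d hd j|D [N [hD hN D0 hDN]]] := @cramer C I r X A bv x0 Pd Pc Pa Pm Pe.
- case: i => [u0|[[a s] F]] /=; first exact: Pc.
  have [hv|hv] := boolP (valid (a, s, F)); last first.
    by apply: Pe (Pc 0) => t; rewrite /A (negbTE hv).
  have /asboolP[/= aP _ _] := hv.
  have aP' := neg_root Phi_root aP.
  have e1 : Pd (fun t => bb lq (yx (pt t) a) a (Lj j) ^+ s).
    apply: Pexp; apply: Pe (Pk a (dot a (Lj j))%:C aP) => t.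
    by rewrite /bb /Submission.yx qpowD.
  have e2 : Pd (fun t => bb lq (yx (pt t) a) a (Lj j) ^- s).
    apply: Pe (Pexp _ s (Pk (- a) (- (dot a (Lj j))%:C) aP')) => t.
    by rewrite /bb /Submission.yx -exprVn -qpowD -qpowN toCN dotNl opprD.
  apply: Pe (Pm _ _ (Pa _ _ e1 (Pm _ _ (Pc (-1)) e2)) (Pc (F (Lj j)))) => t.
  by rewrite /A hv mulN1r.
- case: i => [u0|p]; last exact: Pc.
  rewrite /bv; pose G a t := if (a \in Phi) && (0 < dot xi a) then
    \prod_(1 <= j < (m a).+1) qbr (j%:R - dot (toC a) (pt t)) else 1.
  have hG a : Pd (G a).
    have [h|h] := boolP ((a \in Phi) && (0 < dot xi a)); last first.
      by apply: Pe (Pc 1) => t; rewrite /G (negbTE h).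
    have /andP[aP _] := h.
    have hp := Pprod _ (index_iota 1 (m a).+1) xpredT _ (fun j => Pqbr a j%:R aP).
    by apply: Pe hp => t; rewrite /G h.
  apply: Pe (Pprod _ Phi xpredT G hG) => t.
  rewrite /Submission.topc [RHS]big_mkcond !big_seq; apply: eq_bigr => a aP.
  by rewrite /G aP.
- have Lj_onto u : u \in L -> exists j, Lj j = u.
    by move=> /(tnthP (in_tuple L))[i ->]; exists i.
  rewrite -cfmu'; apply: (good_unique q_log q_nroot Phi_root Phi_red m_inv bs gx).
  + move=> u /cf_in /mapP[p /mapP[k _ ->] ->] /=.
    exact: (mem_tnth k (in_tuple L)).
  + move=> a aP F s pF hs; rewrite evmu'.
    have := hd (inr (a, s, F)); rewrite /A /=.
    have -> : valid (a, s, F) by apply/asboolP.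
    by move=> h; rewrite -[RHS]h; apply: eq_bigr => k _; rewrite mulrC.
  + have := hd (inl tt); rewrite /A /= => h; rewrite -[RHS]h /cf evmu'.
    by apply: eq_bigr => k _; rewrite mulrC.
pose jof u : option 'I_r := [pick j | Lj j == u].
exists D, (fun u t => if jof u is Some j then N j t else 0); split => //.
  by move=> u; case: (jof u) => [j|]; [apply: hN | apply: Pc].
move=> t u uL; rewrite /jof; case: pickP => [j /eqP ju|h]; last first.
  by have /(tnthP (in_tuple L))[i iu] := uL; have := h i; rewrite /Lj -iu eqxx.
rewrite -ju -(hDN t (fun k => c (Lj k) (pt t))) //.
case=> [u0|[[a s] F]] /=.
  rewrite /bv -(bs_top bs).
  have /(tnthP (in_tuple L))[i iu] : rv xi \in L.
    apply/(bs_L bs); split; first exact: rv_zono.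
    exact: (rv_lat Phi_root Phi_red m_inv (bs_reg bs)).
  rewrite (bigD1 i) //= /A /Lj -iu eqxx mul1r big1 ?addr0 // => k ki.
  by rewrite iu (inj_eq Lj_inj) (negbTE ki) mul0r.
rewrite /A; case hv: (valid _); last by rewrite big1 // => k _; rewrite mul0r.
have /asboolP[/= aP hs pF] := hv.
have := bs_E bs (pt t) aP pF hs; rewrite ev_mk => h; rewrite -[RHS]h.
rewrite [RHS]big_tnth; apply: eq_bigr => k _.
by rewrite mulrC.
Qed.

End CramerSolution.

(** * Restriction to a line of lattice points *)

Section LaurentLine.
Variables (R : realType) (n : nat) (q lq : R[i]) (Phi : {fset 'cV[R]_n}).
Hypotheses (q_log : cexp lq = q) (q_nroot : forall k : nat, (0 < k)%N -> q ^+ k != 1).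
Hypotheses (Phi_root : root_system Phi) (Phi_red : reduced Phi).
Local Notation V := 'cV[R]_n.
Local Notation C := R[i].
Local Notation VC := 'cV[R[i]]_n.
Local Notation qpow := (qpow lq).
Implicit Types (a u v : V) (x z : VC) (mu nu : seq (C * V)) (y : C) (S : seq V).

Variable m : V -> nat.
Hypothesis m_inv : weyl_invariant Phi m.
Local Notation yx := (yx lq).
Local Notation Eat := (Eat lq).

Variables (xi : V) (L : seq V) (c : V -> VC -> C).
Hypothesis bs : ba_sol lq Phi m xi L c.
Local Notation mu x := (mk L (c^~ x)).
Local Notation good := (good lq Phi L).

(** The q^k are infinitely many points because q is not a root of unity, and G Q vanishes at all of
    them. *)
Lemma poly_id (G Q : {poly C}) : G != 0 ->
  (forall k, G.[q ^+ k] != 0 -> Q.[q ^+ k] = 0) -> Q = 0.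
Proof.
move=> G0 h; have GQ : G * Q = 0.
  apply/eqP; apply: contraT => GQ0.
  pose rs := [seq q ^+ k | k <- iota 0 (size (G * Q))].
  have : (size rs < size (G * Q)%R)%N.
    apply: max_poly_roots => //.
      apply/allP => w /mapP[k _ ->]; rewrite rootE hornerM mulf_eq0.
      by apply/orP; have [e|/h e] := eqVneq (G.[q ^+ k]) 0; [left | right]; apply/eqP.
    by rewrite map_inj_uniq ?iota_uniq // => i j; apply: (q_inj q_log q_nroot).
  by rewrite size_map size_iota ltnn.
by move/eqP: GQ; rewrite mulf_eq0 (negbTE G0) => /eqP.
Qed.

(* Laurent polynomials in T, evaluated at T = q^k. *)
Definition laurent (F : nat -> C) := exists N (P : {poly C}),
  forall k, F k * (q ^+ k) ^+ N = P.[q ^+ k].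

Lemma laurent_cst d : laurent (fun=> d).
Proof. by exists 0%N, d%:P => k; rewrite expr0 mulr1 hornerC. Qed.

Lemma laurent_ext F G : F =1 G -> laurent F -> laurent G.
Proof. by move=> e [N [P h]]; exists N, P => k; rewrite -e. Qed.

Lemma laurentD F G : laurent F -> laurent G -> laurent (fun k => F k + G k).
Proof.
move=> [N [P h]] [N' [P' h']]; exists (N + N')%N, (P * 'X^N' + P' * 'X^N) => k.
rewrite hornerD !hornerM !hornerXn -h -h' exprD; ring.
Qed.

Lemma laurentM F G : laurent F -> laurent G -> laurent (fun k => F k * G k).
Proof.
move=> [N [P h]] [N' [P' h']]; exists (N + N')%N, (P * P') => k.
rewrite hornerM -h -h' exprD; ring.
Qed.

Lemma laurent_nz F : laurent F -> F 0%N != 0 ->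
  exists2 P : {poly C}, P != 0 & forall k, (P.[q ^+ k] != 0) = (F k != 0).
Proof.
move=> [N [P h]] F0; exists P.
  apply: contraNneq F0 => P0; have := h 0%N; rewrite P0 horner0 expr0 expr1n mulr1.
  by move=> ->.
by move=> k; rewrite -h mulf_eq0 expf_eq0 expf_eq0 (negbTE (q_neq0 q_log)) !andbF orbF.
Qed.

Variables (x0 : VC) (v : V).
Hypotheses (v_lat : lat Phi v) (v_reg : regular Phi v).
Hypothesis gx0 : good x0.
(** A resonance of a at T reads b(u1) b(u2) T^(2 i) = 1 with i = (a, v). Taking the power j of this,
    and the power i of the analogue for b, shows that two non-proportional roots are never resonant
    at the same nonzero T. *)
Hypothesis nocoinc : forall a b u1 u2 u3 u4 (i j : nat), a \in Phi -> b \in Phi ->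
  b != a -> b != - a -> dot a v = i%:R -> dot b v = j%:R ->
  u1 \in L -> u2 \in L -> u3 \in L -> u4 \in L -> (0 < i)%N -> (0 < j)%N ->
  (bb lq (yx x0 a) a u1 * bb lq (yx x0 a) a u2) ^+ j !=
  (bb lq (yx x0 b) b u3 * bb lq (yx x0 b) b u4) ^+ i.

Definition pt (k : nat) : VC := x0 + toC (v *+ k).

Definition slope a : nat := absz (Num.floor (dot a v)).

Lemma slopeE a : a \in Phi -> 0 < dot v a -> dot a v = (slope a)%:R.
Proof.
move=> aP va; have /intrP[z hz] := v_lat aP.
rewrite /slope dotC hz intrKfloor.
by rewrite natr_absz ger0_norm // -(ler0z R) -hz ltW.
Qed.

Lemma slope_gt0 a : a \in Phi -> 0 < dot v a -> (0 < slope a)%N.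
Proof. by move=> aP va; rewrite -(ltr_nat R) -slopeE // dotC. Qed.

Lemma laurent_key a d : a \in Phi -> laurent (fun k => qpow (dot (toC a) (pt k) + d)).
Proof.
move=> aP; have /intrP[z hz] := v_lat aP.
have e k : qpow (dot (toC a) (pt k) + d) = qpow (dot (toC a) x0 + d) * qpow (k%:R * z%:~R).
  rewrite -qpowD; congr Defs.qpow; rewrite dotDr dot_toC -scaler_nat dotZr (dotC a v) hz.
  by rewrite rmorphM rmorph_nat rmorph_int addrAC.
case: z {hz} e => p e.
  exists 0%N, (qpow (dot (toC a) x0 + d) *: 'X^p) => k.
  rewrite e expr0 mulr1 hornerZ hornerXn qpow_natl -pmulrn (qpow_nat q_log).
  by rewrite -!exprM mulnC.
exists p.+1, (qpow (dot (toC a) x0 + d))%:P => k.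
rewrite e hornerC NegzE mulrNz qpow_natl qpowN -pmulrn (qpow_nat q_log) -mulrA.
by rewrite exprVn -!exprM (mulnC k) mulVf ?mulr1 // expf_neq0 // (q_neq0 q_log).
Qed.

Lemma yx_pt a k : a \in Phi -> 0 < dot v a ->
  yx (pt k) a = yx x0 a * (q ^+ k) ^+ slope a.
Proof.
move=> aP va; rewrite /Submission.yx dotDr qpowD; congr (_ * _).
rewrite dot_toC -scaler_nat dotZr slopeE // rmorphM !rmorph_nat.
by rewrite qpow_natl (qpow_nat q_log) -!exprM mulnC.
Qed.

Lemma bbM (y y' : C) a u : bb lq (y * y') a u = bb lq y a u * y'.
Proof. by rewrite /bb mulrAC. Qed.

(** The sum in [Eat] along the line, multiplied by the power [s * slope a] of T to become a
    polynomial. *)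
Definition epoly (P : V -> {poly C}) a s (F : V -> C) : {poly C} :=
  \sum_(u <- L) F u *: (P u * ((bb lq (yx x0 a) a u ^+ s) *: 'X^(2 * s * slope a) -
                               (bb lq (yx x0 a) a u ^- s)%:P)).

Lemma epolyE P a s F (T : C) : T != 0 -> (epoly P a s F).[T] = T ^+ (s * slope a) *
  ev (mk L (fun u => (P u).[T]))
    (fun u => (bb lq (yx x0 a * T ^+ slope a) a u ^+ s -
               bb lq (yx x0 a * T ^+ slope a) a u ^- s) * F u).
Proof.
move=> T0; rewrite /epoly horner_sum ev_mk mulr_sumr; apply: eq_bigr => u _.
rewrite hornerZ hornerM hornerD hornerN hornerC hornerZ hornerXn bbM.
set b := bb _ _ _ _; set t := T ^+ (s * slope a).
have b0 : b != 0 by apply: bb_neq0; apply: yx_neq0.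
have t0 : t != 0 by rewrite expf_neq0.
have e1 : (b * T ^+ slope a) ^+ s = b ^+ s * t.
  by rewrite exprMn -exprM (mulnC (slope a)).
have e2 : T ^+ (2 * s * slope a) = t * t.
  by rewrite -exprD addnn -mul2n mulnA.
rewrite e1 e2; set bs' := b ^+ s; have bs0 : bs' != 0 by rewrite expf_neq0.
by field; rewrite t0 bs0.
Qed.

(* Polynomial vectors proportional to c along the line, off the zeros of G. *)
Definition along (G : {poly C}) (P : V -> {poly C}) := forall k, G.[q ^+ k] != 0 ->
  exists d, forall u, u \in L -> (P u).[q ^+ k] = d * c u (pt k).

Lemma epoly0 G P a s F : G != 0 -> along G P -> a \in Phi -> 0 < dot v a ->
  invariant_by (coroot a) F -> (1 <= s <= m a)%N -> epoly P a s F = 0.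
Proof.
move=> G0 hal aP va pF hs; apply: (poly_id G0) => k Gk.
have [d hd] := hal k Gk.
rewrite epolyE ?expf_neq0 ?(q_neq0 q_log) // -yx_pt //.
have h := bs_E bs (pt k) aP pF hs; rewrite ev_mk in h.
apply/eqP; rewrite mulf_eq0; apply/orP; right; apply/eqP.
rewrite -[RHS](mulr0 d) -[in RHS]h mulr_sumr ev_mk !big_seq.
by apply: eq_bigr => u uL; rewrite hd // -mulrA.
Qed.

(** The conditions hold at infinitely many q^k, hence identically in T; the point is that T may then
    be a zero of a denominator. *)
Lemma along_E G P a (T : C) : G != 0 -> along G P -> a \in Phi -> 0 < dot v a -> T != 0 ->
  Eat (m a) (yx x0 a * T ^+ slope a) (mk L (fun u => (P u).[T])) a.
Proof.
move=> G0 hal aP va T0 F s pF hs.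
have := epolyE P a s F T0; rewrite (epoly0 G0 hal aP va pF hs) horner0.
move/esym/eqP; rewrite mulf_eq0 expf_eq0 (negbTE T0) andbF /=.
by move/eqP.
Qed.

Lemma cf_polys (P : V -> C) u : cf (mk L P) u = if u \in L then P u else 0.
Proof. exact: cf_mk (bs_uniq bs). Qed.

Lemma good_laurent : exists2 G : {poly C}, G != 0 &
  forall k, G.[q ^+ k] != 0 <-> good (pt k).
Proof.
pose F k := \prod_(a <- Phi) \prod_(u <- L) \prod_(w <- L)
   (bb lq (yx (pt k) a) a u * bb lq (yx (pt k) a) a w - 1).
have Fgood k : F k != 0 <-> good (pt k).
  rewrite /F prodf_seq_neq0; split.
    move=> /allP h a aP u w uL wL; have := h a aP; rewrite prodf_seq_neq0.
    move=> /allP/(_ u uL); rewrite prodf_seq_neq0 => /allP/(_ w wL).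
    by rewrite subr_eq0.
  move=> h; apply/allP => a aP; rewrite prodf_seq_neq0; apply/allP => u uL.
  rewrite prodf_seq_neq0; apply/allP => w wL; rewrite /= subr_eq0.
  exact: h.
have Lprod := Pd_prod laurent_cst laurentM laurent_ext.
have FL : laurent F.
  pose F' k := \prod_(a <- Phi) if a \in Phi then \prod_(u <- L) \prod_(w <- L)
   (bb lq (yx (pt k) a) a u * bb lq (yx (pt k) a) a w - 1) else 1.
  apply: (@laurent_ext F'); first by move=> k; rewrite /F /F' !big_seq; apply: eq_bigr => a ->.
  apply: (Lprod) => a; have [aP|aP] := boolP (a \in Phi); last exact: laurent_cst.
  apply: (Lprod) => u; apply: (Lprod) => w.
  apply: laurentD; last exact: laurent_cst.
  have lb t : laurent (fun k => bb lq (yx (pt k) a) a t).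
    apply: laurent_ext (laurent_key (dot a t)%:C aP) => k.
    by rewrite qpowD.
  by apply: laurentM.
have pt0 : pt 0 = x0 by rewrite /pt mulr0n toC0 addr0.
have F0 : F 0%N != 0 by apply/Fgood; rewrite pt0.
have [G G0 hG] := laurent_nz FL F0.
by exists G => // k; rewrite hG Fgood.
Qed.

End LaurentLine.

(** * Cancelling denominators along the line *)

Section Denominator.
Variables (R : realType) (n : nat) (q lq : R[i]) (Phi : {fset 'cV[R]_n}).
Hypotheses (q_log : cexp lq = q) (q_nroot : forall k : nat, (0 < k)%N -> q ^+ k != 1).
Hypotheses (Phi_root : root_system Phi) (Phi_red : reduced Phi).
Local Notation V := 'cV[R]_n.
Local Notation C := R[i].
Local Notation VC := 'cV[R[i]]_n.
Local Notation qbr := (qbr lq).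
Implicit Types (a u v : V) (x z : VC) (mu nu : seq (C * V)) (y : C) (S : seq V).

Variable m : V -> nat.
Hypothesis m_inv : weyl_invariant Phi m.
Local Notation Hz := (Hz Phi m).
Local Notation rv := (rv Phi m).
Local Notation yx := (yx lq).
Local Notation topc := (topc lq Phi m).

Variables (xi : V) (L : seq V) (c : V -> VC -> C).
Hypothesis bs : ba_sol lq Phi m xi L c.
Local Notation mu x := (mk L (c^~ x)).
Local Notation good := (good lq Phi L).

Variables (x0 : VC) (v : V).
Hypotheses (v_lat : lat Phi v) (v_reg : regular Phi v).
Hypothesis gx0 : good x0.
Hypothesis nocoinc : forall a b u1 u2 u3 u4 (i j : nat), a \in Phi -> b \in Phi ->
  b != a -> b != - a -> dot a v = i%:R -> dot b v = j%:R ->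
  u1 \in L -> u2 \in L -> u3 \in L -> u4 \in L -> (0 < i)%N -> (0 < j)%N ->
  (bb lq (yx x0 a) a u1 * bb lq (yx x0 a) a u2) ^+ j !=
  (bb lq (yx x0 b) b u3 * bb lq (yx x0 b) b u4) ^+ i.
Local Notation pt := (pt x0 v).
Local Notation slope := (slope v).
Local Notation laurent := (laurent q).
Local Notation along := (along q L c x0 v).

Lemma laurent_prod (J : eqType) (s : seq J) (Q : pred J) (f : J -> nat -> C) :
  (forall j, j \in s -> laurent (f j)) -> laurent (fun k => \prod_(j <- s | Q j) f j k).
Proof.
move=> h; elim: s h => [|i s IH] h.
  by apply: laurent_ext (laurent_cst q 1) => k; rewrite big_nil.
have h1 := h i (mem_head _ _).
have h2 : laurent (fun k => \prod_(j <- s | Q j) f j k).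
  by apply: IH => j js; apply: h; rewrite inE js orbT.
have [qi|qi] := boolP (Q i).
  by apply: laurent_ext (laurentM h1 h2) => k; rewrite big_cons qi.
by apply: laurent_ext h2 => k; rewrite big_cons (negbTE qi).
Qed.

Lemma laurent_qbr a d : a \in Phi -> laurent (fun k => qbr (d - dot (toC a) (pt k))).
Proof.
move=> aP; have aP' := neg_root Phi_root aP.
have h1 := laurent_key q_log x0 v_lat d aP'.
have h2 := laurent_key q_log x0 v_lat (- d) aP.
have h3 := laurentD h1 (laurentM (laurent_cst q (-1)) h2).
apply: laurent_ext h3 => k.
rewrite /Defs.qbr toCN dotNl mulN1r opprB.
by congr (Defs.qpow _ _ - Defs.qpow _ _); rewrite addrC.
Qed.

Lemma laurent_hb a i : a \in Phi -> laurent (fun k => hb lq m a (pt k) i).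
Proof.
move=> aP; apply: laurent_ext (laurent_qbr ((m a)%:R - i%:R) (neg_root Phi_root aP)) => k.
by rewrite /hb toCN dotNl opprK; congr Defs.qbr; rewrite addrC addrA.
Qed.

Lemma laurent_topc xi1 : laurent (fun k => topc xi1 (pt k)).
Proof.
apply: laurent_prod => a aP; apply: laurent_prod => j _; exact: laurent_qbr.
Qed.

Lemma laurent_facefun xi1 a j : a \in Phi -> laurent (fun k => facefun lq Phi m xi1 a j (pt k)).
Proof.
move=> aP; rewrite /facefun; case: eqP => _; first exact: laurent_topc.
apply: laurentM; last by apply: laurent_prod => i _; apply: laurent_hb.
apply: laurentM; last by apply: laurent_prod => i _; apply: laurent_hb.
apply: laurentM; last exact: laurent_cst.
apply: laurentM; last exact: laurent_cst.
by apply: laurent_prod => b bP; apply: laurent_prod => i _; apply: laurent_qbr.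
Qed.

Lemma wallN xi1 a xi0 : wall Phi xi1 a xi0 -> wall Phi (- xi1) (- a) (- xi0).
Proof.
move=> [h1 h2 h3 h4 h5]; split.
- by move=> b bP; rewrite dotNl oppr_eq0 h1.
- exact: (neg_root Phi_root).
- by rewrite dotNl dotNr opprK.
- by rewrite dotNl dotNr opprK.
move=> b bP b1 b2; rewrite opprK in b2; have [h6 h7] := h5 b bP b2 b1.
rewrite !dotNl oppr_eq0 h6 !oppr_gt0; split => //.
by rewrite !lt_neqAle h6 h1 //= !leNgt h7.
Qed.

(** On such an edge the coefficients are the Laurent polynomials [facefun], or zero, so the
    numerators there are multiples of D itself up to powers of T. *)
Lemma face_vanish G D (P : V -> {poly C}) M (T0 : C) xi1 a0 xi0 p :
  G != 0 -> (forall k, G.[q ^+ k] != 0 -> good (pt k)) ->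
  (forall k, G.[q ^+ k] != 0 -> forall u, u \in L ->
     D.[q ^+ k] * c u (pt k) * (q ^+ k) ^+ M = (P u).[q ^+ k]) ->
  T0 != 0 -> D.[T0] = 0 -> wall Phi xi1 a0 xi0 -> dot xi0 p = Hz xi0 ->
  p \in L -> (P p).[T0] = 0.
Proof.
move=> G0 hG hP T00 DT0 hw hp pL; have [hxi1 a0P _ _ _] := hw.
have q0 k : q ^+ k != 0 by rewrite expf_neq0 // (q_neq0 q_log).
case: (pselect (exists2 j : nat, (j <= m a0)%N & p = rv xi1 - j%:R *: coroot a0)).
  move=> [j jm pE].
  have [N [Q hQ]] := laurent_facefun xi1 j a0P.
  have e : D * Q * 'X^M - P p * 'X^N = 0.
    apply: (poly_id q_log q_nroot G0) => k Gk.
    rewrite hornerD hornerN !hornerM !hornerXn -hQ -hP // pE.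
    rewrite (face_coef q_log q_nroot Phi_root Phi_red m_inv bs (hG k Gk) hw _ jm).
      by ring.
    exact: (good_vertex q_log q_nroot Phi_root Phi_red m_inv bs (hG k Gk)).
  have := congr1 (horner^~ T0) e; rewrite /= hornerD hornerN !hornerM !hornerXn horner0.
  rewrite DT0 !mul0r sub0r => /eqP; rewrite oppr_eq0 mulf_eq0 expf_eq0.
  by rewrite (negbTE T00) andbF orbF => /eqP.
move=> hn.
suff -> : P p = 0 by rewrite horner0.
apply: (poly_id q_log q_nroot G0) => k Gk; rewrite -hP //.
suff -> : c p (pt k) = 0 by rewrite mulr0 mul0r.
apply/eqP; apply: contraT => cp; exfalso; apply: hn.
apply: (face_int q_log q_nroot Phi_root m_inv hw (yx_neq0 lq (pt k) a0) _ _ _ hp (mu := mu (pt k))).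
- exact: (good_msupp bs (hG k Gk)).
- exact: (bs_E bs).
- by move=> u; apply: (cf_mu_zono bs).
- by rewrite (cf_mu bs).
Qed.

(** At [T0] the numerators still solve the conditions, at most one pair of roots is resonant, and on
    the edges exposed by a wall in that direction and by its opposite they vanish by [face_vanish].
    If no root is resonant, [a1] serves as the direction. *)
Lemma root_vanish a1 G D (P : V -> {poly C}) M (T0 : C) : a1 \in Phi ->
  G != 0 -> (forall k, G.[q ^+ k] != 0 -> good (pt k)) ->
  (forall k, G.[q ^+ k] != 0 -> forall u, u \in L ->
     D.[q ^+ k] * c u (pt k) * (q ^+ k) ^+ M = (P u).[q ^+ k]) ->
  T0 != 0 -> D.[T0] = 0 -> forall u, u \in L -> (P u).[T0] = 0.
Proof.
move=> a1P G0 hG hP T00 DT0.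
pose y a := yx x0 a * T0 ^+ slope a.
pose res a := [/\ a \in Phi, 0 < dot v a & ~ nonres lq L (y a) a].
have [a0 a0P ha0] : exists2 a0, a0 \in Phi & forall a, a \in Phi -> 0 < dot v a ->
    a != a0 -> a != - a0 -> nonres lq L (y a) a.
  case: (pselect (exists a, res a)) => [[a [aP va hres]]|hn]; last first.
    by exists a1 => // a aP va _ _; apply: contrapT => h; apply: hn; exists a.
  exists a => // b bP vb b1 b2 u3 u4 u3L u4L; apply/negP => /eqP e34.
  apply: hres => u1 u2 u1L u2L; apply/negP => /eqP e12.
  have := nocoinc aP bP b1 b2 (slopeE v_lat aP va) (slopeE v_lat bP vb) u1L u2L u3L u4L
    (slope_gt0 v_lat aP va) (slope_gt0 v_lat bP vb).
  move: e12 e34; rewrite /y !bbM.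
  set A := bb _ _ _ u1; set A' := bb _ _ _ u2; set B := bb _ _ _ u3; set B' := bb _ _ _ u4.
  set i := slope a; set j := slope b => e12 e34 /eqP; apply.
  have ti : T0 ^+ (2 * i * j) != 0 by rewrite expf_neq0.
  apply: (mulIf ti).
  have -> : (A * A') ^+ j * T0 ^+ (2 * i * j) = (A * T0 ^+ i * (A' * T0 ^+ i)) ^+ j.
    rewrite exprM -exprMn; congr (_ ^+ _); rewrite mul2n -addnn exprD; ring.
  have -> : (B * B') ^+ i * T0 ^+ (2 * i * j) = (B * T0 ^+ j * (B' * T0 ^+ j)) ^+ i.
    rewrite mulnAC exprM -exprMn; congr (_ ^+ _); rewrite mul2n -addnn exprD; ring.
  by rewrite e12 e34 !expr1n.
have [xi1 [xi0 hw]] := wall_exists Phi_root Phi_red a0P.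
have hal : along G P.
  move=> k Gk; exists (D.[q ^+ k] * (q ^+ k) ^+ M) => u uL.
  by rewrite -hP // mulrAC.
pose nu := mk L (fun u => (P u).[T0]).
have cfnu u : cf nu u = if u \in L then (P u).[T0] else 0 by apply: (cf_polys bs).
have nuL u : cf nu u != 0 -> u \in L by rewrite cfnu; case: ifP; rewrite ?eqxx.
suff h u : cf nu u = 0.
  by move=> u uL; have := h u; rewrite cfnu uL.
apply: (E_wall_unique q_log q_nroot Phi_root Phi_red m_inv (y := y) hw v_reg).
- by move=> a _ _; rewrite mulf_neq0 ?expf_neq0 // yx_neq0.
- move=> a aP va b1 b2 u1 u2; rewrite !mem_msupp => /nuL h1 /nuL h2.
  exact: (ha0 a aP va b1 b2).
- move=> a aP va; exact: (along_E q_log q_nroot bs v_lat G0 hal).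
- by move=> p /nuL /(bs_L bs)[].
- move=> p _ hp; rewrite cfnu; case: ifP => // pL.
  exact: (face_vanish G0 hG hP T00 DT0 hw hp pL).
move=> p _ hp; rewrite cfnu; case: ifP => // pL.
apply: (face_vanish G0 hG hP T00 DT0 (wallN hw) _ pL).
by rewrite dotNl hp opprK HzN.
Qed.

(** The field being algebraically closed, D loses one linear factor at a time. A factor X goes into
    the power of T; for another root T0 all numerators are divisible by X - T0, and T0 joins the
    zeros of G, where nothing is claimed. *)
Lemma denominator_free a1 r (G D : {poly C}) (P : V -> {poly C}) M : a1 \in Phi -> (size D <= r)%N -> D != 0 ->
  G != 0 -> (forall k, G.[q ^+ k] != 0 -> good (pt k)) ->
  (forall k, G.[q ^+ k] != 0 -> forall u, u \in L ->
     D.[q ^+ k] * c u (pt k) * (q ^+ k) ^+ M = (P u).[q ^+ k]) ->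
  exists G' (P' : V -> {poly C}) M', [/\ G' != 0,
    forall k, G'.[q ^+ k] != 0 -> good (pt k) &
    forall k, G'.[q ^+ k] != 0 -> forall u, u \in L ->
     c u (pt k) * (q ^+ k) ^+ M' = (P' u).[q ^+ k]].
Proof.
move=> a1P; elim: r D G P M => [|r IH] D G P M sD D0 G0 hG hP.
  by move: sD D0; rewrite leqn0 size_poly_eq0 => ->.
have [sD1|sD1] := eqVneq (size D) 1%N.
  have /eqP/size_poly1P[d d0 DE] := sD1.
  exists G, (fun u => d^-1 *: P u), M; split => // k Gk u uL.
  by rewrite hornerZ -hP // DE hornerC -mulrA mulKf.
have [T0 rT0] := closed_rootP D sD1.
have DT0 : D.[T0] = 0 by apply/eqP.
have /factor_theorem[D' DE] := rT0.
have D'0 : D' != 0 by apply: contraNneq D0 => e; rewrite DE e mul0r.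
have sD' : (size D' <= r)%N.
  by move: sD; rewrite DE size_Mmonic ?monicXsubC // size_XsubC addn2.
have q0 k : q ^+ k != 0 by rewrite expf_neq0 // (q_neq0 q_log).
have [T00|T00] := eqVneq T0 0.
  apply: (IH D' G P M.+1) => // k Gk u uL.
  by rewrite -hP // DE hornerM hornerXsubC T00 subr0 exprS; ring.
have hv := root_vanish a1P G0 hG hP T00 DT0.
have hq u : exists Q : {poly C}, u \in L -> P u = Q * ('X - T0%:P).
  case uL: (u \in L); last by exists 0.
  have /factor_theorem[Q hQ] : root (P u) T0 by rewrite rootE hv.
  by exists Q.
pose P' u := projT1 (cid (hq u)).
have hP' u : u \in L -> P u = P' u * ('X - T0%:P) by rewrite /P'; case: cid.
apply: (IH D' (G * ('X - T0%:P)) P' M) => //.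
- by rewrite mulf_neq0 // polyXsubC_eq0.
- by move=> k; rewrite hornerM mulf_eq0 negb_or => /andP[/hG].
move=> k; rewrite hornerM mulf_eq0 negb_or hornerXsubC => /andP[Gk Tk] u uL.
apply: (mulIf Tk); have := hP k Gk u uL.
rewrite hP' // DE !hornerM hornerXsubC => <-; ring.
Qed.

End Denominator.

(** * Laurent polynomials at all good points, and the degree at the vertex *)

Section Degree.
Variables (R : realType) (n : nat) (q lq : R[i]) (Phi : {fset 'cV[R]_n}).
Hypotheses (q_log : cexp lq = q) (q_nroot : forall k : nat, (0 < k)%N -> q ^+ k != 1).
Hypotheses (Phi_root : root_system Phi) (Phi_red : reduced Phi).
Local Notation V := 'cV[R]_n.
Local Notation C := R[i].
Local Notation VC := 'cV[R[i]]_n.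
Local Notation qpow := (qpow lq).
Local Notation qbr := (qbr lq).
Implicit Types (a u v : V) (x z : VC) (mu nu : seq (C * V)) (y : C) (S : seq V).

Variable m : V -> nat.
Hypothesis m_inv : weyl_invariant Phi m.
Local Notation rv := (rv Phi m).
Local Notation yx := (yx lq).
Local Notation Eat := (Eat lq).
Local Notation topc := (topc lq Phi m).

Variables (xi : V) (L : seq V) (c : V -> VC -> C).
Hypothesis bs : ba_sol lq Phi m xi L c.
Local Notation mu x := (mk L (c^~ x)).
Local Notation good := (good lq Phi L).

Variables (x0 : VC) (v : V).
Hypotheses (v_lat : lat Phi v) (v_reg : regular Phi v).
Hypothesis gx0 : good x0.
Hypothesis nocoinc : forall a b u1 u2 u3 u4 (i j : nat), a \in Phi -> b \in Phi ->
  b != a -> b != - a -> dot a v = i%:R -> dot b v = j%:R ->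
  u1 \in L -> u2 \in L -> u3 \in L -> u4 \in L -> (0 < i)%N -> (0 < j)%N ->
  (bb lq (yx x0 a) a u1 * bb lq (yx x0 a) a u2) ^+ j !=
  (bb lq (yx x0 b) b u3 * bb lq (yx x0 b) b u4) ^+ i.
Local Notation pt := (pt x0 v).
Local Notation slope := (slope v).
Local Notation laurent := (laurent q).

Lemma EatN k y mu a : Eat k y mu a -> Eat k y^-1 mu (- a).
Proof.
move=> h F s pF hs.
have pF' : invariant_by (coroot a) F.
  by move=> u; rewrite -[in RHS](subrK (coroot a) u) -[in RHS](opprK (coroot a)) -corootN addrNK -{2}[u](addrK (coroot a)) -corootN pF.
have e u : bb lq y^-1 (- a) u = (bb lq y a u)^-1.
  by rewrite /bb invfM dotNl rmorphN qpowN.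
rewrite -[RHS]oppr0 -[in RHS](h F s pF' hs) -mulN1r -evZ; apply: eq_ev => u.
rewrite e exprVn invrK; ring.
Qed.

Lemma yxN x a : yx x (- a) = (yx x a)^-1.
Proof. by rewrite /Submission.yx toCN dotNl qpowN. Qed.

(** The formula found off the zeros of G extends to every good point of the line: both sides solve
    the same conditions there and agree at the vertex. In this way the points k = 0 and k = 1 are
    covered. *)
Lemma laurent_line a1 : a1 \in Phi -> exists (G : {poly C}) (P : V -> {poly C}) M,
  [/\ G != 0, forall k, G.[q ^+ k] != 0 -> good (pt k) &
    forall k, good (pt k) -> forall u, u \in L -> c u (pt k) * (q ^+ k) ^+ M = (P u).[q ^+ k]].
Proof.
move=> a1P.
have pt0 : pt 0 = x0 by rewrite /Submission.pt mulr0n toC0 addr0.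
have gpt0 : good (pt 0) by rewrite pt0.
have q0 k : q ^+ k != 0 by rewrite expf_neq0 // (q_neq0 q_log).
have [D [N [hD hN D0 hDN]]] := ba_cramer q_log q_nroot Phi_root Phi_red m_inv bs
  (pt := pt) (x0 := 0%N) (Pd := laurent) (@laurent_cst _ q) (@laurentD _ q) (@laurentM _ q)
  (@laurent_ext _ q) (fun a d aP => laurent_key q_log x0 v_lat d aP) gpt0.
have [N0 [Dp hDp]] := hD.
pose Nu u := projT1 (cid (hN u)); pose Pu u := projT1 (cid (projT2 (cid (hN u)))).
have hPu u k : N u k * (q ^+ k) ^+ Nu u = (Pu u).[q ^+ k].
  by rewrite /Nu /Pu; case: (cid (hN u)) => N1 h1 /=; case: cid => P1 h2 /=.
pose M0 := (\sum_(u <- L) Nu u)%N.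
have NuM u : u \in L -> (Nu u <= M0)%N.
  by move=> uL; rewrite /M0 (bigD1_seq u) ?(bs_uniq bs) //= leq_addr.
have Dp0 : Dp != 0.
  apply: contraNneq D0 => e; have := hDp 0%N; rewrite e horner0 expr0 expr1n mulr1.
  by move=> ->.
have [G [G0 hG]] : exists G : {poly C}, G != 0 /\ forall k, G.[q ^+ k] != 0 -> good (pt k).
  have [G G0 hG] := good_laurent q_log v_lat gx0.
  by exists G; split => // k /hG.
have h1 k : G.[q ^+ k] != 0 -> forall u, u \in L ->
    Dp.[q ^+ k] * c u (pt k) * (q ^+ k) ^+ M0 = (Pu u * 'X^(M0 - Nu u + N0)).[q ^+ k].
  move=> _ u uL; rewrite hornerM hornerXn -hPu -hDN // -hDp -{1}(subnK (NuM u uL)).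
  by rewrite !exprD; ring.
have [G' [P [M [G'0 hG' hP]]]] := denominator_free q_log q_nroot Phi_root Phi_red m_inv bs
  v_lat v_reg nocoinc a1P (leqnn (size Dp)) Dp0 G0 hG h1.
exists G', P, M; split => // k gk u uL.
have rvL : rv xi \in L.
  apply/(bs_L bs); split; first exact: rv_zono.
  exact: (rv_lat Phi_root Phi_red m_inv (bs_reg bs)).
have top_eq : topc xi (pt k) * (q ^+ k) ^+ M = (P (rv xi)).[q ^+ k].
  have [N1 [Q hQ]] := laurent_topc q_log Phi_root m x0 v_lat xi.
  have e : P (rv xi) * 'X^N1 - Q * 'X^M = 0.
    apply: (poly_id q_log q_nroot G'0) => j Gj.
    rewrite hornerD hornerN !hornerM !hornerXn -hQ -hP // (bs_top bs); ring.
  have := congr1 (horner^~ (q ^+ k)) e.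
  rewrite /= hornerD hornerN !hornerM !hornerXn horner0 -hQ => /eqP; rewrite subr_eq0 => /eqP e'.
  have t0 : (q ^+ k) ^+ N1 != 0 by rewrite expf_neq0.
  by apply: (mulIf t0); rewrite e' mulrAC.
have tM0 : (q ^+ k) ^+ M != 0 by rewrite expf_neq0.
pose nu := mk L (fun u => (P u).[q ^+ k]) ++ mZ (- (q ^+ k) ^+ M) (mu (pt k)).
have cfnu w : cf nu w = (if w \in L then (P w).[q ^+ k] else 0) - (q ^+ k) ^+ M * c w (pt k).
  by rewrite cf_cat cf_scale (cf_mu bs) (cf_polys bs) mulNr.
have hal : Submission.along q L c x0 v G' P.
  by move=> j Gj; exists ((q ^+ j) ^+ M) => w wL; rewrite -hP // mulrC.
have hpos a : a \in Phi -> 0 < dot v a -> Eat (m a) (yx (pt k) a) nu a.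
  move=> aP va; apply: Eat_cat; last by apply: Eat_scale; apply: (bs_E bs).
  rewrite (yx_pt q_log x0 v_lat) //.
  exact: (along_E q_log q_nroot bs v_lat G'0 hal aP va (q0 k)).
have : cf nu u = 0.
  apply: (good_unique q_log q_nroot Phi_root Phi_red m_inv bs gk).
  - move=> w; rewrite cfnu; case: ifP => // /negbT wL.
    by rewrite (bs_out bs) // mulr0 subrr eqxx.
  - move=> a aP; have [va|va] := ltP 0 (dot v a); first exact: hpos.
    have va' : 0 < dot v (- a) by rewrite dotNr oppr_gt0 lt_neqAle v_reg.
    have := EatN (hpos _ (neg_root Phi_root aP) va').
    by rewrite yxN invrK opprK (mN Phi_root m_inv).
  - by rewrite cfnu rvL -top_eq (bs_top bs) mulrC subrr.
rewrite cfnu uL => /eqP; rewrite subr_eq0 => /eqP ->.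
by rewrite mulrC.
Qed.

(* Laurent polynomials with extreme exponents exactly -d and d. *)
Definition degB (d : nat) (F : nat -> C) := exists P : {poly C},
  size P = (2 * d).+1 /\ forall k, F k * (q ^+ k) ^+ d = P.[q ^+ k].

Lemma degB1 : degB 0 (fun=> 1).
Proof. by exists 1; split; [rewrite size_poly1 | move=> k; rewrite expr0 mulr1 hornerC]. Qed.

Lemma degBM d d' F F' : degB d F -> degB d' F' -> degB (d + d') (fun k => F k * F' k).
Proof.
move=> [P [sP hP]] [P' [sP' hP']]; exists (P * P'); split.
  rewrite size_mul ?sP ?sP' ?mulnDr //; first by rewrite addnS addSn.
  - by rewrite -size_poly_eq0 sP.
  - by rewrite -size_poly_eq0 sP'.
by move=> k; rewrite hornerM -hP -hP' exprD; ring.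
Qed.

Lemma degB_ext d F F' : F =1 F' -> degB d F -> degB d F'.
Proof. by move=> e [P [h1 h2]]; exists P; split => // k; rewrite -e. Qed.

Lemma slopeN a : a \in Phi -> slope (- a) = slope a.
Proof.
move=> aP; have /intrP[z hz] := v_lat aP.
by rewrite /Submission.slope !(dotC _ v) dotNr hz -rmorphN !intrKfloor abszN.
Qed.

Lemma degB_qbr a (d : C) : a \in Phi -> degB (slope a) (fun k => qbr (d - dot (toC a) (pt k))).
Proof.
have pos b e : b \in Phi -> 0 < dot v b ->
    degB (slope b) (fun k => qbr (e - dot (toC b) (pt k))).
  move=> bP vb; pose Y := yx x0 b.
  exists ((qpow e / Y)%:P - (qpow (- e) * Y) *: 'X^(2 * slope b)).
  have s0 : (0 < 2 * slope b)%N by rewrite muln_gt0 (slope_gt0 v_lat).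
  have d0 : - (qpow (- e) * Y) != 0 by rewrite oppr_eq0 mulf_neq0 ?qpow_neq0.
  split.
    rewrite -scaleNr addrC size_polyDl ?size_scale ?size_polyXn //.
    by rewrite (leq_ltn_trans (size_polyC_leq1 _)) ?size_scale ?size_polyXn // ltnS.
  move=> k; rewrite hornerD hornerN hornerC hornerZ hornerXn.
  have -> : qbr (e - dot (toC b) (pt k)) = qpow e / yx (pt k) b - qpow (- e) * yx (pt k) b.
    by rewrite /Defs.qbr opprB qpowB (qpowB lq (dot _ _)) qpowN [in RHS](mulrC (qpow e)^-1).
  rewrite (yx_pt q_log x0 v_lat) // -/Y mul2n -addnn exprD.
  have t0 : (q ^+ k) ^+ slope b != 0 by rewrite !expf_neq0 ?(q_neq0 q_log).
  have Y0 : Y != 0 by apply: yx_neq0.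
  by field; rewrite t0 Y0.
move=> aP; have [va|va] := ltP 0 (dot v a); first exact: pos.
have va' : 0 < dot v (- a) by rewrite dotNr oppr_gt0 lt_neqAle v_reg.
have [P [sP hP]] := pos _ (- d) (neg_root Phi_root aP) va'.
rewrite slopeN // in sP hP.
exists (- P); rewrite size_polyN; split => // k.
by rewrite hornerN -hP toCN dotNl opprK -mulNr -qbrN opprD opprK.
Qed.

(** The degree in T of the vertex coefficient. It equals 2 (v, rho) for the positive system of v,
    see [dd_dot]. *)
Definition dd : nat := (\sum_(a <- Phi | (0 < dot xi a)%R) m a * slope a)%N.

Lemma degB_topc : degB dd (fun k => topc xi (pt k)).
Proof.
have pw F d j : (forall i : nat, degB d (F i)) -> degB (j * d) (fun k => \prod_(1 <= i < j.+1) F i k).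
  move=> h; elim: j => [|j IH].
    by apply: degB_ext degB1 => k; rewrite big_geq.
  rewrite mulSn addnC; apply: degB_ext (degBM IH (h j.+1)) => k.
  by rewrite [RHS]big_nat_recr.
suff gen (s : seq V) : {subset s <= Phi} ->
    degB (\sum_(a <- s | (0 < dot xi a)%R) m a * slope a)%N
      (fun k => \prod_(a <- s | 0 < dot xi a) \prod_(1 <= j < (m a).+1) qbr (j%:R - dot (toC a) (pt k))).
  exact: gen.
elim: s => [_|a s IH hs].
  by rewrite big_nil; apply: degB_ext degB1 => k; rewrite big_nil.
have aP : a \in Phi by apply: hs; rewrite mem_head.
have {}IH := IH (fun b bs => hs b (@mem_behead _ (a :: s) b bs)).
rewrite big_cons; case: ifP => xa; last first.
  by apply: degB_ext IH => k; rewrite big_cons xa.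
have := pw (fun j k => qbr (j%:R - dot (toC a) (pt k))) (slope a) (m a) (fun j => degB_qbr _ aP).
by move=> h; apply: degB_ext (degBM h IH) => k; rewrite big_cons xa.
Qed.

End Degree.

(** * An explicit solution of the limit conditions *)

Section Leading.
Variables (R : realType) (n : nat) (q lq : R[i]) (Phi : {fset 'cV[R]_n}).
Hypotheses (q_log : cexp lq = q) (q_nroot : forall k : nat, (0 < k)%N -> q ^+ k != 1).
Hypotheses (Phi_root : root_system Phi) (Phi_red : reduced Phi).
Local Notation V := 'cV[R]_n.
Local Notation C := R[i].
Local Notation VC := 'cV[R[i]]_n.
Local Notation qpow := (qpow lq).
Local Notation qbr := (qbr lq).
Implicit Types (a u v : V) (x z : VC) (mu nu : seq (C * V)) (y : C) (S : seq V).

Variable m : V -> nat.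
Hypothesis m_inv : weyl_invariant Phi m.
Local Notation zono := (zono Phi m).
Local Notation rv := (rv Phi m).
Local Notation rr := (rr Phi m).
Local Notation yx := (yx lq).

Variables (xi : V) (L : seq V) (c : V -> VC -> C).
Hypothesis bs : ba_sol lq Phi m xi L c.
Local Notation mu x := (mk L (c^~ x)).

Local Notation Einf := (Einf lq).
Definition psiv x z := ev (mu x) (fun u => qpow (2 * dot (x + toC u) z)).

Lemma psi_quasi a s x z : a \in Phi -> (1 <= s <= m a)%N ->
  qpow (2 * dot (toC (coroot a)) z) = 1 ->
  psiv x (z + (s%:R / 2) *: toC a) = psiv x (z - (s%:R / 2) *: toC a).
Proof.
move=> aP hs hz; apply/eqP; rewrite -subr_eq0 /psiv -evB; apply/eqP.
have pF : invariant_by (coroot a) (fun u => qpow (2 * dot (x + toC u) z)).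
  by move=> u; rewrite toCD addrA dotDl mulrDr qpowD hz mulr1.
rewrite -[RHS](bs_E bs x aP pF hs); apply: eq_ev => u.
have e : bb lq (yx x a) a u ^+ s = qpow (s%:R * dot (x + toC u) (toC a)).
  by rewrite qpow_natl /bb /Submission.yx -qpowD -dot_toC dotDl (dotC x) (dotC (toC u)).
rewrite e -qpowN !dotDr dotNr dotZr !mulrDr !qpowD mulrN.
have -> : 2 * (s%:R / 2 * dot (x + toC u) (toC a)) = s%:R * dot (x + toC u) (toC a).
  by rewrite mulrA mulrCA divff ?mulr1 // pnatr_eq0.
ring.
Qed.

(** For adjacent chambers the two values of rho are z + (m_a / 2) a and z - (m_a / 2) a; since (rho,
    a^vee) = m_a, the midpoint has (a^vee, z) = 0, and quasi-invariance with s = m_a applies. *)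
Lemma psi_walk x xi1 xi2 : regular Phi xi1 -> regular Phi xi2 ->
  psiv x (toC (rr xi1)) = psiv x (toC (rr xi2)).
Proof.
move=> h1 h2; apply: (chamber_walk Phi_root Phi_red
  (Pr := fun xi' => psiv x (toC (rr xi1)) = psiv x (toC (rr xi')))
  _ _ h1 h2 erefl).
  by move=> xi3 xi4 h3 h4 sc ->; rewrite (rr_same m h3 h4 sc).
move=> xi3 a xi0 hw ->; have [_ aP _ _ _] := hw.
rewrite (rr_wall Phi_root m_inv hw).
have [m0|m0] := posnP (m a); first by rewrite m0 scale0r subr0.
pose z := toC (rr xi3 - ((m a)%:R / 2) *: a).
have e : ((m a)%:R / 2 : C) = ((m a)%:R / 2 : R)%:C.
  by rewrite rmorphM fmorphV !rmorph_nat.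
have -> : toC (rr xi3) = z + ((m a)%:R / 2) *: toC a.
  by rewrite e -toCZ -toCD subrK.
have -> : toC (rr xi3 - (m a)%:R *: a) = z - ((m a)%:R / 2) *: toC a.
  rewrite e -toCZ -toCB; congr toC; rewrite -addrA -opprD -scalerDl; congr (_ - _ *: _).
  by field.
apply: psi_quasi => //; first by rewrite m0 leqnn.
rewrite dot_toC dotBr (dotC (coroot a)) (rr_wall_dot Phi_root m_inv hw).
have -> : dot (coroot a) (((m a)%:R / 2) *: a) = (m a)%:R.
  by rewrite (dotZr ((m a)%:R / 2)) (coroot_dot Phi_root) // divfK // pnatr_eq0.
by rewrite subrr mulr0 qpow0.
Qed.

(** On exponential sums in q^(2 (u, lam)) this is multiplication by the bracket of (a^vee, lam) - s,
    where p = (a, s). *)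
Definition opm (p : V * nat) mu : seq (C * V) :=
  mZ (qpow (- p.2%:R)) (mshift (2^-1 *: coroot p.1) mu) ++
  mZ (- qpow p.2%:R) (mshift (- (2^-1 *: coroot p.1)) mu).

(* The exponential sum of [prodm l] is the product of the [(a^vee, lam) - s] over
   the (a, s) in l: see [prodm_exp]. *)
Definition prodm (l : seq (V * nat)) : seq (C * V) := foldr opm [:: (1, 0)] l.

Lemma ev_opm p mu F : ev (opm p mu) F = ev mu (fun u =>
  qpow (- p.2%:R) * F (u + 2^-1 *: coroot p.1) - qpow p.2%:R * F (u - 2^-1 *: coroot p.1)).
Proof. by rewrite ev_cat !ev_scale !ev_shift evB !evZ mulNr. Qed.

Lemma half_coroot (a : V) : 2^-1 *: coroot a + 2^-1 *: coroot a = coroot a.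
Proof. by rewrite -scalerDl -[RHS]scale1r; congr (_ *: _); field. Qed.

(** The factor of (a, s) is responsible: its two shifts differ by a^vee, which F does not see, and
    they scale q^(s (a, u)) by q^s and q^-s, exactly offsetting the weights q^-s and q^s, so the
    terms cancel. The other factors keep F periodic. *)
Lemma prodm_kill l a s F : a \in Phi -> (a, s) \in l -> invariant_by (coroot a) F ->
  ev (prodm l) (fun u => qpow (dot a u)%:C ^+ s * F u) = 0.
Proof.
move=> aP; elim: l F => [//|p l IH] F; rewrite inE => /orP[/eqP<-|h] pF /=; rewrite ev_opm.
  rewrite -[RHS](mul0r (ev (prodm l) (fun=> 0))) -evZ; apply: eq_ev => u /=.
  have -> : F (u + 2^-1 *: coroot a) = F (u - 2^-1 *: coroot a).
    by rewrite -[in RHS]pF -[X in _ = F (_ + X)](half_coroot a) addrA subrK.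
  have h : dot a (2^-1 *: coroot a) = 1.
    by rewrite (dotZr 2^-1) (coroot_dotr Phi_root) // mulVf // pnatr_eq0.
  rewrite dotBr dotDr h rmorphB rmorphD !rmorph1 qpowB qpowD !exprMn exprVn.
  rewrite -[s%:R]mulr1 qpow_natl qpowN qpow_natl.
  have q0 : qpow 1 ^+ s != 0 by rewrite expf_neq0 ?qpow_neq0.
  by field.
pose hc := 2^-1 *: coroot p.1.
pose F' u := qpow (- p.2%:R) * qpow (dot a hc)%:C ^+ s * F (u + hc) -
             qpow p.2%:R * qpow (- (dot a hc)%:C) ^+ s * F (u - hc).
rewrite -[RHS](IH F' h); first last.
  by move=> u; rewrite /F' -!(addrAC u _ (coroot a)) !pF.
apply: eq_ev => u /=; rewrite -/hc dotBr dotDr rmorphB rmorphD !qpowD !exprMn /F'; ring.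
Qed.

Lemma prodm_exp l lam : ev (prodm l) (fun u => qpow (2 * dot u lam)%:C) =
  \prod_(p <- l) qbr ((dot (coroot p.1) lam)%:C - p.2%:R).
Proof.
elim: l => [|p l IH].
  by rewrite big_nil /ev big_seq1 /= dot0l mulr0 qpow0 mulr1.
rewrite big_cons -IH /= ev_opm -evZ; apply: eq_ev => u.
have e : 2 * dot (2^-1 *: coroot p.1) lam = dot (coroot p.1) lam.
  by rewrite dotZl mulrA divff ?mul1r // pnatr_eq0.
rewrite dotBl dotDl mulrBr mulrDr e rmorphB rmorphD !qpowD /Defs.qbr opprB !qpowD; ring.
Qed.

Lemma prodm_supp (v : V) l u : (forall p, p \in l -> (p.1 \in Phi) && (0 < dot v p.1)) ->
  cf (prodm l) u != 0 -> exists k : V -> R,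
  (forall a, `|k a| <= (count (fun p => p.1 == a) l)%:R) /\
  u = 2^-1 *: \sum_(a <- Phi | 0 < dot v a) k a *: coroot a.
Proof.
elim: l u => [|p l IH] u hl.
  move=> /cf_in /=; rewrite inE => /eqP ->; exists (fun=> 0); split => [a|].
    by rewrite normr0.
  by rewrite big1 ?scaler0 // => a _; rewrite scale0r.
have /andP[pP vp] := hl p (mem_head _ _).
have step (e : R) w : `|e| = 1 -> cf (prodm l) w != 0 -> u = w + e *: (2^-1 *: coroot p.1) ->
    exists k : V -> R, (forall a, `|k a| <= (count (fun p => p.1 == a) (p :: l))%:R) /\
    u = 2^-1 *: \sum_(a <- Phi | 0 < dot v a) k a *: coroot a.
  move=> he hw ->; have [p' p'l|k [hk ->]] := IH w _ hw.
    by apply: hl; rewrite inE p'l orbT.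
  exists (fun a => k a + e * (p.1 == a)%:R); split => [a|].
    rewrite /= natrD addrC (le_trans (ler_normD _ _)) // lerD // normrM he mul1r.
    by rewrite ger0_norm ?ler0n.
  rewrite scalerA (mulrC e) -scalerA -scalerDr; congr (_ *: _).
  under [RHS]eq_bigr => a _ do rewrite scalerDl.
  rewrite big_split /=; congr (_ + _).
  rewrite [RHS]big_mkcond (bigD1_seq p.1) ?fset_uniq //= vp eqxx mulr1 big1 ?addr0 //.
  by move=> a; rewrite eq_sym => /negbTE ->; rewrite mulr0 scale0r; case: ifP.
rewrite /= cf_cat !cf_scale !cf_shift opprK.
have [h|h] := eqVneq (cf (prodm l) (u - 2^-1 *: coroot p.1)) 0; last first.
  by move=> _; apply: (step 1 _ _ h); rewrite ?normr1 // scale1r subrK.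
have [h'|h'] := eqVneq (cf (prodm l) (u + 2^-1 *: coroot p.1)) 0; last first.
  by move=> _; apply: (step (-1) _ _ h'); rewrite ?normrN1 // scaleN1r addrK.
by rewrite h h' !mulr0 addr0 eqxx.
Qed.

Definition plist (v : V) : seq (V * nat) :=
  [seq (a, s) | a <- [seq a <- Phi | 0 < dot v a], s <- iota 1 (m a)].

Lemma mem_plist v a s : ((a, s) \in plist v) = [&& a \in Phi, 0 < dot v a & (1 <= s <= m a)%N].
Proof.
apply/allpairsPdep/idP => [[b [t [hb ht [-> ->]]]]|/and3P[h1 h2 h3]].
  by move: hb ht; rewrite mem_filter mem_iota add1n ltnS => /andP[-> ->].
by exists a, s; rewrite mem_filter mem_iota add1n ltnS h1 h2.
Qed.

Lemma count_plist v b : (count (fun p => p.1 == b) (plist v) <= m b)%N.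
Proof.
rewrite /plist -sum1_count big_mkcond big_allpairs_dep big_filter big_mkcond /=.
have e a : (\sum_(s <- iota 1 (m a)) (if a == b then 1 else 0) = if a == b then m b else 0)%N.
  case: eqP => [->|_]; last by rewrite big1.
  by rewrite sum1_size size_iota.
have [bP|bP] := boolP (b \in Phi); last first.
  rewrite big_seq big1 // => a aP; case: ifP => // _; rewrite e.
  by case: eqP => // eab; rewrite -eab aP in bP.
rewrite (bigD1_seq b) ?fset_uniq //= e eqxx [X in (_ + X)%N]big1 ?addn0.
  by case: ifP.
by move=> a ab; rewrite e (negbTE ab); case: ifP.
Qed.

(** Each positive root a contributes m_a factors, each shifting by half of a^vee one way or the
    other. *)
Lemma prodm_zono v u : regular Phi v -> cf (prodm (plist v)) u != 0 -> zono u.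
Proof.
move=> hv /prodm_supp - /(_ v)[|k [hk ->]].
  by move=> [a s]; rewrite mem_plist /= => /and3P[-> ->].
have flip a : a \in Phi -> (0 < dot v (- a)) = ~~ (0 < dot v a).
  by move=> aP; rewrite dotNr oppr_gt0 -leNgt le_eqVlt (negbTE (hv a aP)).
exists (fun a => if 0 < dot v a then k a else - k (- a)); split => [a aP|].
  case: ifP => _; rewrite ?normrN (le_trans (hk _)) // ler_nat ?count_plist //.
  by rewrite -(mN Phi_root m_inv aP) count_plist.
rewrite (sum_root_half Phi_root (xi := v)).
- rewrite -quarter_double; congr (_ *: (_ *+ _)).
  by apply: eq_bigr => a ->.
- move=> a aP; rewrite flip // opprK corootN.
  by case: (0 < dot v a) => /=; rewrite ?scaleNr ?scalerN ?opprK.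
- by move=> a aP e; have := hv a aP; rewrite e eqxx.
Qed.

(* [dot xi' (rr xi')] dominates [dot xi' (rr xi'')], in particular at reflected [xi'']. *)
Lemma rr_coroot_ge0 (v : V) a : a \in Phi -> 0 < dot v a -> 0 <= dot (rr v) (coroot a).
Proof.
move=> aP va.
have h : dot v (rr (refl a *m v)) <= dot v (rr v).
  rewrite !dotZr ler_pM2l ?invr_gt0 ?ltr0n // !dot_sumr.
  rewrite !big_seq; apply: ler_sum => b bP; rewrite !dotZr -!mulrA ler_wpM2l ?ler0n //.
  rewrite -[X in _ <= X]/(Num.sg (dot v b) * dot v b) -normrEsg.
  rewrite (le_trans (ler_norm _)) // normrM normr_sg.
  by case: (_ != 0); rewrite ?mul1r ?mul0r.
move: h; rewrite (rr_weyl Phi_root m_inv _ (weyl_refl1 aP)) reflE dotBr dotZr.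
by rewrite lerBlDr lerDl pmulr_lge0.
Qed.

Lemma rr_coroot_int (v : V) a : regular Phi v -> a \in Phi ->
  2 * dot (rr v) (coroot a) \is a Num.int.
Proof.
move=> hv aP.
rewrite dotZl dot_suml (sum_root_half Phi_root (xi := v)); last first.
- by move=> b bP e; have := hv b bP; rewrite e eqxx.
- by move=> b bP; rewrite (mN Phi_root m_inv bP) dotNr sgrN mulrN scalerN scaleNr opprK.
set S := \sum_(_ <- _ | _) _.
have -> : 2 * (4^-1 * (S *+ 2)) = S by rewrite -mulr_natl; field.
rewrite /S big_seq_cond; apply: rpred_sum => b /andP[bP vb].
rewrite dotZl gtr0_sg // mulr1 rpredM ?rpred_nat //.
exact: (root_int Phi_root).
Qed.

(** Each bracket has argument -((a^vee, rho) + s) with s >= 1 and 2 (a^vee, rho) a nonnegative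
    integer. *)
Lemma prodm_exp_neq0 (v : V) : regular Phi v ->
  ev (prodm (plist v)) (fun u => qpow (2 * dot u (rr (- v)))%:C) != 0.
Proof.
move=> hv; rewrite prodm_exp prodf_seq_neq0; apply/allP => -[a s].
rewrite mem_plist /= => /and3P[aP va /andP[s0 _]].
have e : rr (- v) = - rr v.
  rewrite /Submission.rr -scalerN -sumrN; congr (_ *: _); apply: eq_bigr => b _.
  by rewrite dotNl sgrN mulrN scaleNr.
rewrite e dotNr rmorphN -opprD qbrN oppr_eq0 qbr_eq0.
have /intrP[j hj] := rr_coroot_int hv aP.
have -> : 2 * ((dot (coroot a) (rr v))%:C + s%:R) = (j + (2 * s)%N%:Z)%:~R :> C.
  rewrite mulrDr.
  have -> : 2 * (dot (coroot a) (rr v))%:C = (2 * dot (coroot a) (rr v))%:C :> C.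
    by rewrite rmorphM !rmorph_nat.
  by rewrite (dotC (coroot a)) hj rmorph_int intrD -pmulrn natrM.
apply: (qpow_int_neq1 q_log q_nroot).
have j0 : 0 <= j.
  by rewrite -(ler0z R) -hj mulr_ge0 ?ler0n // rr_coroot_ge0.
by lia.
Qed.

Lemma Einf_prodm (v : V) a : a \in Phi -> 0 < dot v a ->
  Einf false (m a) (prodm (plist v)) a.
Proof.
move=> aP va F s pF hs; rewrite expr0.
under eq_ev => u do rewrite mul1r.
by apply: prodm_kill => //; rewrite mem_plist aP va.
Qed.

(** By uniqueness the solution is proportional to the explicit product, whose exponential sum does
    not vanish at this point. *)
Lemma leading_neq0 (v : V) mu : regular Phi v ->
  (forall a, a \in Phi -> 0 < dot v a -> Einf false (m a) mu a) ->
  (forall u, cf mu u != 0 -> zono u) -> cf mu (rv xi) != 0 ->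
  ev mu (fun u => qpow (2 * dot u (rr (- v)))%:C) != 0.
Proof.
move=> hv hE hz h0; pose Pi := prodm (plist v).
pose nu := mZ (cf Pi (rv xi)) mu ++ mZ (- cf mu (rv xi)) Pi.
have cfnu u : cf nu u = cf Pi (rv xi) * cf mu u - cf mu (rv xi) * cf Pi u.
  by rewrite cf_cat !cf_scale mulNr.
have nu0 u : cf nu u = 0.
  apply: (Einf_unique q_log q_nroot Phi_root Phi_red m_inv (bs_reg bs) hv (e := false)).
  - move=> a aP va F s pF hs; rewrite ev_cat !ev_scale hE //.
    by rewrite (Einf_prodm aP va) // !mulr0 addr0.
  - move=> p; rewrite cfnu; have [e|e _] := eqVneq (cf mu p) 0; last exact: hz.
    rewrite e mulr0 sub0r oppr_eq0 mulf_eq0 negb_or => /andP[_].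
    exact: prodm_zono.
  - by rewrite cfnu mulrC subrr.
have := ev_cf0 (fun u => qpow (2 * dot u (rr (- v)))%:C) nu0.
rewrite ev_cat !ev_scale mulNr => /eqP; rewrite subr_eq0 => /eqP e.
apply: contraTneq isT => e0; move: e; rewrite e0 mulr0 => /esym/eqP.
by rewrite mulf_eq0 (negbTE h0) (negbTE (prodm_exp_neq0 hv)).
Qed.

End Leading.

(** * Constancy along a line at z = rho *)

Section LineConstancy.
Variables (R : realType) (n : nat) (q lq : R[i]) (Phi : {fset 'cV[R]_n}).
Hypotheses (q_log : cexp lq = q) (q_nroot : forall k : nat, (0 < k)%N -> q ^+ k != 1).
Hypotheses (Phi_root : root_system Phi) (Phi_red : reduced Phi).
Local Notation V := 'cV[R]_n.
Local Notation C := R[i].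
Local Notation VC := 'cV[R[i]]_n.
Local Notation qpow := (qpow lq).
Implicit Types (a u v : V) (x z : VC) (mu nu : seq (C * V)) (y : C) (S : seq V).

Variable m : V -> nat.
Hypothesis m_inv : weyl_invariant Phi m.
Local Notation zono := (zono Phi m).
Local Notation rv := (rv Phi m).
Local Notation rr := (rr Phi m).
Local Notation yx := (yx lq).
Local Notation topc := (topc lq Phi m).

Variables (xi : V) (L : seq V) (c : V -> VC -> C).
Hypothesis bs : ba_sol lq Phi m xi L c.
Local Notation mu x := (mk L (c^~ x)).
Local Notation good := (good lq Phi L).

Variables (x0 : VC) (v : V).
Hypotheses (v_lat : lat Phi v) (v_reg : regular Phi v).
Hypothesis gx0 : good x0.
Hypothesis nocoinc : forall a b u1 u2 u3 u4 (i j : nat), a \in Phi -> b \in Phi ->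
  b != a -> b != - a -> dot a v = i%:R -> dot b v = j%:R ->
  u1 \in L -> u2 \in L -> u3 \in L -> u4 \in L -> (0 < i)%N -> (0 < j)%N ->
  (bb lq (yx x0 a) a u1 * bb lq (yx x0 a) a u2) ^+ j !=
  (bb lq (yx x0 b) b u3 * bb lq (yx x0 b) b u4) ^+ i.
Local Notation pt := (pt x0 v).
Local Notation slope := (slope v).
Local Notation along := (along q L c x0 v).

Local Notation dd := (dd Phi m xi v).
Local Notation Einf := (Einf lq).
Local Notation psiv := (psiv lq L c).

Lemma dd_dot : 2 * dot v (rr v) = dd%:R :> R.
Proof.
have absd a : a \in Phi -> `|dot v a| = (slope a)%:R.
  move=> aP; have [va|va] := ltP 0 (dot v a).
    by rewrite gtr0_norm // dotC (slopeE v_lat aP va).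
  have va' : 0 < dot v (- a) by rewrite dotNr oppr_gt0 lt_neqAle v_reg.
  rewrite -(slopeN v_lat aP) -(slopeE v_lat (neg_root Phi_root aP) va').
  by rewrite dotNl (dotC a v) ler0_norm.
rewrite dotZr dot_sumr.
have -> : \sum_(a <- Phi) dot v (((m a)%:R * Num.sg (dot v a)) *: a) =
    \sum_(a <- Phi) (m a * slope a)%:R :> R.
  rewrite !big_seq; apply: eq_bigr => a aP.
  by rewrite dotZr -mulrA -normrEsg absd // natrM.
rewrite (sum_root_half Phi_root (xi := xi)).
- by rewrite -natr_sum -mulr_natl; field.
- by move=> a aP; rewrite (mN Phi_root m_inv aP) (slopeN v_lat aP).
- by move=> a aP e; have := bs_reg bs aP; rewrite e eqxx.
Qed.

Lemma rrN : rr (- v) = - rr v.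
Proof.
rewrite /Submission.rr -scalerN -sumrN; congr (_ *: _); apply: eq_bigr => b _.
by rewrite dotNl sgrN mulrN scaleNr.
Qed.

Section Coefs.
Variables (G : {poly C}) (P : V -> {poly C}) (M : nat) (Bp : {poly C}).
Hypotheses (G0 : G != 0) (hG : forall k, G.[q ^+ k] != 0 -> good (pt k)).
Hypothesis hP : forall k, good (pt k) -> forall u, u \in L ->
  c u (pt k) * (q ^+ k) ^+ M = (P u).[q ^+ k].
Hypotheses (sB : size Bp = (2 * dd).+1)
  (hB : forall k, topc xi (pt k) * (q ^+ k) ^+ dd = Bp.[q ^+ k]) (dM : (dd <= M)%N).

Lemma rvL : rv xi \in L.
Proof.
apply/(bs_L bs); split; first exact: rv_zono.
exact: (rv_lat Phi_root Phi_red m_inv (bs_reg bs)).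
Qed.

Lemma top_poly : P (rv xi) = Bp * 'X^(M - dd).
Proof.
have e : P (rv xi) * 'X^dd - Bp * 'X^M = 0.
  apply: (poly_id q_log q_nroot G0) => k Gk.
  rewrite hornerD hornerN !hornerM !hornerXn -hB -hP ?rvL //; last exact: hG.
  by rewrite (bs_top bs) mulrAC subrr.
move/eqP: e; rewrite subr_eq0 -{1}(subnK dM) exprD mulrA => /eqP e.
by apply: (mulIf _ e); rewrite expf_neq0 // polyX_eq0.
Qed.

Lemma top_coef_out i : (i < M - dd)%N || (M + dd < i)%N -> (P (rv xi))`_i = 0.
Proof.
rewrite top_poly coefMXn => h; case: ltnP => // hi.
by apply: nth_default; rewrite sB; lia.
Qed.

Lemma top_coef_lead : (P (rv xi))`_(M + dd) != 0.
Proof.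
rewrite top_poly coefMXn ltnNge (leq_trans (leq_subr _ _) (leq_addr _ _)) /=.
have -> : (M + dd - (M - dd) = (size Bp).-1)%N by rewrite sB; lia.
by rewrite lead_coef_eq0 -size_poly_eq0 sB.
Qed.

Lemma al : along G P.
Proof. by move=> k Gk; exists ((q ^+ k) ^+ M) => u uL; rewrite -(hP (hG Gk) uL) mulrC. Qed.

Lemma epoly_coef a s F i : a \in Phi -> 0 < dot v a -> invariant_by (coroot a) F ->
  (1 <= s <= m a)%N -> \sum_(u <- L) F u * (bb lq (yx x0 a) a u ^+ s *
    (if (i < 2 * s * slope a)%N then 0 else (P u)`_(i - 2 * s * slope a)) -
    bb lq (yx x0 a) a u ^- s * (P u)`_i) = 0.
Proof.
move=> aP va pF hs.
have := epoly0 q_log q_nroot bs v_lat G0 al aP va pF hs.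
move/(congr1 (fun p : {poly C} => p`_i)); rewrite coef0 /epoly coef_sum => h.
rewrite -[RHS]h; apply: eq_bigr => u _.
rewrite coefZ; congr (_ * _); rewrite [in RHS]mulrBr coefB -scalerAr coefZ coefMXn.
by rewrite [in RHS](mulrC (P u)) coefCM.
Qed.

Notation Lam i := (mk L (fun u => (P u)`_i)).

Lemma cf_Lam i u : cf (Lam i) u = if u \in L then (P u)`_i else 0.
Proof. exact: cf_mk (bs_uniq bs). Qed.

Lemma Lam_zono i u : cf (Lam i) u != 0 -> zono u.
Proof.
rewrite cf_Lam; case: ifP => [uL _|]; last by rewrite eqxx.
by have /(bs_L bs)[] := uL.
Qed.

(** When no degree above i occurs, the coefficient of degree i + 2 s (a, v) in [epoly] involves only
    the terms b^s. *)
Lemma Einf_top i a : a \in Phi -> 0 < dot v a ->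
  (forall j u, (i < j)%N -> u \in L -> (P u)`_j = 0) -> Einf false (m a) (Lam i) a.
Proof.
move=> aP va h F s pF hs; rewrite expr0 ev_mk.
have s0 : (0 < 2 * s * slope a)%N.
  by rewrite !muln_gt0 (slope_gt0 v_lat aP va) andbT; case/andP: hs.
have y0 : yx x0 a ^+ s != 0 by rewrite expf_neq0 // yx_neq0.
apply: (mulfI y0); rewrite mulr0 -[RHS](epoly_coef (i + 2 * s * slope a) aP va pF hs).
rewrite mulr_sumr !big_seq; apply: eq_bigr => u uL.
have hij : (i < i + 2 * s * slope a)%N by rewrite -addn1 leq_add2l.
rewrite ltnNge leq_addl /= addnK (h _ _ hij uL).
by rewrite mulr0 subr0 mul1r /bb exprMn; ring.
Qed.

Lemma Einf_bot i a : a \in Phi -> 0 < dot v a ->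
  (forall j u, (j < i)%N -> u \in L -> (P u)`_j = 0) -> Einf true (m a) (Lam i) a.
Proof.
move=> aP va h F s pF hs; rewrite expr1 ev_mk.
have s0 : (0 < 2 * s * slope a)%N.
  by rewrite !muln_gt0 (slope_gt0 v_lat aP va) andbT; case/andP: hs.
have y0 : - (yx x0 a ^- s) != 0 by rewrite oppr_eq0 invr_eq0 expf_neq0 // yx_neq0.
apply: (mulfI y0); rewrite mulr0 -[RHS](epoly_coef i aP va pF hs).
rewrite mulr_sumr !big_seq; apply: eq_bigr => u uL.
have -> : (if (i < 2 * s * slope a)%N then 0 else (P u)`_(i - 2 * s * slope a)) = 0.
  by case: ltnP => // hi; apply: h => //; rewrite -subn_gt0 subKn.
rewrite mulr0 sub0r mulN1r qpowN /bb exprMn invfM exprVn; ring.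
Qed.

(** Descending induction from a degree beyond all sizes, k being the distance to it: the top
    coefficients solve the limit conditions in N and vanish at [rv xi], where the degree is known,
    hence vanish everywhere. *)
Lemma coef_high k i u : (M + dd < i)%N -> (\sum_(u <- L) size (P u) <= i + k)%N ->
  u \in L -> (P u)`_i = 0.
Proof.
elim: k i u => [|k IH] i u Mi hi uL.
  apply: nth_default; move: hi; rewrite addn0; apply: leq_trans.
  by rewrite (bigD1_seq u) ?(bs_uniq bs) //= leq_addr.
have h0 : forall u, cf (Lam i) u = 0.
  apply: (Einf_unique q_log q_nroot Phi_root Phi_red m_inv (bs_reg bs) v_reg (e := false)).
  - move=> a aP va; apply: Einf_top => // j w ij wL; apply: IH => //.
      by lia.
    by lia.
  - exact: Lam_zono.
  - by rewrite cf_Lam rvL top_coef_out // Mi orbT.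
by have := h0 u; rewrite cf_Lam uL.
Qed.

Lemma coef_low i u : (i < M - dd)%N -> u \in L -> (P u)`_i = 0.
Proof.
elim/ltn_ind: i u => i IH u Mi uL.
have h0 : forall u, cf (Lam i) u = 0.
  apply: (Einf_unique q_log q_nroot Phi_root Phi_red m_inv (bs_reg bs) v_reg (e := true)).
  - move=> a aP va; apply: Einf_bot => // j w ij wL; apply: IH => //.
    exact: ltn_trans Mi.
  - exact: Lam_zono.
  - by rewrite cf_Lam rvL top_coef_out // Mi.
by have := h0 u; rewrite cf_Lam uL.
Qed.

Let W (lam : V) : {poly C} := \sum_(u <- L) qpow (2 * dot u lam)%:C *: P u.

Lemma W_out lam i : (i < M - dd)%N || (M + dd < i)%N -> (W lam)`_i = 0.
Proof.
move=> h; rewrite coef_sum big_seq big1 // => u uL; rewrite coefZ.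
case/orP: h => h; first by rewrite coef_low ?mulr0.
by rewrite (coef_high (k := \sum_(u <- L) size (P u)) h) ?mulr0 // leq_addl.
Qed.

Lemma psiv_W k lam : good (pt k) -> psiv (pt k) (toC lam) * (q ^+ k) ^+ M =
  qpow (2 * dot x0 (toC lam)) * qpow (k%:R * (2 * dot v lam)%:C) * (W lam).[q ^+ k].
Proof.
move=> gk; rewrite /Submission.psiv ev_mk mulr_suml horner_sum mulr_sumr !big_seq.
apply: eq_bigr => u uL; rewrite hornerZ -hP //.
have -> : 2 * dot (pt k + toC u) (toC lam) =
    2 * dot x0 (toC lam) + k%:R * (2 * dot v lam)%:C + (2 * dot u lam)%:C.
  have vk : v *+ k = k%:R *: v :> V by rewrite scaler_nat.
  rewrite /Submission.pt !dotDl !dot_toC vk (dotZl k%:R v).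
  rewrite !rmorphM !rmorph_nat; ring.
rewrite !qpowD; ring.
Qed.

(** The values at rho and -rho agree; up to T^M and constants they are T^dd W1 and T^-dd W2, where
    both W have degrees between M - dd and M + dd. So A1 T^(2 dd) W1 = A2 W2 leaves only the degree
    M + dd, with nonzero coefficient by [leading_neq0]. *)
Lemma psiv_line : exists2 g0 : C, g0 != 0 & forall k, good (pt k) ->
  psiv (pt k) (toC (rr xi)) = g0.
Proof.
have q0 k : q ^+ k != 0 by rewrite expf_neq0 // (q_neq0 q_log).
have vN : regular Phi (- v) by move=> a aP; rewrite dotNl oppr_eq0 v_reg.
pose W1 := W (rr v); pose W2 := W (rr (- v)).
pose A1 := qpow (2 * dot x0 (toC (rr v))); pose A2 := qpow (2 * dot x0 (toC (rr (- v)))).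
have wk x eta : regular Phi eta -> psiv x (toC (rr xi)) = psiv x (toC (rr eta)).
  by move=> he; apply: (psi_walk Phi_root Phi_red m_inv bs _ (bs_reg bs) he).
have h1 k : good (pt k) -> psiv (pt k) (toC (rr xi)) * (q ^+ k) ^+ M =
    A1 * (q ^+ k) ^+ dd * W1.[q ^+ k].
  move=> gk; rewrite (wk _ _ v_reg) psiv_W // dd_dot -/A1 rmorph_nat.
  by rewrite qpow_natl (qpow_nat q_log) -!exprM mulnC.
have h2 k : good (pt k) -> psiv (pt k) (toC (rr xi)) * (q ^+ k) ^+ M * (q ^+ k) ^+ dd =
    A2 * W2.[q ^+ k].
  move=> gk; rewrite (wk _ _ vN) psiv_W // -/A2 -/W2 rrN dotNr mulrN dd_dot rmorphN rmorph_nat.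
  rewrite mulrN qpowN qpow_natl (qpow_nat q_log) -!exprM (mulnC dd).
  by rewrite mulrAC divfK // mulf_neq0 // expf_neq0 // (q_neq0 q_log).
have e : A1 *: (W1 * 'X^(2 * dd)) = A2 *: W2.
  apply/eqP; rewrite -subr_eq0; apply/eqP; apply: (poly_id q_log q_nroot G0) => k Gk.
  rewrite hornerD hornerN !hornerZ hornerM hornerXn -(h2 k (hG Gk)) (h1 k (hG Gk)) mul2n -addnn exprD.
  by rewrite !mulrA (mulrAC A1 W1.[q ^+ k]) subrr.
have A20 : A2 != 0 by apply: qpow_neq0.
have W2E : W2 = W2`_(M + dd) *: 'X^(M + dd).
  apply/polyP => i; rewrite coefZ coefXn; case: (ltngtP i (M + dd)%N) => hi.
  - rewrite mulr0; apply: (mulfI A20); rewrite mulr0 -coefZ -e coefZ coefMXn.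
    case: ltnP => h'; first by rewrite mulr0.
    by rewrite /W1 W_out ?mulr0 //; apply/orP; left; lia.
  - by rewrite mulr0 /W2 W_out // hi orbT.
  - by rewrite hi mulr1.
exists (A2 * W2`_(M + dd)).
  rewrite mulf_neq0 // /W2 coef_sum.
  have := leading_neq0 q_log q_nroot Phi_root Phi_red m_inv bs (mu := Lam (M + dd)) v_reg.
  rewrite ev_mk => h; apply: contra_neq (h _ _ _).
  - move=> h0; rewrite -[RHS]h0; apply: eq_bigr => u _.
    by rewrite coefZ mulrC.
  - move=> a aP va; apply: Einf_top => // j u hj uL.
    by apply: (coef_high (k := \sum_(u <- L) size (P u)) hj) => //; rewrite leq_addl.
  - exact: Lam_zono.
  - by rewrite cf_Lam rvL top_coef_lead.
move=> k gk; have t0 : (q ^+ k) ^+ (M + dd) != 0 by rewrite expf_neq0.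
apply: (mulIf t0); rewrite exprD mulrA h2 // -mulrA -exprD; congr (_ * _).
by rewrite [in LHS]W2E hornerZ hornerXn.
Qed.

End Coefs.

Lemma psiv_step a1 : a1 \in Phi -> good (x0 + toC v) ->
  psiv x0 (toC (rr xi)) != 0 /\ psiv (x0 + toC v) (toC (rr xi)) = psiv x0 (toC (rr xi)).
Proof.
move=> a1P g1.
have [G [P [M [G0 hG hP]]]] := laurent_line q_log q_nroot Phi_root Phi_red m_inv bs
  v_lat v_reg gx0 nocoinc a1P.
have [Bp [sB hB]] := degB_topc q_log Phi_root m xi x0 v_lat v_reg.
(* The extra factor ['X^dd] ensures that the exponent of T in the denominator is at least [dd]. *)
have [||g0 g00 hg] := psiv_line G0 hG (P := fun u => P u * 'X^dd) (M := (M + dd)%N) _ sB hB.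
- by move=> k gk u uL; rewrite hornerM hornerXn -hP // exprD mulrA.
- exact: leq_addl.
have e0 : pt 0 = x0 by rewrite /Submission.pt mulr0n toC0 addr0.
have e1 : pt 1 = x0 + toC v by rewrite /Submission.pt mulr1n.
by rewrite -e1 -{1 3}e0 !hg ?e0 ?e1.
Qed.

End LineConstancy.

(** * Constancy under all lattice shifts, generically *)

Section Constancy.
Variables (R : realType) (n : nat) (q lq : R[i]) (Phi : {fset 'cV[R]_n}).
Hypotheses (q_log : cexp lq = q) (q_nroot : forall k : nat, (0 < k)%N -> q ^+ k != 1).
Hypotheses (Phi_root : root_system Phi) (Phi_red : reduced Phi).
Local Notation V := 'cV[R]_n.
Local Notation C := R[i].
Local Notation VC := 'cV[R[i]]_n.
Local Notation qpow := (qpow lq).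
Implicit Types (a u v : V) (x z : VC) (mu nu : seq (C * V)) (y : C) (S : seq V).

Variable m : V -> nat.
Hypothesis m_inv : weyl_invariant Phi m.
Local Notation rr := (rr Phi m).
Local Notation yx := (yx lq).

Variables (xi : V) (L : seq V) (c : V -> VC -> C).
Hypothesis bs : ba_sol lq Phi m xi L c.
Local Notation mu x := (mk L (c^~ x)).
Local Notation good := (good lq Phi L).

Local Notation gen := (generically lq).
Local Notation psiv := (psiv lq L c).

Lemma two_root_neq0 a : a \in Phi -> 2 *: a != 0.
Proof. by move=> aP; rewrite scaler_eq0 pnatr_eq0 /= (root_neq0 Phi_root). Qed.

Lemma bb_key x a u : bb lq (yx x a) a u = qpow (dot a u)%:C * qpow (dot (toC a) x).
Proof. by rewrite /bb mulrC. Qed.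

Lemma gen_good : gen good.
Proof.
have h : gen (fun x => forall a, a \in Phi -> forall u, u \in L -> forall w, w \in L ->
    bb lq (yx x a) a u * bb lq (yx x a) a w != 1).
  apply: (gen_seq q_log q_nroot) => a aP; apply: (gen_seq q_log q_nroot) => u _; apply: (gen_seq q_log q_nroot) => w _.
  apply: gen_imp (gen_key q_log q_nroot (qpow (dot a u)%:C * qpow (dot a w)%:C) (two_root_neq0 aP)).
  move=> x hx; rewrite !bb_key mulrACA -expr2; move: hx.
  by rewrite toCZ dotZl rmorph_nat qpow_natl.
by apply: gen_imp h => x h a aP u w uL wL; apply: h.
Qed.

Definition noncoincident (v : V) x := forall a b u1 u2 u3 u4 (i j : nat), a \in Phi -> b \in Phi ->
  b != a -> b != - a -> dot a v = i%:R -> dot b v = j%:R ->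
  u1 \in L -> u2 \in L -> u3 \in L -> u4 \in L -> (0 < i)%N -> (0 < j)%N ->
  (bb lq (yx x a) a u1 * bb lq (yx x a) a u2) ^+ j !=
  (bb lq (yx x b) b u3 * bb lq (yx x b) b u4) ^+ i.

(** A coincidence prescribes the value of q^(w, x) for w = 2 j a - 2 i b, and w is nonzero because
    the roots are not proportional. *)
Lemma gen_noncoincident v : gen (noncoincident v).
Proof.
have h : gen (fun x => forall a, a \in Phi -> forall b, b \in Phi ->
   forall u1, u1 \in L -> forall u2, u2 \in L -> forall u3, u3 \in L -> forall u4, u4 \in L ->
   forall i j : nat, b != a -> b != - a -> dot a v = i%:R -> dot b v = j%:R ->
   (0 < i)%N -> (0 < j)%N -> (bb lq (yx x a) a u1 * bb lq (yx x a) a u2) ^+ j !=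
  (bb lq (yx x b) b u3 * bb lq (yx x b) b u4) ^+ i).
  apply: (gen_seq q_log q_nroot) => a aP; apply: (gen_seq q_log q_nroot) => b bP; apply: (gen_seq q_log q_nroot) => u1 _.
  apply: (gen_seq q_log q_nroot) => u2 _; apply: (gen_seq q_log q_nroot) => u3 _; apply: (gen_seq q_log q_nroot) => u4 _.
  have [[i [j [hi hj i0 j0]]]|hn] := pselect (exists i j : nat,
      [/\ dot a v = i%:R, dot b v = j%:R, (0 < i)%N & (0 < j)%N]); last first.
    by apply: gen_true => x i j _ _ h1 h2 h3 h4; exfalso; apply: hn; exists i, j.
  have [hb|hb] := boolP ((b != a) && (b != - a)); last first.
    by apply: gen_true => x i' j' h1 h2; rewrite h1 h2 in hb.
  have /andP[b1 b2] := hb.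
  pose w := (2 * j)%:R *: a - (2 * i)%:R *: b : V.
  have w0 : w != 0.
    rewrite subr_eq0 eq_sym; apply/eqP => e.
    have := root_noncol Phi_red aP bP b1 b2 e.
    by move/eqP; rewrite pnatr_eq0 muln_eq0 /= -leqn0 leqNgt i0.
  pose K1 := (qpow (dot a u1)%:C * qpow (dot a u2)%:C) ^+ j.
  pose K2 := (qpow (dot b u3)%:C * qpow (dot b u4)%:C) ^+ i.
  have K20 : K2 != 0 by rewrite expf_neq0 // mulf_neq0 ?qpow_neq0.
  apply: gen_imp (gen_key q_log q_nroot (K1 / K2) w0) => x hx i' j' _ _ hi' hj' _ _.
  have -> : i' = i by apply/eqP; rewrite -(eqr_nat R) -hi' hi.
  have -> : j' = j by apply/eqP; rewrite -(eqr_nat R) -hj' hj.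
  apply: contraNneq hx => e.
  rewrite toCB !toCZ dotBl !dotZl !rmorph_nat qpowB !qpow_natl.
  have E1 : (bb lq (yx x a) a u1 * bb lq (yx x a) a u2) ^+ j =
     K1 * qpow (dot (toC a) x) ^+ (2 * j).
    by rewrite !bb_key mulrACA -expr2 exprMn -exprM.
  have E2 : (bb lq (yx x b) b u3 * bb lq (yx x b) b u4) ^+ i =
     K2 * qpow (dot (toC b) x) ^+ (2 * i).
    by rewrite !bb_key mulrACA -expr2 exprMn -exprM.
  by rewrite E1 E2 in e; rewrite mulrACA e -invfM divff // mulf_neq0 // expf_neq0 // qpow_neq0.
by apply: gen_imp h => x h a b u1 u2 u3 u4 i j aP bP b1 b2 hi hj h1 h2 h3 h4; apply: h.
Qed.

(** A nonzero pairing of a lattice vector with a root has absolute value at least 1, so a large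
    multiple of v outweighs w. *)
Lemma lat_combine (v w : V) (s : seq V) : lat Phi v -> {subset s <= Phi} ->
  (forall a, a \in s -> dot v a != 0) ->
  exists N : nat, (0 < N)%N /\ forall a, a \in s -> dot (v *+ N + w) a != 0.
Proof.
move=> lv sP hv.
pose B := \sum_(a <- s) `|dot w a|; have B0 : 0 <= B by apply: sumr_ge0.
exists (Num.truncn B).+1; split => // a sa.
have aB : `|dot w a| <= B.
  rewrite /B (big_rem a) //= lerDl; apply: sumr_ge0 => ? _; exact: normr_ge0.
have ha : 1 <= `|dot v a|.
  have /intrP[j hj] := lv a (sP _ sa); have := hv a sa; rewrite hj intr_eq0 -intr_norm ler1z.
  by lia.
apply/negP => /eqP; rewrite dotDl -scaler_nat dotZl => /eqP; rewrite addr_eq0 => /eqP e.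
have : `|(Num.truncn B).+1%:R * dot v a| <= B by rewrite e normrN.
rewrite normrM normr_nat => h.
have h2 : (Num.truncn B).+1%:R <= B.
  by apply: le_trans h; rewrite ler_peMr.
by have := truncnS_gt B; rewrite ltNge h2.
Qed.

Lemma lat_regular : exists v, lat Phi v /\ regular Phi v.
Proof.
suff h (s : seq V) : {subset s <= Phi} -> exists v, lat Phi v /\ forall a, a \in s -> dot v a != 0.
  by have [v [h1 h2]] := h Phi (fun a h => h); exists v.
elim: s => [_|b s IH hs]; first by exists 0; split => //; apply: lat0.
have sP : {subset s <= Phi} by move=> a h; apply: hs; rewrite inE h orbT.
have bP : b \in Phi by apply: hs; rewrite mem_head.
have [v [lv hv]] := IH sP.
have [vb|vb] := eqVneq (dot v b) 0; last first.
  by exists v; split => // a; rewrite inE => /orP[/eqP->|/hv].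
have [N [_ hN]] := lat_combine (coroot b) lv sP hv.
exists (v *+ N + coroot b); split.
  apply: latD; last exact: (lat_coroot Phi_root).
  by rewrite pmulrn; apply: latMz.
move=> a; rewrite inE => /orP[/eqP->|/hN //].
by rewrite dotDl -scaler_nat (dotZl N%:R v) vb mulr0 add0r (coroot_dot Phi_root) // pnatr_eq0.
Qed.

Hypothesis Phi_ne : exists a, a \in Phi.

Lemma psiv_neq0 : gen (fun x => psiv x (toC (rr xi)) != 0).
Proof.
have [a aP] := Phi_ne; have [v [lv rv_]] := lat_regular.
apply: (gen_imp2 q_log q_nroot _ (gen_and q_log q_nroot gen_good (gen_shift v gen_good)) (gen_noncoincident v)) => x [h1 h2] h3.
by have [] := psiv_step q_log q_nroot Phi_root Phi_red m_inv bs lv rv_ h1 h3 aP h2.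
Qed.

(** The line argument needs a regular direction; t is the difference of N v + t and N v, both
    regular for suitable N. *)
Lemma psiv_const (t : V) : lat Phi t ->
  gen (fun x => psiv (x + toC t) (toC (rr xi)) = psiv x (toC (rr xi))).
Proof.
move=> lt; have [a aP] := Phi_ne; have [v [lv rv_]] := lat_regular.
have reg (w : V) : lat Phi w -> regular Phi w ->
    gen (fun x => psiv (x + toC w) (toC (rr xi)) = psiv x (toC (rr xi))).
  move=> lw rw.
  apply: (gen_imp2 q_log q_nroot _ (gen_and q_log q_nroot gen_good (gen_shift w gen_good)) (gen_noncoincident w)) => x [h1 h2] h3.
  by have [] := psiv_step q_log q_nroot Phi_root Phi_red m_inv bs lw rw h1 h3 aP h2.
have [N [N0 hN]] := lat_combine t lv (fun a h => h) rv_.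
have lN : lat Phi (v *+ N) by rewrite pmulrn; apply: latMz.
have g1 := reg _ (latD lN lt) hN.
have g2 := gen_shift t (reg _ lN _).
apply: (gen_imp2 q_log q_nroot _ g1 (g2 _)).
  by move=> x; rewrite toCD (addrC (toC (v *+ N))) addrA => -> ->.
move=> b bP; rewrite -scaler_nat (dotZl N%:R v) mulf_neq0 ?rv_ // pnatr_eq0.
by rewrite -lt0n.
Qed.

End Constancy.

(** * Shifted Baker-Akhiezer functions *)

Section Spanning.
Variables (R : realType) (n : nat) (q lq : R[i]) (Phi : {fset 'cV[R]_n}).
Hypotheses (q_log : cexp lq = q) (q_nroot : forall k : nat, (0 < k)%N -> q ^+ k != 1).
Hypotheses (Phi_root : root_system Phi) (Phi_red : reduced Phi).
Local Notation V := 'cV[R]_n.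
Local Notation C := R[i].
Local Notation VC := 'cV[R[i]]_n.
Implicit Types (a u v : V) (x z : VC) (mu nu : seq (C * V)) (y : C) (S : seq V).

Variable m : V -> nat.
Hypothesis m_inv : weyl_invariant Phi m.
Local Notation Hz := (Hz Phi m).
Local Notation rv := (rv Phi m).
Local Notation yx := (yx lq).
Local Notation Eat := (Eat lq).
Local Notation topc := (topc lq Phi m).

Variables (xi : V) (L : seq V) (c : V -> VC -> C).
Hypothesis bs : ba_sol lq Phi m xi L c.
Local Notation mu x := (mk L (c^~ x)).
Local Notation good := (good lq Phi L).

Local Notation Qv := (coroot_lattice Phi).
Local Notation hullf := (@hullf R n).

Lemma dot_bound (A : seq V) : exists B : R, forall u a, u \in A -> a \in Phi -> `|dot u a| <= B.
Proof.
exists (\sum_(u <- A) \sum_(a <- Phi) `|dot u a|) => u a uA aP.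
rewrite (big_rem u) //= (big_rem a) //= -addrA lerDl addr_ge0 //.
  by apply: sumr_ge0 => ? _; exact: normr_ge0.
by apply: sumr_ge0 => ? _; apply: sumr_ge0 => ? _; exact: normr_ge0.
Qed.

Lemma region_list (A : seq V) (Q : V -> Prop) : exists s : seq V, uniq s /\
  forall u, (u \in s) <-> [/\ lat Phi u, region Phi m A u & Q u].
Proof.
have [B hB] := dot_bound A.
apply: finite_enum; apply: sub_finite_set (lattice_finite Phi_root (B + \sum_(a <- Phi) Hz a)).
move=> u [lu ru _]; split => // a aP.
apply: le_trans (region_bound ru (fun w wA => hB w a wA aP)) _.
rewrite lerD2l (big_rem a) //= lerDl; apply: sumr_ge0 => b _; exact: Hz_ge0.
Qed.

Lemma hull_sub_region (A : seq V) u : hullf A u -> region Phi m A u.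
Proof.
move=> h eta; have [w wA hw] := h eta; exists w => //.
by apply: le_trans hw _; rewrite lerDl Hz_ge0.
Qed.

Lemma hull_list (A : seq V) (Q : V -> Prop) : exists s : seq V, uniq s /\
  forall u, (u \in s) <-> [/\ lat Phi u, hullf A u & Q u].
Proof.
have [s [us hs]] := region_list A (fun u => hullf A u /\ Q u).
exists s; split => // u; rewrite hs; split; first by move=> [? _ []].
by move=> [? h ?]; split => //; apply: hull_sub_region.
Qed.

Lemma c_top_le u x : c u x != 0 -> dot xi u <= Hz xi /\ (dot xi u = Hz xi -> u = rv xi).
Proof.
move=> /(c_zono bs) hu; split; first exact: zono_le.
by move=> e; apply: zono_vertex hu e => //; exact: (bs_reg bs).
Qed.

Section Peel.
Variables (x : VC) (A : seq V) (kap : V) (Om N : seq V).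
Hypothesis hOm : forall u, (u \in Om) <-> [/\ lat Phi u, region Phi m A u & Qv (u - kap)].
Hypothesis hN : forall u, lat Phi u -> hullf A u -> Qv (u - (kap - rv xi)) -> u \in N.
Hypothesis uN : uniq N.
Hypothesis hres : forall a, a \in Phi -> nonres lq Om (yx x a) a.
Hypothesis hgood : forall u, u \in N -> good (x + toC u) /\ topc xi (x + toC u) != 0.

Lemma c_shift_Om (v u : V) : v \in N -> hullf A v -> Qv (v - (kap - rv xi)) -> lat Phi v ->
  c (u - v) (x + toC v) != 0 -> u \in Om.
Proof.
move=> vN hv qv lv cu; have [gv _] := hgood vN.
have /(bs_L bs)[zu lu] := c_in bs cu.
apply/hOm; split.
- by rewrite -[u](subrK v); apply: latD.
- by rewrite -[u](subrK v) addrC; apply: hull_region.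
have := coset_support q_log q_nroot Phi_root Phi_red m_inv bs gv cu.
move=> h; have := QvD h qv; congr Qv; move: (rv xi) => r.
by apply/matrixP => i j; rewrite !mxE; ring.
Qed.

(** S lists the points not yet cleared, highest first. If the top point p carries a coefficient, it
    is v + [rv xi] with v in the hull by [span_top], and a multiple of the shift by v removes it. A
    new support point outside S would be at least as high as p; the shifted copy of N has a unique
    highest point, so it would be p. *)
Lemma peel S nu : sorted (fun u v => dot xi v <= dot xi u) S -> uniq S -> {subset S <= Om} ->
  (forall w, w \in Om -> w \notin S -> forall p, p \in S -> dot xi p <= dot xi w) ->
  (forall u, cf nu u != 0 -> u \in S) ->
  (forall a, a \in Phi -> Eat (m a) (yx x a) nu a) ->
  exists d : V -> C, forall u, cf nu u = \sum_(v <- N) d v * c (u - v) (x + toC v).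
Proof.
elim: S nu => [|p S IH] nu sS uS sub hw hnu hE.
  exists (fun=> 0) => u; rewrite big1 => [|v _]; last by rewrite mul0r.
  by apply/eqP; apply: contraT => /hnu.
have tr : transitive (fun u v : V => dot xi v <= dot xi u) by move=> b a d h1 h2; apply: le_trans h1.
have pS u : u \in S -> dot xi u <= dot xi p.
  by move: sS; rewrite /= path_sortedE // => /andP[/allP h _] /h.
have sS' := path_sorted sS; have /andP[pnS uS'] := uS.
have sub' : {subset S <= Om} by move=> w h; apply: sub; rewrite inE h orbT.
have hw' w : w \in Om -> w \notin S -> forall r, r \in S -> dot xi r <= dot xi w.
  move=> wO wS r rS; have [->|wp] := eqVneq w p; first exact: pS.
  by apply: hw => //; rewrite inE ?rS ?orbT // negb_or wp.
have [p0|p0] := eqVneq (cf nu p) 0.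
  apply: (IH nu) => // u hu; have := hnu u hu; rewrite inE => /orP[/eqP e|//].
  by rewrite e p0 eqxx in hu.
have pO : p \in Om by apply: sub; rewrite mem_head.
have /hOm[lp rp qp] := pO.
pose v := p - rv xi.
have lv : lat Phi v by apply: latB => //; apply: (rv_lat Phi_root Phi_red m_inv (bs_reg bs)).
have suppOm u : u \in msupp nu -> u \in Om by rewrite mem_msupp => /hnu /sub.
have hv : hullf A v.
  apply: (span_top Phi_root Phi_red m_inv (P := msupp nu) (bs_reg bs)).
  - move=> a aP _; apply: node_edges; apply: (Eat_node q_log q_nroot Phi_root aP (yx_neq0 lq x a)).
      by move=> u1 u2 h1 h2; apply: (hres aP); apply: suppOm.
    exact: hE.
  - by move=> p' /suppOm /hOm[].
  - by rewrite mem_msupp.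
  - move=> p'; rewrite mem_msupp => /hnu; rewrite inE => /orP[/eqP->//|].
    exact: pS.
have qv : Qv (v - (kap - rv xi)).
  by rewrite /v opprB addrA subrK.
have vN : v \in N by apply: hN.
have [gv tv] := hgood vN.
pose e := cf nu p / topc xi (x + toC v).
pose nu' := nu ++ mZ (- e) (mshift v (mu (x + toC v))).
have cfnu' u : cf nu' u = cf nu u - e * c (u - v) (x + toC v).
  by rewrite cf_cat cf_scale cf_shift (cf_mu bs) mulNr.
have nu'p : cf nu' p = 0.
  have pv : p - v = rv xi by rewrite /v opprB addrC subrK.
  by rewrite cfnu' pv (bs_top bs) /e divfK ?subrr.
have [||d hd] := IH nu' sS' uS' sub' hw'.
- move=> u hu; have up : u != p by apply: contraNneq hu => ->; rewrite nu'p.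
  have [uO cu] : u \in Om /\ (u \notin p :: S -> c (u - v) (x + toC v) != 0).
    have [h|h] := eqVneq (cf nu u) 0; last first.
      by split; [apply: sub; apply: hnu | move: (hnu u h) => ->].
    have cu : c (u - v) (x + toC v) != 0.
      apply: contraNneq hu => h'; by rewrite cfnu' h h' mulr0 subr0.
    by split => //; apply: c_shift_Om cu.
  apply: contraT => uS1.
  have unS : u \notin p :: S by rewrite inE negb_or up.
  have [h1 h2] := c_top_le (cu unS).
  have h3 := hw u uO unS p (mem_head _ _).
  have h4 : dot xi (u - v) = Hz xi.
    apply/eqP; rewrite eq_le h1 /=.
    have -> : dot xi (u - v) = dot xi u - dot xi p + Hz xi.
      by rewrite /v !dotBr (dot_rv_self Phi_root); ring.
    lra.
  have := h2 h4; rewrite /v opprB addrC -{2}[rv xi]addr0 -addrA => /addrI /eqP.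
  by rewrite addrC subr_eq0 (negbTE up).
- move=> a aP; apply: Eat_cat; first exact: hE.
  by apply: Eat_scale; apply: Eat_shift; apply: (bs_E bs).
exists (fun w => d w + e * (w == v)%:R) => u.
under eq_bigr => w _ do rewrite mulrDl.
rewrite big_split /= -hd cfnu' (bigD1_seq v) //= eqxx mulr1 big1 ?addr0 ?subrK //.
by move=> w /negbTE ->; rewrite mulr0 mul0r.
Qed.

Lemma spanning nu : uniq Om -> (forall u, cf nu u != 0 -> u \in Om) ->
  (forall a, a \in Phi -> Eat (m a) (yx x a) nu a) ->
  exists d : V -> C, forall u, cf nu u = \sum_(v <- N) d v * c (u - v) (x + toC v).
Proof.
move=> uOm hnu hE; pose le := fun u v : V => dot xi v <= dot xi u.
have perm : perm_eq (sort le Om) Om by apply/permPl; apply: perm_sort.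
have tot : total le by move=> u v; apply: le_total.
apply: (@peel (sort le Om) nu) => //.
- exact: sort_sorted.
- by rewrite (perm_uniq perm).
- by move=> u; rewrite (perm_mem perm).
- by move=> w wO; rewrite (perm_mem perm) wO.
- by move=> u hu; rewrite (perm_mem perm) hnu.
Qed.

(** Among the shifts with nonzero coefficient take one that is highest for xi: no other reaches its
    top vertex. *)
Lemma shift_free (d : V -> C) :
  (forall u, \sum_(v <- N) d v * c (u - v) (x + toC v) = 0) -> forall v, v \in N -> d v = 0.
Proof.
move=> h v vN; apply/eqP; apply: contraT => dv.
have vS : v \in [seq v <- N | d v != 0] by rewrite mem_filter dv.
have [p] := seq_argmax (dot xi) vS; rewrite mem_filter => /andP[dp pN] hp.
have := h (p + rv xi); rewrite (bigD1_seq p) //= big_seq_cond big1 ?addr0.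
  rewrite addrAC subrr add0r (bs_top bs) => /eqP.
  by rewrite mulf_eq0 (negbTE dp) /= (negbTE (hgood pN).2).
move=> w /andP[wN wp]; have [->|dw] := eqVneq (d w) 0; first by rewrite mul0r.
have [->|cw] := eqVneq (c (p + rv xi - w) (x + toC w)) 0; first by rewrite mulr0.
have [h1 h2] := c_top_le cw.
have h3 : dot xi w <= dot xi p by apply: hp; rewrite mem_filter dw.
have h4 : dot xi (p + rv xi - w) = Hz xi.
  apply/eqP; rewrite eq_le h1 /=.
  have -> : dot xi (p + rv xi - w) = dot xi p + Hz xi - dot xi w.
    by rewrite dotBr dotDr dot_rv_self.
  lra.
move: (h2 h4); rewrite addrAC -[X in _ = X]add0r => /addIr /eqP.
by rewrite subr_eq0 eq_sym (negbTE wp).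
Qed.

End Peel.

End Spanning.

(** * Macdonald operators *)

Section Orbit.
Variables (R : realType) (n : nat) (q lq : R[i]) (Phi : {fset 'cV[R]_n}).
Hypotheses (q_log : cexp lq = q) (q_nroot : forall k : nat, (0 < k)%N -> q ^+ k != 1).
Hypotheses (Phi_root : root_system Phi) (Phi_red : reduced Phi).
Local Notation V := 'cV[R]_n.
Local Notation C := R[i].
Local Notation VC := 'cV[R[i]]_n.
Local Notation qpow := (qpow lq).
Implicit Types (a u v : V) (x z : VC) (mu nu : seq (C * V)) (y : C) (S : seq V).

Local Notation Eat := (Eat lq).

Local Notation Qv := (coroot_lattice Phi).
Local Notation hullf := (@hullf R n).
Local Notation orbit := (weyl_orbit Phi).

Lemma weyl_Qv w u : weyl Phi w -> lat Phi u -> Qv (w *m u - u).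
Proof.
move=> hw lu; elim: hw => [|a w' aP hw' IH]; first by rewrite mul1mx subrr; apply: Qv0.
have lw := lat_weyl Phi_root hw' lu.
rewrite -mulmxA reflE' addrAC; apply: QvD => //.
have /intrP[j ->] := lw a aP.
by rewrite scaler_int; apply: QvN; apply: QvMz; apply: Qv_coroot.
Qed.

Lemma orbit_lat t u : lat Phi t -> orbit t u -> lat Phi u.
Proof. by move=> lt [w hw ->]; apply: lat_weyl. Qed.

Lemma orbit_weyl w t u : weyl Phi w -> orbit t u -> orbit t (w *m u).
Proof. by move=> hw [w' hw' ->]; exists (w *m w'); [apply: weyl_mul | rewrite mulmxA]. Qed.

Lemma orbit_self t : orbit t t.
Proof. by exists 1%:M; [exact: weyl_1 | rewrite mul1mx]. Qed.

Lemma orbit_norm t u : orbit t u -> dot u u = dot t t.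
Proof. by move=> [w hw ->]; rewrite (dot_weyl Phi_root). Qed.

Lemma orbit_list t : lat Phi t -> exists O : seq V, uniq O /\ forall u, (u \in O) <-> orbit t u.
Proof.
move=> lt; apply: finite_enum.
have B0 : 0 <= \sum_(b <- Phi) `|dot t b| by apply: sumr_ge0.
apply: sub_finite_set (lattice_finite Phi_root (\sum_(b <- Phi) `|dot t b|)).
move=> u hu; split; first exact: orbit_lat hu.
move=> a aP; have [w hw ->] := hu.
have [w' [hw' _ e']] := weyl_inv Phi_root hw.
have bP := weyl_root Phi_root hw' aP.
have -> : dot (w *m t) a = dot t (w' *m a).
  by rewrite -(dot_weyl Phi_root _ _ hw') mulmxA e' mul1mx.
by rewrite (big_rem _ bP) /= lerDl; apply: sumr_ge0.
Qed.

Lemma coroot_coroot (a : V) : a != 0 -> coroot (coroot a) = a.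
Proof.
move=> a0; have h := dot_gt0 a0.
rewrite (corootE (coroot a)) !corootE (dotZl (2 / dot a a)) (dotZr (2 / dot a a)) scalerA -[RHS]scale1r; congr (_ *: _).
by field; rewrite gt_eqF.
Qed.

Section Min.
Variables (varpi : V) (O : seq V).
Hypothesis hmin : quasi_or_minuscule Phi varpi.
Hypothesis hO : forall u, (u \in O) <-> orbit varpi u.

Lemma min_lat : lat Phi varpi.
Proof.
have [_ [[/in_coweight//]|[[a aP ->] _]]] := hmin; exact: lat_coroot.
Qed.

Lemma orbit_dot u a : orbit varpi u -> a \in Phi -> exists2 b, b \in Phi & dot u a = dot varpi b /\
  exists2 w, weyl Phi w & u = w *m varpi /\ a = w *m b.
Proof.
move=> [w hw ->] aP; have [w' [hw' e e']] := weyl_inv Phi_root hw.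
exists (w' *m a); first exact: weyl_root.
split; first by rewrite -(dot_weyl Phi_root _ _ hw') mulmxA e' mul1mx.
by exists w => //; rewrite mulmxA e mul1mx.
Qed.

Lemma orbit_root_bound u a : orbit varpi u -> a \in Phi ->
  dot u a <= 2 /\ (1 < dot u a -> u = coroot a).
Proof.
move=> hu aP; have [b bP [-> [w hw [-> ->]]]] := orbit_dot hu aP.
have [_ [[_ h]|[[c0 cP e] h]]] := hmin.
  have h1 : dot varpi b <= 1 by apply: le_trans (h b bP); apply: ler_norm.
  by split; [apply: le_trans h1 _; rewrite ler1n | rewrite ltNge h1].
have cc : coroot varpi = c0 by rewrite e coroot_coroot // (root_neq0 Phi_root).
rewrite cc in h.
have [->|b1] := eqVneq b c0.
  by rewrite (coroot_weyl Phi_root) // e (coroot_dot Phi_root).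
have [->|b2] := eqVneq b (- c0).
  rewrite dotNr e (coroot_dot Phi_root) //.
  by split; [rewrite (@le_trans _ _ 0) // oppr_le0 | rewrite ltNge (@le_trans _ _ 0) // oppr_le0].
have h1 : dot varpi b <= 1 by apply: le_trans (h b bP b1 b2); apply: ler_norm.
by split; [apply: le_trans h1 _; rewrite ler1n | rewrite ltNge h1].
Qed.

(** If some (u, a) is 2, comparing norms with the longest vectors of the hull gives u = a^vee.
    Otherwise all (u, a) lie in [-1, 1] and [min_orbit] applies, from varpi in the minuscule case
    and from 0 in the quasiminuscule one. *)
Lemma hull_orbit u : lat Phi u -> hullf O u -> Qv (u - varpi) -> orbit varpi u \/ u = 0.
Proof.
move=> lu hu qu.
have b2 a : a \in Phi -> dot u a <= 2.
  move=> aP; have [t /hO tO ht] := hu a.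
  by rewrite dotC (le_trans ht) // dotC; have [] := orbit_root_bound tO aP.
have int a : a \in Phi -> 1 < dot u a -> dot u a = 2.
  move=> aP; have := b2 a aP; have /intrP[j ->] := lu a aP.
  by rewrite ltr1z (_ : 2 = 2%:~R) // ler_int => h1 h2; congr _%:~R; lia.
case: (pselect (exists2 a, a \in Phi & 1 < dot u a)) => [[a aP h1]|hn].
  left; have e2 := int a aP h1.
  have [t /hO tO ht] := hu a.
  have ta : t = coroot a.
    by apply: (orbit_root_bound tO aP).2; rewrite dotC (lt_le_trans _ ht) // dotC.
  have [t' /hO tO' ht'] := hu u.
  suff -> : u = coroot a by rewrite -ta.
  apply/eqP; rewrite -subr_eq0 -dot_eq0 eq_le dot_ge0 andbT.
  have n1 : dot u u <= dot (coroot a) (coroot a).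
    rewrite -ta (orbit_norm tO) -(orbit_norm tO').
    have := dot_ge0 (u - t'); rewrite dotBl !dotBr (dotC t' u) => h3; lra.
  have n2 : dot u (coroot a) = dot (coroot a) (coroot a).
    by rewrite corootE !(dotZr (2 / dot a a)) (dotZl (2 / dot a a)) e2; field; rewrite gt_eqF // (root_dot_gt0 Phi_root).
  by rewrite dotBl !dotBr (dotC (coroot a) u) n2; lra.
have b1 a : a \in Phi -> dot u a <= 1.
  by move=> aP; rewrite leNgt; apply/negP => h; apply: hn; exists a.
have bm1 a : a \in Phi -> -1 <= dot u a.
  move=> aP; have := b1 _ (neg_root Phi_root aP).
  by rewrite dotNr lerNl.
have [_ [[_ h]|[[c0 cP e] h]]] := hmin.
  left; have qu' : Qv (varpi - u) by rewrite -opprB; apply: QvN.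
  have [[w hw ->] _] := min_orbit Phi_root qu'
    (fun a aP => le_trans (ler_norm _) (h a aP)) bm1.
  by exists w.
right; have [||[w hw ->] _] := min_orbit Phi_root (varpi := 0) (nu := u) _ _ bm1.
- rewrite sub0r; apply: QvN; rewrite -[u](subrK varpi); apply: QvD => //.
  by rewrite e; apply: Qv_coroot.
- by move=> a _; rewrite dot0l.
by rewrite mulmx0.
Qed.

(** Vectors of one orbit have equal length, so the form t is strictly maximal at t, also against 0;
    a generic perturbation preserves this. *)
Lemma orbit_sep (N : seq V) t : orbit varpi t -> (forall u, u \in N -> orbit varpi u \/ u = 0) ->
  exists xi1, regular Phi xi1 /\ forall u, u \in N -> u != t -> dot xi1 u < dot xi1 t.
Proof.
move=> tO hN.
have t0 : t != 0.
  apply: contra_neq hmin.1 => e; have [w hw] := tO.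
  rewrite e => h; apply: (weyl_inj Phi_root hw).
  by rewrite -h mulmx0.
have [|a /(root_neq0 Phi_root)//|xi1 [h1 h2]] := @perturb_generic R n t [seq u - t | u <- [seq u <- N | u != t]] Phi.
  move=> y /mapP[u]; rewrite mem_filter => /andP[ut uN] ->.
  have [hu|->] := hN u uN; last by rewrite sub0r dotNr oppr_lt0 dot_gt0.
  have h : 0 < dot (u - t) (u - t) by apply: dot_gt0; rewrite subr_eq0.
  move: h; rewrite dotBl !dotBr (orbit_norm hu) (orbit_norm tO) (dotC t u) => h; lra.
exists xi1; split => // u uN ut; rewrite -subr_lt0 -dotBr; apply: h1.
by apply/mapP; exists u => //; rewrite mem_filter ut.
Qed.

End Min.

Lemma refl_perm (O : seq V) (t : V) a (K : nmodType) (F : V -> K) : uniq O -> (forall u, (u \in O) <-> orbit t u) ->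
  a \in Phi -> \sum_(u <- O) F (refl a *m u) = \sum_(u <- O) F u.
Proof.
move=> uO hO aP; rewrite -(big_map (fun u => refl a *m u) xpredT F).
apply: perm_big; apply: uniq_perm => //.
  by rewrite map_inj_uniq // => u w e; move/(congr1 (mulmx (refl a))): e; rewrite !(refl_invol Phi_root).
move=> u; apply/mapP/idP => [[w /hO hw ->]|/hO hu].
  by apply/hO; apply: orbit_weyl => //; apply: weyl_refl1.
exists (refl a *m u); last by rewrite (refl_invol Phi_root).
by apply/hO; apply: orbit_weyl => //; apply: weyl_refl1.
Qed.

(** Multiplication by f(z) preserves the conditions: replacing u by its reflection inverts q^(a, u)
    and leaves F(v + u) unchanged, the difference being a multiple of a^vee. Averaging the two terms
    makes b^s - b^-s a factor. *)
Lemma Eat_orbit (O : seq V) (t : V) k y mu a : uniq O -> (forall u, (u \in O) <-> orbit t u) ->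
  lat Phi t -> a \in Phi -> y != 0 ->
  Eat k y mu a -> Eat k y (flatten [seq mshift u mu | u <- O]) a.
Proof.
move=> uO hO lt aP y0 hE F s pF hs; rewrite ev_flatten.
pose tt u := qpow (dot a u)%:C ^+ s.
have tt0 u : tt u != 0 by rewrite expf_neq0 ?qpow_neq0.
pose G v u := (bb lq y a v ^+ s * tt u - bb lq y a v ^- s / tt u) * F (v + u).
have e1 u : ev (mshift u mu) (fun u => (bb lq y a u ^+ s - bb lq y a u ^- s) * F u) =
    ev mu (fun v => G v u).
  rewrite ev_shift; apply: eq_ev => v; rewrite /G.
  have -> : bb lq y a (v + u) = bb lq y a v * qpow (dot a u)%:C.
    by rewrite /bb dotDr rmorphD qpowD mulrA.
  by rewrite exprMn invfM.
under eq_bigr => u _ do rewrite e1.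
rewrite -ev_sum.
have e2 v : \sum_(u <- O) G v u =
    \sum_(u <- O) 2^-1 * (tt u + (tt u)^-1) * ((bb lq y a v ^+ s - bb lq y a v ^- s) * F (v + u)).
  have h : \sum_(u <- O) G v u + \sum_(u <- O) G v (refl a *m u) =
      \sum_(u <- O) (tt u + (tt u)^-1) * ((bb lq y a v ^+ s - bb lq y a v ^- s) * F (v + u)).
    rewrite -big_split /= !big_seq; apply: eq_bigr => u /hO hu.
    have /intrP[j hj] := orbit_lat lt hu aP.
    have eF : F (v + refl a *m u) = F (v + u).
      rewrite reflE' hj scaler_int -mulrNz addrA; exact: periodicz.
    have et : tt (refl a *m u) = (tt u)^-1.
      rewrite /tt dotC (dot_refl_adj Phi_root) // reflE (coroot_dotr Phi_root aP).
      rewrite (_ : a - 2 *: a = - a); last by rewrite scaler_nat mulr2n opprD addNKr; rewrite ?addrA ?subrr ?sub0r.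
      by rewrite dotNr dotC rmorphN qpowN exprVn.
    by rewrite /G eF et invrK; ring.
  rewrite (refl_perm _ uO hO aP) -mulr2n -mulr_natl in h.
  have n2 : (2%:R : C) != 0 by rewrite pnatr_eq0.
  apply: (mulfI n2); rewrite h mulr_sumr; apply: eq_bigr => u _.
  by rewrite !mulrA (mulfV n2) mul1r.
rewrite (eq_ev _ e2) ev_sum big1_seq // => u _; rewrite evZ.
rewrite (hE (fun v => F (v + u)) s) ?mulr0 // => v.
by rewrite addrAC pF.
Qed.

End Orbit.

Section Eigen.
Variables (R : realType) (n : nat) (q lq : R[i]) (Phi : {fset 'cV[R]_n}).
Hypotheses (q_log : cexp lq = q) (q_nroot : forall k : nat, (0 < k)%N -> q ^+ k != 1).
Hypotheses (Phi_root : root_system Phi) (Phi_red : reduced Phi).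
Local Notation V := 'cV[R]_n.
Local Notation C := R[i].
Local Notation VC := 'cV[R[i]]_n.
Local Notation qpow := (qpow lq).
Local Notation qbr := (qbr lq).
Implicit Types (a u v : V) (x z : VC) (mu nu : seq (C * V)) (y : C) (S : seq V).

Variable m : V -> nat.
Hypothesis m_inv : weyl_invariant Phi m.
Local Notation rv := (rv Phi m).
Local Notation rr := (rr Phi m).
Local Notation yx := (yx lq).
Local Notation topc := (topc lq Phi m).

Variables (xi : V) (L : seq V) (c : V -> VC -> C).
Hypothesis bs : ba_sol lq Phi m xi L c.
Local Notation mu x := (mk L (c^~ x)).
Local Notation good := (good lq Phi L).

Local Notation Qv := (coroot_lattice Phi).
Local Notation hullf := (@hullf R n).
Local Notation orbit := (weyl_orbit Phi).
Local Notation gen := (generically lq).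
Local Notation psiv := (psiv lq L c).

(** The factor of one root in the vertex coefficient. Its ratio under X -> X + 1 telescopes to one
    factor of the Macdonald coefficient. *)
Definition qfall (k : nat) (X : C) := \prod_(1 <= j < k.+1) qbr (j%:R - X).

Lemma qfall_shift k (X : C) : qbr X != 0 ->
  qfall k X = qbr (X - k%:R) / qbr X * qfall k (X + 1).
Proof.
move=> X0; rewrite /qfall; elim: k => [|k IH].
  by rewrite !big_geq // subr0 divff ?mul1r.
rewrite !(@big_nat_recr _ _ _ k.+1) //= IH.
have -> : qbr (k.+1%:R - (X + 1)) = - qbr (X - k%:R).
  by rewrite -qbrN -addn1 natrD; congr Defs.qbr; ring.
have -> : qbr (k.+1%:R - X) = - qbr (X - k.+1%:R) by rewrite -qbrN opprB.
by field.
Qed.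

Lemma topcE xi1 x : topc xi1 x = \prod_(a <- Phi | 0 < dot xi1 a) qfall (m a) (dot (toC a) x).
Proof. by []. Qed.

Lemma topc_shift xi1 (t : V) x :
  (forall a, a \in Phi -> 0 < dot xi1 a -> [\/ dot a t = 0, dot a t = 1 | dot a t = 2]) ->
  (forall a, a \in Phi -> 0 < dot a t -> 0 < dot xi1 a) ->
  (forall a, a \in Phi -> qbr (dot (toC a) x) != 0 /\ qbr (dot (toC a) x + 1) != 0) ->
  topc xi1 x = mac_coef lq Phi m t x * topc xi1 (x + toC t).
Proof.
move=> h012 hpos hnz; rewrite !topcE /mac_coef !(big_mkcond (fun a => 0 < dot xi1 a)).
rewrite (big_mkcond (fun a => 0 < dot a t)) (big_mkcond (fun a => dot a t == 2)).
rewrite -!big_split /= !big_seq; apply: eq_bigr => a aP.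
have [n1 n2] := hnz a aP; set X := dot (toC a) x.
rewrite dotDr dot_toC -/X.
case: ifP => xa; last first.
  have h : (0 < dot a t) = false by apply: contraFF xa; apply: hpos.
  rewrite h; case: eqP => [e|_]; last by rewrite !mul1r.
  by move: h; rewrite e ltr0n.
have [->|->|->] := h012 a aP xa.
- by rewrite ltxx eq_sym pnatr_eq0 addr0 !mul1r.
- have e12 : ((1 : R) == 2) = false by apply: (eqr_nat R 1 2).
  by rewrite ltr01 e12 mulr1; apply: qfall_shift.
rewrite ltr0n eqxx rmorph_nat.
rewrite (qfall_shift _ n1) (qfall_shift _ n2) mulrA.
have -> : X + 1 + 1 = X + 2 by ring.
have -> : X + 1 - (m a)%:R = X - (m a)%:R + 1 by ring.
by [].
Qed.

Lemma gen_topc xi1 : gen (fun x => topc xi1 x != 0).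
Proof.
have h : gen (fun x => forall a, a \in Phi -> forall j, j \in iota 1 (m a) ->
    qbr (j%:R - dot (toC a) x) != 0).
  apply: (gen_seq q_log q_nroot) => a aP; apply: (gen_seq q_log q_nroot) => j _.
  by apply: (gen_qbrN q_log q_nroot); apply: (root_neq0 Phi_root).
apply: gen_imp h => x h; rewrite /Submission.topc prodf_seq_neq0; apply/allP => a aP.
apply/implyP => _; rewrite prodf_seq_neq0; apply/allP => j.
by rewrite /index_iota subSS subn0 => hj; apply: h.
Qed.

Lemma ev_shift_psiv x (t : V) z : ev (mshift t (mu (x + toC t))) (fun u => qpow (2 * dot (x + toC u) z)) =
  psiv (x + toC t) z.
Proof.
by rewrite ev_shift; apply: eq_ev => u; rewrite toCD addrA (addrAC x).
Qed.

Lemma fsum_list (A : set V) (O : seq V) (F : V -> C) : uniq O -> (forall u, (u \in O) <-> A u) ->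
  \sum_(u \in A) F u = \sum_(u <- O) F u.
Proof.
move=> uO hO; have -> : A = [set` O] by apply/seteqP; split => u /hO.
by apply/esym/fsbig_seq.
Qed.

Hypothesis Phi_ne : exists a, a \in Phi.
Variables (varpi : V) (O : seq V).
Hypothesis hmin : quasi_or_minuscule Phi varpi.
Hypothesis hO : forall u, (u \in O) <-> orbit varpi u.
Hypothesis uO : uniq O.

(** Maximality of t for xi1 forces (a, t) to be 0, 1 or 2 on the roots positive for xi1, which is
    the case distinction in the product a_tau. *)
Lemma orbit_topc (N : seq V) xi1 t x : regular Phi xi1 -> t \in O ->
  {subset O <= N} -> (forall u, u \in N -> u != t -> dot xi1 u < dot xi1 t) ->
  (forall a, a \in Phi -> qbr (dot (toC a) x) != 0 /\ qbr (dot (toC a) x + 1) != 0) ->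
  topc xi1 x = mac_coef lq Phi m t x * topc xi1 (x + toC t).
Proof.
move=> r1 tO ON hN hnz.
have hr a : a \in Phi -> 0 <= dot t a * dot xi1 (coroot a).
  move=> aP; pose t' := refl a *m t.
  have tN : t' \in N by apply: ON; apply/hO; apply: orbit_weyl (weyl_refl1 aP) _; apply/hO.
  have e : dot xi1 t' = dot xi1 t - dot t a * dot xi1 (coroot a).
    by rewrite /t' reflE' dotBr; move: (coroot a) => ca; rewrite dotZr.
  have [h|h] := eqVneq t' t; first by move: e; rewrite h; lra.
  by have := hN t' tN h; rewrite e; lra.
apply: topc_shift => // a aP.
- move=> xa; have /intrP[j hj] := orbit_lat Phi_root (min_lat Phi_root hmin) ((hO t).1 tO) aP.
  have xc : 0 < dot xi1 (coroot a) by rewrite dotC (coroot_dot_gt0 Phi_root).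
  have := hr a aP; rewrite pmulr_lge0 // (dotC a) hj ler0z => j0.
  have [] := orbit_root_bound Phi_root hmin ((hO t).1 tO) aP.
  rewrite hj (_ : 2 = 2%:~R) // ler_int => j2 _.
  have : (j == 0) || (j == 1) || (j == 2) by lia.
  by move=> /orP[/orP[]|] /eqP ->; [constructor 1 | constructor 2 | constructor 3].
move=> ta; have := hr a aP; rewrite (dotC t) pmulr_rge0 // => h.
rewrite -(coroot_dot_gt0 Phi_root) // dotC lt_neqAle h andbT eq_sym.
by rewrite dotC (coroot_dot_eq0 Phi_root) // r1.
Qed.

Lemma eigen Phip : (forall a, (a \in Phip) = (a \in Phi) && (0 < dot xi a)) ->
  gen (fun x => forall z, macdonald lq Phi Phip m varpi (fun x => psiv x z) x =
    (\sum_(t <- O) qpow (2 * dot (toC t) z)) * psiv x z).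
Proof.
move=> hPhip; have lv := min_lat Phi_root hmin.
have lrv := rv_lat Phi_root Phi_red m_inv (bs_reg bs).
pose kap := varpi + rv xi.
(* [Om] is to contain the support of f psi_m: lattice points of conv(W pi) + N in the coset of pi +
   rho^vee. The shifts in [N] are then in W pi or 0. *)
have [Om [uOm hOm]] := region_list Phi_root m O (fun u => Qv (u - kap)).
have [N [uN hN]] := hull_list Phi_root m O (fun u => Qv (u - (kap - rv xi))).
have kE : kap - rv xi = varpi by rewrite /kap addrK.
have hN0 u : u \in N -> orbit varpi u \/ u = 0.
  by move=> /hN[lu hu]; rewrite kE; apply: (hull_orbit Phi_root hmin hO).
have hull_O u : u \in O -> hullf O u by move=> uO' eta; exists u.
have QO u : u \in O -> Qv (u - varpi).
  by move=> /hO[w hw ->]; apply: (weyl_Qv Phi_root hw).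
have latO u : u \in O -> lat Phi u by move=> /hO; apply: (orbit_lat Phi_root).
have ON : {subset O <= N}.
  by move=> u uO'; apply/hN; split; [apply: latO | apply: hull_O | rewrite kE; apply: QO].
have gOm : gen (fun x => forall a, a \in Phi -> forall u, u \in Om -> forall w, w \in Om ->
    bb lq (yx x a) a u * bb lq (yx x a) a w != 1).
  apply: (gen_seq q_log q_nroot) => a aP; apply: (gen_seq q_log q_nroot) => u _.
  apply: (gen_seq q_log q_nroot) => w _.
  apply: gen_imp (gen_key q_log q_nroot (qpow (dot a u)%:C * qpow (dot a w)%:C) (two_root_neq0 Phi_root aP)).
  move=> x hx; rewrite !bb_key mulrACA -expr2; move: hx.
  by rewrite toCZ dotZl rmorph_nat qpow_natl.
have gN : gen (fun x => forall u, u \in N -> good (x + toC u) /\ topc xi (x + toC u) != 0).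
  apply: (gen_seq q_log q_nroot) => u _; apply: (gen_and q_log q_nroot).
    exact: (gen_shift u (gen_good q_log q_nroot Phi_root L)).
  exact: (gen_shift u (gen_topc xi)).
have gq : gen (fun x => forall a, a \in Phi -> qbr (dot (toC a) x) != 0 /\ qbr (dot (toC a) x + 1) != 0).
  apply: (gen_seq q_log q_nroot) => a aP; have a0 := root_neq0 Phi_root aP.
  apply: (gen_imp2 q_log q_nroot _ (gen_qbr q_log q_nroot 0 a0) (gen_qbr q_log q_nroot 1 a0)) => x.
  by rewrite add0r addrC.
pose xt t := if pselect (t \in O) is left tO
  then projT1 (cid (orbit_sep Phi_root hmin ((hO t).1 tO) hN0)) else xi.
have hxt t : t \in O -> regular Phi (xt t) /\ forall u, u \in N -> u != t -> dot (xt t) u < dot (xt t) t.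
  by move=> tO; rewrite /xt; case: pselect => // tO'; case: cid.
have gt_ : gen (fun x => forall t, t \in O -> topc (xt t) (x + toC t) != 0).
  by apply: (gen_seq q_log q_nroot) => t _; apply: (gen_shift t (gen_topc _)).
have gc : gen (fun x => forall t, t \in N -> psiv (x + toC t) (toC (rr xi)) = psiv x (toC (rr xi))).
  apply: (gen_seq q_log q_nroot) => t /hN[lt _ _].
  exact: (psiv_const q_log q_nroot Phi_root Phi_red m_inv bs Phi_ne lt).
have g0 := psiv_neq0 q_log q_nroot Phi_root Phi_red m_inv bs Phi_ne.
have g1 := gen_and q_log q_nroot (gen_and q_log q_nroot gOm gN) (gen_and q_log q_nroot gq gt_).
have g2 := gen_and q_log q_nroot (gen_and q_log q_nroot gc g0) (gen_good q_log q_nroot Phi_root L).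
apply: (gen_imp2 q_log q_nroot _ g1 g2) => x [[xOm xN] [xq xt_]] [[xc x0] gx].
pose nu := flatten [seq mshift t (mu x) | t <- O].
have cfnu u : cf nu u = \sum_(t <- O) c (u - t) x.
  by rewrite cf_flatten; apply: eq_bigr => t _; rewrite cf_shift (cf_mu bs).
have [] := spanning q_log q_nroot Phi_root Phi_red m_inv bs (x := x) (A := O) (kap := kap) (Om := Om) (N := N) hOm _ uN _ xN (nu := nu) uOm.
- by move=> u lu hu qu; apply/hN.
- by move=> a aP u w uO' wO'; apply: xOm.
- move=> u; rewrite cfnu => h.
  have [t tO ct] : exists2 t, t \in O & c (u - t) x != 0.
    apply: contrapT => hn; move/eqP: h; apply; rewrite big_seq big1 // => t tO.
    by apply/eqP; apply: contraT => ct; exfalso; apply: hn; exists t.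
  have /(bs_L bs)[zu lu] := c_in bs ct.
  have qu := coset_support q_log q_nroot Phi_root Phi_red m_inv bs gx ct.
  apply/hOm; split.
  + by rewrite -[u](subrK t); apply: latD => //; apply: latO.
  + by rewrite -[u](subrK t) addrC; apply: hull_region => //; apply: hull_O.
  have := QvD qu (QO t tO); congr Qv; rewrite /kap; move: (rv xi) => r.
  by apply/matrixP => i j; rewrite !mxE; ring.
- move=> a aP; apply: (Eat_orbit Phi_root uO hO lv aP (yx_neq0 lq x a)).
  exact: (bs_E bs).
move=> d hd.
(* Read at the vertex t + [rv (xt t)]: the form [xt t] singles out the term of t on both sides. *)
have dt t : t \in O -> d t = mac_coef lq Phi m t x.
  move=> tO; have [r1 sep] := hxt t tO.
  have := hd (t + rv (xt t)).
  have only (w : V) x' : w \in N -> w != t -> c (t + rv (xt t) - w) x' = 0.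
    move=> wN wt; apply/eqP; apply: contraT => /(c_zono bs) /(zono_le (xt t)).
    rewrite dotBr dotDr (dot_rv_self Phi_root) => h.
    by have := sep w wN wt; lra.
  have tt : t + rv (xt t) - t = rv (xt t) by rewrite addrAC subrr add0r.
  rewrite cfnu (bigD1_seq t) //= big_seq_cond big1 ?addr0; last first.
    by move=> w /andP[wO wt]; apply: only => //; apply: ON.
  rewrite (bigD1_seq t) ?ON //= [X in _ = _ + X]big_seq_cond [X in _ = _ + X]big1 ?addr0; last first.
    by move=> w /andP[wO wt]; rewrite only ?mulr0.
  rewrite tt !(good_vertex q_log q_nroot Phi_root Phi_red m_inv bs) //; last first.
    by have [] := xN t (ON t tO).
  rewrite (orbit_topc r1 tO ON sep xq) => /(mulIf (xt_ t tO)) //.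
have evE z : (\sum_(t <- O) qpow (2 * dot (toC t) z)) * psiv x z =
    \sum_(t <- N) d t * psiv (x + toC t) z.
  pose K u := qpow (2 * dot (x + toC u) z).
  have -> : (\sum_(t <- O) qpow (2 * dot (toC t) z)) * psiv x z = ev nu K.
    rewrite ev_flatten mulr_suml; apply: eq_bigr => t _; rewrite ev_shift -evZ.
    apply: eq_ev => u; rewrite /K -qpowD; congr Defs.qpow.
    by rewrite toCD !dotDl; ring.
  pose nu' := flatten [seq mZ (d t) (mshift t (mu (x + toC t))) | t <- N].
  have -> : \sum_(t <- N) d t * psiv (x + toC t) z = ev nu' K.
    by rewrite ev_flatten; apply: eq_bigr => t _; rewrite ev_scale ev_shift_psiv.
  apply: eq_ev_cf => u; rewrite hd cf_flatten; apply: eq_bigr => t _.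
  by rewrite cf_scale cf_shift (cf_mu bs).
have Nsplit z : \sum_(t <- N) d t * psiv (x + toC t) z =
    \sum_(t <- O) mac_coef lq Phi m t x * psiv (x + toC t) z +
    (if 0 \in N then d 0 else 0) * psiv x z.
  have O0 : 0 \notin O.
    apply/negP => /hO /(orbit_norm Phi_root) /esym/eqP; rewrite dot0l dot_eq0.
    by rewrite (negbTE hmin.1).
  have pO : perm_eq (if 0 \in N then 0 :: O else O) N.
    apply: uniq_perm => //; first by case: ifP => //= _; rewrite O0.
    move=> u; apply/idP/idP.
      case: ifP => [zN|_]; last exact: ON.
      by rewrite inE => /orP[/eqP->|/ON].
    move=> uN'; have [/hO uO'|u0] := hN0 u uN'.
      by case: ifP => // _; rewrite inE uO' orbT.
    by rewrite -u0 uN' inE u0 eqxx.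
  rewrite -(perm_big _ pO) /=.
  have eO : \sum_(t <- O) d t * psiv (x + toC t) z = \sum_(t <- O) mac_coef lq Phi m t x * psiv (x + toC t) z.
    by rewrite !big_seq; apply: eq_bigr => t tO; rewrite dt.
  case: ifP => _; last by rewrite mul0r addr0 eO.
  by rewrite big_cons toC0 addr0 eO addrC.
set d0 := if 0 \in N then d 0 else 0 in Nsplit.
(* At z = rho the values of [psiv] at all shifts agree and are nonzero; dividing by them leaves an
   equation between sums of coefficients. *)
have d0E : d0 = \sum_(t <- O) qpow (2 * (dot (rr xi) t)%:C) - \sum_(t <- O) mac_coef lq Phi m t x.
  have := evE (toC (rr xi)); rewrite Nsplit.
  have -> : \sum_(t <- O) mac_coef lq Phi m t x * psiv (x + toC t) (toC (rr xi)) =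
      (\sum_(t <- O) mac_coef lq Phi m t x) * psiv x (toC (rr xi)).
    rewrite mulr_suml; apply: eq_big_seq => t tO.
    by rewrite (xc _ (ON _ tO)).
  rewrite -mulrDl => /(mulIf x0) e.
  have -> : \sum_(t <- O) qpow (2 * (dot (rr xi) t)%:C) = \sum_(t <- O) qpow (2 * dot (toC t) (toC (rr xi))).
    by apply: eq_bigr => t _; rewrite dot_toC (dotC t).
  by rewrite e; ring.
move=> z; rewrite evE Nsplit d0E /macdonald !(fsum_list _ uO hO).
rewrite (rho_rr Phi_root (bs_reg bs) hPhip m_inv).
have e2 : \sum_(t <- O) mac_coef lq Phi m t x * (psiv (x + toC t) z - psiv x z) =
    \sum_(t <- O) mac_coef lq Phi m t x * psiv (x + toC t) z -
    (\sum_(t <- O) mac_coef lq Phi m t x) * psiv x z.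
  apply/esym; rewrite mulr_suml; apply/eqP; rewrite subr_eq; apply/eqP.
  have := @big_split C 0 +%R V O xpredT (fun t => mac_coef lq Phi m t x * (psiv (x + toC t) z - psiv x z))
    (fun t => mac_coef lq Phi m t x * psiv x z).
  by move=> <-; apply: eq_bigr => t _; rewrite /= -mulrDr subrK.
rewrite e2.
by rewrite mulrBl addrA addrAC.
Qed.

End Eigen.

(** * The shift operator *)

Section Shift.
Variables (R : realType) (n : nat) (q lq : R[i]) (Phi : {fset 'cV[R]_n}).
Hypotheses (q_log : cexp lq = q) (q_nroot : forall k : nat, (0 < k)%N -> q ^+ k != 1).
Hypotheses (Phi_root : root_system Phi) (Phi_red : reduced Phi).
Local Notation V := 'cV[R]_n.
Local Notation C := R[i].
Local Notation VC := 'cV[R[i]]_n.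
Local Notation qpow := (qpow lq).
Implicit Types (a u v : V) (x z : VC) (mu nu : seq (C * V)) (y : C) (S : seq V).

Variable m : V -> nat.
Hypothesis m_inv : weyl_invariant Phi m.
Local Notation zono := (zono Phi m).
Local Notation Hz := (Hz Phi m).
Local Notation rv := (rv Phi m).
Local Notation yx := (yx lq).
Local Notation topc := (topc lq Phi m).

Variables (xi : V) (L : seq V) (c : V -> VC -> C).
Hypothesis bs : ba_sol lq Phi m xi L c.
Local Notation mu x := (mk L (c^~ x)).
Local Notation good := (good lq Phi L).

Local Notation Qv := (coroot_lattice Phi).
Local Notation hullf := (@hullf R n).
Local Notation orbit := (weyl_orbit Phi).
Local Notation gen := (generically lq).
Local Notation m1 := (fun a => (m a).-1).
Local Notation one := (fun _ : V => 1%N).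
Hypothesis m_gt0 : forall a, a \in Phi -> (0 < m a)%N.

Lemma m1_inv : weyl_invariant Phi m1.
Proof. by move=> w a hw aP; rewrite /= m_inv. Qed.

Lemma one_inv : weyl_invariant Phi one.
Proof. by []. Qed.

Local Notation r0 := (Submission.rv Phi one xi).

Lemma mE a : a \in Phi -> (m a)%:R = (m1 a)%:R + 1 :> R.
Proof. by move=> aP; rewrite -[in LHS](prednK (m_gt0 aP)) -natr1. Qed.

Lemma rv_add eta : rv eta = Submission.rv Phi m1 eta + Submission.rv Phi one eta.
Proof.
rewrite /Submission.rv -scalerDr -big_split /=; congr (_ *: _); apply: eq_big_seq => a aP.
by rewrite -scalerDl -mulrDl -mE.
Qed.

(** In terms of polytopes: N for m is the Minkowski sum of those for m - 1 and for 1. *)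
Lemma Hz_add eta : Hz eta = Submission.Hz Phi m1 eta + Submission.Hz Phi one eta.
Proof.
rewrite /Submission.Hz -mulrDr -big_split /=; congr (_ * _); apply: eq_big_seq => a aP.
by rewrite -mulrDl -mE.
Qed.

Lemma rv_orbit eta : regular Phi eta -> orbit r0 (Submission.rv Phi one eta).
Proof.
move=> he; apply: (chamber_walk Phi_root Phi_red (Pr := fun eta => orbit r0 (Submission.rv Phi one eta))
  _ _ (bs_reg bs) he (orbit_self _ _)).
  by move=> x1 x2 h1 h2 sc; rewrite (rv_same one h1 h2 sc).
move=> x1 a x2 [_ aP _ _ _] h.
rewrite (rv_weyl Phi_root one_inv _ (weyl_refl1 aP)).
by apply: orbit_weyl => //; apply: weyl_refl1.
Qed.

(** A chamber near eta has a vertex that attains the support function at eta, and all these vertices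
    are W-conjugate. Thus the polytope for multiplicity 1 has the support function of the orbit. *)
Lemma Hz_orbit eta : exists2 u, orbit r0 u & dot eta u = Submission.Hz Phi one eta.
Proof.
have [|a /(root_neq0 Phi_root)//|eta' [h1 h2]] := @perturb_generic R n eta
  [seq - Num.sg (dot eta a) *: a | a <- [seq a <- Phi | dot eta a != 0]] Phi.
  move=> y /mapP[a]; rewrite mem_filter => /andP[ea aP] ->.
  by rewrite (dotZr (- Num.sg (dot eta a))) mulNr -normrEsg oppr_lt0 normr_gt0.
exists (Submission.rv Phi one eta'); first exact: rv_orbit.
apply: (dot_rv Phi_root) => a aP ea.
have : dot eta' (- Num.sg (dot eta a) *: a) < 0.
  by apply: h1; apply/mapP; exists a => //; rewrite mem_filter ea.
rewrite (dotZr (- Num.sg (dot eta a))) mulNr oppr_lt0.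
by case: (sgrP (dot eta a)) ea => // _ _; case: (sgrP (dot eta' a)); rewrite ?mulN1r ?mul1r ?oppr_gt0; lra.
Qed.

Lemma orbit_Hz_le u eta : orbit r0 u -> dot eta u <= Submission.Hz Phi one eta.
Proof.
move=> [w hw ->]; have [w' [hw' e _]] := weyl_inv Phi_root hw.
apply: zono_le; apply: (zono_weyl Phi_root one_inv hw).
exact: rv_zono.
Qed.

Lemma r0_lat : lat Phi r0.
Proof. exact: (rv_lat Phi_root Phi_red one_inv (bs_reg bs)). Qed.

Variable O : seq V.
Hypotheses (uO : uniq O) (hO : forall u, (u \in O) <-> orbit r0 u).

Lemma zono_region u : zono u -> region Phi m1 O u.
Proof.
move=> zu eta; have [w hw e] := Hz_orbit eta; exists w; first exact/hO.
by rewrite e addrC -Hz_add; apply: zono_le.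
Qed.

Lemma hull_weyl w u : weyl Phi w -> hullf O u -> hullf O (w *m u).
Proof.
move=> hw hu eta; have [w' [hw' e e']] := weyl_inv Phi_root hw.
have ad v : dot eta (w *m v) = dot (w' *m eta) v.
  by rewrite -(dot_weyl Phi_root _ _ hw') mulmxA e' mul1mx.
have [v /hO vO hv] := hu (w' *m eta); exists (w *m v); last by rewrite !ad.
by apply/hO; apply: orbit_weyl.
Qed.

(** By [gordan], if u were not a convex combination of the orbit, a form negative on all differences
    w - u would violate a half-space condition. *)
Lemma hull_conv u : hullf O u -> conv_hull (orbit r0) u.
Proof.
move=> hu; have [[eta h]|[t [t0 t1 e]]] := gordan (fun w => w - u) uO.
  have [w wO hw] := hu eta; have := h w wO; rewrite dotBr subr_lt0 => h'.
  by move: hw; rewrite leNgt h'.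
exists O, t; split => //; first by move=> w /hO.
apply/esym/eqP; rewrite -subr_eq0; apply/eqP; rewrite -[RHS]e.
rewrite -[X in _ - X](scale1r u) -t1 scaler_suml -sumrB.
by apply: eq_bigr => w _; rewrite scalerBr.
Qed.

Variable N : seq V.
Hypotheses (uN : uniq N) (hN : forall u, (u \in N) <-> [/\ lat Phi u, hullf O u & Qv (u - r0)]).

Lemma r0N : r0 \in N.
Proof.
apply/hN; split; [exact: r0_lat| |by rewrite subrr; apply: Qv0].
by move=> eta; exists r0 => //; apply/hO; apply: orbit_self.
Qed.

Lemma N_weyl w u : weyl Phi w -> u \in N -> w *m u \in N.
Proof.
move=> hw /hN[lu hu qu]; apply/hN; split; [exact: lat_weyl|exact: hull_weyl|].
rewrite -[w *m u](subrK u) -addrA; apply: QvD => //.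
exact: (weyl_Qv Phi_root hw lu).
Qed.

Variables (L1 : seq V) (c1 : V -> VC -> C).
Hypothesis bs1 : ba_sol lq Phi m1 xi L1 c1.
Local Notation good1 := (Submission.good lq Phi L1).
Local Notation topc1 := (Submission.topc lq Phi m1 xi).

Definition shift_ok x := forall u, u \in N -> good1 (x + toC u) /\ topc1 (x + toC u) != 0.

Lemma gen_shift_ok (M : seq V) :
  gen (fun x => forall u, u \in M -> good1 (x + toC u) /\ topc1 (x + toC u) != 0).
Proof.
apply: (gen_seq q_log q_nroot) => u _; apply: (gen_and q_log q_nroot).
  exact: (gen_shift u (gen_good q_log q_nroot Phi_root L1)).
exact: (gen_shift u (gen_topc q_log q_nroot Phi_root m1 xi)).
Qed.

Definition intertwines x (d : V -> C) :=
  forall u, c u x = \sum_(v <- N) d v * c1 (u - v) (x + toC v).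

Lemma gen_intertwines : gen (fun x => exists d, intertwines x d).
Proof.
have [Om [uOm hOm]] := region_list Phi_root m1 O (fun u => Qv (u - rv xi)).
have gOm : gen (fun x => forall a, a \in Phi -> forall u, u \in Om -> forall w, w \in Om ->
    bb lq (yx x a) a u * bb lq (yx x a) a w != 1).
  apply: (gen_seq q_log q_nroot) => a aP; apply: (gen_seq q_log q_nroot) => u _.
  apply: (gen_seq q_log q_nroot) => w _.
  apply: gen_imp (gen_key q_log q_nroot (qpow (dot a u)%:C * qpow (dot a w)%:C) (two_root_neq0 Phi_root aP)).
  move=> x hx; rewrite !bb_key mulrACA -expr2; move: hx.
  by rewrite toCZ dotZl rmorph_nat qpow_natl.
have g1 := gen_and q_log q_nroot gOm (gen_shift_ok N).
apply: (gen_imp2 q_log q_nroot _ g1 (gen_good q_log q_nroot Phi_root L)) => x [xOm xN] gx.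
have rE : rv xi - Submission.rv Phi m1 xi = r0 by rewrite rv_add addrAC subrr add0r.
have [] := spanning q_log q_nroot Phi_root Phi_red m1_inv bs1 (x := x) (A := O) (kap := rv xi) (Om := Om) (N := N) hOm _ uN _ xN (nu := mu x) uOm.
- by move=> u lu hu; rewrite rE => qu; apply/hN.
- by move=> a aP u w hu hw; apply: xOm.
- move=> u; rewrite (cf_mu bs) => cu; have /(bs_L bs)[zu lu] := c_in bs cu.
  apply/hOm; split => //; first exact: zono_region.
  exact: (coset_support q_log q_nroot Phi_root Phi_red m_inv bs gx cu).
- move=> a aP F s pF /andP[s1 s2]; apply: (bs_E bs) => //.
  by rewrite s1 (leq_trans s2) // leq_pred.
by move=> d hd; exists d => u; rewrite -hd (cf_mu bs).
Qed.

Lemma intertwines_uniq x d d' : shift_ok x -> intertwines x d -> intertwines x d' ->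
  forall v, v \in N -> d v = d' v.
Proof.
move=> ok h h' v vN; apply/eqP; rewrite -subr_eq0; apply/eqP.
apply: (shift_free Phi_root bs1 uN ok (d := fun v => d v - d' v) _ vN) => u.
under eq_bigr => w _ do rewrite mulrBl.
by rewrite sumrB -h -h' subrr.
Qed.

(** Both coefficient systems are equivariant and N is stable under W, so the relation at w x can be
    relabelled to one at x. *)
Lemma intertwines_weyl w x d : weyl Phi w -> good x -> (forall u, u \in N -> good1 (x + toC u)) ->
  intertwines (toC w *m x) d -> intertwines x (fun v => d (w *m v)).
Proof.
move=> hw gx gN h u; rewrite -(equivariance q_log q_nroot Phi_root Phi_red m_inv bs _ hw gx) h.
have pN : perm_eq [seq w *m v | v <- N] N.
  have un : uniq [seq w *m v | v <- N].
    by rewrite map_inj_uniq // => v1 v2 e; apply: (weyl_inj Phi_root hw).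
  have [] := uniq_min_size un (_ : {subset _ <= N}) _.
  - by move=> v /mapP[v' v'N ->]; apply: N_weyl.
  - by rewrite size_map.
  by move=> _ e; apply: uniq_perm => // v; rewrite e.
rewrite -(perm_big _ pN) big_map; apply: eq_big_seq => v vN; congr (_ * _).
rewrite -mulmxBr toCM -mulmxDr.
exact: (equivariance q_log q_nroot Phi_root Phi_red m1_inv bs1 _ hw (gN v vN)).
Qed.

(** The vertex of N for m is the sum of [r0] and the vertex for m - 1; only the shift by [r0]
    reaches it. *)
Lemma intertwines_lead x d : shift_ok x -> intertwines x d ->
  topc xi x = d r0 * topc1 (x + toC r0).
Proof.
move=> ok h; rewrite -(bs_top bs) h (bigD1_seq r0) ?r0N //= rv_add addrK (bs_top bs1).
rewrite big_seq_cond big1 ?addr0 // => v /andP[vN vr].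
apply/eqP; rewrite mulf_eq0; apply/orP; right; apply: contraT => cv; rewrite -(negbTE vr).
have [le1 eq1] := c_top_le Phi_root bs1 cv.
have /hN[_ hv _] := vN; have [w /hO wO hw] := hv xi.
have h2 := le_trans hw (orbit_Hz_le xi wO).
have e : dot xi (Submission.rv Phi m1 xi + r0 - v) = Submission.Hz Phi m1 xi.
  move: le1; rewrite dotBr dotDr !(dot_rv_self Phi_root) => le1.
  by apply/eqP; rewrite eq_le; apply/andP; split; lra.
have := eq1 e; rewrite -addrA -[X in _ = X]addr0 => /addrI/eqP.
by rewrite subr_eq0 eq_sym.
Qed.

Lemma cramer_ba (m' : V -> nat) (L' : seq V) (c' : V -> VC -> C) : weyl_invariant Phi m' ->
  ba_sol lq Phi m' xi L' c' -> exists (D : VC -> C) (N' : V -> VC -> C),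
  [/\ nonzero_qpoly lq D, forall u, qpoly lq (N' u) & forall x u, D x * c' u x = N' u x].
Proof.
move=> inv' bs'.
have [x0 gx0] := gen_exists (gen_good q_log q_nroot Phi_root L').
have [D [N' [hD hN' D0 h]]] := ba_cramer q_log q_nroot Phi_root Phi_red inv' bs'
  (pt := id) (x0 := x0) (Pd := qpoly lq) (@qpoly_cst R n lq) (@qpolyD R n lq) (@qpolyM R n lq)
  (@qpoly_ext R n lq) (fun a d _ => qpoly_key lq a d) gx0.
exists D, (fun u x => if u \in L' then N' u x else 0); split.
- by split => //; exists x0.
- by move=> u; case: (u \in L'); [apply: hN' | apply: qpoly_cst].
by move=> x u; case: ifP => [/h//|/negbT uL]; rewrite (bs_out bs') // mulr0.
Qed.

(** In the unknowns D(x) d_v / D1(x + v) the system has exponential polynomials as coefficients, and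
    freeness of the shifts at one point gives it a trivial kernel there, so [cramer] applies. The
    resulting formula is exhibited as S. *)
Lemma shift_coefs : exists S : V -> VC -> C,
  [/\ forall v x, v \notin N -> S v x = 0, forall v, qrational lq (S v) &
      gen (fun x => intertwines x (S^~ x))].
Proof.
have [D [P [hD hP DP]]] := cramer_ba m_inv bs.
have [D1 [P1 [hD1 hP1 DP1]]] := cramer_ba m1_inv bs1.
have gD1 : gen (fun x => forall v, v \in N -> D1 (x + toC v) != 0).
  by apply: (gen_seq q_log q_nroot) => v _; apply: (gen_shift v (gen_nonzero hD1)).
have [x0 [ok0 D10]] := gen_exists (gen_and q_log q_nroot (gen_shift_ok N) gD1).
pose Nj (j : 'I_(size N)) := tnth (in_tuple N) j.
have Nj_inj : injective Nj by move=> i j; apply: (tuple_uniqP (in_tuple N) uN).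
have NjN j : Nj j \in N by apply: (mem_tnth j (in_tuple N)).
have sumN (F : V -> C) : \sum_(v <- N) F v = \sum_j F (Nj j).
  by rewrite big_tnth; apply: eq_bigr.
pose jof v : option 'I_(size N) := [pick j | Nj j == v].
have jofE j : jof (Nj j) = Some j.
  by rewrite /jof; case: pickP => [k /eqP /Nj_inj ->//|/(_ j)]; rewrite eqxx.
have Nj_onto v : v \in N -> exists j, v = Nj j.
  by move=> /(tnthP (in_tuple N))[j ->]; exists j.
have ker (U : 'I_(size N) -> C) : (forall u, \sum_j P1 (u - Nj j) (x0 + toC (Nj j)) * U j = 0) ->
    forall j, U j = 0.
  move=> hU j; pose d v := D1 (x0 + toC v) * (if jof v is Some j then U j else 0).
  have := shift_free Phi_root bs1 uN ok0 (d := d) _ (NjN j).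
  rewrite /d jofE => h; apply: (mulfI (D10 _ (NjN j))); rewrite mulr0; apply: h => u.
  rewrite sumN -[RHS](hU u); apply: eq_bigr => k _.
  by rewrite jofE mulrAC DP1.
have [D2 [Q [hD2 hQ D20 h2]]] := @cramer C V (size N) VC
    (fun u j x => P1 (u - Nj j) (x + toC (Nj j))) (fun u x => P u x) x0 (qpoly lq)
    (@qpoly_cst R n lq) (@qpolyD R n lq) (@qpolyM R n lq) (@qpoly_ext R n lq)
    (fun u j => qpoly_shift (Nj j) (hP1 _)) hP ker.
have hD2' : nonzero_qpoly lq D2 by split => //; exists x0.
have hDD := nonzero_qpolyM q_log q_nroot hD2' hD.
pose S v x := if jof v is Some j then Q j x * D1 (x + toC v) / (D2 x * D x) else 0.
exists S; split.
- move=> v x vN; rewrite /S; case e: (jof v) => [j|//].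
  by move: e vN; rewrite /jof; case: pickP => // k /eqP <- _; rewrite NjN.
- move=> v; case e: (jof v) => [j|]; last first.
    exists (fun=> 0), (fun x => D2 x * D x); split => //; first exact: qpoly_cst.
    by move=> x _; rewrite /S e mul0r.
  exists (fun x => Q j x * D1 (x + toC v)), (fun x => D2 x * D x); split => //.
    by apply: qpolyM; [apply: hQ | apply: qpoly_shift; case: hD1].
  by move=> x _; rewrite /S e.
have g1 := gen_and q_log q_nroot (gen_nonzero hDD) gD1.
apply: (gen_imp2 q_log q_nroot _ g1 gen_intertwines) => x [DDx D1x] [d hd] u.
have := DDx; rewrite mulf_eq0 negb_or => /andP[D2x Dx].
have hU := h2 x (fun j => D x * d (Nj j) / D1 (x + toC (Nj j))).
rewrite hd; apply: eq_big_seq => v /Nj_onto[j ->]; congr (_ * _).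
rewrite /S jofE -hU.
  by field; rewrite D2x Dx D1x.
move=> w; rewrite -DP hd sumN mulr_sumr; apply: eq_bigr => k _.
by rewrite -DP1; field; rewrite D1x.
Qed.

End Shift.

(** * The intertwining relation on arbitrary functions *)

Section Intertwining.
Variables (R : realType) (n : nat) (q lq : R[i]) (Phi : {fset 'cV[R]_n}).
Hypotheses (q_log : cexp lq = q) (q_nroot : forall k : nat, (0 < k)%N -> q ^+ k != 1).
Hypotheses (Phi_root : root_system Phi) (Phi_red : reduced Phi).
Local Notation V := 'cV[R]_n.
Local Notation C := R[i].
Local Notation VC := 'cV[R[i]]_n.
Local Notation qpow := (qpow lq).
Implicit Types (a u v : V) (x z : VC) (mu nu : seq (C * V)) (y : C) (S : seq V).

Variable m : V -> nat.
Hypothesis m_inv : weyl_invariant Phi m.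

Local Notation orbit := (weyl_orbit Phi).

(** Evaluation at multiples of one separating real direction divided by log q reduces the claim to
    power sums. *)
Lemma exp_free mu : (forall z, ev mu (fun u => qpow (2 * dot (toC u) z)) = 0) ->
  forall u, cf mu u = 0.
Proof.
move=> h u; have [um|um] := boolP (u \in [seq p.2 | p <- mu]); last exact: cf_notin.
set s := [seq p.2 | p <- mu] in um.
have [|eta heta] := @avoid R n [seq v - w | v <- s, w <- [seq w <- s | w != v]].
  by move=> b /allpairsPdep[v [w [_]]]; rewrite mem_filter => /andP[wv _] ->; rewrite subr_eq0 eq_sym.
apply: (power_sums_ev (X := fun v => (expR (dot v eta))%:C)).
  move=> k; rewrite -[RHS](h ((k%:R / (2 * lq)) *: toC eta)); apply: eq_ev => v.
  rewrite dotZr dot_toC.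
  have l0 := lq_neq0 q_log q_nroot.
  have -> : 2 * (k%:R / (2 * lq) * (dot v eta)%:C) = k%:R * ((dot v eta)%:C / lq).
    by field.
  by rewrite qpow_natl /Defs.qpow divfK // cexpR.
move=> v w vs ws /complexI /expR_inj e.
have [->//|vw] := eqVneq v w.
have := heta (v - w); rewrite dotBr (dotC eta) (dotC eta w) e subrr eqxx => H.
have : false; last by []; apply: H; apply/allpairsPdep; exists v, w.
by rewrite mem_filter ws eq_sym vw.
Qed.

Section Delta.
Variables (xi : V) (Phip : {fset 'cV[R]_n}).
Hypotheses (hxi : regular Phi xi)
  (hPhip : forall a, (a \in Phip) = (a \in Phi) && (0 < dot xi a)).

(** Each factor of [Delta_neg] is the inverse of q^-j [j - (a, x)], so the comparison with the
    vertex coefficient costs q^(1 + ... + k) per root. The step [triS] is the source of the power of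
    q in the leading coefficient. *)
Definition tri (k : nat) := (\sum_(1 <= j < k.+1) j)%N.

Lemma triS k : (0 < k)%N -> tri k = (tri k.-1 + k)%N.
Proof. by case: k => // k _; rewrite /tri big_nat_recr. Qed.

Lemma qpow_sum (I : Type) (s : seq I) (F : I -> nat) :
  \prod_(i <- s) qpow (F i)%:R = qpow (\sum_(i <- s) F i)%N%:R.
Proof.
elim: s => [|i s IH]; first by rewrite !big_nil qpow0.
by rewrite !big_cons natrD qpowD IH.
Qed.

Lemma Delta_topc (k : V -> nat) x : Delta_neg lq Phip k x =
  qpow (\sum_(a <- Phip) tri (k a))%N%:R / Submission.topc lq Phi k xi x.
Proof.
rewrite /Delta_neg /Submission.topc -(big_Phip hPhip) -qpow_sum -prodf_div; apply: eq_bigr => a _.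
rewrite /tri -qpow_sum -prodf_div; apply: eq_bigr => j _.
rewrite -[qpow j%:R]invrK -qpowN -invfM; congr (_^-1).
rewrite /Defs.qbr mulrBr -!qpowD; congr (Defs.qpow _ _ - Defs.qpow _ _); first by ring.
by rewrite natrM; ring.
Qed.

End Delta.

Section Intertwine.
Variables (xi : V) (Phip : {fset 'cV[R]_n}) (L L1 N T : seq V) (c c1 S : V -> VC -> C) (varpi : V).
Local Notation m1 := (fun a => (m a).-1).
Hypothesis bs1 : ba_sol lq Phi m1 xi L1 c1.
Hypotheses (uN : uniq N) (uT : uniq T) (hT : forall u, (u \in T) <-> orbit varpi u).
Hypothesis hS : forall v x, v \notin N -> S v x = 0.
Local Notation psiv := (Submission.psiv lq L c).
Local Notation psiv1 := (Submission.psiv lq L1 c1).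

Lemma diff_applyE f x : diff_apply S f x = \sum_(v <- N) S v x * f (x + toC v).
Proof.
rewrite /diff_apply -(fsum_list _ uN (A := [set` N])) //.
apply/esym/fsbig_widen => // v [_ vN] /=; rewrite hS ?mul0r //.
exact/negP.
Qed.

Lemma macdonaldE (k : V -> nat) f x : macdonald lq Phi Phip k varpi f x =
  \sum_(t <- T) mac_coef lq Phi k t x * (f (x + toC t) - f x) +
  (\sum_(t <- T) qpow (2 * (dot (rho Phip k) t)%:C)) * f x.
Proof. by rewrite /macdonald !(fsum_list _ uT hT). Qed.

Definition ishifts : seq V := undup (N ++ [seq v + t | v <- N, t <- T]).

(** For fixed x both sides are pairings of f with finite measures on the shifts u in f(x + u). The
    difference of the measures kills [psiv1] for all z; independence of exponentials in z and of the
    shifts makes it zero, whence the identity for arbitrary f. *)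
Lemma intertwine_at x :
  (forall t, t \in 0 :: T -> forall z,
     diff_apply S (fun x => psiv1 x z) (x + toC t) = psiv (x + toC t) z) ->
  (forall z, macdonald lq Phi Phip m varpi (fun x => psiv x z) x =
    (\sum_(t <- T) qpow (2 * dot (toC t) z)) * psiv x z) ->
  (forall v, v \in N -> forall z, macdonald lq Phi Phip m1 varpi (fun x => psiv1 x z) (x + toC v) =
    (\sum_(t <- T) qpow (2 * dot (toC t) z)) * psiv1 (x + toC v) z) ->
  (forall u, u \in ishifts -> Submission.good lq Phi L1 (x + toC u) /\ Submission.topc lq Phi m1 xi (x + toC u) != 0) ->
  forall f, macdonald lq Phi Phip m varpi (diff_apply S f) x =
    diff_apply S (macdonald lq Phi Phip m1 varpi f) x.
Proof.
move=> hpsi heig heig1 ok f.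
pose at_ (g : VC -> C) u := g (x + toC u).
pose sig t := mshift t (mk N (S^~ (x + toC t))).
have sigE t g : diff_apply S g (x + toC t) = ev (sig t) (at_ g).
  rewrite diff_applyE ev_shift ev_mk; apply: eq_bigr => v _.
  by rewrite /at_ toCD addrA addrAC.
have x00 : x = x + toC 0 by rewrite toC0 addr0.
have sig0 g : diff_apply S g x = ev (sig 0) (at_ g) by rewrite -sigE -x00.
pose Ek k := \sum_(t <- T) qpow (2 * (dot (rho Phip k) t)%:C).
pose Lam1 := flatten [seq mZ (mac_coef lq Phi m t x) (sig t ++ mZ (-1) (sig 0)) | t <- T] ++ mZ (Ek m) (sig 0).
pose del v : seq (C * V) := [:: (1, v)].
pose Lam2 := flatten [seq mZ (S v x) (flatten [seq mZ (mac_coef lq Phi m1 t (x + toC v))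
   (del (v + t) ++ mZ (-1) (del v)) | t <- T] ++ mZ (Ek m1) (del v)) | v <- N].
have evdel v F : ev (del v) F = F v by rewrite /ev big_seq1 mul1r.
have E1 g : macdonald lq Phi Phip m varpi (diff_apply S g) x = ev Lam1 (at_ g).
  rewrite macdonaldE ev_cat ev_flatten ev_scale sig0; congr (_ + _).
  by apply: eq_bigr => t _; rewrite ev_scale ev_cat ev_scale mulN1r sigE.
have E2 g : diff_apply S (macdonald lq Phi Phip m1 varpi g) x = ev Lam2 (at_ g).
  rewrite diff_applyE ev_flatten; apply: eq_bigr => v _.
  rewrite macdonaldE ev_scale ev_cat ev_flatten ev_scale evdel; congr (_ * (_ + _)).
  apply: eq_bigr => t _; rewrite ev_scale ev_cat ev_scale !evdel mulN1r.
  by rewrite /at_ toCD addrA.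
pose Lam := Lam1 ++ mZ (-1) Lam2.
have ELam g : ev Lam (at_ g) = macdonald lq Phi Phip m varpi (diff_apply S g) x -
    diff_apply S (macdonald lq Phi Phip m1 varpi g) x.
  by rewrite ev_cat ev_scale mulN1r -E1 -E2.
have uM : uniq ishifts by apply: undup_uniq.
have inM u : u \in N -> u \in ishifts by move=> h; rewrite mem_undup mem_cat h.
have inM2 u t : u \in N -> t \in T -> u + t \in ishifts.
  by move=> h h'; rewrite mem_undup mem_cat; apply/orP; right; apply/allpairsPdep; exists u, t.
have out u : cf Lam u != 0 -> u \in ishifts.
  apply: contraNT => uM'.
  have s0 : cf (sig 0) u = 0.
    rewrite cf_shift cf_mk // subr0; case: ifP => // /inM; by rewrite (negbTE uM').
  have d0 v : v \in ishifts -> cf (del v) u = 0.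
    by move=> vM; rewrite /cf evdel; case: eqP => // e; rewrite -e vM in uM'.
  rewrite cf_cat cf_scale cf_cat cf_scale s0 mulr0 addr0 !cf_flatten.
  rewrite big1_seq ?add0r; last first.
    move=> t /andP[_ tT]; rewrite cf_scale cf_cat cf_scale s0 mulr0 addr0 cf_shift cf_mk //.
    case: ifP => [h|_]; last by rewrite mulr0.
    by have := inM2 _ _ h tT; rewrite subrK (negbTE uM').
  rewrite big1_seq ?mulr0 // => v /andP[_ vN].
  rewrite cf_scale cf_cat cf_scale d0 ?inM // mulr0 addr0 cf_flatten big1_seq ?mulr0 // => t /andP[_ tT].
  by rewrite cf_scale cf_cat cf_scale (d0 _ (inM _ vN)) (d0 _ (inM2 _ _ vN tT)) !(mulr0, addr0).
have psi0 z : ev Lam (at_ (fun x => psiv1 x z)) = 0.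
  rewrite ELam macdonaldE.
  have e0 : diff_apply S (fun x => psiv1 x z) x = psiv x z.
    by rewrite {1 2}x00 hpsi ?mem_head.
  have -> : \sum_(t <- T) mac_coef lq Phi m t x * (diff_apply S (fun x => psiv1 x z) (x + toC t) -
      diff_apply S (fun x => psiv1 x z) x) =
      \sum_(t <- T) mac_coef lq Phi m t x * (psiv (x + toC t) z - psiv x z).
    apply: eq_big_seq => t tT; rewrite e0 hpsi // inE tT orbT.
    by [].
  rewrite e0; have := heig z; rewrite macdonaldE => ->.
  rewrite diff_applyE.
  have -> : \sum_(v <- N) S v x * macdonald lq Phi Phip m1 varpi (fun x => psiv1 x z) (x + toC v) =
      (\sum_(t <- T) qpow (2 * dot (toC t) z)) * \sum_(v <- N) S v x * psiv1 (x + toC v) z.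
    by rewrite mulr_sumr; apply: eq_big_seq => v vN; rewrite heig1 // mulrCA.
  by rewrite -e0 diff_applyE subrr.
have lam0 u : cf Lam u = 0.
  have [uM'|] := boolP (u \in ishifts); last first.
    by move=> h; apply/eqP; apply: contraNT h; apply: out.
  apply: (shift_free Phi_root bs1 uM ok (d := fun v => cf Lam v) _ uM') => w.
  pose Lam' := flatten [seq mZ (cf Lam v) (mshift v (mk L1 (c1^~ (x + toC v)))) | v <- ishifts].
  have -> : \sum_(v <- ishifts) cf Lam v * c1 (w - v) (x + toC v) = cf Lam' w.
    rewrite cf_flatten; apply: eq_bigr => v _.
    by rewrite cf_scale cf_shift (cf_mu bs1).
  apply: exp_free => z.
  have k0 : qpow (2 * dot x z) != 0 by apply: qpow_neq0.
  apply: (mulfI k0); rewrite mulr0 -[RHS](psi0 z) (ev_cf _ uM out) -evZ ev_flatten.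
  apply: eq_bigr => v _; rewrite ev_scale /at_ -ev_shift_psiv; congr (_ * _).
  by apply: eq_ev => u'; rewrite -qpowD dotDl mulrDr.
by apply/eqP; rewrite -subr_eq0 -ELam; apply/eqP; apply: ev_cf0.
Qed.

End Intertwine.

End Intertwining.

Theorem proposition5p7
  (R : realType) (n : nat)
  (q lq : R[i]) (q_log : cexp lq = q)
  (q_nroot : forall k : nat, (0 < k)%N -> q ^+ k != 1)
  (Phi Phip : {fset 'cV[R]_n})
  (Phi_root : root_system Phi) (Phi_red : reduced Phi)
  (Phi_irr : irreducible Phi) (Phi_pos : positive_roots Phi Phip)
  (m : 'cV[R]_n -> nat)
  (m_inv : weyl_invariant Phi m) (m_gt0 : forall a, a \in Phi -> (0 < m a)%N)
  (varpi : 'cV[R]_n) (varpi_min : quasi_or_minuscule Phi varpi)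
  (psi psi1 : 'cV[R[i]]_n -> 'cV[R[i]]_n -> R[i])
  (psi_BA : baker_akhiezer lq Phi Phip m psi)
  (psi1_BA : baker_akhiezer lq Phi Phip (fun a => (m a).-1) psi1) :
  let varrho := rhov Phip (fun=> 1%N) in
  exists S : 'cV[R]_n -> 'cV[R[i]]_n -> R[i],
    difference_operator lq Phi S /\
    generically lq (fun x => forall z,
      diff_apply S (fun y => psi1 y z) x = psi x z) /\
    generically lq (fun x => forall f : 'cV[R[i]]_n -> R[i],
      macdonald lq Phi Phip m varpi (diff_apply S f) x =
      diff_apply S (macdonald lq Phi Phip (fun a => (m a).-1) varpi f) x) /\
    diff_invariant lq Phi S /\
    (forall nu x, S nu x != 0 ->
      nu - varrho \in coroot_lattice Phi /\
      nu \in conv_hull (weyl_orbit Phi varrho)) /\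
    generically lq (fun x =>
      S varrho x = qpow lq (\sum_(a <- Phip) m a)%N%:R *
        (Delta_neg lq Phip (fun a => (m a).-1) (x + toC varrho) /
         Delta_neg lq Phip m x)) /\
    (forall w, weyl Phi w -> generically lq (fun x =>
      S (w *m varrho) x = S varrho (invmx (toC w) *m x))).
Proof.
have [xi [hxi hPhip]] := Phi_pos.
have xreg : regular Phi xi by move=> a aP; apply: hxi.
have ne : exists a, a \in Phi by case: Phi_irr.
have m1i := m1_inv m_inv.
have [L [c [bs psiE]]] := ba_data q_log q_nroot Phi_root Phi_red m_inv xreg hPhip psi_BA.
have [L1 [c1 [bs1 psi1E]]] := ba_data q_log q_nroot Phi_root Phi_red m1i xreg hPhip psi1_BA.
have {psiE} -> : psi = psiv lq L c by apply/funext => x; apply/funext => z; apply: psiE.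
have {psi1E} -> : psi1 = psiv lq L1 c1 by apply/funext => x; apply/funext => z; apply: psi1E.
rewrite (rhov_rv Phi_root xreg hPhip (k := fun=> 1%N)) //; set r0 := rv _ _ _; cbv zeta.
have lr0 : lat Phi r0 := r0_lat Phi_root Phi_red bs.
have [Orb [uO hO]] := orbit_list Phi_root lr0.
have [T [uT hT]] := orbit_list Phi_root (min_lat Phi_root varpi_min).
have [N [uN hN]] := hull_list Phi_root m Orb (fun u => coroot_lattice Phi (u - r0)).
have [S [Sout Srat Sint]] :=
  shift_coefs q_log q_nroot Phi_root Phi_red m_inv bs m_gt0 hO uN hN bs1.
have SN v x : S v x != 0 -> v \in N by apply: contraNT => /Sout ->; rewrite eqxx.
have ggood := gen_good q_log q_nroot Phi_root L.
have gok M := gen_shift_ok q_log q_nroot Phi_root m xi L1 M.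
have gpsi : generically lq (fun x => forall z, diff_apply S (fun y => psiv lq L1 c1 y z) x = psiv lq L c x z).
  apply: gen_imp Sint => x hx z; rewrite (diff_applyE uN Sout).
  pose nu := flatten [seq mZ (S v x) (mshift v (mk L1 (c1^~ (x + toC v)))) | v <- N].
  have -> : \sum_(v <- N) S v x * psiv lq L1 c1 (x + toC v) z =
      ev nu (fun u => qpow lq (2 * dot (x + toC u) z)).
    by rewrite ev_flatten; apply: eq_bigr => v _; rewrite ev_scale ev_shift_psiv.
  apply: eq_ev_cf => u; rewrite (cf_mu bs) hx cf_flatten; apply: eq_bigr => v _.
  by rewrite cf_scale cf_shift (cf_mu bs1).
(* The coefficients transported by w satisfy the same relation at x, and these coefficients are
   unique. *)
have ginv w v : weyl Phi w -> generically lq (fun x => S (w *m v) (toC w *m x) = S v x).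
  move=> hw; have [w' [hw' ww' w'w]] := weyl_inv Phi_root hw.
  have [vN|vN] := boolP (v \in N); last first.
    apply: gen_true => x; rewrite (Sout _ _ vN) Sout //.
    apply: contra vN => h; have := N_weyl Phi_root hO hN hw' h.
    by rewrite mulmxA w'w mul1mx.
  have g1 := gen_and q_log q_nroot (gok N) ggood.
  have g2 := gen_and q_log q_nroot Sint (gen_linear ww' Sint).
  apply: (gen_imp2 q_log q_nroot _ g1 g2) => x [ok gx] [i1 i2].
  have i3 := intertwines_weyl q_log q_nroot Phi_root Phi_red m_inv bs hO uN hN bs1 hw gx
    (fun u uN' => (ok u uN').1) i2.
  exact: (intertwines_uniq Phi_root uN bs1 ok i3 i1 vN).
exists S; split; last split; [| exact: gpsi | split; [| split; [| split; [| split]]]].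
- split => //.
    apply: (@sub_finite_set _ _ [set` N]); last exact: finite_seq.
    by move=> v [x] /SN.
  by move=> v x /SN /hN[lv _ _]; apply/in_coweight.
- have geig := eigen q_log q_nroot Phi_root Phi_red m_inv bs ne varpi_min hT uT hPhip.
  have geig1 := eigen q_log q_nroot Phi_root Phi_red m1i bs1 ne varpi_min hT uT hPhip.
  have g1 : generically lq (fun x => forall t, t \in 0 :: T -> forall z,
      diff_apply S (fun y => psiv lq L1 c1 y z) (x + toC t) = psiv lq L c (x + toC t) z).
    by apply: (gen_seq q_log q_nroot) => t _; apply: (gen_shift t gpsi).
  have g2 : generically lq (fun x => forall v, v \in N -> forall z,
      macdonald lq Phi Phip (fun a => (m a).-1) varpi (fun y => psiv lq L1 c1 y z) (x + toC v) =
      (\sum_(t <- T) qpow lq (2 * dot (toC t) z)) * psiv lq L1 c1 (x + toC v) z).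
    by apply: (gen_seq q_log q_nroot) => v _; apply: (gen_shift v geig1).
  have g3 := gen_and q_log q_nroot g1 (gok (ishifts N T)).
  have g4 := gen_and q_log q_nroot g2 geig.
  apply: (gen_imp2 q_log q_nroot _ g3 g4) => x [h1 h2] [h3 h4] f.
  exact: (intertwine_at q_log q_nroot Phi_root bs1 uN uT hT Sout h1 h4 h3 h2).
- by move=> w v hw; apply: ginv.
- move=> v x /SN /hN[_ hv qv]; rewrite !inE; split => //.
  exact: (hull_conv uO hO hv).
- have gt1 := gen_shift r0 (gen_topc q_log q_nroot Phi_root (fun a => (m a).-1) xi).
  have gt := gen_topc q_log q_nroot Phi_root m xi.
  have g1 := gen_and q_log q_nroot (gok N) gt1.
  have g2 := gen_and q_log q_nroot gt Sint.
  apply: (gen_imp2 q_log q_nroot _ g1 g2) => x [ok t1] [t0 hx].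
  have := intertwines_lead Phi_root Phi_red bs m_gt0 hO uN hN bs1 ok hx; rewrite -/r0 => e.
  rewrite !(Delta_topc lq hPhip).
  have tr : (\sum_(a <- Phip) tri (m a) = \sum_(a <- Phip) tri (m a).-1 + \sum_(a <- Phip) m a)%N.
    rewrite -big_split /=; apply: eq_big_seq => a; rewrite hPhip => /andP[aP _].
    exact/triS/m_gt0.
  rewrite tr natrD qpowD e.
  have q1 := qpow_neq0 lq (\sum_(a <- Phip) tri (m a).-1)%N%:R.
  have q2 := qpow_neq0 lq (\sum_(a <- Phip) m a)%N%:R.
  have S0 : S r0 x != 0 by apply: contraNneq t0 => S0; rewrite e S0 mul0r.
  by field; rewrite q1 q2 S0 t1.
move=> w hw; have [w' [hw' ww' w'w]] := weyl_inv Phi_root hw.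
have iw : invmx (toC w) = toC w'.
  have e : toC w *m toC w' = 1%:M by rewrite -toCM ww' toC1.
  have [uw _] := mulmx1_unit e.
  by rewrite -[LHS]mulmx1 -e mulmxA mulVmx // mul1mx.
apply: gen_imp (gen_linear w'w (ginv w r0 hw)) => x.
by rewrite iw mulmxA -toCM ww' toC1 mul1mx.
Qed.
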